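(* Let $f(z)=\mathbb{E}_{\zeta\sim Z}[F(z;\zeta)]$ satisfy the deterministic and stochastic assumptions in the context. Let $\kappa:=L/\mu$, $\beta=2\mu^{-1}$, $\Delta_0\ge\mathbb{E}[h_\beta(\boldsymbol z_0)]-\bar\Phi$ with $\Delta_0>0$, $c=(3\beta L+1)\rho/6$, $R_\Delta=2\sqrt{\mu\Delta_0/(\beta\mu-1)}$, $c_1=(1+\beta\sigma_2)^2\sigma_1^2+\beta^2\sigma_2^2R_\Delta^2$, $c_2=L^2(1+\beta\sigma_2)^2+\beta^2\rho^2(\sigma_1^2+R_\Delta^2)$, and $c_3=1+\beta(L+\sigma_2)$. Then, for $\varepsilon>0$ sufficiently small, the S-ACQRN method (described in the context) with cycle lengths $$S^g=\left\lfloor\frac{\sqrt{c_1c}}{\sqrt{c_2\varepsilon}}\right\rfloor+1\qquad\text{and}\qquad S^h=\left\lfloor\frac{\sigma_2\sqrt c}{\rho\sqrt\varepsilon}\right\rfloor+1$$ finds an $(\varepsilon,\sqrt{\kappa\rho\varepsilon})$-SOSP of $\min_zh_\beta(z)$ (in expectation) with $$T=O(\sqrt{\kappa\rho}\,\Delta_0\,\varepsilon^{-3/2})$$ iterations (subproblem oracle calls), $$O\Big(\sqrt{c_1c_2}\,\Delta_0\,\varepsilon^{-3}+\sigma_1^2\beta^2\rho^2c^{-1/2}\Delta_0\,\varepsilon^{-5/2}\Big)$$ stochastic gradient evaluations and stochastic Hessian-vector products, and $$O\big(\sigma_2\,\rho\,c_3^2\,c^{-1}\Delta_0\,\varepsilon^{-2}\big)$$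 stochastic Hessian evaluations.
   Context: Write $z=(x,y)\in\mathbb{R}^n\times\mathbb{R}^m=\mathbb{R}^{n+m}$. $\|\cdot\|$ is the Euclidean norm for vectors and the spectral norm for matrices; $\|\cdot\|_F$ is the Frobenius norm. Deterministic assumptions: $f$ is thrice continuously differentiable; for each $x$, $f(x,\cdot)$ is $\mu$-strongly concave ($\mu>0$); for each $y$, $f(\cdot,y)$ is possibly nonconvex; with constants $L,\rho>0$, $\nabla f$ is $L$-Lipschitz and $\nabla^2f$ is $\rho$-Lipschitz (in spectral norm) on $\mathbb{R}^{n+m}$; with $\Phi(x):=\max_yf(x,y)$, $\bar\Phi:=\inf_x\Phi(x)>-\infty$. Stochastic assumptions (derivatives of $F$ are in $z$; $\zeta\sim Z$; $\sigma_1,\sigma_2$ constants): for all $z,z_1,z_2$, $\mathbb{E}[\nabla F(z;\zeta)]=\nabla f(z)$, $\mathbb{E}[\nabla^2F(z;\zeta)]=\nabla^2f(z)$, $\mathbb{E}\|\nabla F(z;\zeta)-\nabla f(z)\|^3\le\sigma_1^3$, $\mathbb{E}\|\nabla F(z_1;\zeta)-\nabla F(z_2;\zeta)\|^3\le L^3\|z_1-z_2\|^3$, $\mathbb{E}\|\nabla^2F(z;\zeta)\|_F^3\le\sigma_2^3$, $\mathbb{E}\|\nabla^2F(z_1;\zeta)-\nabla^2F(z_2;\zeta)\|_F^3\le\rho^3\|z_1-z_2\|^3$. Notation: $h_\beta(z):=f(z)+\frac\beta2\|\nabla_yf(z)\|^2$ and $P:=\begin{pmatrix}0&0\\0&I_m\end{pmatrix}$.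 For independent i.i.d. batches $\mathcal{B}_1=\{\zeta_{i,1}\}_{i=1}^B$, $\mathcal{B}_2=\{\zeta_{i,2}\}_{i=1}^B$ from $Z$: $Q(z;\mathcal{B}_1,\mathcal{B}_2):=\frac1B\sum_{i=1}^B[I+\beta\nabla^2F(z;\zeta_{i,1})P]\nabla F(z;\zeta_{i,2})$; $W(z;\mathcal{B}_1,\mathcal{B}_2):=$ the symmetric part $\frac12(A+A^\top)$ of $A=\frac1B\sum_{i=1}^B[I+\beta\nabla^2F(z;\zeta_{i,1})P]\nabla^2F(z;\zeta_{i,2})$; $G_y(z;\mathcal{B}_1):=\frac1B\sum_{i=1}^B\nabla_yF(z;\zeta_{i,1})$. S-ACQRN method. Inputs: deterministic $\boldsymbol z_0$, tolerance $\varepsilon>0$, $\Delta_0>0$, iteration count $T=\lfloor\Delta_0c^{1/2}/(6\varepsilon^{3/2})\rfloor+1$, positive integer cycle lengths $S^g,S^h$, $\beta>\mu^{-1}$; $\alpha_1=2\beta\rho$, $\alpha_2=12c$; $c,c_1,c_2,c_3$ as in the claim. For $k=0,\dots,T-1$: draw fresh independent i.i.d. batches $\mathcal{B}^g_{k,1},\mathcal{B}^g_{k,2},\mathcal{B}^h_{k,1},\mathcal{B}^h_{k,2},\mathcal{B}^g_{k,y}$ from $Z$, whose sizes are taken as the smallest positive integers satisfying (i) $|\mathcal{B}^g_{k,1}|=|\mathcal{B}^g_{k,2}|\ge64c_1\varepsilon^{-2}$ if $S^g\mid k$, and $\ge\lfloor64c_2S^g\|\boldsymbol\xi_{k-1}\|^2\varepsilon^{-2}\rfloor+1$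 otherwise; (ii) $|\mathcal{B}^h_{k,1}|=|\mathcal{B}^h_{k,2}|\ge648\sigma_2^2c_3^2(c\varepsilon)^{-1}$ if $S^h\mid k$, and $\ge\lfloor648\rho^2c_3^2S^h\|\boldsymbol\xi_{k-1}\|^2(c\varepsilon)^{-1}\rfloor+1$ otherwise; (iii) $|\mathcal{B}^g_{k,y}|\ge36(\sigma_1\beta\rho)^2(c\varepsilon)^{-1}$. Set $\boldsymbol g_k=Q(\boldsymbol z_k;\mathcal{B}^g_{k,1},\mathcal{B}^g_{k,2})$ if $S^g\mid k$, and $\boldsymbol g_k=Q(\boldsymbol z_k;\mathcal{B}^g_{k,1},\mathcal{B}^g_{k,2})-Q(\boldsymbol z_{k-1};\mathcal{B}^g_{k,1},\mathcal{B}^g_{k,2})+\boldsymbol g_{k-1}$ otherwise; $\bar{\boldsymbol H}_k=W(\boldsymbol z_k;\mathcal{B}^h_{k,1},\mathcal{B}^h_{k,2})$ if $S^h\mid k$, and $\bar{\boldsymbol H}_k=W(\boldsymbol z_k;\mathcal{B}^h_{k,1},\mathcal{B}^h_{k,2})-W(\boldsymbol z_{k-1};\mathcal{B}^h_{k,1},\mathcal{B}^h_{k,2})+\bar{\boldsymbol H}_{k-1}$ otherwise; $\boldsymbol g_{y,k}=G_y(\boldsymbol z_k;\mathcal{B}^g_{k,y})$. Choose a global minimizer $\boldsymbol\xi_k\in\arg\min_{\xi}\ \boldsymbol g_k^\top\xi+\frac12\xi^\top[\bar{\boldsymbol H}_k+\alpha_1\|\boldsymbol g_{y,k}\|I_{n+m}]\xi+\frac{\alpha_2}6\|\xi\|^3$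 and set $\boldsymbol z_{k+1}=\boldsymbol z_k+\boldsymbol\xi_k$. Output: $z_{\mathrm{out}}=\boldsymbol z_{\tilde k}$, $\tilde k$ uniform on $\{1,\dots,T\}$ (drawn independently of the run). $(\varepsilon,\delta)$-SOSP of $\min_z h_\beta(z)$ ''in expectation'' means that the output satisfies $\mathbb{E}\|\nabla h_\beta(z_{\mathrm{out}})\|\le\varepsilon$ and $\mathbb{E}[\lambda_{\min}(\nabla^2h_\beta(z_{\mathrm{out}}))]\ge-\delta$, up to universal constant factors in $\varepsilon$ and $\delta$. Oracle counts are the expected total batch sizes over the run: gradient evaluations and Hessian-vector products are counted by $\sum_k\mathbb{E}(|\mathcal{B}^g_{k,1}|+|\mathcal{B}^g_{k,2}|+|\mathcal{B}^g_{k,y}|)$ and Hessian evaluations by $\sum_k\mathbb{E}(|\mathcal{B}^h_{k,1}|+|\mathcal{B}^h_{k,2}|)$. All $O(\cdot)$'s hide universal constants, for $\varepsilon$ sufficiently small depending on the problem data and $\Delta_0$. *)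

(* Defs.v *)
From HB Require Import structures.
From mathcomp Require Import all_boot all_order all_algebra.
From mathcomp Require Import all_classical all_reals all_analysis.

Set Implicit Arguments.
Unset Strict Implicit.
Unset Printing Implicit Defensive.

Import Order.TTheory GRing.Theory Num.Theory numFieldNormedType.Exports.
Local Open Scope classical_set_scope.
Local Open Scope ring_scope.

(* The library norm `|_| on matrices is the sup norm, hence these norms. *)
Definition enorm (R : realType) (d : nat) (v : 'cV[R]_d) : R :=
  Num.sqrt (\sum_i v i 0 ^+ 2).

Definition frobenius (R : realType) (p q : nat) (A : 'M[R]_(p, q)) : R :=
  Num.sqrt (\sum_i \sum_j A i j ^+ 2).

Definition specnorm (R : realType) (p q : nat) (A : 'M[R]_(p, q)) : R :=
  sup [set enorm (A *m v) | v in [set v : 'cV[R]_q | enorm v <= 1]].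

(* Used on real symmetric matrices of positive size only. *)
Definition lambda_min (R : realType) (d : nat) (A : 'M[R]_d) : R :=
  inf [set a : R | eigenvalue A a].

Definition sympart (R : realType) (d : nat) (A : 'M[R]_d) : 'M[R]_d :=
  2^-1 *: (A + A^T).

Definition grad (R : realType) (d : nat) (f : 'cV[R]_d -> R) (z : 'cV[R]_d) :
    'cV[R]_d :=
  \col_i 'D_(delta_mx i 0 : 'cV[R]_d) f z.

Definition hess (R : realType) (d : nat) (f : 'cV[R]_d -> R) (z : 'cV[R]_d) :
    'M[R]_d :=
  \matrix_(i, j)
    'D_(delta_mx i 0 : 'cV[R]_d) (fun w => 'D_(delta_mx j 0 : 'cV[R]_d) f w) z.

(* In finite dimension, z |-> 'd f z is of class C^k iff all its evaluations
   z |-> 'd f z v = 'D_v f z are. *)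
Fixpoint class_C (R : realType) (d k : nat) (f : 'cV[R]_d -> R) : Prop :=
  match k with
  | 0%N => continuous f
  | k'.+1 => (forall z, differentiable f z) /\
             (forall v, class_C k' (fun z => 'D_v f z))
  end.

Definition twice_differentiable (R : realType) (d : nat) (f : 'cV[R]_d -> R) :
    Prop :=
  (forall z, differentiable f z) /\
  (forall v z, differentiable (fun w => 'D_v f w) z).

Definition strongly_concave (R : realType) (d : nat) (mu : R)
    (g : 'cV[R]_d -> R) : Prop :=
  forall (y1 y2 : 'cV[R]_d) (t : R), 0 <= t <= 1 ->
    t * g y1 + (1 - t) * g y2 + mu / 2 * t * (1 - t) * enorm (y1 - y2) ^+ 2
      <= g (t *: y1 + (1 - t) *: y2).

(* A point z = (x, y) of R^n x R^m is col_mx x y. *)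
Definition grad_y (R : realType) (n m : nat) (f : 'cV[R]_(n + m) -> R)
    (z : 'cV[R]_(n + m)) : 'cV[R]_m :=
  dsubmx (grad f z).

(* Under strong concavity in y the supremum is attained. *)
Definition Phi (R : realType) (n m : nat) (f : 'cV[R]_(n + m) -> R)
    (x : 'cV[R]_n) : R :=
  sup [set f (col_mx x y) | y in [set: 'cV[R]_m]].

Definition Phi_bar (R : realType) (n m : nat) (f : 'cV[R]_(n + m) -> R) : R :=
  inf [set Phi f x | x in [set: 'cV[R]_n]].

Definition h_beta (R : realType) (n m : nat) (f : 'cV[R]_(n + m) -> R) (beta : R)
    (z : 'cV[R]_(n + m)) : R :=
  f z + beta / 2 * enorm (grad_y f z) ^+ 2.

Definition Pmx (R : realType) (n m : nat) : 'M[R]_(n + m) :=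
  block_mx 0 0 0 1%:M.

Record deterministic_assumptions (R : realType) (n m : nat)
    (f : 'cV[R]_(n + m) -> R) (mu L rho : R) : Prop := {
  det_mu_gt0 : 0 < mu;
  det_L_gt0 : 0 < L;
  det_rho_gt0 : 0 < rho;
  det_C3 : class_C 3 f;
  det_concave : forall x : 'cV[R]_n,
    strongly_concave mu (fun y : 'cV[R]_m => f (col_mx x y));
  det_grad_lipschitz : forall z1 z2,
    enorm (grad f z1 - grad f z2) <= L * enorm (z1 - z2);
  det_hess_lipschitz : forall z1 z2,
    specnorm (hess f z1 - hess f z2) <= rho * enorm (z1 - z2);
  det_Phi_lbound : has_lbound [set Phi f x | x in [set: 'cV[R]_n]]
}.

(* Since the right-hand sides are finite, the equations on expectations
   include the integrability of their integrands. *)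
Record stochastic_assumptions (R : realType) (n m : nat)
    (d : measure_display) (Xi : measurableType d) (Z : probability Xi R)
    (F : 'cV[R]_(n + m) -> Xi -> R) (f : 'cV[R]_(n + m) -> R)
    (L rho sigma1 sigma2 : R) : Prop := {
  sto_measurable : forall z, measurable_fun [set: Xi] (F z);
  sto_differentiable : forall s, twice_differentiable (fun z => F z s);
  sto_mean : forall z, ('E_Z[F z] = (f z)%:E)%E;
  sto_grad_mean : forall z i,
    ('E_Z[fun s => grad (fun w => F w s) z i 0%R] = (grad f z i 0%R)%:E)%E;
  sto_hess_mean : forall z i j,
    ('E_Z[fun s => hess (fun w => F w s) z i j] = (hess f z i j)%:E)%E;
  sto_grad_moment : forall z,
    ('E_Z[fun s => (enorm (grad (fun w => F w s) z - grad f z) ^+ 3)%R]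
       <= (sigma1 ^+ 3)%:E)%E;
  sto_grad_lipschitz : forall z1 z2,
    ('E_Z[fun s => (enorm (grad (fun w => F w s) z1
                           - grad (fun w => F w s) z2) ^+ 3)%R]
       <= (L ^+ 3 * enorm (z1 - z2) ^+ 3)%:E)%E;
  sto_hess_moment : forall z,
    ('E_Z[fun s => (frobenius (hess (fun w => F w s) z) ^+ 3)%R]
       <= (sigma2 ^+ 3)%:E)%E;
  sto_hess_lipschitz : forall z1 z2,
    ('E_Z[fun s => (frobenius (hess (fun w => F w s) z1
                               - hess (fun w => F w s) z2) ^+ 3)%R]
       <= (rho ^+ 3 * enorm (z1 - z2) ^+ 3)%:E)%E
}.

(* A batch of size N is given by the first N terms of a sequence of samples. *)
Definition Q_est (R : realType) (n m : nat) (X : Type)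
    (F : 'cV[R]_(n + m) -> X -> R) (beta : R) (N : nat) (s1 s2 : nat -> X)
    (z : 'cV[R]_(n + m)) : 'cV[R]_(n + m) :=
  N%:R^-1 *: \sum_(i < N)
    (1%:M + beta *: (hess (fun w => F w (s1 i)) z *m Pmx R n m))
      *m grad (fun w => F w (s2 i)) z.

Definition W_est (R : realType) (n m : nat) (X : Type)
    (F : 'cV[R]_(n + m) -> X -> R) (beta : R) (N : nat) (s1 s2 : nat -> X)
    (z : 'cV[R]_(n + m)) : 'M[R]_(n + m) :=
  sympart (N%:R^-1 *: \sum_(i < N)
    (1%:M + beta *: (hess (fun w => F w (s1 i)) z *m Pmx R n m))
      *m hess (fun w => F w (s2 i)) z).

Definition Gy_est (R : realType) (n m : nat) (X : Type)
    (F : 'cV[R]_(n + m) -> X -> R) (N : nat) (s1 : nat -> X)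
    (z : 'cV[R]_(n + m)) : 'cV[R]_m :=
  N%:R^-1 *: \sum_(i < N) grad_y (fun w => F w (s1 i)) z.

Record sacqrn_params (R : realType) := {
  p_eps : R; p_Delta0 : R; p_beta : R; p_rho : R; p_sigma1 : R; p_sigma2 : R;
  p_c : R; p_c1 : R; p_c2 : R; p_c3 : R; p_Sg : nat; p_Sh : nat
}.

Definition iter_count (R : realType) (p : sacqrn_params R) : nat :=
  (Num.truncn (p_Delta0 p * Num.sqrt (p_c p) / (6 * p_eps p `^ (3 / 2)))).+1.

Definition alpha1 (R : realType) (p : sacqrn_params R) : R :=
  2 * p_beta p * p_rho p.

Definition alpha2 (R : realType) (p : sacqrn_params R) : R := 12 * p_c p.

(* Smallest positive integer N with x <= N, for 0 <= x. *)
Definition least_pos_ge (R : realType) (x : R) : nat :=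
  maxn 1 `|Num.ceil x|%N.

(* In the three size functions xi stands for the previous step xi_(k-1); it is
   irrelevant when the cycle length divides k, in particular for k = 0. *)
Definition size_g (R : realType) (d : nat) (p : sacqrn_params R) (k : nat)
    (xi : 'cV[R]_d) : nat :=
  if (p_Sg p %| k)%N then least_pos_ge (64 * p_c1 p / p_eps p ^+ 2)
  else (Num.truncn (64 * p_c2 p * (p_Sg p)%:R * enorm xi ^+ 2
                      / p_eps p ^+ 2)).+1.

Definition size_h (R : realType) (d : nat) (p : sacqrn_params R) (k : nat)
    (xi : 'cV[R]_d) : nat :=
  if (p_Sh p %| k)%N
  then least_pos_ge (648 * p_sigma2 p ^+ 2 * p_c3 p ^+ 2 / (p_c p * p_eps p))
  else (Num.truncn (648 * p_rho p ^+ 2 * p_c3 p ^+ 2 * (p_Sh p)%:R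
                      * enorm xi ^+ 2 / (p_c p * p_eps p))).+1.

Definition size_y (R : realType) (p : sacqrn_params R) : nat :=
  least_pos_ge (36 * (p_sigma1 p * p_beta p * p_rho p) ^+ 2
                  / (p_c p * p_eps p)).

Definition cubic_model (R : realType) (d : nat) (g : 'cV[R]_d) (H : 'M[R]_d)
    (a1 a2 : R) (xi : 'cV[R]_d) : R :=
  (g^T *m xi) 0 0 + 2^-1 * (xi^T *m (H + a1%:M) *m xi) 0 0
  + a2 / 6 * enorm xi ^+ 3.

Inductive batch_label := Bg1 | Bg2 | Bh1 | Bh2 | By.

Definition all_batches : seq batch_label := [:: Bg1; Bg2; Bh1; Bh2; By].

(* A run on the probability space (Omega, P). At iteration k the five batches
   are initial segments of five sequences r_sample k b of fresh samples, of
   lengths determined by the past; r_filt k is the information available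
   before the samples of iteration k are drawn. The minimizer xi_k is any one
   chosen measurably from the information available after they are drawn. *)
Record sacqrn_run (R : realType) (n m : nat)
    (d : measure_display) (Xi : measurableType d) (Z : probability Xi R)
    (F : 'cV[R]_(n + m) -> Xi -> R)
    (d' : measure_display) (Omega : measurableType d') (P : probability Omega R)
    (p : sacqrn_params R) (z0 : 'cV[R]_(n + m)) := {
  r_filt : nat -> set (set Omega);
  r_sample : nat -> batch_label -> nat -> Omega -> Xi;
  r_z : nat -> Omega -> 'cV[R]_(n + m);
  r_g : nat -> Omega -> 'cV[R]_(n + m);
  r_H : nat -> Omega -> 'M[R]_(n + m);
  r_gy : nat -> Omega -> 'cV[R]_m;
  r_xi : nat -> Omega -> 'cV[R]_(n + m);
  r_ktilde : Omega -> nat;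

  r_filt_sigma : forall k, sigma_algebra setT (r_filt k);
  r_filt_measurable : forall k, r_filt k `<=` measurable;
  r_filt_nondecreasing : forall k, r_filt k `<=` r_filt k.+1;

  r_sample_adapted : forall k b i (B : set Xi), (k < iter_count p)%N ->
    measurable B -> r_filt k.+1 (r_sample k b i @^-1` B);
  (* The samples of iteration k are mutually independent, of law Z, and
     jointly independent of r_filt k. *)
  r_sample_fresh : forall k (A : set Omega) (N : nat)
      (B : batch_label -> nat -> set Xi),
    (k < iter_count p)%N -> r_filt k A -> (forall b i, measurable (B b i)) ->
    P (A `&` [set w | forall b i, (i < N)%N -> B b i (r_sample k b i w)])
      = (P A * \prod_(b <- all_batches) \prod_(i < N) Z (B b i))%E;

  r_z0 : forall w, r_z 0 w = z0;
  r_gE : forall k w, (k < iter_count p)%N ->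
    let N := size_g p k (r_xi k.-1 w) in
    let s1 i := r_sample k Bg1 i w in
    let s2 i := r_sample k Bg2 i w in
    r_g k w =
      if (p_Sg p %| k)%N then Q_est F (p_beta p) N s1 s2 (r_z k w)
      else Q_est F (p_beta p) N s1 s2 (r_z k w)
           - Q_est F (p_beta p) N s1 s2 (r_z k.-1 w) + r_g k.-1 w;
  r_HE : forall k w, (k < iter_count p)%N ->
    let N := size_h p k (r_xi k.-1 w) in
    let s1 i := r_sample k Bh1 i w in
    let s2 i := r_sample k Bh2 i w in
    r_H k w =
      if (p_Sh p %| k)%N then W_est F (p_beta p) N s1 s2 (r_z k w)
      else W_est F (p_beta p) N s1 s2 (r_z k w)
           - W_est F (p_beta p) N s1 s2 (r_z k.-1 w) + r_H k.-1 w;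
  r_gyE : forall k w, (k < iter_count p)%N ->
    r_gy k w = Gy_est F (size_y p) (fun i => r_sample k By i w) (r_z k w);
  r_xi_argmin : forall k w (xi : 'cV[R]_(n + m)), (k < iter_count p)%N ->
    let a1 := alpha1 p * enorm (r_gy k w) in
    cubic_model (r_g k w) (r_H k w) a1 (alpha2 p) (r_xi k w)
      <= cubic_model (r_g k w) (r_H k w) a1 (alpha2 p) xi;
  r_xi_adapted : forall k i (B : set R), (k < iter_count p)%N ->
    measurable B -> r_filt k.+1 [set w | B (r_xi k w i 0)];
  r_zS : forall k w, (k < iter_count p)%N ->
    r_z k.+1 w = r_z k w + r_xi k w;

  r_ktilde_range : forall w, (1 <= r_ktilde w <= iter_count p)%N;
  r_ktilde_measurable : forall j, measurable (r_ktilde @^-1` [set j]);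
  (* ktilde is uniform on {1, ..., T} and independent of the run. *)
  r_ktilde_uniform : forall (A : set Omega) j,
    r_filt (iter_count p) A -> (1 <= j <= iter_count p)%N ->
    P (A `&` r_ktilde @^-1` [set j]) = (P A * ((iter_count p)%:R^-1)%:E)%E
}.

Section run_quantities.
Context (R : realType) (n m : nat) (d : measure_display) (Xi : measurableType d)
  (Z : probability Xi R) (F : 'cV[R]_(n + m) -> Xi -> R)
  (d' : measure_display) (Omega : measurableType d') (P : probability Omega R)
  (p : sacqrn_params R) (z0 : 'cV[R]_(n + m)) (r : sacqrn_run Z F P p z0).

Definition z_out (w : Omega) : 'cV[R]_(n + m) := r_z r (r_ktilde r w) w.

Definition gradient_calls : \bar R :=
  (\sum_(k < iter_count p)
     'E_P[fun w => (size_g p k (r_xi r k.-1 w) + size_g p k (r_xi r k.-1 w)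
                    + size_y p)%N%:R])%E.

Definition hessian_calls : \bar R :=
  (\sum_(k < iter_count p)
     'E_P[fun w => (size_h p k (r_xi r k.-1 w)
                    + size_h p k (r_xi r k.-1 w))%N%:R])%E.

End run_quantities.

(* Integrability is part of the second condition because the library gives the
   expectation a value in \bar R, possibly +oo, for every function. *)
Definition sosp_in_expectation (R : realType) (d : nat) (h : 'cV[R]_d -> R)
    (d' : measure_display) (Omega : measurableType d') (P : probability Omega R)
    (z : Omega -> 'cV[R]_d) (eps delta : R) : Prop :=
  [/\ ('E_P[fun w => enorm (grad h (z w))] <= eps%:E)%E,
      P.-integrable setT (fun w => (lambda_min (hess h (z w)))%:E) &
      ((- delta)%:E <= 'E_P[fun w => lambda_min (hess h (z w))])%E].

(* Main.v *)
Require Import Defs.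
From HB Require Import structures.
From mathcomp Require Import all_boot all_order all_algebra.
From mathcomp Require Import all_classical all_reals all_analysis.
From mathcomp Require Import measurable_realfun.
From mathcomp Require Import ring lra.

Import Order.TTheory GRing.Theory Num.Theory numFieldNormedType.Exports.
Local Open Scope classical_set_scope.
Local Open Scope ring_scope.
Set Implicit Arguments.
Unset Strict Implicit.
Unset Printing Implicit Defensive.

(** The penalty function [h = f + beta / 2 * |grad_y f| ^ 2] with [beta = 2 / mu]
    is minimized by a cubic regularized Newton method that only sees random
    estimates of its gradient, of the part [(I + beta H P) H] of its Hessian
    that is free of third derivatives, and of [grad_y f].

    Geometry. For this [beta], strong concavity gives
    [|grad_y f| <= |grad h|] ([ygrad_le_grad_h]) and
    [h >= Phi_bar + |grad_y f| ^ 2 / (2 * mu)] ([h_beta_lower]). The neglected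
    third derivatives are evaluated in the direction of [grad_y f], so they are
    at most [beta * rho * |grad_y f|] ([hess_h_form]); the shift of the model by
    [2 * beta * rho * |gy|] compensates for them. A minimizer of a cubic model is
    stationary, has nonnegative shifted curvature and a value of at most
    [- c * |xi| ^ 3]. Hence one step decreases [h] by a multiple of
    [c * |xi| ^ 3 + beta * rho * |gy| * |xi| ^ 2] and bounds the gradient and the
    negative curvature at the next point, up to the errors of the estimates
    ([one_step_descent], [one_step_grad], [one_step_hess]).

    Errors. Between two checkpoints the error of an estimate is a sum of batch
    averages that are centered given the past. Second moments of such sums
    add, and the batch sizes are proportional to the squared steps, which makes
    each average as small as one cycle can afford ([g_error_second_moment]). For
    the Hessian a third moment is needed; it is controlled by the growth of
    [|U| ^ 3 + 3 * t ^ 3] along the samples ([batch_third_moment],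
    [H_error_third_moment]). The samples are integrated out one at a time by
    [freeze], the batch sizes and the points being functions of the past.

    Descent. By Young's inequality the errors cost at most [2 * c * s ^ 3] per
    iteration in mean, where [s = sqrt (eps / c)], while the number of iterations
    is about [Delta0 / (6 * c * s ^ 3)]. So the gap plus the progress made so far
    stays below [2 * Delta0] in mean ([potential_bound]), by an induction that
    also keeps [E |grad_y f| ^ 2 <= 4 * mu * Delta0], on which the gradient errors
    depend. On average over the iterations, [c * |xi| ^ 3] is therefore of order
    [c * s ^ 3].

    Conclusion. Summing the one-step bounds over the run gives average gradients
    of order [c * s ^ 2 = eps] ([gradient_total]) and average negative curvature
    of order [c * s = sqrt (c * eps)] ([curvature_total]), where [c] is at most a
    multiple of [kappa * rho]. The output index is uniform and independent of the
    run, which turns averages into expectations ([random_index_mean]). The same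
    sums bound the mean squared steps, hence the expected batch sizes
    ([cycle_cost]). *)

(** * Frobenius inner product and operator bounds *)

Section frobenius_inner_product.
Context {R : realType}.

Definition fdot (p q : nat) (A B : 'M[R]_(p, q)) : R := \tr (A^T *m B).

Lemma fdotE p q (A B : 'M[R]_(p, q)) :
  fdot A B = \sum_i \sum_j A i j * B i j.
Proof.
rewrite exchange_big; apply: eq_bigr => j _; rewrite mxE.
by apply: eq_bigr => i _; rewrite mxE.
Qed.

Lemma fdotC p q (A B : 'M[R]_(p, q)) : fdot A B = fdot B A.
Proof. by rewrite /fdot -mxtrace_tr trmx_mul trmxK. Qed.

Lemma fdotDr p q (A B C : 'M[R]_(p, q)) : fdot A (B + C) = fdot A B + fdot A C.
Proof. by rewrite /fdot mulmxDr mxtraceD. Qed.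

Lemma fdotDl p q (A B C : 'M[R]_(p, q)) : fdot (A + B) C = fdot A C + fdot B C.
Proof. by rewrite !(fdotC _ C) fdotDr. Qed.

Lemma fdotZr p q a (A B : 'M[R]_(p, q)) : fdot A (a *: B) = a * fdot A B.
Proof. by rewrite /fdot -scalemxAr mxtraceZ. Qed.

Lemma fdotZl p q a (A B : 'M[R]_(p, q)) : fdot (a *: A) B = a * fdot A B.
Proof. by rewrite fdotC fdotZr fdotC. Qed.

Lemma fdotNr p q (A B : 'M[R]_(p, q)) : fdot A (- B) = - fdot A B.
Proof. by rewrite -scaleN1r fdotZr mulN1r. Qed.

Lemma fdotNl p q (A B : 'M[R]_(p, q)) : fdot (- A) B = - fdot A B.
Proof. by rewrite fdotC fdotNr fdotC. Qed.

Lemma fdot0r p q (A : 'M[R]_(p, q)) : fdot A 0 = 0.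
Proof. by rewrite -(scale0r 0) fdotZr mul0r. Qed.

Lemma fdot0l p q (A : 'M[R]_(p, q)) : fdot 0 A = 0.
Proof. by rewrite fdotC fdot0r. Qed.

Definition fdot_lin := (fdotDl, fdotDr, fdotZl, fdotZr, fdotNl, fdotNr).

Lemma fdot_suml p q (I : Type) (r : seq I) (Q : pred I) (F : I -> 'M[R]_(p, q)) B :
  fdot (\sum_(i <- r | Q i) F i) B = \sum_(i <- r | Q i) fdot (F i) B.
Proof.
by elim/big_rec2: _ => [|i x y _ <-]; rewrite ?fdot0l ?fdotDl.
Qed.

Lemma fdot_mulmxl p q r (A : 'M[R]_(p, q)) (B : 'M[R]_(q, r)) C :
  fdot (A *m B) C = fdot B (A^T *m C).
Proof. by rewrite /fdot trmx_mul mulmxA. Qed.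

Lemma fdot_trmx p q (A B : 'M[R]_(p, q)) : fdot A^T B^T = fdot A B.
Proof. by rewrite /fdot trmxK mxtrace_mulC -mxtrace_tr trmx_mul !trmxK. Qed.

Lemma fdot_delta d (v : 'cV[R]_d) i : fdot v (delta_mx i 0) = v i 0.
Proof.
rewrite fdotE (bigD1 i) //= big_ord1 mxE !eqxx mulr1 big1 ?addr0 // => j ji.
by rewrite big_ord1 mxE (negbTE ji) mulr0.
Qed.

Lemma fdot_cV d (u v : 'cV[R]_d) : fdot u v = \sum_i u i 0 * v i 0.
Proof. by rewrite fdotE; apply: eq_bigr => i _; rewrite big_ord1. Qed.

Lemma mulmx_trl_fdot d (u v : 'cV[R]_d) : (u^T *m v) 0 0 = fdot u v.
Proof. by rewrite /fdot /mxtrace big_ord1. Qed.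

Lemma fdot_ge0 p q (A : 'M[R]_(p, q)) : 0 <= fdot A A.
Proof.
by rewrite fdotE; do 2![apply: sumr_ge0 => ? _]; rewrite -expr2 sqr_ge0.
Qed.

Lemma frob_ge0 p q (A : 'M[R]_(p, q)) : 0 <= frobenius A.
Proof. exact: sqrtr_ge0. Qed.

Lemma frob_sqr p q (A : 'M[R]_(p, q)) : frobenius A ^+ 2 = fdot A A.
Proof.
rewrite sqr_sqrtr; last by do 2![apply: sumr_ge0 => ? _]; rewrite sqr_ge0.
by rewrite fdotE; do 2![apply: eq_bigr => ? _]; rewrite expr2.
Qed.

Lemma enorm_frob d (v : 'cV[R]_d) : enorm v = frobenius v.
Proof.
by rewrite /enorm /frobenius; congr Num.sqrt; apply: eq_bigr => i _; rewrite big_ord1.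
Qed.

Lemma enorm_ge0 d (v : 'cV[R]_d) : 0 <= enorm v.
Proof. exact: sqrtr_ge0. Qed.

Lemma frob_eq0 p q (A : 'M[R]_(p, q)) : frobenius A = 0 -> A = 0.
Proof.
move=> A0; have : fdot A A = 0 by rewrite -frob_sqr A0 expr0n.
rewrite fdotE => /eqP; rewrite psumr_eq0 => [/allP/= h|i _]; last first.
  by apply: sumr_ge0 => j _; rewrite -expr2 sqr_ge0.
apply/matrixP => i j; rewrite mxE.
have := h i (mem_index_enum i); rewrite psumr_eq0 => [/allP/= h'|k _]; last first.
  by rewrite -expr2 sqr_ge0.
by have := h' j (mem_index_enum j); rewrite -expr2 sqrf_eq0 => /eqP.
Qed.

Lemma frob_le_sqr p q (A : 'M[R]_(p, q)) a : 0 <= a ->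
  (frobenius A <= a) = (fdot A A <= a ^+ 2).
Proof. by move=> a0; rewrite -frob_sqr ler_sqr ?nnegrE ?frob_ge0. Qed.

Lemma frob0 p q : frobenius (0 : 'M[R]_(p, q)) = 0.
Proof.
by apply/eqP; rewrite -sqrf_eq0 frob_sqr fdot0r.
Qed.

Lemma cauchy_schwarz p q (A B : 'M[R]_(p, q)) :
  fdot A B <= frobenius A * frobenius B.
Proof.
have [/frob_eq0 ->|a0] := eqVneq (frobenius A) 0; first by rewrite fdot0l frob0 mul0r.
have [/frob_eq0 ->|b0] := eqVneq (frobenius B) 0; first by rewrite fdot0r frob0 mulr0.
have ap : 0 < frobenius A by rewrite lt_def a0 frob_ge0.
have bp : 0 < frobenius B by rewrite lt_def b0 frob_ge0.
have := fdot_ge0 (frobenius B *: A - frobenius A *: B).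
rewrite !fdot_lin -!frob_sqr (fdotC B A) => h.
rewrite -(ler_pM2l (mulr_gt0 ap bp)).
move: h; set a := frobenius A; set b := frobenius B; set t := fdot A B; nra.
Qed.

Lemma frobN p q (A : 'M[R]_(p, q)) : frobenius (- A) = frobenius A.
Proof.
apply/eqP; rewrite -(@eqrXn2 _ 2) ?frob_ge0 //.
by rewrite !frob_sqr !fdot_lin opprK.
Qed.

Lemma cauchy_schwarzN p q (A B : 'M[R]_(p, q)) :
  - (frobenius A * frobenius B) <= fdot A B.
Proof. by rewrite lerNl -fdotNl -[frobenius A]frobN cauchy_schwarz. Qed.

Lemma frob_triangle p q (A B : 'M[R]_(p, q)) :
  frobenius (A + B) <= frobenius A + frobenius B.
Proof.
rewrite frob_le_sqr ?addr_ge0 ?frob_ge0 // !fdot_lin (fdotC B A) -!frob_sqr.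
have := cauchy_schwarz A B; nra.
Qed.

Lemma frob_triangleB p q (A B : 'M[R]_(p, q)) :
  frobenius (A - B) <= frobenius A + frobenius B.
Proof. by rewrite (le_trans (frob_triangle _ _)) // frobN. Qed.

Lemma frobZ p q a (A : 'M[R]_(p, q)) : frobenius (a *: A) = `|a| * frobenius A.
Proof.
apply/eqP; rewrite -(@eqrXn2 _ 2) ?mulr_ge0 ?normr_ge0 ?frob_ge0 //.
by rewrite exprMn !frob_sqr !fdot_lin real_normK ?num_real // mulrA -expr2.
Qed.

Lemma frob_trmx p q (A : 'M[R]_(p, q)) : frobenius A^T = frobenius A.
Proof. by apply/eqP; rewrite -(@eqrXn2 _ 2) ?frob_ge0 // !frob_sqr fdot_trmx. Qed.

Lemma frob_sqr_cols p q (A : 'M[R]_(p, q)) :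
  frobenius A ^+ 2 = \sum_j frobenius (col j A) ^+ 2.
Proof.
rewrite frob_sqr fdotE exchange_big /=; apply: eq_bigr => j _.
by rewrite frob_sqr fdot_cV; apply: eq_bigr => i _; rewrite !mxE.
Qed.

Lemma frob_mulmx_cV p q (A : 'M[R]_(p, q)) (v : 'cV_q) :
  frobenius (A *m v) <= frobenius A * frobenius v.
Proof.
rewrite frob_le_sqr ?mulr_ge0 ?frob_ge0 // exprMn.
rewrite fdot_cV -(frob_trmx A) frob_sqr_cols mulr_suml; apply: ler_sum => i _.
rewrite -expr2 -exprMn.
have -> : (A *m v) i 0 = fdot (col i A^T) v.
  by rewrite mxE fdot_cV; apply: eq_bigr => k _; rewrite !mxE.
rewrite -[leLHS]real_normK ?num_real // ler_sqr ?nnegrE ?mulr_ge0 ?frob_ge0 //.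
by rewrite ler_norml cauchy_schwarz cauchy_schwarzN.
Qed.

(** A bound of the operator norm, kept as a property of the matrix: unlike a
   supremum it can be applied to a vector at once. *)
Definition opbound p q (A : 'M[R]_(p, q)) (a : R) :=
  forall v : 'cV_q, frobenius (A *m v) <= a * frobenius v.

Lemma frob_opbound p q (A : 'M[R]_(p, q)) : opbound A (frobenius A).
Proof. by move=> v; apply: frob_mulmx_cV. Qed.

Lemma opbound_mulmx p q r (A : 'M[R]_(p, q)) (B : 'M[R]_(q, r)) a : 0 <= a ->
  opbound A a -> frobenius (A *m B) <= a * frobenius B.
Proof.
move=> a0 Aa; rewrite -(ler_sqr (frob_ge0 _)) ?nnegrE ?mulr_ge0 ?frob_ge0 //.
rewrite exprMn (frob_sqr_cols B) (frob_sqr_cols (A *m B)) mulr_sumr; apply: ler_sum => j _.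
by rewrite -exprMn ler_sqr ?nnegrE ?mulr_ge0 ?frob_ge0 // !colE -mulmxA; exact: Aa.
Qed.

Lemma frob_mulmx p q r (A : 'M[R]_(p, q)) (B : 'M[R]_(q, r)) :
  frobenius (A *m B) <= frobenius A * frobenius B.
Proof. by apply: opbound_mulmx; [exact: frob_ge0|exact: frob_opbound]. Qed.

Lemma opbound_le p q (A : 'M[R]_(p, q)) a b : opbound A a -> a <= b -> opbound A b.
Proof. by move=> Aa ab v; rewrite (le_trans (Aa v)) // ler_wpM2r ?frob_ge0. Qed.

Lemma opboundD p q (A B : 'M[R]_(p, q)) a b :
  opbound A a -> opbound B b -> opbound (A + B) (a + b).
Proof.
by move=> Aa Bb v; rewrite mulmxDl mulrDl (le_trans (frob_triangle _ _)) // lerD.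
Qed.

Lemma opboundZ p q (A : 'M[R]_(p, q)) a k : opbound A a -> opbound (k *: A) (`|k| * a).
Proof. by move=> Aa v; rewrite -scalemxAl frobZ -mulrA ler_wpM2l. Qed.

Lemma opboundM p q r (A : 'M[R]_(p, q)) (B : 'M[R]_(q, r)) a b : 0 <= a ->
  opbound A a -> opbound B b -> opbound (A *m B) (a * b).
Proof.
by move=> a0 Aa Bb v; rewrite -mulmxA (le_trans (Aa _)) // -mulrA ler_wpM2l.
Qed.

Lemma opbound1 d : opbound (1%:M : 'M[R]_d) 1.
Proof. by move=> v; rewrite mul1mx mul1r. Qed.

Lemma specnorm_opbound p q (A : 'M[R]_(p, q)) a : specnorm A <= a -> opbound A a.
Proof.
move=> Aa v; have [v0|nz] := eqVneq (frobenius v) 0.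
  by rewrite (frob_eq0 v0) mulmx0 !frob0 mulr0.
have pos : 0 < frobenius v by rewrite lt_def nz frob_ge0.
rewrite -ler_pdivrMr //.
apply: le_trans Aa; rewrite /specnorm; apply: ub_le_sup.
  exists (frobenius A) => _ [w /= w1 <-]; rewrite enorm_frob (le_trans (frob_mulmx_cV _ _)) //.
  by rewrite ler_piMr ?frob_ge0 // -enorm_frob.
exists ((frobenius v)^-1 *: v) => /=.
  by rewrite enorm_frob frobZ ger0_norm ?invr_ge0 ?frob_ge0 // mulVf.
by rewrite enorm_frob -scalemxAr frobZ ger0_norm ?invr_ge0 ?frob_ge0 // mulrC.
Qed.

(** The cube of a Euclidean norm is smooth to second order at any point. With
    [r] the norm of the sum and [a], [b] those of the terms, the difference of
    the two sides is [b ^ 2 * (b + 3 / 2 * a) - (r - a) ^ 2 * (r + a / 2)], and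
    [r] differs from [a] by at most [b]. *)
Lemma frob_cube_le p q (u v : 'M[R]_(p, q)) :
  frobenius (u + v) ^+ 3 <= frobenius u ^+ 3 + 3 * frobenius u * fdot u v
    + 3 * frobenius u * frobenius v ^+ 2 + frobenius v ^+ 3.
Proof.
have h1 := frob_triangle u v.
have h2 : frobenius u <= frobenius (u + v) + frobenius v.
  by have := frob_triangleB (u + v) v; rewrite addrK.
have e : frobenius (u + v) ^+ 2 = frobenius u ^+ 2 + 2 * fdot u v + frobenius v ^+ 2.
  by rewrite !frob_sqr !fdot_lin (fdotC v u); ring.
move: h1 h2 e (frob_ge0 u) (frob_ge0 v) (frob_ge0 (u + v)).
set a := frobenius u; set b := frobenius v; set r := frobenius (u + v); set t := fdot u v.
move=> h1 h2 e a0 b0 r0.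
have -> : t = (r ^+ 2 - a ^+ 2 - b ^+ 2) / 2 by rewrite e; field.
have k1 : (r - a) ^+ 2 <= b ^+ 2.
  by rewrite -[(r - a) ^+ 2]real_normK ?num_real // ler_sqr ?nnegrE // ler_norml; lra.
have k2 : (r - a) ^+ 2 * (r + a / 2) <= b ^+ 2 * (b + 3 / 2 * a).
  apply: ler_pM; rewrite ?sqr_ge0 //; lra.
lra.
Qed.

End frobenius_inner_product.

(** * Taylor estimates along lines *)

Section one_variable.
Context {R : realType}.
Implicit Types phi psi : R -> R.

Lemma is_derive_continuous (phi : R -> R) x l : is_derive x (1 : R) phi l ->
  {for x, continuous phi}.
Proof. by move=> [dx _]; exact/differentiable_continuous/derivable1_diffP. Qed.

Lemma mean_value_seg (phi dphi : R -> R) (a b : R) : a < b ->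
  (forall t, is_derive t (1 : R) phi (dphi t)) ->
  exists2 t, a < t < b & phi b - phi a = dphi t * (b - a).
Proof.
move=> ab dp.
have phic : {within `[a, b], continuous phi}.
  by apply: continuous_subspaceT => t; exact: is_derive_continuous (dp t).
have [t] := MVT ab (fun t _ => dp t) phic.
by rewrite in_itv /= => tab e; exists t.
Qed.

Lemma derive_le_increment (phi psi dphi dpsi : R -> R) (b : R) : 0 <= b ->
  (forall t, is_derive t (1 : R) phi (dphi t)) ->
  (forall t, is_derive t (1 : R) psi (dpsi t)) ->
  (forall t, 0 <= t <= b -> dphi t <= dpsi t) ->
  phi b - phi 0 <= psi b - psi 0.
Proof.
move=> b0 dp ds le; have [->|bn] := eqVneq b 0; first by rewrite !subrr.
have bp : 0 < b by rewrite lt_def bn.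
have [t /andP[t0 tb]] := mean_value_seg bp (fun t => is_deriveB (ds t) (dp t)).
have -> : (psi - phi) b - (psi - phi) 0 = (psi b - psi 0) - (phi b - phi 0).
  by rewrite !fctE; ring.
move=> e; rewrite -subr_ge0 e mulr_ge0 ?subr_ge0 // le // ?(ltW t0) ?(ltW tb) //.
Qed.

(** The second order term disappears from the difference quotient as [t] tends
    to 0. *)
Lemma derive_le_slope (phi : R -> R) (l a b : R) : is_derive (0 : R) (1 : R) phi l ->
  (forall t, 0 < t <= 1 -> phi t - phi 0 <= a * t + b * t ^+ 2) -> l <= a.
Proof.
move=> [dp <-] le; apply/ler_addgt0Pr => e e0.
have /cvg_ex[/= m hm] := dp.
have em : 'D_1 phi 0 = m by exact/cvg_lim.
rewrite em.
have /cvgrPdist_lt/(_ (e / 2)) := hm.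
move=> /(_ ltac:(by rewrite divr_gt0)).
rewrite near_withinE => -[r /= r0 hr].
pose t := Num.min (r / 2) (Num.min 1 (e / (2 * (`|b| + 1)))).
have b1 : 0 < `|b| + 1 by rewrite ltr_wpDl.
have t0 : 0 < t.
  by rewrite !lt_min ltr01 !divr_gt0 // mulr_gt0.
have [tr t1 tb] : [/\ t <= r / 2, t <= 1 & t <= e / (2 * (`|b| + 1))].
  by split; rewrite /t !ge_min lexx ?orbT.
have bt : ball_ Num.norm 0 r t.
  by rewrite /ball_ /= sub0r normrN gtr0_norm // (le_lt_trans tr) // ltr_pdivrMr //; lra.
have h := hr t bt (lt0r_neq0 t0).
have {}h : m < t^-1 * (phi t - phi 0) + e / 2.
  move: h; rewrite /= addr0 [_ *: 1]mulr1.
  by rewrite ltr_norml => /andP[_]; rewrite ltrBlDl.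
have := le t; rewrite t0 t1 => /(_ isT) h2.
have h3 : t^-1 * (phi t - phi 0) <= a + b * t.
  rewrite mulrC ler_pdivrMr //; apply: le_trans h2 _; rewrite le_eqVlt; apply/orP; left.
  by apply/eqP; ring.
have h4 : b * t <= e / 2.
  have : (`|b| + 1) * t <= e / 2.
    rewrite mulrC -ler_pdivlMr //; apply: le_trans tb _.
    by rewrite invfM mulrA.
  have := ler_norm b; nra.
lra.
Qed.

End one_variable.

Section line_calculus.
Context {R : realType} {d : nat}.
Implicit Types (f g : 'cV[R]_d -> R) (z v w : 'cV[R]_d).

Lemma continuous_eps_delta f z e : {for z, continuous f} -> 0 < e ->
  exists2 r, 0 < r & forall w, `|z - w| < r -> `|f z - f w| < e.
Proof.
move=> cf e0; have /cvgrPdist_lt/(_ e e0) := cf.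
by move=> /nbhs_normP[r /= r0 h]; exists r.
Qed.

Lemma is_derive_line f z v t : differentiable f (z + t *: v) ->
  is_derive t (1 : R) (fun s => f (z + s *: v)) ('D_v f (z + t *: v)).
Proof.
move=> df; have dv : derivable f (z + t *: v) v by exact: diff_derivable.
have e : (fun h : R => h^-1 *: (((fun s => f (z + s *: v)) \o shift t) (h *: (1 : R))
             - f (z + t *: v))) =
         (fun h => h^-1 *: ((f \o shift (z + t *: v)) (h *: v) - f (z + t *: v))).
  apply/funext => h /=; congr (_ *: (f _ - _)).
  by rewrite [h *: 1]mulr1 scalerDl addrCA addrC.
by apply: DeriveDef; rewrite /derivable /derive e.
Qed.

Lemma derive_fdot f z v : differentiable f z -> 'D_v f z = fdot (grad f z) v.
Proof.
move=> df; rewrite deriveE // [in LHS](matrix_sum_delta v) fdot_cV linear_sum /=.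
apply: eq_bigr => i _; rewrite big_ord1 linearZ /= mulrC mxE deriveE //.
Qed.

Lemma class_C_derive k f v : class_C k.+1 f -> class_C k ('D_v f).
Proof. by case=> _; exact. Qed.

Lemma class_C_continuous k f : class_C k f -> continuous f.
Proof. by case: k => [//|k] [h _] z; exact/differentiable_continuous/h. Qed.

Lemma class_CW k f : class_C k.+1 f -> class_C k f.
Proof.
elim: k f => [|k IH] f; first exact: class_C_continuous.
by move=> [df h]; split=> // v; exact/IH/h.
Qed.

Lemma class_CD k f g : class_C k f -> class_C k g -> class_C k (f + g).
Proof.
elim: k f g => [|k IH] f g; first by move=> cf cg z; exact: (cvgD (cf z) (cg z)).
move=> [df hf] [dg hg]; split=> [z|v]; first exact: differentiableD.
have -> : (fun z => 'D_v (f + g) z) = 'D_v f + 'D_v g.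
  by apply/funext => z; rewrite deriveD //; exact: diff_derivable.
by apply: IH; [exact: hf|exact: hg].
Qed.

Lemma class_CM k f g : class_C k f -> class_C k g -> class_C k (f * g).
Proof.
elim: k f g => [|k IH] f g; first by move=> cf cg z; exact: (cvgM (cf z) (cg z)).
move=> Cf Cg; have [df hf] := Cf; have [dg hg] := Cg; split=> [z|v].
  exact: differentiableM.
have -> : (fun z => 'D_v (f * g) z) = f * 'D_v g + g * 'D_v f.
  by apply/funext => z; rewrite deriveM //; exact: diff_derivable.
by apply: class_CD; apply: IH; do ?[exact: hf|exact: hg|exact: class_CW].
Qed.

Lemma class_C_cst k (a : R) : class_C k (cst a : 'cV[R]_d -> R).
Proof.
elim: k a => [|k IH] a; first by move=> z; exact: cst_continuous.
split=> [z|v]; first exact: differentiable_cst.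
have -> : (fun z => 'D_v (cst a) z) = cst 0 by apply/funext => z; rewrite derive_cst.
exact: IH.
Qed.

Lemma class_CZ k a f : class_C k f -> class_C k (fun z => a * f z).
Proof. by move=> h; have := class_CM (class_C_cst k a) h. Qed.

Lemma class_C_sum k n (F : 'I_n -> 'cV[R]_d -> R) :
  (forall i, class_C k (F i)) -> class_C k (\sum_(i < n) F i).
Proof.
move=> h; elim/big_ind: _ => [|? ?|//]; first exact: class_C_cst.
exact: class_CD.
Qed.

Lemma class_C_twice f : class_C 2 f -> twice_differentiable f.
Proof. by move=> [df h]; split=> // v z; exact: (h v).1. Qed.

(** [D h / h ^ 2] is a value of [A] and a value of [B], at points that tend to
    [z] with [h]. *)
Lemma second_difference_limit (A B : 'cV[R]_d -> R) (D : R -> R) z u v :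
  {for z, continuous A} -> {for z, continuous B} ->
  (forall h, 0 < h -> exists s t, [/\ 0 < s < h, 0 < t < h &
     D h = h ^+ 2 * A (z + s *: u + t *: v)]) ->
  (forall h, 0 < h -> exists s t, [/\ 0 < s < h, 0 < t < h &
     D h = h ^+ 2 * B (z + s *: v + t *: u)]) ->
  A z = B z.
Proof.
move=> cA cB hA hB.
apply/eqP; rewrite -subr_eq0 -normr_eq0; apply/eqP/le_anti; rewrite normr_ge0 andbT.
apply/ler_addgt0Pr => e e0; rewrite add0r.
have e2 : 0 < e / 2 by rewrite divr_gt0.
have [r1 r10 h1] := continuous_eps_delta cA e2.
have [r2 r20 h2] := continuous_eps_delta cB e2.
pose M := `|u| + `|v| + 1; pose h := Num.min r1 r2 / M.
have M0 : 0 < M by rewrite ltr_wpDl // addr_ge0.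
have h0 : 0 < h by rewrite divr_gt0 // lt_min r10 r20.
have near (a b : 'cV[R]_d) (s t : R) : `|a| + `|b| + 1 = M -> 0 < s < h -> 0 < t < h ->
     `|z - (z + s *: a + t *: b)| < Num.min r1 r2.
  move=> eM /andP[s0 sh] /andP[t0 th].
  rewrite -addrA opprD addNKr normrN (le_lt_trans (ler_normD _ _)) //.
  rewrite !normrZ !gtr0_norm //.
  have -> : Num.min r1 r2 = h * M by rewrite /h divfK // gt_eqF.
  rewrite -eM; have := normr_ge0 a; have := normr_ge0 b; nra.
have [s [t [sh th e1]]] := hA h h0.
have [s' [t' [sh' th' e3]]] := hB h h0.
have ee : A (z + s *: u + t *: v) = B (z + s' *: v + t' *: u).
  have hh : h ^+ 2 != 0 by rewrite expf_neq0 // gt_eqF.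
  by apply: (mulfI hh); rewrite -e1 -e3.
have := near u v s t erefl sh th; rewrite lt_min => /andP[/h1 k1 _].
have := near v u s' t' _ sh' th'; rewrite lt_min /M (addrC `|v|) => /(_ erefl)/andP[_ /h2 k2].
rewrite -(subrKA (A (z + s *: u + t *: v))) (le_trans (ler_normD _ _)) //.
by rewrite (splitr e) lerD ?ltW // distrC ee.
Qed.

(** Both mixed derivatives are limits of the same second difference over a
    small parallelogram, by the mean value theorem in either order. *)
Lemma derive_comm f z u v : class_C 2 f -> 'D_u ('D_v f) z = 'D_v ('D_u f) z.
Proof.
move=> Cf; have [df hf] := Cf.
have key (a b : 'cV[R]_d) (h : R) : 0 < h -> exists s t : R,
    [/\ 0 < s < h, 0 < t < h &
    f (z + h *: a + h *: b) - f (z + h *: a) - f (z + h *: b) + f z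
     = h ^+ 2 * 'D_b ('D_a f) (z + s *: a + t *: b)].
  move=> h0.
  have d1 t : is_derive t (1 : R)
     ((fun s => f (z + h *: b + s *: a)) - (fun s => f (z + s *: a)))
     ('D_a f (z + h *: b + t *: a) - 'D_a f (z + t *: a)).
    by apply: is_deriveB; exact: is_derive_line.
  have [s s0 es] := mean_value_seg h0 d1.
  have d2 t : is_derive t (1 : R)
     (fun t => 'D_a f (z + s *: a + t *: b)) ('D_b ('D_a f) (z + s *: a + t *: b)).
    by apply: is_derive_line; exact: (hf a).1.
  have [t t0 et] := mean_value_seg h0 d2.
  exists s, t; split => //.
  move: es et; rewrite !fctE.
  rewrite !scale0r !addr0 subr0 -[z + h *: b + h *: a]addrAC -[z + h *: b + s *: a]addrAC.
  move=> es et; rewrite et in es; move: es.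
  set A := f _; set B := f _; set C := f _; set D := f _; set E := 'D_b _ _ => es.
  have -> : A - B - C + D = A - B - (C - D) by ring.
  rewrite es; ring.
have c1 := class_C_continuous (class_C_derive u (class_C_derive v Cf)).
have c2 := class_C_continuous (class_C_derive v (class_C_derive u Cf)).
pose D (h : R) := f (z + h *: u + h *: v) - f (z + h *: u) - f (z + h *: v) + f z.
apply: (@second_difference_limit _ _ D z v u (c1 z) (c2 z)) => h h0.
  have [s [t [sh th e]]] := key v u h h0; exists s, t; split=> //.
  by apply: etrans e; rewrite /D (addrAC z); ring.
by have [s [t [sh th e]]] := key u v h h0; exists s, t.
Qed.

End line_calculus.

Lemma is_derive_cubic {R : realType} (a b c t : R) :
  is_derive t (1 : R) (fun s : R => s * a + s ^+ 2 * b + s ^+ 3 * c)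
    (a + 2 * t * b + 3 * t ^+ 2 * c).
Proof.
have h1 : is_derive t (1 : R) (@id R) 1 by exact: is_derive_id.
have h := is_deriveD (is_deriveD (is_deriveM h1 (is_derive_cst a t 1))
   (is_deriveM (is_deriveX 2 h1) (is_derive_cst b t 1)))
   (is_deriveM (is_deriveX 3 h1) (is_derive_cst c t 1)).
have -> : (fun s : R => s * a + s ^+ 2 * b + s ^+ 3 * c) =
  id * cst a + id ^+ 2 * cst b + id ^+ 3 * cst c.
  by apply/funext => s; rewrite !fctE.
apply: is_derive_eq h _.
by rewrite !scaler0 !fctE /GRing.scale /= /cst; ring.
Qed.

Section second_order.
Context {R : realType} {d : nat}.
Implicit Types (f g : 'cV[R]_d -> R) (z v w xi : 'cV[R]_d).

Lemma hess_sym f z : class_C 2 f -> (hess f z)^T = hess f z.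
Proof. by move=> Cf; apply/matrixP => i j; rewrite !mxE derive_comm. Qed.

Lemma derive_derive g z u v : twice_differentiable g ->
  'D_u ('D_v g) z = fdot u (hess g z *m v).
Proof.
move=> [dg ddg].
have -> : 'D_v g = \sum_(j < d) (v j 0 *: 'D_(delta_mx j 0) g).
  apply/funext => w; rewrite fct_sumE derive_fdot // fdot_cV.
  by apply: eq_bigr => j _; rewrite !mxE /= fctE mulrC.
have dj j : differentiable (v j 0 *: 'D_(delta_mx j 0 : 'cV[R]_d) g) z.
  exact/differentiableZ/ddg.
rewrite derive_sum; last by move=> j; exact/diff_derivable/dj.
rewrite fdot_cV.
under [RHS]eq_bigr do rewrite mxE mulr_sumr.
rewrite exchange_big /=; apply: eq_bigr => j _.
rewrite deriveZ; last exact/diff_derivable/ddg.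
rewrite derive_fdot ?fdot_cV; last exact: ddg.
rewrite /GRing.scale /= mulr_sumr; apply: eq_bigr => i _.
rewrite !mxE; ring.
Qed.

Lemma is_derive_line_grad f z v w t : class_C 2 f ->
  is_derive t (1 : R) (fun s => fdot w (grad f (z + s *: v)))
    (fdot w (hess f (z + t *: v) *m v)).
Proof.
move=> Cf; have [df ddf] := class_C_twice Cf.
have -> : (fun s => fdot w (grad f (z + s *: v))) = (fun s => 'D_w f (z + s *: v)).
  by apply/funext => s; rewrite derive_fdot // fdotC.
have -> : fdot w (hess f (z + t *: v) *m v) = 'D_v ('D_w f) (z + t *: v).
  by rewrite derive_derive ?fdot_mulmxl ?hess_sym ?(fdotC (hess _ _ *m _)) // fdotC fdot_mulmxl hess_sym.
exact/is_derive_line/ddf.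
Qed.

Definition grad_lipschitz f (L : R) :=
  forall z1 z2, enorm (grad f z1 - grad f z2) <= L * enorm (z1 - z2).

Definition hess_lipschitz f (rho : R) :=
  forall z1 z2, opbound (hess f z1 - hess f z2) (rho * enorm (z1 - z2)).

Lemma opbound_fdot p q (A : 'M[R]_(p, q)) a : 0 <= a ->
  (forall (u : 'cV_p) (v : 'cV_q), fdot u (A *m v) <= a * frobenius u * frobenius v) ->
  opbound A a.
Proof.
move=> a0 h v.
have [->|nz] := eqVneq (frobenius (A *m v)) 0; first by rewrite mulr_ge0 ?frob_ge0.
have pos : 0 < frobenius (A *m v) by rewrite lt_def nz frob_ge0.
rewrite -(ler_pM2l pos) -expr2 frob_sqr; apply: le_trans (h _ _) _.
by rewrite le_eqVlt; apply/orP; left; apply/eqP; ring.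
Qed.

(** The second derivatives are limits of difference quotients of the gradient. *)
Lemma opbound_hess f L z : class_C 2 f -> 0 <= L -> grad_lipschitz f L ->
  opbound (hess f z) L.
Proof.
move=> Cf L0 gl; apply: opbound_fdot => // u v.
have := is_derive_line_grad z v u 0 Cf; rewrite scale0r addr0 => h.
apply: (derive_le_slope (b := 0) h) => t /andP[t0 _].
rewrite scale0r addr0 -fdotNr -fdotDr mul0r addr0.
rewrite (le_trans (cauchy_schwarz _ _)) // -enorm_frob -[frobenius (_ - _)]enorm_frob.
rewrite mulrAC (mulrC L) -!mulrA ler_wpM2l ?enorm_ge0 //.
rewrite (le_trans (gl _ _)) // ler_wpM2l // addrAC subrr add0r.
by rewrite !enorm_frob frobZ gtr0_norm // mulrC.
Qed.

(** Testing the remainder against itself reduces the estimate to a scalar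
    function on a segment, along which the Hessian drifts by at most
    [rho * t * |xi|]. *)
Lemma grad_remainder f rho z xi : class_C 2 f -> hess_lipschitz f rho ->
  frobenius (grad f (z + xi) - grad f z - hess f z *m xi)
    <= rho / 2 * frobenius xi ^+ 2.
Proof.
move=> Cf hl; set r := _ - _ - _.
have key : fdot r r <= frobenius r * (rho / 2 * frobenius xi ^+ 2).
  have dq := is_derive_cubic (fdot r (hess f z *m xi))
    (rho / 2 * frobenius r * frobenius xi ^+ 2) 0.
  have le t : 0 <= t <= 1 -> fdot r (hess f (z + t *: xi) *m xi) <=
       fdot r (hess f z *m xi) + 2 * t * (rho / 2 * frobenius r * frobenius xi ^+ 2)
         + 3 * t ^+ 2 * 0.
    move=> /andP[t0 _]; rewrite mulr0 addr0 -lerBlDl -fdotNr -fdotDr -mulmxBl.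
    rewrite (le_trans (cauchy_schwarz _ _)) //.
    have ez : z + t *: xi - z = t *: xi by rewrite addrAC subrr add0r.
    have := hl (z + t *: xi) z xi; rewrite ez enorm_frob frobZ ger0_norm // => k.
    have := frob_ge0 r; move: k; set A := frobenius _; set B := frobenius xi; nra.
  have := derive_le_increment ler01 (fun t => is_derive_line_grad z xi r t Cf) dq le.
  rewrite scale0r scale1r addr0 => h.
  rewrite {2}/r !fdotDr !fdotNr; move: h; set X := fdot r (grad f z).
  by rewrite !mulr0 !mul0r !mul1r !expr0n /= !expr1n; nra.
rewrite -frob_sqr expr2 in key.
have [->|nz] := eqVneq (frobenius r) 0; last first.
  by move: key; rewrite ler_pM2l // lt_def nz frob_ge0.
have ez : z + xi - z = xi by rewrite addrAC subrr add0r.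
have := hl (z + xi) z xi; rewrite ez enorm_frob => k.
have := le_trans (frob_ge0 _) k; nra.
Qed.

(** Integrates [grad_remainder] along the segment. *)
Lemma value_remainder f rho z xi : class_C 2 f -> hess_lipschitz f rho ->
  f (z + xi) <= f z + fdot (grad f z) xi + 2^-1 * fdot xi (hess f z *m xi)
     + rho / 6 * frobenius xi ^+ 3.
Proof.
move=> Cf hl; have [df ddf] := class_C_twice Cf.
pose A := fdot (grad f z) xi; pose B := fdot xi (hess f z *m xi).
pose D := rho * frobenius xi ^+ 3.
have dq := is_derive_cubic A (B / 2) (D / 6).
have dl t := @is_derive_line _ _ f z xi t (df _).
have le t : 0 <= t <= 1 -> 'D_xi f (z + t *: xi) <= A + 2 * t * (B / 2) + 3 * t ^+ 2 * (D / 6).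
  move=> /andP[t0 t1]; rewrite derive_fdot //.
  have := cauchy_schwarz xi (grad f (z + t *: xi) - grad f z - hess f z *m (t *: xi)).
  have := grad_remainder z (t *: xi) Cf hl.
  rewrite !fdotDr !fdotNr -scalemxAr fdotZr -/B !(fdotC xi) -/A frobZ ger0_norm // /D.
  set E := frobenius (_ - _); set F := frobenius xi; have := frob_ge0 xi; rewrite -/F => F0.
  move=> h1 h2; have h3 := ler_wpM2l F0 h1.
  have -> : 3 * t ^+ 2 * (rho * F ^+ 3 / 6) = F * (rho / 2 * (t * F) ^+ 2) by field.
  lra.
have := derive_le_increment ler01 dl dq le.
rewrite scale0r scale1r addr0 -/A -/B !mul0r !mul1r !expr0n /= !expr1n !mul0r !mul1r /D; lra.
Qed.

End second_order.

(** * Derivatives of the penalty function *)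

Section block_projection.
Context {R : realType} {n m : nat}.
Implicit Types (v w : 'cV[R]_(n + m)).
Local Notation P := (Pmx R n m).

Lemma Pmx_col (a : 'cV[R]_n) (b : 'cV[R]_m) : P *m col_mx a b = col_mx 0 b.
Proof. by rewrite mul_block_col !mul0mx mul1mx !add0r. Qed.

Lemma Pmx_tr : P^T = P.
Proof. by rewrite /Pmx tr_block_mx !trmx0 trmx1. Qed.

Lemma Pmx_idem : P *m P = P.
Proof. by rewrite /Pmx mulmx_block !(mul0mx, mulmx0, mul1mx, addr0, add0r). Qed.

Lemma fdot_col (a c : 'cV[R]_n) (b e : 'cV[R]_m) :
  fdot (col_mx a b) (col_mx c e) = fdot a c + fdot b e.
Proof.
rewrite !fdot_cV big_split_ord /=; congr (_ + _); apply: eq_bigr => i _.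
  by rewrite !col_mxEu.
by rewrite !col_mxEd.
Qed.

Lemma fdot_Pmx v w : fdot (P *m v) w = fdot v (P *m w).
Proof. by rewrite fdot_mulmxl Pmx_tr. Qed.

Lemma fdot_PmxP v w : fdot (P *m v) (P *m w) = fdot (P *m v) w.
Proof. by rewrite -fdot_Pmx mulmxA Pmx_idem. Qed.

Lemma opbound_Pmx : opbound P 1.
Proof.
move=> v; rewrite mul1r frob_le_sqr ?frob_ge0 // frob_sqr.
rewrite -[v]vsubmxK Pmx_col !fdot_col fdot0l add0r lerDr; exact: fdot_ge0.
Qed.

Lemma frob_Pmx v : frobenius (P *m v) <= frobenius v.
Proof. by have := opbound_Pmx v; rewrite mul1r. Qed.

Lemma frob_dsubmx v : frobenius (dsubmx v) = frobenius (P *m v).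
Proof.
apply/eqP; rewrite -(@eqrXn2 _ 2) ?frob_ge0 // !frob_sqr.
by rewrite -{3 4}[v]vsubmxK Pmx_col fdot_col fdot0l add0r.
Qed.

Lemma Pmx_sum v : P *m v = \sum_(l < m) v (rshift n l) 0 *: delta_mx (rshift n l) 0.
Proof.
apply/matrixP => i j; rewrite ord1 summxE -[in LHS](vsubmxK v) Pmx_col.
case: (split_ordP i) => k ->.
  rewrite col_mxEu mxE big1 // => l _.
  by rewrite !mxE eq_lrshift mulr0.
rewrite col_mxEd mxE (bigD1 k) //= big1 => [|l lk].
  by rewrite !mxE !eqxx mulr1 addr0.
by rewrite !mxE eq_rshift eq_sym (negbTE lk) mulr0.
Qed.

End block_projection.

Lemma fdot_ext {R : realType} d (a b : 'cV[R]_d) : (forall v, fdot a v = fdot b v) -> a = b.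
Proof.
by move=> h; apply/matrixP => i j; rewrite ord1 -!fdot_delta.
Qed.

Lemma is_derive_mulR {R : realType} d (F G : 'cV[R]_d -> R) z v a b :
  is_derive z v F a -> is_derive z v G b -> is_derive z v (F * G) (F z * b + G z * a).
Proof. by move=> dF dG; exact: is_deriveM. Qed.

Lemma derive_Pmx {R : realType} n m (G : 'cV[R]_(n + m) -> R) z w :
  differentiable G z -> 'D_(Pmx R n m *m w) G z =
  \sum_(l < m) w (rshift n l) 0 * 'D_(delta_mx (rshift n l) 0 : 'cV[R]_(n + m)) G z.
Proof.
move=> dG; rewrite derive_fdot // fdotC Pmx_sum fdot_suml.
by apply: eq_bigr => l _; rewrite fdotZl fdotC fdot_delta mxE.
Qed.

Section penalty.
Context {R : realType} {n m : nat} (f : 'cV[R]_(n + m) -> R) (beta : R).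
Implicit Types (z v w xi : 'cV[R]_(n + m)).
Context (Cf : class_C 3 f).
Local Notation P := (Pmx R n m).
Local Notation h := (h_beta f beta).
Local Notation e_ l := (delta_mx (rshift n l) 0 : 'cV[R]_(n + m)).

Let C2f : class_C 2 f := class_CW Cf.
Let tf : twice_differentiable f := class_C_twice C2f.

Definition prefactor z : 'M[R]_(n + m) := 1%:M + beta *: (hess f z *m P).

(** The Hessian of the penalty function up to third derivatives of [f]. *)
Definition hess_model z := prefactor z *m hess f z.

(** The partial gradient in the concave variable, padded with zeros so that it
    can be paired with full gradients. *)
Definition ygrad z : 'cV[R]_(n + m) := P *m grad f z.

Lemma enorm_grad_y z : enorm (grad_y f z) = frobenius (ygrad z).
Proof. by rewrite enorm_frob frob_dsubmx. Qed.

Lemma h_betaE z : h z = f z + beta / 2 * frobenius (ygrad z) ^+ 2.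
Proof. by rewrite /h_beta enorm_grad_y. Qed.

(** Writes the penalty as a polynomial in directional derivatives, to which the
    sum and product rules apply. *)
Lemma h_beta_sum : h = f + (fun z => beta / 2 * (\sum_(l < m) ('D_(e_ l) f * 'D_(e_ l) f)) z).
Proof.
apply/funext => z; rewrite !fctE h_betaE; congr (_ + _ * _).
rewrite frob_sqr fdot_PmxP Pmx_sum.
rewrite fct_sumE fdot_suml.
apply: eq_bigr => l _; rewrite fdotZl fdotC fdot_delta.
by rewrite mxE fctE.
Qed.

Lemma class_C_h_beta : class_C 2 h.
Proof.
have C2l l := class_C_derive (e_ l) Cf.
have C2s := class_C_sum (fun l => class_CM (C2l l) (C2l l)).
by rewrite h_beta_sum; exact: (class_CD C2f (class_CZ (beta / 2) C2s)).
Qed.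

Lemma twice_h_beta : twice_differentiable h.
Proof. exact/class_C_twice/class_C_h_beta. Qed.

Lemma derive_h_beta v : 'D_v h =
  'D_v f + (fun z => beta * (\sum_(l < m) ('D_(e_ l) f * 'D_v ('D_(e_ l) f))) z).
Proof.
apply/funext => z; rewrite h_beta_sum.
have [df ddf] := tf.
have dM l : is_derive z v ('D_(e_ l) f * 'D_(e_ l) f)
    (2 * ('D_(e_ l) f z * 'D_v ('D_(e_ l) f) z)).
  have dl : is_derive z v ('D_(e_ l) f) ('D_v ('D_(e_ l) f) z).
    exact/derivableP/diff_derivable/ddf.
  by apply: is_derive_eq (is_deriveM dl dl) _; rewrite /GRing.scale /=; ring.
have dS := is_deriveZ (beta / 2) (is_derive_sum dM).
have dF : is_derive z v f ('D_v f z) by exact/derivableP/diff_derivable/df.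
have := is_deriveD dF dS => -[_].
rewrite [X in 'D_v X z](_ : _ = f + (fun z => beta / 2 *
     (\sum_(l < m) ('D_(e_ l) f * 'D_(e_ l) f)) z)); last by [].
move=> ->; rewrite !fctE /GRing.scale /= -mulr_sumr fct_sumE mulrA.
by congr (_ + _ * _); field.
Qed.

Lemma derive_h_beta_at v z : 'D_v h z =
  'D_v f z + beta * \sum_(l < m) ('D_(e_ l) f z * 'D_v ('D_(e_ l) f) z).
Proof.
by have := congr1 (fun g => g z) (derive_h_beta v); rewrite /= => ->; rewrite !fctE fct_sumE.
Qed.

Lemma grad_h_beta z : grad h z = prefactor z *m grad f z.
Proof.
have [df ddf] := tf; have [dh _] := twice_h_beta.
apply: fdot_ext => v; rewrite -derive_fdot // derive_h_beta_at derive_fdot //.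
rewrite mulmxDl mul1mx fdotDl; congr (_ + _).
rewrite -scalemxAl fdotZl -mulmxA Pmx_sum mulmx_sumr; congr (_ * _).
rewrite fdot_suml; apply: eq_bigr => l _.
rewrite -scalemxAr fdotZl derive_derive // fdotC mxE.
by [].
Qed.

Lemma hess_model_form z v : fdot v (hess_model z *m v) =
  fdot v (hess f z *m v) + beta * frobenius (P *m (hess f z *m v)) ^+ 2.
Proof.
rewrite /hess_model /prefactor !mulmxDl mul1mx fdotDr; congr (_ + _).
rewrite -!scalemxAl fdotZr frob_sqr fdot_PmxP; congr (_ * _).
by rewrite -!mulmxA [RHS]fdotC fdot_mulmxl hess_sym.
Qed.

Lemma hess_model_sym z : (hess_model z)^T = hess_model z.
Proof.
rewrite /hess_model /prefactor mulmxDl mul1mx -scalemxAl linearD /= linearZ /=.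
by rewrite !trmx_mul Pmx_tr hess_sym // mulmxA.
Qed.

(** Commuting the third derivatives gathers them into one derivative in the
    direction of the partial gradient: they are small where it is. *)
Lemma derive2_h_beta z v : 'D_v ('D_v h) z =
  fdot v (hess_model z *m v) + beta * 'D_(ygrad z) ('D_v ('D_v f)) z.
Proof.
have [df ddf] := tf.
have C2v u : class_C 2 ('D_u f) := class_C_derive u Cf.
have dM l : is_derive z v ('D_(e_ l) f * 'D_v ('D_(e_ l) f))
    ('D_(e_ l) f z * 'D_v ('D_v ('D_(e_ l) f)) z + 'D_v ('D_(e_ l) f) z * 'D_v ('D_(e_ l) f) z).
  apply: is_derive_mulR; apply/derivableP/diff_derivable; first exact: ddf.
  exact: (class_C_twice (C2v _)).2.
have dS := is_deriveZ beta (is_derive_sum dM).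
have dF : is_derive z v ('D_v f) ('D_v ('D_v f) z).
  exact/derivableP/diff_derivable/ddf.
rewrite derive_h_beta.
have := is_deriveD dF dS => -[_] e.
apply: etrans e _; rewrite hess_model_form (derive_derive z v v tf) -addrA; congr (_ + _).
rewrite /GRing.scale /= -mulrDr; congr (_ * _).
rewrite big_split /= addrC; congr (_ + _).
  rewrite frob_sqr fdot_PmxP Pmx_sum fdot_suml.
  apply: eq_bigr => l _; rewrite fdotZl (fdotC (delta_mx _ _)) fdot_delta.
  rewrite (derive_derive z v _ tf) -fdot_delta.
  by congr (_ * _); rewrite fdotC fdot_mulmxl hess_sym // fdotC fdot_mulmxl hess_sym.
have dvv : differentiable ('D_v ('D_v f)) z by exact: (class_C_twice (C2v v)).2.
transitivity (\sum_(l < m) grad f z (rshift n l) 0 * 'D_(e_ l) ('D_v ('D_v f)) z);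
  last exact/esym/derive_Pmx.
have E l : 'D_v ('D_(e_ l) f) = 'D_(e_ l) ('D_v f).
  by apply/funext => y; exact: (derive_comm y v (e_ l) C2f).
apply: eq_bigr => l _; rewrite [in RHS]mxE.
exact: (congr1 (fun x => 'D_(e_ l) f z * x) (etrans
  (congr1 (fun F : 'cV[R]_(n + m) -> R => 'D_v F z) (E l))
  (derive_comm z v (e_ l) (C2v v)))).
Qed.

End penalty.

(** * Estimates for the penalty function *)

Lemma add_subl (V : zmodType) (z xi : V) : z + xi - z = xi.
Proof. by rewrite addrAC subrr add0r. Qed.

Lemma mulmx_diff_split (R : realType) d (A' A H' H : 'M[R]_d) (v : 'cV_d) :
  (A' *m H' - A *m H) *m v = A' *m ((H' - H) *m v) + (A' - A) *m (H *m v).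
Proof. by rewrite !mulmxBl !mulmxBr !mulmxA addrA subrK. Qed.

Lemma mulmx_remainder_split (R : realType) d (A' A H : 'M[R]_d) (g' g x : 'cV_d) :
  A' *m g' - A *m g - A *m H *m x = A *m (g' - g - H *m x) + (A' - A) *m g'.
Proof.
rewrite !mulmxBr mulmxBl !mulmxA.
move: (A' *m _) (A *m g') (A *m g) (_ *m x) => a b c e.
apply/matrixP => i j; rewrite !mxE; ring.
Qed.

Lemma frob_sqr_add3 (R : realType) p q (a b c : 'M[R]_(p, q)) :
  frobenius (a + b + c) ^+ 2 = frobenius a ^+ 2 + 2 * fdot a b + frobenius b ^+ 2
    + fdot c (a + b + (a + b + c)).
Proof.
by rewrite !frob_sqr !fdot_lin (fdotC b a) (fdotC c a) (fdotC c b); ring.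
Qed.

Section smooth_strongly_concave.
Context {R : realType} {n m : nat} (f : 'cV[R]_(n + m) -> R) (mu L rho beta : R).
Context (hd : deterministic_assumptions f mu L rho).
Context (beta_ge0 : 0 <= beta).
Implicit Types (z v w xi : 'cV[R]_(n + m)).
Local Notation P := (Pmx R n m).
Local Notation h := (h_beta f beta).
Local Notation A_ := (prefactor f beta).
Local Notation HW := (hess_model f beta).
Local Notation u z := (frobenius (ygrad f z)).
Let mu0 := det_mu_gt0 hd.
Let L0 := det_L_gt0 hd.
Let rho0 := det_rho_gt0 hd.
Let Cf := det_C3 hd.
Let C2f : class_C 2 f := class_CW Cf.
Let tf : twice_differentiable f := class_C_twice C2f.

Lemma det_hess_opbound : hess_lipschitz f rho.
Proof. by move=> z1 z2; exact/specnorm_opbound/(det_hess_lipschitz hd). Qed.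

Lemma det_opbound_hess z : opbound (hess f z) L.
Proof. by apply: opbound_hess C2f (ltW L0) _ => ? ?; exact: (det_grad_lipschitz hd). Qed.

Lemma det_hess_sym z : (hess f z)^T = hess f z.
Proof. exact: hess_sym. Qed.

Lemma det_grad_lip z xi : frobenius (grad f (z + xi) - grad f z) <= L * frobenius xi.
Proof. by have := det_grad_lipschitz hd (z + xi) z; rewrite !enorm_frob add_subl. Qed.

Lemma ygrad_lip z xi : u (z + xi) <= u z + L * frobenius xi.
Proof.
have -> : ygrad f (z + xi) = ygrad f z + P *m (grad f (z + xi) - grad f z).
  by rewrite /ygrad mulmxBr [RHS]addrC subrK.
rewrite (le_trans (frob_triangle _ _)) // lerD2l (le_trans (frob_Pmx _)) //.
exact: det_grad_lip.
Qed.

(** Strong concavity at [z + t W], divided by [t], as [t] tends to 0. *)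
Lemma concave_above z (w : 'cV[R]_m) :
  f (z + col_mx 0 w) <= f z + fdot (grad f z) (col_mx 0 w) - mu / 2 * frobenius w ^+ 2.
Proof.
have [df _] := tf; set W := col_mx 0 w.
have dl := @is_derive_line _ _ f z W 0 (df _).
rewrite scale0r addr0 derive_fdot // in dl.
rewrite -[f z + _]opprK -lerN2 opprK.
have := derive_le_slope (is_deriveN dl) (a := - (f (z + W) - f z + mu / 2 * frobenius w ^+ 2))
  (b := mu / 2 * frobenius w ^+ 2).
move=> /(_ _)/wrap[t /andP[t0 t1]|]; last lra.
have := det_concave hd (usubmx z) (dsubmx z + w) (dsubmx z) (t := t).
rewrite ltW // t1 => /(_ isT) /=.
have e1 : col_mx (usubmx z) (dsubmx z + w) = z + W.
  by rewrite -[in RHS](vsubmxK z) add_col_mx addr0.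
have e2 : col_mx (usubmx z) (t *: (dsubmx z + w) + (1 - t) *: dsubmx z) = z + t *: W.
  rewrite -[in RHS](vsubmxK z) scale_col_mx add_col_mx scaler0 addr0; congr col_mx.
  by rewrite scalerDr addrAC -scalerDl [t + _]addrC subrK scale1r.
rewrite e1 e2 vsubmxK add_subl enorm_frob !fctE scale0r addr0; nra.
Qed.

(** Adding the tangent bounds at [z] and at [z + t W] leaves the strong
    monotonicity of the gradient, whose difference quotient is the quadratic
    form. *)
Lemma hess_yy_neg z (w : 'cV[R]_m) :
  fdot (col_mx 0 w) (hess f z *m col_mx 0 w) <= - mu * frobenius w ^+ 2.
Proof.
set W := col_mx 0 w.
have h := is_derive_line_grad z W W 0 C2f; rewrite scale0r addr0 in h.
apply: (derive_le_slope (b := 0) h) => t /andP[t0 _].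
rewrite scale0r addr0.
have e : t *: W = col_mx 0 (t *: w) by rewrite scale_col_mx scaler0.
have h1 := concave_above z (t *: w).
have h2 := concave_above (z + t *: W) (- (t *: w)).
have e3 : z + t *: W + col_mx 0 (- (t *: w)) = z.
  by rewrite e -addrA add_col_mx addr0 subrr col_mx0 addr0.
have e4 : col_mx 0 (- (t *: w)) = - (t *: W) by rewrite e opp_col_mx oppr0.
rewrite -e in h1; rewrite e3 e4 frobN in h2.
rewrite !(fdotNr, fdotZr) frobZ (ger0_norm (ltW t0)) in h1 h2.
rewrite !(fdotC W); move: h1 h2.
set a := fdot _ _; set b := fdot _ _; set p := f _; set q := f _; set F := frobenius w.
move=> h1 h2.
have : t * (b - a) <= t * (- mu * F ^+ 2 * t) by nra.
rewrite ler_pM2l //; lra.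
Qed.

Lemma ygradE z : ygrad f z = col_mx 0 (dsubmx (grad f z)).
Proof. by rewrite /ygrad -{1}[grad f z]vsubmxK Pmx_col. Qed.

Lemma frob_col0 (w : 'cV[R]_m) : frobenius (col_mx (0 : 'cV[R]_n) w) = frobenius w.
Proof.
by apply/eqP; rewrite -(@eqrXn2 _ 2) ?frob_ge0 // !frob_sqr fdot_col fdot0l add0r.
Qed.

Lemma mu_le_L : (0 < m)%N -> mu <= L.
Proof.
move=> m0; pose w : 'cV[R]_m := delta_mx (Ordinal m0) 0; pose W : 'cV[R]_(n + m) := col_mx 0 w.
have w1 : frobenius w ^+ 2 = 1 by rewrite frob_sqr fdot_delta mxE !eqxx.
have := hess_yy_neg 0 w; rewrite -/W w1 mulr1 => h1.
have w2 : frobenius w = 1.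
  by apply/eqP; rewrite -(@eqrXn2 _ 2) ?frob_ge0 // w1 expr1n.
have := cauchy_schwarzN W (hess f 0 *m W); have := det_opbound_hess 0 W.
by rewrite !frob_col0 w2 mulr1 mul1r => h2 h3; lra.
Qed.

(** The tangent bound is largest for a displacement of norm [u z / mu]. *)
Lemma Phi_le z : Phi f (usubmx z) <= f z + u z ^+ 2 / (2 * mu).
Proof.
rewrite /Phi; apply: ge_sup; first by exists (f (col_mx (usubmx z) 0)); exists 0.
move=> _ [y _ <-]; pose w := y - dsubmx z.
have -> : col_mx (usubmx z) y = z + col_mx 0 w.
  by rewrite -[in RHS](vsubmxK z) add_col_mx addr0 /w addrC subrK.
rewrite (le_trans (concave_above _ _)) // -addrA lerD2l.
have -> : fdot (grad f z) (col_mx 0 w) = fdot (ygrad f z) (col_mx 0 w).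
  by rewrite fdot_Pmx Pmx_col.
have := cauchy_schwarz (ygrad f z) (col_mx 0 w); rewrite frob_col0.
set a := fdot _ _; set b := frobenius _; set c := frobenius w => h1.
rewrite ler_pdivlMr ?mulr_gt0 //.
have := sqr_ge0 (b - mu * c); have := ler_wpM2l (ltW mu0) h1; lra.
Qed.

Lemma Phi_bar_le z : Phi_bar f <= Phi f (usubmx z).
Proof. by apply: ge_inf; [exact: (det_Phi_lbound hd)|exists (usubmx z)]. Qed.

Lemma opbound_prefactor z : opbound (A_ z) (1 + beta * L).
Proof.
apply: opboundD; first exact: opbound1.
rewrite -{2}(ger0_norm beta_ge0); apply: opboundZ.
rewrite -[X in opbound _ X]mulr1; apply: opboundM; [exact: ltW|exact: det_opbound_hess|].
exact: opbound_Pmx.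
Qed.

Lemma opbound_hess_model z : opbound (HW z) ((1 + beta * L) * L).
Proof.
apply: opboundM; [|exact: opbound_prefactor|exact: det_opbound_hess].
by rewrite addr_ge0 // mulr_ge0 // ltW.
Qed.

Lemma prefactorB z xi v : frobenius ((A_ (z + xi) - A_ z) *m v) <=
  beta * (rho * frobenius xi) * frobenius (P *m v).
Proof.
have -> : A_ (z + xi) - A_ z = beta *: ((hess f (z + xi) - hess f z) *m P).
  by rewrite opprD addrACA subrr add0r -scalerBr -mulmxBl.
rewrite -scalemxAl frobZ ger0_norm // -mulmxA -mulrA ler_wpM2l //.
by have := det_hess_opbound (z + xi) z (P *m v); rewrite add_subl enorm_frob.
Qed.

Lemma hess_model_lip z xi :
  opbound (HW (z + xi) - HW z) ((1 + 2 * beta * L) * rho * frobenius xi).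
Proof.
move=> v.
rewrite /hess_model mulmx_diff_split (le_trans (frob_triangle _ _)) //.
have h1 := opbound_prefactor (z + xi) ((hess f (z + xi) - hess f z) *m v).
have h2 := det_hess_opbound (z + xi) z v; rewrite add_subl enorm_frob in h2.
have h3 := prefactorB z xi (hess f z *m v).
have h4 := le_trans (frob_Pmx _) (det_opbound_hess z v).
have bL : 0 <= 1 + beta * L by rewrite addr_ge0 // mulr_ge0 // ltW.
have k1 := ler_wpM2l bL h2.
have br : 0 <= beta * (rho * frobenius xi) by rewrite !mulr_ge0 ?frob_ge0 // ltW.
have k2 := ler_wpM2l br h4.
apply: le_trans (lerD (le_trans h1 k1) (le_trans h3 k2)) _.
by rewrite le_eqVlt; apply/orP; left; apply/eqP; ring.
Qed.

(** In the gradient of the penalty function the varying factor is multiplied by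
    [P], hence it only meets the partial gradient; this is the source of the
    term with [u z]. *)
Lemma grad_h_remainder z xi :
  frobenius (grad h (z + xi) - grad h z - HW z *m xi) <=
   (3 * beta * L + 1) * rho / 2 * frobenius xi ^+ 2 + beta * rho * u z * frobenius xi.
Proof.
rewrite !grad_h_beta // /hess_model.
rewrite mulmx_remainder_split (le_trans (frob_triangle _ _)) //.
have h1 := opbound_prefactor z (grad f (z + xi) - grad f z - hess f z *m xi).
have h2 := grad_remainder z xi C2f det_hess_opbound.
have h3 := prefactorB z xi (grad f (z + xi)).
have h4 := ygrad_lip z xi.
have bL : 0 <= 1 + beta * L by rewrite addr_ge0 // mulr_ge0 // ltW.
have k1 := ler_wpM2l bL h2.
have br : 0 <= beta * (rho * frobenius xi) by rewrite !mulr_ge0 ?frob_ge0 // ltW.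
have k2 := ler_wpM2l br h4.
apply: le_trans (lerD (le_trans h1 k1) (le_trans h3 k2)) _.
by rewrite le_eqVlt; apply/orP; left; apply/eqP; field.
Qed.

(** The new partial gradient is its first order model plus a remainder, and the
    difference of their squares is the remainder times a sum that is bounded by
    [u z] and the step. *)
Lemma h_beta_remainder z xi : h (z + xi) <= h z + fdot (grad h z) xi
  + 2^-1 * fdot xi (HW z *m xi) + beta * rho / 2 * u z * frobenius xi ^+ 2
  + (3 * beta * L + 1) * rho / 6 * frobenius xi ^+ 3.
Proof.
have h1 := value_remainder z xi C2f det_hess_opbound.
have h2 := grad_remainder z xi C2f det_hess_opbound.
have h3 := ygrad_lip z xi.
rewrite !h_betaE hess_model_form // grad_h_beta // /prefactor mulmxDl mul1mx fdotDl.
rewrite -scalemxAl fdotZl -mulmxA fdot_mulmxl det_hess_sym -/(ygrad f z) .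
set r := grad f (z + xi) - grad f z - hess f z *m xi in h2.
pose Hx := P *m (hess f z *m xi).
have eg : ygrad f (z + xi) = ygrad f z + Hx + P *m r.
  rewrite /ygrad /Hx -!mulmxDr /r; congr (P *m _).
  move: (hess f z *m xi) (grad f z) (grad f (z + xi)) => a b c.
  by apply/matrixP => i j; rewrite !mxE; ring.
have hx : frobenius Hx <= L * frobenius xi.
  exact: le_trans (frob_Pmx _) (det_opbound_hess z xi).
have hr := le_trans (frob_Pmx r) h2.
have hs : frobenius (ygrad f z + Hx + ygrad f (z + xi)) <= 2 * u z + 2 * L * frobenius xi.
  have t1 := frob_triangle (ygrad f z + Hx) (ygrad f (z + xi)).
  have t2 := le_trans (frob_triangle (ygrad f z) Hx) (lerD (lexx _) hx).
  apply: le_trans t1 (le_trans (lerD t2 h3) _).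
  by rewrite le_eqVlt; apply/orP; left; apply/eqP; ring.
have e2 : u (z + xi) ^+ 2 = u z ^+ 2 + 2 * fdot (ygrad f z) (hess f z *m xi)
    + frobenius Hx ^+ 2 + fdot (P *m r) (ygrad f z + Hx + ygrad f (z + xi)).
  have e3 : fdot (ygrad f z) (hess f z *m xi) = fdot (ygrad f z) Hx.
    by rewrite /ygrad /Hx fdot_PmxP.
  by rewrite e3 eg frob_sqr_add3.
have cs := cauchy_schwarz (P *m r) (ygrad f z + Hx + ygrad f (z + xi)).
have x0 := frob_ge0 xi.
have k : fdot (P *m r) (ygrad f z + Hx + ygrad f (z + xi)) <=
     rho / 2 * frobenius xi ^+ 2 * (2 * u z + 2 * L * frobenius xi).
  apply: le_trans cs _; apply: ler_pM; rewrite ?frob_ge0 //.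
have k2 := ler_wpM2l (divr_ge0 beta_ge0 (ler0n _ 2)) k.
rewrite e2; move: h1 k2; rewrite -/Hx.
move: (fdot (P *m r) _) (frobenius xi) (fdot (grad f z) xi) (fdot xi _) (fdot (ygrad f z) _)
  (frobenius Hx) (frobenius (ygrad f z)) (f (z + xi)) (f z) => E x a b c e U F1 F0 h1 k2.
have -> : beta / 2 * (U ^+ 2 + 2 * c + e ^+ 2 + E) =
   beta / 2 * U ^+ 2 + beta * c + beta / 2 * e ^+ 2 + beta / 2 * E by field.
apply: le_trans (lerD h1 (lerD (lexx _) k2)) _.
by rewrite le_eqVlt; apply/orP; left; apply/eqP; field.
Qed.

(** A third derivative is a limit of differences of the Hessian. *)
Lemma third_derivative_bound z v w :
  'D_w ('D_v ('D_v f)) z <= rho * frobenius w * frobenius v ^+ 2.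
Proof.
have [df ddf] := tf.
have dvv : differentiable ('D_v ('D_v f)) z.
  exact: (class_C_twice (class_C_derive v Cf)).2.
have dz : differentiable ('D_v ('D_v f)) (z + 0 *: w) by rewrite scale0r addr0.
have := is_derive_line dz; rewrite [X in 'D_w _ X](_ : _ = z) ?scale0r ?addr0 // => dl.
apply: (derive_le_slope (b := 0) dl) => t /andP[t0 _].
rewrite scale0r addr0 mul0r addr0 !(derive_derive _ _ _ tf).
rewrite -fdotNr -fdotDr -mulmxBl (le_trans (cauchy_schwarz _ _)) //.
have := det_hess_opbound (z + t *: w) z v; rewrite add_subl enorm_frob frobZ gtr0_norm // => k.
apply: le_trans (ler_wpM2l (frob_ge0 v) k) _.
by rewrite le_eqVlt; apply/orP; left; apply/eqP; ring.
Qed.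

Lemma hess_h_form z v :
  `|fdot v (hess h z *m v) - fdot v (HW z *m v)| <= beta * rho * u z * frobenius v ^+ 2.
Proof.
rewrite -(derive_derive _ _ _ (twice_h_beta beta Cf)) derive2_h_beta // addrAC subrr add0r.
have [df ddf] := tf.
have dvv : differentiable ('D_v ('D_v f)) z.
  exact: (class_C_twice (class_C_derive v Cf)).2.
have h1 := third_derivative_bound z v (ygrad f z).
have h2 := third_derivative_bound z v (- ygrad f z).
move: h2; rewrite frobN (derive_fdot _ dvv) fdotNr -(derive_fdot _ dvv) => h2.
move: h1 h2; move: ('D_(ygrad f z) ('D_v ('D_v f)) z) => T h1 h2.
have hT : `|T| <= rho * u z * frobenius v ^+ 2 by rewrite ler_norml h1 andbT lerNl.
rewrite normrM ger0_norm //; apply: le_trans (ler_wpM2l beta_ge0 hT) _.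
by rewrite !mulrA.
Qed.

(** For this [beta] the penalty is twice the gap that [Phi_le] leaves between [f]
    and its maximum in the concave variable: half of it fills the gap, the other
    half bounds the partial gradient. *)
Lemma h_beta_lower z : beta = 2 * mu^-1 -> Phi_bar f + u z ^+ 2 / (2 * mu) <= h z.
Proof.
move=> bE; rewrite h_betaE; have := Phi_le z; have := Phi_bar_le z.
have -> : beta / 2 * u z ^+ 2 = 2 * (u z ^+ 2 / (2 * mu)).
  by rewrite bE; field; exact: lt0r_neq0.
lra.
Qed.

(** On the block of the strongly concave variable the factor [I + beta H P] is
    at most [- I], so the gradient of the penalty function dominates the
    partial gradient. *)
Lemma ygrad_le_grad_h z : beta = 2 * mu^-1 -> u z <= frobenius (grad h z).
Proof.
move=> bE.
have k1 : fdot (ygrad f z) (grad h z) <= - u z ^+ 2.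
  rewrite grad_h_beta // /prefactor mulmxDl mul1mx fdotDr -scalemxAl fdotZr -mulmxA.
  rewrite -/(ygrad f z).
  have -> : fdot (ygrad f z) (grad f z) = u z ^+ 2 by rewrite frob_sqr fdot_PmxP.
  have := hess_yy_neg z (dsubmx (grad f z)); rewrite -ygradE frob_dsubmx -/(ygrad f z).
  move=> k; have := ler_wpM2l beta_ge0 k.
  have -> : beta * (- mu * u z ^+ 2) = - 2 * u z ^+ 2.
    by rewrite bE; field; exact: lt0r_neq0.
  lra.
have := cauchy_schwarzN (ygrad f z) (grad h z).
have [-> _|nz] := eqVneq (u z) 0; first exact: frob_ge0.
have pos : 0 < u z by rewrite lt_def nz frob_ge0.
move=> k2; rewrite -(ler_pM2l pos); lra.
Qed.

End smooth_strongly_concave.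

(** * Minimizers of the cubic model *)

Section cubic_minimizer.
Context {R : realType}.

Lemma cubic_germ_ge0 (p q r : R) :
  (forall s, 0 < s <= 1 -> 0 <= s * p + s ^+ 2 * q + s ^+ 3 * r) -> 0 <= p.
Proof.
move=> H; rewrite leNgt; apply/negP => p0.
pose K := `|q| + `|r| + 1.
have K0 : 0 < K by rewrite ltr_wpDl // addr_ge0.
pose s := Num.min 1 (- p / (2 * K)).
have pK : 0 < - p / (2 * K) by rewrite divr_gt0 ?mulr_gt0 // oppr_gt0.
have s0 : 0 < s by rewrite lt_min ltr01.
have s1 : s <= 1 by rewrite ge_min lexx.
have sp : s * (2 * K) <= - p by rewrite -ler_pdivlMr ?mulr_gt0 // ge_min lexx orbT.
have := H s; rewrite s0 s1 => /(_ isT) h.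
have {}h : 0 <= p + s * (q + s * r).
  by rewrite -(pmulr_rge0 _ s0); apply: le_trans h _; rewrite le_eqVlt; apply/orP; left; apply/eqP; ring.
have h1 : q + s * r <= K.
  rewrite /K; have := ler_norm q; have := ler_norm r; have := normr_ge0 r; nra.
have := ler_wpM2l (ltW s0) h1; nra.
Qed.

Context {d : nat} (g : 'cV[R]_d) (H : 'M[R]_d) (a : R) (xi : 'cV[R]_d).
Context (Hs : H^T = H).
Context (a0 : 0 <= a).

Definition cubic (v : 'cV[R]_d) : R :=
  fdot g v + 2^-1 * fdot v (H *m v) + a / 6 * frobenius v ^+ 3.

Context (xi_min : forall v, cubic xi <= cubic v).

(** Minimality in the direction opposite to the gradient of the model. *)
Lemma cubic_stationary : g + H *m xi + (a / 2 * frobenius xi) *: xi = 0.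
Proof.
set G := _ + _ + _.
have key v : 0 <= fdot G v.
  apply: (@cubic_germ_ge0 _ (2^-1 * fdot v (H *m v) + a / 2 * frobenius xi * frobenius v ^+ 2)
    (a / 6 * frobenius v ^+ 3)) => s /andP[s0 _].
  have := xi_min (xi + s *: v); rewrite /cubic -subr_ge0 => h; apply: le_trans h _.
  have := frob_cube_le xi (s *: v).
  rewrite frobZ gtr0_norm // fdotZr => k; have a6 : 0 <= a / 6 by rewrite divr_ge0.
  have {}k := ler_wpM2l a6 k.
  rewrite mulmxDr -scalemxAr !fdot_lin (fdotC xi (H *m v)) fdot_mulmxl Hs.
  rewrite (fdotC (H *m xi) v).
  move: k; set x := frobenius xi; set V := frobenius v.
  move: (frobenius (_ + _)) (fdot g xi) (fdot g v) (fdot xi _) (fdot v _) (fdot v _) (fdot xi v).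
  move=> r b1 b2 b3 b4 b5 b6 k; lra.
have := key (- G); rewrite fdotNr -frob_sqr oppr_ge0 => h.
by apply: frob_eq0; apply/eqP; rewrite -sqrf_eq0 eq_le h sqr_ge0.
Qed.

(** Steps that keep the norm leave the cubic term alone, so along them
    minimality is a statement about the shifted quadratic form; directions
    orthogonal to the minimizer are reached up to a third order error. *)
Lemma cubic_curvature (v : 'cV[R]_d) : 0 <= fdot v (H *m v) + a / 2 * frobenius xi * frobenius v ^+ 2.
Proof.
set q := _ + _; set x := frobenius xi; set V := frobenius v.
have [v0|vn] := eqVneq V 0; first by rewrite /q (frob_eq0 v0) fdot0l frob0 expr0n mulr0 addr0.
have V0 : 0 < V by rewrite lt_def vn frob_ge0.
have x0 : 0 <= x := frob_ge0 xi.
have ge : g = - (H *m xi) - (a / 2 * x) *: xi.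
  by have := cubic_stationary; rewrite -addrA => /addr0_eq e; rewrite -[LHS]opprK e opprD.
have key s : let r := frobenius (xi + s *: v) in
    0 <= 2^-1 * s ^+ 2 * q + a / 12 * ((r - x) ^+ 2 * (2 * r + x)).
  move=> r; have := xi_min (xi + s *: v); rewrite /cubic -subr_ge0 => h; apply: le_trans h _.
  have e : r ^+ 2 = x ^+ 2 + 2 * s * fdot xi v + s ^+ 2 * V ^+ 2.
    by rewrite /r /x /V !frob_sqr !fdot_lin (fdotC v xi); ring.
  rewrite mulmxDr -scalemxAr !fdot_lin (fdotC xi (H *m v)) fdot_mulmxl Hs ge.
  rewrite !fdot_lin !(fdotC (H *m xi)) -/r -/x.
  have e' : fdot xi v * s = (r ^+ 2 - x ^+ 2 - s ^+ 2 * V ^+ 2) / 2 by rewrite e; field.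
  move: e'; rewrite /q -/x -/V -frob_sqr -/x.
  move: (fdot xi (H *m xi)) (fdot v (H *m xi)) (fdot v (H *m v)) (fdot xi v) => b1 b2 b3 b4 e'.
  by have := congr1 (fun t => a / 2 * x * t) e'; lra.
have [xv|xv] := eqVneq (fdot xi v) 0.
  have : 0 <= 2^-1 * q.
    apply: (@cubic_germ_ge0 _ (a / 6 * V ^+ 3) 0) => s /andP[s0 _].
    rewrite mulr0 addr0 -(pmulr_rge0 _ s0).
    have := key s; set r := frobenius _; rewrite /= => h; apply: le_trans h _.
    have e : r ^+ 2 = x ^+ 2 + s ^+ 2 * V ^+ 2.
      by rewrite /r /x /V !frob_sqr !fdot_lin (fdotC v xi) xv; ring.
    have r0 : 0 <= r := frob_ge0 _.
    have rx : x <= r by rewrite -(@ler_pXn2r _ 2) ?nnegrE // e lerDl mulr_ge0 ?sqr_ge0.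
    have rs : r <= x + s * V.
      rewrite -(@ler_pXn2r _ 2) ?nnegrE ?addr_ge0 ?mulr_ge0 ?(ltW s0) ?(ltW V0) //.
      rewrite e; have : 0 <= x * (s * V) by rewrite mulr_ge0 // mulr_ge0 // ltW.
      nra.
    have k1 : (r - x) ^+ 2 * (2 * r + x) <= 2 * (s * V) ^+ 3.
      have k2 : (r - x) * (r + x) = (s * V) ^+ 2 by rewrite exprMn -subr_sqr e; ring.
      have k3 : (r - x) ^+ 2 * (2 * r + x) <= 2 * (r - x) * ((r - x) * (r + x)).
        have := sqr_ge0 (r - x); nra.
      apply: le_trans k3 _; rewrite k2; have := sqr_ge0 (s * V); nra.
    have a12 : 0 <= a / 12 by rewrite divr_ge0.
    have := ler_wpM2l a12 k1; rewrite exprMn; lra.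
  by rewrite pmulr_rge0.
(* The second point of the line at which the norm is that of [xi]. *)
pose s := - 2 * fdot xi v / V ^+ 2.
have er : frobenius (xi + s *: v) = x.
  apply/eqP; rewrite -(@eqrXn2 _ 2) ?frob_ge0 //; apply/eqP.
  rewrite /x !frob_sqr !fdot_lin (fdotC v xi) -(frob_sqr v) -/V /s; field.
  exact: vn.
have := key s; rewrite /= er subrr expr0n mul0r mulr0 addr0 pmulr_rge0 //.
rewrite pmulr_rgt0 // lt_def sqr_ge0 andbT expf_neq0 // /s.
by rewrite mulf_neq0 ?invr_eq0 ?expf_neq0 // mulf_neq0 // oppr_eq0.
Qed.

(** Combines stationarity and curvature, both in the direction of the minimizer
    itself. *)
Lemma cubic_value : cubic xi <= - (a / 12) * frobenius xi ^+ 3.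
Proof.
have h := cubic_curvature xi.
have e : fdot g xi = - fdot xi (H *m xi) - a / 2 * frobenius xi ^+ 3.
  have := congr1 (fun G => fdot G xi) cubic_stationary; rewrite fdot0l !fdot_lin -frob_sqr.
  by rewrite (fdotC (H *m xi)) => k; lra.
rewrite /cubic e; move: h; set A := fdot _ _; nra.
Qed.

End cubic_minimizer.

Lemma descent_arith (R : realType)
  (h1 h0 dh dg w q b c x eg eH ey y u : R) :
  h1 <= h0 + dh + 2^-1 * w + b / 2 * u * x ^+ 2 + c * x ^+ 3 ->
  dg + 2^-1 * (q + 2 * b * y * x ^+ 2) + 12 * c / 6 * x ^+ 3 <= - (12 * c / 12) * x ^+ 3 ->
  dh - dg <= eg * x -> w - q <= eH * x ^+ 2 -> b * u * x ^+ 2 <= b * (y + ey) * x ^+ 2 ->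
  h1 <= h0 - 2 * c * x ^+ 3 + eg * x + eH / 2 * x ^+ 2 + b / 2 * (ey - y) * x ^+ 2.
Proof. move=> *; lra. Qed.

Lemma curvature_arith (R : realType) (k q w w' c x eH b y u V : R) :
  0 <= q + 2 * b * y * V ^+ 2 + 12 * c / 2 * x * V ^+ 2 ->
  - (b * u * V ^+ 2) <= k - w' -> - (eH * V ^+ 2) <= w - q ->
  - (6 * c * x * V ^+ 2) <= w' - w ->
  - k <= (12 * c * x + eH + 2 * b * y + b * u) * V ^+ 2.
Proof. move=> *; lra. Qed.

Section one_step.
Context {R : realType} {n m : nat} (f : 'cV[R]_(n + m) -> R) (mu L rho beta : R).
Context (hd : deterministic_assumptions f mu L rho).
Context (beta_ge0 : 0 <= beta).
Local Notation h := (h_beta f beta).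
Local Notation HW := (hess_model f beta).
Local Notation u z := (frobenius (ygrad f z)).
Context (z g xi : 'cV[R]_(n + m)) (H : 'M[R]_(n + m)) (gy : 'cV[R]_m).
Let c := (3 * beta * L + 1) * rho / 6.
Let a1 := 2 * beta * rho * enorm gy.
Context (Hs : H^T = H).
Context (xi_min : forall v, cubic_model g H a1 (12 * c) xi <= cubic_model g H a1 (12 * c) v).
Let L0 := det_L_gt0 hd.
Let rho0 := det_rho_gt0 hd.
Let Cf := det_C3 hd.
Let eg := frobenius (g - grad h z).
Let eH := frobenius (H - HW z).
Let ey := frobenius (gy - grad_y f z).
Let x := frobenius xi.
Let y := frobenius gy.

Lemma c_gt0 : 0 < c.
Proof. by rewrite /c divr_gt0 // mulr_gt0 // ltr_wpDl // !mulr_ge0 // ltW. Qed.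

Lemma cubic_modelE (v : 'cV[R]_(n + m)) : cubic_model g H a1 (12 * c) v = cubic g (H + a1%:M) (12 * c) v.
Proof. by rewrite /cubic_model /cubic -mulmxA !mulmx_trl_fdot enorm_frob. Qed.

Let Hs1 : (H + a1%:M)^T = H + a1%:M.
Proof. by rewrite linearD /= Hs tr_scalar_mx. Qed.

Let c12 : 0 <= 12 * c.
Proof. by rewrite mulr_ge0 // ltW // c_gt0. Qed.

Let mn v : cubic g (H + a1%:M) (12 * c) xi <= cubic g (H + a1%:M) (12 * c) v.
Proof. by rewrite -!cubic_modelE. Qed.

Let uy : u z <= y + ey.
Proof.
rewrite -enorm_grad_y enorm_frob /y /ey.
have := frob_triangleB gy (gy - grad_y f z); rewrite opprB addrC subrK.
by [].
Qed.

Let yu : y <= u z + ey.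
Proof.
rewrite -enorm_grad_y enorm_frob /y /ey.
by have := frob_triangle (grad_y f z) (gy - grad_y f z); rewrite addrC subrK.
Qed.

Let br0 : 0 <= beta * rho.
Proof. by rewrite mulr_ge0 // ltW. Qed.

Let shiftE (v : 'cV[R]_(n + m)) : (H + a1%:M) *m v = H *m v + (2 * beta * rho * y) *: v.
Proof. by rewrite mulmxDl mul_scalar_mx /a1 enorm_frob. Qed.

(** The model dominates the expansion of the penalty function: its cubic weight
    is [2 c] instead of [c], and its quadratic shift is twice what the third
    derivatives require. The surplus is the decrease. *)
Lemma one_step_descent : h (z + xi) <= h z - 2 * c * x ^+ 3 + eg * x + eH / 2 * x ^+ 2
   + beta * rho / 2 * (ey - y) * x ^+ 2.
Proof.
have h1 := h_beta_remainder hd beta_ge0 z xi.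
have h2 := cubic_value Hs1 c12 mn; rewrite /cubic shiftE !fdot_lin -frob_sqr in h2.
have h3 := cauchy_schwarz (grad h z - g) xi.
rewrite -frobN opprB -/eg -/x fdotDl fdotNl in h3.
have h4 : fdot xi (HW z *m xi) - fdot xi (H *m xi) <= eH * x ^+ 2.
  rewrite -fdotNr -fdotDr -mulmxBl (le_trans (cauchy_schwarz _ _)) // -/x.
  have := frob_mulmx_cV (HW z - H) xi; rewrite -[frobenius (HW z - H)]frobN opprB -/eH -/x => k.
  by have := ler_wpM2l (frob_ge0 xi) k; rewrite -/x expr2 mulrCA.
have h5 := ler_wpM2r (sqr_ge0 x) (ler_wpM2l br0 uy).
have := descent_arith h1 _ h3 h4 h5; apply.
by move: h2; rewrite (mulrA 2 beta rho).
Qed.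

(** Stationarity of the model cancels all of the expansion of the gradient but
    the estimation errors, the shift and the cubic term. *)
Lemma one_step_grad : frobenius (grad h (z + xi)) <=
  eg + eH * x + 9 * c * x ^+ 2 + beta * rho * u z * x + 2 * beta * rho * y * x.
Proof.
have h1 := grad_h_remainder hd beta_ge0 z xi; rewrite -/x in h1.
have h2 := cubic_stationary Hs1 c12 mn; rewrite shiftE -/x in h2.
set r := _ - _ in h1.
have e : grad h (z + xi) = r + (grad h z - g) + (HW z - H) *m xi
   - (2 * beta * rho * y) *: xi - (12 * c / 2 * x) *: xi.
  rewrite -[LHS]subr0 -h2 /r mulmxBl.
  move: (grad h (z + xi)) (grad h z) (HW z *m xi) (H *m xi) (_ *: xi) (_ *: xi) => v1 v2 v3 v4 v5 v6.
  by apply/matrixP => i j; rewrite !mxE; ring.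
have k1 : frobenius ((2 * beta * rho * y) *: xi) = 2 * beta * rho * y * x.
  by rewrite frobZ ger0_norm // -!mulrA !mulr_ge0 ?frob_ge0 // ltW.
have k2 : frobenius ((12 * c / 2 * x) *: xi) = 6 * c * x ^+ 2.
  rewrite frobZ ger0_norm; first by rewrite -/x; field.
  by rewrite mulr_ge0 ?frob_ge0 // divr_ge0.
have k3 : frobenius ((HW z - H) *m xi) <= eH * x.
  by have := frob_mulmx_cV (HW z - H) xi; rewrite -[frobenius (HW z - H)]frobN opprB.
have k4 : frobenius (grad h z - g) = eg by rewrite -frobN opprB.
rewrite e; apply: le_trans (frob_triangleB _ _) _; rewrite k2.
apply: le_trans (lerD (frob_triangleB _ _) (lexx _)) _; rewrite k1.
apply: le_trans (lerD (lerD (frob_triangle _ _) (lexx _)) (lexx _)) _.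
apply: le_trans (lerD (lerD (lerD (frob_triangle _ _) (lexx _)) (lexx _)) (lexx _)) _.
have -> : 9 * c * x ^+ 2 = (3 * beta * L + 1) * rho / 2 * x ^+ 2 + 6 * c * x ^+ 2.
  by rewrite /c; field.
rewrite k4 addrAC lerD2r; apply: le_trans (lerD (lerD (lerD h1 (lexx _)) k3) (lexx _)) _.
by rewrite le_eqVlt; apply/orP; left; apply/eqP; ring.
Qed.

(** The curvature of the model at its minimizer, carried over to the new point
    by the Lipschitz bound of [hess_model]. *)
Lemma one_step_hess (v : 'cV[R]_(n + m)) : - fdot v (hess h (z + xi) *m v) <=
  (12 * c * x + eH + 2 * beta * rho * y + beta * rho * u (z + xi)) * frobenius v ^+ 2.
Proof.
have h1 := cubic_curvature Hs1 c12 mn v; rewrite shiftE fdotDr fdotZr -frob_sqr -/x in h1.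
have := hess_h_form hd beta_ge0 (z + xi) v; rewrite ler_norml => /andP[h2 _].
set V := frobenius v in h1 h2 *.
have h3 : - (eH * V ^+ 2) <= fdot v (HW z *m v) - fdot v (H *m v).
  rewrite -fdotNr -fdotDr -mulmxBl; apply: le_trans (cauchy_schwarzN _ _).
  have := frob_mulmx_cV (HW z - H) v; rewrite -[frobenius (HW z - H)]frobN opprB -/eH => k.
  by rewrite lerN2; have := ler_wpM2l (frob_ge0 v) k; rewrite -/V expr2 mulrCA.
have h4 : - (6 * c * x * V ^+ 2) <= fdot v (HW (z + xi) *m v) - fdot v (HW z *m v).
  rewrite -fdotNr -fdotDr -mulmxBl; apply: le_trans (cauchy_schwarzN _ _).
  have k := hess_model_lip hd beta_ge0 z xi v.
  have {}k := ler_wpM2l (frob_ge0 v) k; rewrite -/V -/x in k *.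
  rewrite lerN2; apply: le_trans k _.
  have -> : V * ((1 + 2 * beta * L) * rho * x * V) = (1 + 2 * beta * L) * rho * (x * V ^+ 2) by ring.
  have -> : 6 * c * x * V ^+ 2 = (3 * beta * L + 1) * rho * (x * V ^+ 2) by rewrite /c; field.
  rewrite ler_wpM2r ?mulr_ge0 ?sqr_ge0 ?frob_ge0 // ler_wpM2r ?(ltW rho0) //.
  by rewrite addrC lerD2r -!mulrA ler_wpM2r ?ler_nat // mulr_ge0 // ltW.
have := curvature_arith _ h2 h3 h4; rewrite !(mulrA 2 beta rho); apply.
exact: h1.
Qed.

End one_step.

(** * The smallest eigenvalue of a symmetric matrix *)

Section minimal_eigenvalue.
Context {R : realType}.

Lemma fdot_sym_mulmx d (A : 'M[R]_d) (u v : 'cV[R]_d) : A^T = A ->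
  fdot u (A *m v) = fdot v (A *m u).
Proof. by move=> As; rewrite fdotC fdot_mulmxl As. Qed.

Lemma quadratic_form_continuous d (A : 'M[R]_d) :
  continuous (fun v : 'rV[R]_d => fdot v^T (A *m v^T)).
Proof.
have cS (F : 'I_d -> 'rV[R]_d -> R) : (forall i, continuous (F i)) ->
    continuous (\sum_(i < d) F i).
  move=> cF; elim/big_ind: _ => [||i _]; last exact: cF.
    by move=> z; exact: cst_continuous.
  by move=> f g cf cg z; exact: (cvgD (cf z) (cg z)).
have cc i : continuous (fun v : 'rV[R]_d => v 0 i) by exact: coord_continuous.
have -> : (fun v : 'rV[R]_d => fdot v^T (A *m v^T)) =
    \sum_(i < d) ((fun v : 'rV[R]_d => v 0 i) *
       \sum_(j < d) ((fun=> A i j) * (fun v : 'rV[R]_d => v 0 j))).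
  apply/funext => v; rewrite fct_sumE fdot_cV; apply: eq_bigr => i _.
  rewrite !mxE !fctE fct_sumE; congr (_ * _); apply: eq_bigr => j _.
  by rewrite !mxE !fctE.
apply: (cS) => i z; apply: (cvgM (cc i z)).
have := cS (fun j => (fun=> A i j) * (fun v : 'rV[R]_d => v 0 j)); apply=> j y.
exact: (cvgM (cvg_cst (A i j)) (cc j y)).
Qed.

Lemma abs_coord_le_frob d (v : 'cV[R]_d) i : `|v i 0| <= frobenius v.
Proof.
rewrite -(@ler_pXn2r _ 2) ?nnegrE ?frob_ge0 // real_normK ?num_real // frob_sqr fdot_cV.
rewrite (bigD1 i) //= -expr2 lerDl; apply: sumr_ge0 => j _.
by rewrite -expr2 sqr_ge0.
Qed.

Lemma sphere_compact d : compact [set v : 'rV[R]_d | fdot v^T v^T = 1].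
Proof.
apply: bounded_closed_compact.
  exists 1; split; first exact: num_real.
  move=> M M1 v /= v1.
  rewrite [leLHS]mx_normrE; apply/bigmax_leP; split; first lra.
  move=> [i j] _ /=; rewrite (ord1 i).
  have := abs_coord_le_frob v^T j; rewrite mxE => h; apply: le_trans h _.
  rewrite frob_le_sqr ?v1; nra.
have -> : [set v : 'rV[R]_d | fdot v^T v^T = 1] =
    (fun v : 'rV[R]_d => fdot v^T (1%:M *m v^T)) @^-1` [set 1].
  by apply/seteqP; split => v /=; rewrite mul1mx.
apply: closed_comp; last exact: closed_eq.
by move=> v _; exact: quadratic_form_continuous.
Qed.

(** The smallest eigenvalue of a symmetric matrix is the minimum of its
    quadratic form over the unit sphere, attained at an eigenvector. *)
Lemma lambda_minP d (A : 'M[R]_d) : (0 < d)%N -> A^T = A ->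
  (forall v : 'cV[R]_d, lambda_min A * frobenius v ^+ 2 <= fdot v (A *m v)) /\
  exists2 v : 'cV[R]_d, frobenius v = 1 & fdot v (A *m v) = lambda_min A.
Proof.
move=> d0 As; pose S := [set v : 'rV[R]_d | fdot v^T v^T = 1].
have S0 : S !=set0.
  exists (delta_mx 0 (Ordinal d0)); rewrite /S /= trmx_delta fdot_delta.
  by rewrite mxE !eqxx.
have qc : {within S, continuous (fun v : 'rV[R]_d => fdot v^T (A *m v^T))}.
  by apply: continuous_subspaceT; exact: quadratic_form_continuous.
have [v0 v0S minv0] := EVT_min_rV S0 (@sphere_compact d) qc.
rewrite inE /S /= in v0S; set v := v0^T in v0S minv0.
have v1 : frobenius v = 1.
  by apply/eqP; rewrite -(@eqrXn2 _ 2) ?frob_ge0 // frob_sqr v0S expr1n.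
set a := fdot v (A *m v).
have low (w : 'cV[R]_d) : a * frobenius w ^+ 2 <= fdot w (A *m w).
  have [w0|wn] := eqVneq (frobenius w) 0.
    by rewrite (frob_eq0 w0) frob0 expr0n mulr0 fdot0l.
  have wp : 0 < frobenius w by rewrite lt_def wn frob_ge0.
  have := minv0 ((frobenius w)^-1 *: w)^T; rewrite trmxK inE /S /=.
  move=> /(_ _)/wrap[|].
    rewrite trmxK !fdot_lin -frob_sqr; field; exact: wn.
  rewrite -scalemxAr !fdot_lin -/a mulrA -expr2 exprVn mulrC => h.
  by rewrite -ler_pdivlMr // exprn_gt0.
have Bv : A *m v = a *: v.
  have key w : 0 <= fdot w (A *m v - a *: v).
    rewrite -(pmulr_rge0 _ (ltr0n R 2)).
    apply: (@cubic_germ_ge0 _ _ (fdot w (A *m w) - a * fdot w w) 0) => s _.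
    have := low (v + s *: w); rewrite -subr_ge0 => h; apply: le_trans h _.
    rewrite le_eqVlt; apply/orP; left; apply/eqP.
    rewrite frob_sqr mulmxDr -scalemxAr !fdot_lin (fdot_sym_mulmx v w As) (fdotC v w).
    by rewrite -frob_sqr v1 -/a; ring.
  have := key (- (A *m v - a *: v)); rewrite fdotNl oppr_ge0 -frob_sqr => h.
  apply/eqP; rewrite -subr_eq0; apply/eqP/frob_eq0/eqP.
  by rewrite -sqrf_eq0 eq_le h sqr_ge0.
have av : eigenvalue A a.
  apply/eigenvalueP; exists v0; first by rewrite -[LHS]trmxK trmx_mul As Bv linearZ /= trmxK.
  apply/eqP => v00; have := v1; rewrite /v v00 trmx0 frob0 => /eqP.
  by rewrite eq_sym oner_eq0.
have lb : lbound [set b | eigenvalue A b] a.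
  move=> b /= /eigenvalueP[w wE w0].
  have := low w^T; have -> : A *m w^T = b *: w^T by rewrite -As -trmx_mul wE linearZ.
  rewrite fdotZr -frob_sqr ler_pM2r // lt_def sqr_ge0 andbT sqrf_eq0.
  apply: contra w0 => /eqP/frob_eq0 h; rewrite -[w]trmxK h trmx0; exact: eqxx.
have aE : lambda_min A = a.
  apply/le_anti/andP; split.
    by apply: ge_inf => //; exists a.
  by apply: lb_le_inf => //; exists a.
by rewrite aE; split => //; exists v.
Qed.

Lemma lambda_min_ge d (A : 'M[R]_d) b : (0 < d)%N -> A^T = A ->
  (forall v : 'cV[R]_d, - fdot v (A *m v) <= b * frobenius v ^+ 2) -> - b <= lambda_min A.
Proof.
move=> d0 As h; have [_ [v v1 <-]] := lambda_minP d0 As.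
by have := h v; rewrite v1 expr1n mulr1 lerNl.
Qed.

Lemma lambda_min_le d (A : 'M[R]_d) b : (0 < d)%N -> A^T = A ->
  (forall v : 'cV[R]_d, fdot v (A *m v) <= b * frobenius v ^+ 2) -> lambda_min A <= b.
Proof.
move=> d0 As h; have [_ [v v1 <-]] := lambda_minP d0 As.
by have := h v; rewrite v1 expr1n mulr1.
Qed.

Lemma lambda_min_lipschitz d (A B : 'M[R]_d) : (0 < d)%N -> A^T = A -> B^T = B ->
  lambda_min A <= lambda_min B + frobenius (A - B).
Proof.
move=> d0 As Bs; have [lowA _] := lambda_minP d0 As.
have [_ [v v1 <-]] := lambda_minP d0 Bs.
have := lowA v; rewrite v1 expr1n mulr1 => h; apply: le_trans h _.
rewrite -lerBlDl -fdotNr -fdotDr -mulmxBl (le_trans (cauchy_schwarz _ _)) // v1 mul1r.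
by rewrite (le_trans (frob_mulmx_cV _ _)) // v1 mulr1.
Qed.

(** Makes the smallest eigenvalue of a random Hessian a random variable. *)
Lemma lambda_min_continuous d p (A : 'cV[R]_p -> 'M[R]_d) : (0 < d)%N ->
  (forall z, (A z)^T = A z) -> (forall i j, continuous (fun z => A z i j)) ->
  continuous (fun z => lambda_min (A z)).
Proof.
move=> d0 As cA z.
pose D w := frobenius (A w - A z).
have cD : continuous D.
  have -> : D = Num.sqrt \o (\sum_(i < d) \sum_(j < d)
      ((fun w => A w i j + - A z i j) * (fun w => A w i j + - A z i j))).
    apply/funext => w /=; rewrite /D /frobenius fct_sumE; congr Num.sqrt; apply: eq_bigr => i _.
    by rewrite fct_sumE; apply: eq_bigr => j _; rewrite !mxE expr2 !fctE.
  move=> w; apply: continuous_comp; last exact: sqrt_continuous.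
  have c1 i j : class_C 0 (fun w => A w i j + - A z i j).
    exact: (class_CD (cA i j : class_C 0 _) (class_C_cst 0 (- A z i j))).
  have c2 := class_C_sum (fun i => class_C_sum (fun j => class_CM (c1 i j) (c1 i j))).
  exact: (c2 w).
apply/(@cvgrPdist_lt _ _ _ (nbhs z)) => e e0.
have /cvgrPdist_lt/(_ e e0) := cD z.
apply: filterS => w; rewrite /D subrr frob0 sub0r normrN ger0_norm ?frob_ge0 // => h.
rewrite ltr_norml; have h1 := lambda_min_lipschitz d0 (As z) (As w).
have h2 := lambda_min_lipschitz d0 (As w) (As z).
rewrite -frobN opprB in h1.
move: h h1 h2; move: (lambda_min _) (lambda_min _) (frobenius _) => a b r; lra.
Qed.

End minimal_eigenvalue.

(** * Measurability of random matrices and sampled derivatives *)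

Section matrix_measurability.
Context {R : realType} {dT : measure_display} {T : measurableType dT}.

Definition mxmeas p q (A : T -> 'M[R]_(p, q)) :=
  forall i j, measurable_fun [set: T] (fun w => A w i j).

Lemma mxmeas_cst p q (A : 'M[R]_(p, q)) : mxmeas (fun=> A).
Proof. by move=> i j; exact: measurable_cst. Qed.

Lemma mxmeasD p q (A B : T -> 'M[R]_(p, q)) : mxmeas A -> mxmeas B ->
  mxmeas (fun w => A w + B w).
Proof.
move=> mA mB i j; under eq_fun do rewrite mxE.
exact: measurable_funD (mA i j) (mB i j).
Qed.

Lemma mxmeasN p q (A : T -> 'M[R]_(p, q)) : mxmeas A -> mxmeas (fun w => - A w).
Proof.
move=> mA i j; under eq_fun do rewrite mxE.
exact: measurable_funN (mA i j).
Qed.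

Lemma mxmeasB p q (A B : T -> 'M[R]_(p, q)) : mxmeas A -> mxmeas B ->
  mxmeas (fun w => A w - B w).
Proof. by move=> mA mB; apply: mxmeasD => //; exact: mxmeasN. Qed.

Lemma mxmeasZ p q (k : T -> R) (A : T -> 'M[R]_(p, q)) :
  measurable_fun [set: T] k -> mxmeas A -> mxmeas (fun w => k w *: A w).
Proof.
move=> mk mA i j; under eq_fun do rewrite mxE.
exact: measurable_funM mk (mA i j).
Qed.

Lemma mxmeasM p q r (A : T -> 'M[R]_(p, q)) (B : T -> 'M[R]_(q, r)) :
  mxmeas A -> mxmeas B -> mxmeas (fun w => A w *m B w).
Proof.
move=> mA mB i j; under eq_fun do rewrite mxE.
apply: measurable_sum => k.
exact: measurable_funM (mA i k) (mB k j).
Qed.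

Lemma mxmeas_tr p q (A : T -> 'M[R]_(p, q)) : mxmeas A -> mxmeas (fun w => (A w)^T).
Proof. by move=> mA i j; under eq_fun do rewrite mxE; exact: mA. Qed.

Lemma mxmeas_sum p q (I : Type) (r : seq I) (A : I -> T -> 'M[R]_(p, q)) :
  (forall i, mxmeas (A i)) -> mxmeas (fun w => \sum_(i <- r) A i w).
Proof.
move=> mA i j; under eq_fun do rewrite summxE.
by apply: measurable_sum => k; exact: mA.
Qed.

Lemma mxmeas_frob p q (A : T -> 'M[R]_(p, q)) : mxmeas A ->
  measurable_fun [set: T] (fun w => frobenius (A w)).
Proof.
move=> mA.
have mS : measurable_fun [set: T] (fun w => \sum_i \sum_j A w i j ^+ 2).
  by do 2![apply: measurable_sum => ?]; apply: measurable_funX; exact: mA.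
have mq : measurable_fun [set: R] (@Num.sqrt R).
  by apply: continuous_measurable_fun; exact: sqrt_continuous.
exact: (measurableT_comp mq mS).
Qed.

Lemma mxmeas_enorm p (v : T -> 'cV[R]_p) : mxmeas v ->
  measurable_fun [set: T] (fun w => enorm (v w)).
Proof. by move=> mv; under eq_fun do rewrite enorm_frob; exact: mxmeas_frob. Qed.

Lemma mxmeas_dsubmx p1 p2 (v : T -> 'cV[R]_(p1 + p2)) : mxmeas v ->
  mxmeas (fun w => dsubmx (v w)).
Proof. by move=> mv i j; under eq_fun do rewrite mxE; exact: mv. Qed.

Lemma measurable_countable_pieces d' (S : measurableType d') (I : countType)
    (N : T -> I) (G : I -> T -> S) (g : T -> S) :
  (forall i, measurable [set w | N w = i]) ->
  (forall i, measurable_fun [set: T] (G i)) -> (forall w, g w = G (N w) w) ->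
  measurable_fun [set: T] g.
Proof.
move=> mN mG gE _ B mB; rewrite setTI.
have -> : g @^-1` B = \bigcup_i ([set w | N w = i] `&` (G i @^-1` B)).
  apply/seteqP; split => w /=; first by rewrite gE => ?; exists (N w).
  by move=> [i _ [<-]] /=; rewrite gE.
apply: countable_bigcupT_measurable => [|i]; first exact: countableP.
apply: measurableI => //.
by rewrite -[X in measurable X]setTI; exact: mG.
Qed.

Lemma mxmeas_countable_pieces p q (I : countType) (N : T -> I)
    (G : I -> T -> 'M[R]_(p, q)) (g : T -> 'M[R]_(p, q)) :
  (forall i, measurable [set w | N w = i]) ->
  (forall i, mxmeas (G i)) -> (forall w, g w = G (N w) w) -> mxmeas g.
Proof.
move=> mN mG gE i j.
apply: (measurable_countable_pieces mN (G := fun k w => G k w i j)) => [k|w].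
  exact: mG.
by rewrite gE.
Qed.

Lemma measurable_floor_fiber (h : T -> R) (k : int) : measurable_fun [set: T] h ->
  measurable [set w | Num.floor (h w) = k].
Proof.
move=> mh.
have -> : [set w | Num.floor (h w) = k] = [set: T] `&` h @^-1` `[k%:~R, (k + 1)%:~R[%classic.
  rewrite setTI; apply/seteqP; split => w /=; rewrite in_itv /=.
    by move=> <-; rewrite floor_itv.
  by move=> h1; apply/eqP; rewrite floor_eq.
by apply: mh => //; exact: measurable_itv.
Qed.

Definition grid_index p (N : nat) (z : 'cV[R]_p) : {ffun 'I_p -> int} :=
  [ffun i => Num.floor (z i 0 * N.+1%:R)].

Definition grid_point p (N : nat) (a : {ffun 'I_p -> int}) : 'cV[R]_p :=
  \col_i ((a i)%:~R / N.+1%:R).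

Lemma measurable_grid_index p N (z : T -> 'cV[R]_p) a : mxmeas z ->
  measurable [set w | grid_index N (z w) = a].
Proof.
move=> mz.
have -> : [set w | grid_index N (z w) = a] =
    \bigcap_(i in [set: 'I_p]) [set w | Num.floor (z w i 0 * N.+1%:R) = a i].
  apply/seteqP; split => w /=; first by move=> <- i _ /=; rewrite ffunE.
  by move=> h; apply/ffunP => i; rewrite ffunE; exact: h.
apply: fin_bigcap_measurable; first exact: finite_finset.
move=> i _; apply: measurable_floor_fiber; apply: measurable_funM; first exact: mz.
exact: measurable_cst.
Qed.

Lemma grid_point_cvg p (z : 'cV[R]_p) :
  (fun N => grid_point N (grid_index N z)) @ \oo --> z.
Proof.
apply/cvgrPdist_lt => e e0.
have /cvgrPdist_lt/(_ e e0) := @cvg_harmonic R.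
apply: filterS => N; rewrite /= sub0r normrN => h.
have h0 : 0 < (N.+1%:R : R)^-1 by rewrite invr_gt0.
rewrite (gtr0_norm h0) in h.
apply: le_lt_trans h; rewrite [leLHS]mx_normrE; apply/bigmax_leP; split; first exact: ltW.
move=> [i j] _ /=; rewrite (ord1 j) !mxE ffunE.
have /andP[f1 f2] := floor_itv (z i 0 * N.+1%:R).
set k := Num.floor _ in f1 f2 *; rewrite intrD in f2.
have -> : z i 0 - k%:~R / N.+1%:R = (z i 0 * N.+1%:R - k%:~R) / N.+1%:R.
  by rewrite mulrBl mulfK // pnatr_eq0.
rewrite ger0_norm; last by rewrite mulr_ge0 ?subr_ge0 // ltW.
by rewrite -[leRHS]mul1r ler_pM2r //; lra.
Qed.

(** A function continuous in a vector argument and measurable in the other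
    one is jointly measurable: it is a limit of its values on finer and finer
    grids, which involve countably many vectors. *)
Lemma measurable_caratheodory p d' (S : measurableType d') (H : 'cV[R]_p -> S -> R)
    (z : T -> 'cV[R]_p) (s : T -> S) :
  (forall s, continuous (H^~ s)) -> (forall z, measurable_fun [set: S] (H z)) ->
  mxmeas z -> measurable_fun [set: T] s ->
  measurable_fun [set: T] (fun w => H (z w) (s w)).
Proof.
move=> cH mH mz ms.
apply: (measurable_fun_cvg (h := fun N w => H (grid_point N (grid_index N (z w))) (s w))).
  move=> N.
  apply: (measurable_countable_pieces (N := fun w => grid_index N (z w))
    (G := fun a w => H (grid_point N a) (s w))) => [a|a|//].
    exact: measurable_grid_index.
  exact: measurableT_comp (mH _) ms.
move=> w _; exact: (cvg_comp _ _ (@grid_point_cvg p (z w)) (cH (s w) (z w))).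
Qed.

Lemma measurable_continuous_comp p (g : 'cV[R]_p -> R) (z : T -> 'cV[R]_p) :
  continuous g -> mxmeas z -> measurable_fun [set: T] (fun w => g (z w)).
Proof.
move=> cg mz.
by apply: (@measurable_caratheodory p _ T (fun z _ => g z) z id) => // ?; exact: measurable_cst.
Qed.

End matrix_measurability.

Lemma mxmeas_comp {R : realType} d1 d2 (T1 : measurableType d1) (T2 : measurableType d2)
  p q (A : T2 -> 'M[R]_(p, q)) (g : T1 -> T2) :
  mxmeas A -> measurable_fun [set: T1] g -> mxmeas (fun w => A (g w)).
Proof. by move=> mA mg i j; exact: measurableT_comp (mA i j) mg. Qed.

Section derivative_measurability.
Context {R : realType} {p : nat} {dS : measure_display} {S : measurableType dS}.
Context (F : 'cV[R]_p -> S -> R).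
Context (mF : forall z, measurable_fun [set: S] (F z)).
Context (dF : forall s, twice_differentiable (fun z => F z s)).

(** Derivatives of a random function are measurable as limits of these sequences. *)
Lemma derivable_cvg_seq (g : 'cV[R]_p -> R) z v : derivable g z v ->
  (fun n => n.+1%:R * (g (z + n.+1%:R^-1 *: v) - g z)) @ \oo --> 'D_v g z.
Proof.
move=> dg.
have h0 : (fun n : nat => (n.+1%:R : R)^-1) @ \oo --> (0 : R)^'.
  move=> A hA; have /= h := @cvg_harmonic R [set y | y != 0 -> A y] hA.
  have {}h : \forall n \near \oo, @harmonic R n != 0 -> A (@harmonic R n) := h.
  by apply: (filterS _ h) => n hn; apply: hn; apply: lt0r_neq0; exact: harmonic_gt0.
have := cvg_comp _ _ h0 dg.
rewrite (_ : _ \o _ = (fun n => n.+1%:R * (g (z + n.+1%:R^-1 *: v) - g z))) //.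
by apply/funext => n /=; rewrite invrK; congr (_ * (g _ - _)); rewrite addrC.
Qed.

Lemma continuous_derive v s0 : continuous (fun y => 'D_v (fun w => F w s0) y).
Proof. by move=> y; apply/differentiable_continuous; exact: (dF s0).2. Qed.

Lemma measurable_derive v y : measurable_fun [set: S] (fun s0 => 'D_v (fun w => F w s0) y).
Proof.
apply: (measurable_fun_cvg
  (h := fun n s0 => n.+1%:R * (F (y + n.+1%:R^-1 *: v) s0 - F y s0))) => [n|s0 _].
  by apply: measurable_funM; [exact: measurable_cst|exact: measurable_funB].
apply: derivable_cvg_seq; apply: diff_derivable; exact: (dF s0).1.
Qed.

Context {dT : measure_display} {T : measurableType dT} (s : T -> S).
Context (ms : measurable_fun [set: T] s).

Lemma measurable_sample_derive v (z : T -> 'cV[R]_p) : mxmeas z ->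
  measurable_fun [set: T] (fun w => 'D_v (fun y => F y (s w)) (z w)).
Proof.
move=> mz; exact: (@measurable_caratheodory _ _ _ p _ S
  (fun y s0 => 'D_v (fun w => F w s0) y) z s (@continuous_derive v) (@measurable_derive v) mz ms).
Qed.

Lemma mxmeas_sample_grad (z : T -> 'cV[R]_p) : mxmeas z ->
  mxmeas (fun w => grad (fun y => F y (s w)) (z w)).
Proof.
by move=> mz i j; under eq_fun do rewrite mxE; exact: measurable_sample_derive.
Qed.

(** The second derivatives of a sampled function need not be continuous in the
    point, so [measurable_caratheodory] is applied to the first derivatives
    only, and the second ones are limits of their difference quotients. *)
Lemma mxmeas_sample_hess (z : T -> 'cV[R]_p) : mxmeas z ->
  mxmeas (fun w => hess (fun y => F y (s w)) (z w)).
Proof.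
move=> mz i j; under eq_fun do rewrite mxE.
set u := delta_mx i 0; set v := delta_mx j 0.
pose G n w := 'D_v (fun y => F y (s w)) (z w + n.+1%:R^-1 *: u).
pose G0 w := 'D_v (fun y => F y (s w)) (z w).
have mG n : measurable_fun [set: T] (G n).
  by apply: measurable_sample_derive; apply: mxmeasD => //; exact: mxmeas_cst.
have mG0 : measurable_fun [set: T] G0 by exact: measurable_sample_derive.
have cG w : (fun n => n.+1%:R * (G n w - G0 w)) @ \oo -->
     'D_u (fun y => 'D_v (fun y' => F y' (s w)) y) (z w).
  have dd : derivable (fun y => 'D_v (fun y' => F y' (s w)) y) (z w) u.
    exact: (diff_derivable ((dF (s w)).2 v (z w))).
  exact: (derivable_cvg_seq dd).
apply: (measurable_fun_cvg (h := fun n w => n.+1%:R * (G n w - G0 w)) _ (fun w _ => cG w)) => n.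
by apply: measurable_funM; [exact: measurable_cst|exact: measurable_funB].
Qed.

End derivative_measurability.

(** * Expectations and moments *)

Section bounded_expectation.
Context {R : realType} {dT : measure_display} {T : measurableType dT} (P : probability T R).
Implicit Types f g : T -> R.

(** Expectations of nonnegative variables are handled through their upper
    bounds, which needs no integrability side condition. *)
Record Ebound f (r : R) : Prop := {
  Eb_meas : measurable_fun [set: T] f;
  Eb_ge0 : forall w, 0 <= f w;
  Eb_le : (\int[P]_w (f w)%:E <= r%:E)%E
}.

Lemma Eb_real_ge0 f r : Ebound f r -> 0 <= r.
Proof.
move=> [_ f0 h]; rewrite -lee_fin; apply: le_trans h.
by apply: integral_ge0 => w _; rewrite lee_fin.
Qed.

Lemma Eb_mono f g r : measurable_fun [set: T] f -> (forall w, 0 <= f w <= g w) ->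
  Ebound g r -> Ebound f r.
Proof.
move=> mf fg [mg g0 h]; split=> // [w|]; first by have /andP[] := fg w.
apply: le_trans h; apply: ge0_le_integral => //.
- by move=> w _; rewrite lee_fin; have /andP[] := fg w.
- exact/measurable_EFinP.
- exact/measurable_EFinP.
- by move=> w _; rewrite lee_fin; have /andP[] := fg w.
Qed.

Lemma Eb_weaken f r r' : Ebound f r -> r <= r' -> Ebound f r'.
Proof. by move=> [mf f0 h] rr; split=> //; apply: le_trans h _; rewrite lee_fin. Qed.

Lemma EbD f g r s : Ebound f r -> Ebound g s -> Ebound (fun w => f w + g w) (r + s).
Proof.
move=> [mf f0 hf] [mg g0 hg]; split; first exact: measurable_funD.
  by move=> w; rewrite addr_ge0.
under eq_integral do rewrite EFinD.
rewrite ge0_integralD //=; first by rewrite EFinD leeD.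
- by move=> w _; rewrite lee_fin.
- exact/measurable_EFinP.
- by move=> w _; rewrite lee_fin.
- exact/measurable_EFinP.
Qed.

Lemma EbZ f r k : 0 <= k -> Ebound f r -> Ebound (fun w => k * f w) (k * r).
Proof.
move=> k0 [mf f0 hf]; split.
- by apply: measurable_funM => //; exact: measurable_cst.
- by move=> w; rewrite mulr_ge0.
under eq_integral do rewrite EFinM.
rewrite ge0_integralZl_EFin //=; first by rewrite EFinM lee_wpmul2l // lee_fin.
- by move=> w _; rewrite lee_fin.
- exact/measurable_EFinP.
Qed.

Lemma Eb_cst r : 0 <= r -> Ebound (fun=> r) r.
Proof.
move=> r0; split => //.
rewrite integral_cst //= probability_setT mule1 //.
Qed.

Lemma Eb_sum n (f : 'I_n -> T -> R) (r : 'I_n -> R) :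
  (forall i, Ebound (f i) (r i)) -> Ebound (fun w => \sum_(i < n) f i w) (\sum_(i < n) r i).
Proof.
elim: n f r => [|n IH] f r h.
  rewrite big_ord0; apply: Eb_mono (Eb_cst (lexx 0)); last by move=> w; rewrite big_ord0 lexx.
  have -> : (fun w => \sum_(i < 0) f i w) = cst 0 by apply/funext => w; rewrite big_ord0.
  exact: measurable_cst.
rewrite big_ord_recr /=.
have h1 := EbD (IH _ _ (fun i => h (widen_ord (leqnSn n) i))) (h ord_max).
apply: Eb_mono h1; last first.
  move=> w; rewrite big_ord_recr /= lexx andbT.
  by rewrite addr_ge0 ?sumr_ge0 // => [i _|]; exact: (Eb_ge0 (h _)).
under eq_fun do rewrite big_ord_recr /=.
apply: measurable_funD; last exact: (Eb_meas (h _)).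
by apply: measurable_sum => i; exact: (Eb_meas (h _)).
Qed.

End bounded_expectation.

Section freezing.
Context {R : realType} {dO dX : measure_display} {Om : measurableType dO}
  {Xi : measurableType dX} (P : probability Om R) (Z : probability Xi R).
Context (G : set (set Om)).
Context (Gm : G `<=` measurable).
Context (GI : setI_closed G).
Context (GT : G setT).
Local Notation TG := (g_sigma_algebraType G).

Lemma generated_measurable (A : set Om) : measurable (A : set TG) -> measurable A.
Proof. by apply: smallest_sub => //; exact: sigma_algebra_measurable. Qed.

Lemma measurable_coarsen : measurable_fun [set: Om] (id : Om -> TG).
Proof. by move=> _ A mA; rewrite setTI preimage_id; exact: generated_measurable. Qed.

Context (X : Om -> Xi).
Context (mX : measurable_fun [set: Om] X).
Context (ind : forall A B, G A -> measurable B -> P (A `&` X @^-1` B) = (P A * Z B)%E).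

(** Both sides are finite measures in [A] and agree on a class stable under
    intersection that generates the measurable sets. *)
Lemma generated_independence (A : set TG) (B : set Xi) : measurable A -> measurable B ->
  P (A `&` X @^-1` B) = (P A * Z B)%E.
Proof.
move=> mA mB.
have mXB : measurable (X @^-1` B) by rewrite -[X in measurable X]setTI; exact: mX.
pose r := NngNum (fine_ge0 (measure_ge0 Z B)).
pose m1 : {measure set Om -> \bar R} := mrestr P mXB.
pose m2 : {measure set Om -> \bar R} := mscale r P.
have m2E C : m2 C = (P C * Z B)%E.
  have -> : m2 C = ((fine (Z B))%:E * P C)%E by [].
  by rewrite fineK ?fin_num_measure // muleC.
have -> : P (A `&` X @^-1` B) = m1 A by [].
rewrite -m2E.
apply: (@g_sigma_algebra_measure_unique _ _ _ G Gm (fun=> setT)) => //.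
- by rewrite bigcup_const.
- by move=> C GC; rewrite m2E; exact: ind.
- by move=> k; change (P ([set: Om] `&` X @^-1` B) < +oo)%E; rewrite setTI; apply: le_lt_trans (probability_le1 P mXB) _; rewrite ltry.
Qed.

(** A sample independent of the past can be integrated out while the past is
    kept fixed. *)
Lemma freeze (phi : TG * Xi -> \bar R) : measurable_fun [set: TG * Xi] phi ->
  (forall x, 0 <= phi x)%E ->
  (\int[P]_w phi (w, X w) = \int[P]_w \int[Z]_s phi (w, s))%E.
Proof.
move=> mphi phi0.
pose idm : {mfun Om >-> TG} := HB.pack (id : Om -> TG)
  (isMeasurableFun.Build _ _ _ _ _ measurable_coarsen).
have mpair : measurable_fun [set: Om] (fun w => (w, X w) : TG * Xi).
  by apply/measurable_fun_pairP; split; [exact: measurable_coarsen|exact: mX].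
pose pr : {mfun Om >-> (TG * Xi)%type} := HB.pack (fun w => (w, X w) : TG * Xi)
  (isMeasurableFun.Build _ _ _ _ _ mpair).
pose PG : probability TG R := distribution P idm.
pose m' : probability (TG * Xi)%type R := distribution P pr.
have uni (C : set (TG * Xi)) : measurable C -> (PG \x Z)%E C = m' C.
  apply: product_measure_unique => A B mA mB.
  exact: generated_independence.
transitivity (\int[m']_x phi x)%E.
  by rewrite ge0_integral_distribution.
transitivity (\int[PG \x Z]_x phi x)%E.
  by apply: eq_measure_integral => C mC _; exact/esym/uni.
rewrite fubini_tonelli1 // ge0_integral_distribution //.
  exact: measurable_fun_fubini_tonelli_F.
by move=> y; apply: integral_ge0.
Qed.

End freezing.

Section means.
Context {R : realType} {dT : measure_display} {T : measurableType dT} (P : probability T R).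
Implicit Types f g : T -> R.

Definition has_ev f (r : R) :=
  P.-integrable [set: T] (EFin \o f) /\ (\int[P]_w (f w)%:E = r%:E)%E.

Lemma has_ev_cst r : has_ev (fun=> r) r.
Proof.
split; first by apply: finite_measure_integrable_cst.
by rewrite integral_cst //= probability_setT mule1.
Qed.

Lemma has_evD f g r s : has_ev f r -> has_ev g s -> has_ev (fun w => f w + g w) (r + s).
Proof.
move=> [f_int fr] [g_int gs]; split; first exact: (integrableD _ f_int g_int).
under eq_integral do rewrite EFinD.
by rewrite integralD // fr gs.
Qed.

Lemma has_evZ f r k : has_ev f r -> has_ev (fun w => k * f w) (k * r).
Proof.
move=> [f_int fr]; split; first exact: (integrableZl _ k f_int).
under eq_integral do rewrite EFinM.
by rewrite integralZl // fr.
Qed.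

Lemma has_ev_sum (I : Type) (s : seq I) (f : I -> T -> R) r :
  (forall i, has_ev (f i) (r i)) -> has_ev (fun w => \sum_(i <- s) f i w) (\sum_(i <- s) r i).
Proof.
move=> h; elim: s => [|i s IH].
  rewrite big_nil; have -> : (fun w => \sum_(i <- [::]) f i w) = (fun=> 0).
    by apply/funext => w; rewrite big_nil.
  exact: has_ev_cst.
rewrite big_cons; have -> : (fun w => \sum_(j <- i :: s) f j w) =
    (fun w => f i w + \sum_(j <- s) f j w).
  by apply/funext => w; rewrite big_cons.
exact: has_evD.
Qed.

Lemma Eb_has_ev f r : Ebound P f r -> exists2 s, s <= r & has_ev f s.
Proof.
move=> [mf f0 h].
have fin : (\int[P]_w (f w)%:E)%E \is a fin_num.
  rewrite ge0_fin_numE; first by rewrite (le_lt_trans h) // ltry.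
  by apply: integral_ge0 => w _; rewrite lee_fin.
exists (fine (\int[P]_w (f w)%:E)%E); first by rewrite -lee_fin fineK.
split; last by rewrite fineK.
apply/integrableP; split; first exact/measurable_EFinP.
under eq_integral do rewrite /= ger0_norm //.
by rewrite (le_lt_trans h) // ltry.
Qed.

Lemma has_ev_Eb f r : (forall w, 0 <= f w) -> has_ev f r -> Ebound P f r.
Proof.
move=> f0 [f_int fr]; split => //; last by rewrite fr.
by have /measurable_int/measurable_EFinP := f_int.
Qed.

(** For expansions of norms around a shift, where the linear term has a known
    expectation but no sign. *)
Lemma Eb_affine f g k r s : measurable_fun [set: T] f ->
  (forall w, 0 <= f w <= g w + k w) -> Ebound P g r -> has_ev k s -> Ebound P f (r + s).
Proof.
move=> mf fgk /Eb_has_ev[r' r'r hg] hk.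
have h := has_evD hg hk.
apply: (@Eb_weaken _ _ _ _ _ (r' + s)); last by rewrite lerD2r.
apply: (Eb_mono mf fgk); apply: has_ev_Eb h => w.
by have /andP[a b] := fgk w; exact: le_trans b.
Qed.

(** A case of Jensen's inequality, from the tangent bound
    [f ^ 2 <= 2 * f ^ 3 / (3 * e) + e ^ 2 / 3] at [e = b]. For [b = 0] the number
    [e] tends to 0 instead. *)
Lemma Eb_sqr_of_cube f b : 0 <= b -> measurable_fun [set: T] f ->
  (forall w, 0 <= f w) -> Ebound P (fun w => f w ^+ 3) (b ^+ 3) ->
  Ebound P (fun w => f w ^+ 2) (b ^+ 2).
Proof.
move=> b0 mf f0 h.
have key e : 0 < e -> Ebound P (fun w => f w ^+ 2) (2 / 3 / e * b ^+ 3 + e ^+ 2 / 3).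
  move=> e0; have e1 : 0 <= 2 / 3 / e by rewrite divr_ge0 ?divr_ge0 // ltW.
  apply: Eb_mono (EbD (EbZ e1 h) (Eb_cst P _)); first exact: measurable_funX.
    move=> w; rewrite sqr_ge0 /=.
    have -> : 2 / 3 / e * f w ^+ 3 + e ^+ 2 / 3 = f w ^+ 2 +
       (f w - e) ^+ 2 * (2 * f w + e) / (3 * e) by field; rewrite gt_eqF.
    have e00 := ltW e0; have fw := f0 w.
    rewrite lerDl; apply: divr_ge0; last lra.
    by apply: mulr_ge0; [exact: sqr_ge0|lra].
  by rewrite divr_ge0 // sqr_ge0.
have [b00|bn] := eqVneq b 0; last first.
  have bp : 0 < b by rewrite lt_def bn.
  by apply: Eb_weaken (key b bp) _; rewrite le_eqVlt; apply/orP; left; apply/eqP; field.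
split; [exact: measurable_funX|by move=> w; exact: sqr_ge0|].
rewrite b00 expr0n /=; apply/lee_addgt0Pr => e e0; rewrite add0e.
have s0 : 0 < Num.sqrt e by rewrite sqrtr_gt0.
have s2 := sqr_sqrtr (ltW e0).
apply: le_trans (Eb_le (key _ s0)) _; rewrite b00 expr0n mulr0 add0r s2 lee_fin.
by rewrite ler_pdivrMr //; lra.
Qed.

Lemma Eb_of_sqr f b : 0 <= b -> measurable_fun [set: T] f ->
  (forall w, 0 <= f w) -> Ebound P (fun w => f w ^+ 2) (b ^+ 2) -> Ebound P f b.
Proof.
move=> b0 mf f0 h.
have key e : 0 < e -> Ebound P f (b ^+ 2 / (2 * e) + e / 2).
  move=> e0; have e1 : 0 <= (2 * e)^-1 by rewrite invr_ge0 mulr_ge0 // ltW.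
  rewrite (mulrC (b ^+ 2)); apply: Eb_mono (EbD (EbZ e1 h) (Eb_cst P _)) => //; last first.
    by rewrite divr_ge0 // ltW.
  move=> w; rewrite f0 /=.
  have -> : (2 * e)^-1 * f w ^+ 2 + e / 2 = f w + (f w - e) ^+ 2 / (2 * e) by field; rewrite gt_eqF.
  by rewrite lerDl divr_ge0 ?sqr_ge0 // mulr_ge0 // ltW.
have [b00|bn] := eqVneq b 0; last first.
  have bp : 0 < b by rewrite lt_def bn.
  by apply: Eb_weaken (key b bp) _; rewrite le_eqVlt; apply/orP; left; apply/eqP; field.
split=> //; rewrite b00; apply/lee_addgt0Pr => e e0; rewrite add0e.
apply: le_trans (Eb_le (key _ e0)) _; rewrite b00 expr0n mul0r add0r lee_fin.
by rewrite ler_pdivrMr //; lra.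
Qed.

Definition has_mean p q (X : T -> 'M[R]_(p, q)) (M : 'M[R]_(p, q)) :=
  forall i j, has_ev (fun w => X w i j) (M i j).

Lemma has_mean_mxmeas p q (X : T -> 'M[R]_(p, q)) M : has_mean X M -> mxmeas X.
Proof. by move=> h i j; have [/measurable_int/measurable_EFinP] := h i j. Qed.

Lemma has_mean_cst p q (M : 'M[R]_(p, q)) : has_mean (fun=> M) M.
Proof. by move=> i j; exact: has_ev_cst. Qed.

Lemma has_meanD p q (X Y : T -> 'M[R]_(p, q)) M N : has_mean X M -> has_mean Y N ->
  has_mean (fun w => X w + Y w) (M + N).
Proof.
move=> hX hY i j; rewrite mxE; under [X in has_ev X]eq_fun do rewrite mxE.
exact: has_evD.
Qed.

Lemma has_meanZ p q (X : T -> 'M[R]_(p, q)) M k : has_mean X M ->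
  has_mean (fun w => k *: X w) (k *: M).
Proof.
move=> hX i j; rewrite mxE; under [X in has_ev X]eq_fun do rewrite mxE.
exact: has_evZ.
Qed.

Lemma has_meanB p q (X Y : T -> 'M[R]_(p, q)) M N : has_mean X M -> has_mean Y N ->
  has_mean (fun w => X w - Y w) (M - N).
Proof.
move=> hX hY; rewrite -(scaleN1r N); under [X in has_mean X]eq_fun do rewrite -(scaleN1r (Y _)).
by apply: has_meanD => //; exact: has_meanZ.
Qed.

Lemma has_mean_fdot p q (U : 'M[R]_(p, q)) (X : T -> 'M[R]_(p, q)) M : has_mean X M ->
  has_ev (fun w => fdot U (X w)) (fdot U M).
Proof.
move=> hX; rewrite fdotE; under [X in has_ev X]eq_fun do rewrite fdotE.
by do 2![apply: has_ev_sum => ?]; exact: has_evZ.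
Qed.

Lemma has_mean_mulmxl p q r (A : 'M[R]_(p, q)) (X : T -> 'M[R]_(q, r)) M : has_mean X M ->
  has_mean (fun w => A *m X w) (A *m M).
Proof.
move=> hX i j; rewrite mxE; under [X in has_ev X]eq_fun do rewrite mxE.
by apply: has_ev_sum => k; exact: has_evZ.
Qed.

Lemma has_mean_mulmxr p q r (X : T -> 'M[R]_(p, q)) (A : 'M[R]_(q, r)) M : has_mean X M ->
  has_mean (fun w => X w *m A) (M *m A).
Proof.
move=> hX i j; rewrite mxE; under [X in has_ev X]eq_fun do rewrite mxE.
apply: has_ev_sum => k; rewrite mulrC; under [X in has_ev X]eq_fun do rewrite mulrC.
exact: has_evZ.
Qed.

Lemma mean_frob_le p q (X : T -> 'M[R]_(p, q)) M b : has_mean X M ->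
  Ebound P (fun w => frobenius (X w)) b -> frobenius M <= b.
Proof.
move=> hX hb; have b0 := Eb_real_ge0 hb.
have [->//|nz] := eqVneq (frobenius M) 0.
have pos : 0 < frobenius M by rewrite lt_def nz frob_ge0.
rewrite -(ler_pM2l pos) -expr2 frob_sqr.
have [_ e] := has_mean_fdot M hX; rewrite -lee_fin -e.
have [s sb [s_int es]] := Eb_has_ev hb.
have [h_int eh] := has_evZ (frobenius M) (conj s_int es : has_ev _ _).
apply: (@le_trans _ _ (\int[P]_w (frobenius M * frobenius (X w))%:E)%E); last first.
  by rewrite eh lee_fin ler_wpM2l ?frob_ge0.
apply: le_integral => //; first by have [] := has_mean_fdot M hX.
by move=> w _; rewrite lee_fin cauchy_schwarz.
Qed.

Lemma second_moment_shift p q (X : T -> 'M[R]_(p, q)) U v : has_mean X 0 ->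
  Ebound P (fun w => frobenius (X w) ^+ 2) v ->
  Ebound P (fun w => frobenius (U + X w) ^+ 2) (frobenius U ^+ 2 + v).
Proof.
move=> hX hv; have mX := has_mean_mxmeas hX.
have := Eb_affine _ _ (EbD (Eb_cst P (sqr_ge0 (frobenius U))) hv)
  (has_evZ 2 (has_mean_fdot U hX)).
rewrite fdot0r mulr0 addr0; apply.
  apply: measurable_funX; apply: mxmeas_frob; apply: mxmeasD => //; exact: mxmeas_cst.
move=> w; rewrite sqr_ge0 /= le_eqVlt; apply/orP; left; apply/eqP.
by rewrite !frob_sqr !fdot_lin (fdotC (X w) U); ring.
Qed.

Lemma centered_second_moment p q (X : T -> 'M[R]_(p, q)) M v : has_mean X M ->
  Ebound P (fun w => frobenius (X w) ^+ 2) v ->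
  Ebound P (fun w => frobenius (X w - M) ^+ 2) v.
Proof.
move=> hX hv; have mX := has_mean_mxmeas hX.
have h : Ebound P (fun w => frobenius (X w - M) ^+ 2)
    (v + (frobenius M ^+ 2 + (- 2) * fdot M M)).
  apply: Eb_affine hv (has_evD (has_ev_cst _) (has_evZ (- 2) (has_mean_fdot M hX))).
    by apply: measurable_funX; apply: mxmeas_frob; apply: mxmeasB => //; exact: mxmeas_cst.
  move=> w; rewrite sqr_ge0 /= le_eqVlt; apply/orP; left; apply/eqP.
  by rewrite !frob_sqr !fdot_lin (fdotC (X w) M); ring.
apply: Eb_weaken h _; rewrite -frob_sqr; have := sqr_ge0 (frobenius M); lra.
Qed.

(** The first order term of [frob_cube_le] has mean zero. *)
Lemma third_moment_shift p q (X : T -> 'M[R]_(p, q)) U b : 0 <= b -> has_mean X 0 ->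
  Ebound P (fun w => frobenius (X w) ^+ 3) (b ^+ 3) ->
  Ebound P (fun w => frobenius (U + X w) ^+ 3)
    (frobenius U ^+ 3 + 3 * frobenius U * b ^+ 2 + b ^+ 3).
Proof.
move=> b0 hX hv; have mX := has_mean_mxmeas hX; have U0 := frob_ge0 U.
have h2 : Ebound P (fun w => frobenius (X w) ^+ 2) (b ^+ 2).
  by apply: Eb_sqr_of_cube => //; [exact: mxmeas_frob|move=> w; exact: frob_ge0].
have := Eb_affine _ _ (EbD (EbD (Eb_cst P (exprn_ge0 3 U0)) (EbZ (mulr_ge0 (ler0n _ 3) U0) h2)) hv)
  (has_evZ (3 * frobenius U) (has_mean_fdot U hX)).
rewrite fdot0r mulr0 addr0; apply.
  apply: measurable_funX; apply: mxmeas_frob; apply: mxmeasD => //; exact: mxmeas_cst.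
move=> w; rewrite exprn_ge0 ?frob_ge0 //=; have := frob_cube_le U (X w); lra.
Qed.

(** The cube being convex, [(a + b) ^ 3 <= 4 * (a ^ 3 + b ^ 3)]. *)
Lemma third_momentD p q (X Y : T -> 'M[R]_(p, q)) r s : mxmeas X -> mxmeas Y ->
  Ebound P (fun w => frobenius (X w) ^+ 3) r -> Ebound P (fun w => frobenius (Y w) ^+ 3) s ->
  Ebound P (fun w => frobenius (X w + Y w) ^+ 3) (4 * (r + s)).
Proof.
move=> mX mY hX hY; apply: Eb_mono (EbZ (ler0n _ 4) (EbD hX hY)).
  by apply: measurable_funX; apply: mxmeas_frob; exact: mxmeasD.
move=> w; rewrite exprn_ge0 ?frob_ge0 //=.
have := frob_triangle (X w) (Y w); have := frob_ge0 (X w + Y w).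
have := frob_ge0 (X w); have := frob_ge0 (Y w).
move: (frobenius (X w)) (frobenius (Y w)) (frobenius (X w + Y w)) => a b c b0 a0 c0 h.
apply: (@le_trans _ _ ((b + a) ^+ 3)); first by rewrite ler_pXn2r ?nnegrE ?addr_ge0 //; lra.
have : 0 <= (b - a) ^+ 2 * (b + a) by rewrite mulr_ge0 ?sqr_ge0 ?addr_ge0.
lra.
Qed.

Lemma centered_third_moment p q (X : T -> 'M[R]_(p, q)) M b : 0 <= b -> has_mean X M ->
  Ebound P (fun w => frobenius (X w) ^+ 3) (b ^+ 3) ->
  Ebound P (fun w => frobenius (X w - M) ^+ 3) (8 * b ^+ 3).
Proof.
move=> b0 hX hb; have mX := has_mean_mxmeas hX.
have f0 w : 0 <= frobenius (X w) := frob_ge0 _.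
have mf := mxmeas_frob mX.
have h1 : Ebound P (fun w => frobenius (X w)) b.
  by apply: Eb_of_sqr => //; apply: Eb_sqr_of_cube.
have Mb := mean_frob_le hX h1.
have h2 : Ebound P (fun=> frobenius (- M) ^+ 3) (b ^+ 3).
  apply: Eb_weaken (Eb_cst P _) _; first by rewrite exprn_ge0 ?frob_ge0.
  by rewrite frobN ler_pXn2r ?nnegrE ?frob_ge0.
apply: Eb_weaken (third_momentD mX (mxmeas_cst _) hb h2) _; lra.
Qed.

End means.

(** * Batches of fresh samples *)

Lemma measurable_inner_integral {R : realType} d1 d2 (T1 : measurableType d1)
  (T2 : measurableType d2) (nu : probability T2 R) (f : T1 * T2 -> \bar R) :
  measurable_fun setT f -> (forall x, 0 <= f x)%E -> measurable_fun setT (fubini_F nu f).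
Proof. by move=> mf f0; exact: measurable_fun_fubini_tonelli_F. Qed.

Section fresh_samples.
Context {R : realType} {dO dX : measure_display} {Om : measurableType dO}
  {Xi : measurableType dX} (P : probability Om R) (Z : probability Xi R).

(** The past is given by a class of events stable under intersection, so that
    a sample already drawn is added to it by mere enlargement of that class. *)
Record past (G : set (set Om)) : Prop := {
  past_measurable : G `<=` measurable;
  past_setI : setI_closed G;
  past_setT : G setT
}.

(** Independence is asked of product events only; [generated_independence]
    extends it to all events. *)
Definition fresh_pairs (G : set (set Om)) (X1 X2 : nat -> Om -> Xi) :=
  forall n A B1 B2, G A -> (forall i, measurable (B1 i)) -> (forall i, measurable (B2 i)) ->
  P (A `&` [set w | forall i, (i < n)%N -> B1 i (X1 i w) /\ B2 i (X2 i w)])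
   = (P A * \prod_(i < n) (Z (B1 i) * Z (B2 i)))%E.

Definition enlarge (G : set (set Om)) (X : Om -> Xi) : set (set Om) :=
  [set C | exists A B, [/\ G A, measurable B & C = A `&` X @^-1` B]].

Lemma past_enlarge G X : past G -> measurable_fun [set: Om] X -> past (enlarge G X).
Proof.
move=> [Gm GI GT] mX; split.
- move=> _ [A [B [GA mB ->]]]; apply: measurableI; first exact: Gm.
  by rewrite -[Y in measurable Y]setTI; exact: mX.
- move=> _ _ [A [B [GA mB ->]]] [A' [B' [GA' mB' ->]]].
  exists (A `&` A'), (B `&` B'); split; [exact: GI|exact: measurableI|].
  by rewrite preimage_setI setIACA.
- by exists setT, setT; split => //; rewrite preimage_setT setIT.
Qed.

Lemma sub_enlarge G X : G `<=` enlarge G X.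
Proof. by move=> A GA; exists A, setT; split => //; rewrite preimage_setT setIT. Qed.

Lemma measurable_enlarge_id G X :
  measurable_fun [set: g_sigma_algebraType (enlarge G X)]
    (id : g_sigma_algebraType (enlarge G X) -> g_sigma_algebraType G).
Proof.
move=> _ A mA; rewrite setTI preimage_id.
exact: (sub_smallest2r (@smallest_sigma_algebra _ setT (enlarge G X)) (@sub_enlarge G X)).
Qed.

Lemma measurable_enlarge_sample G X : G setT ->
  measurable_fun [set: g_sigma_algebraType (enlarge G X)]
    (X : g_sigma_algebraType (enlarge G X) -> Xi).
Proof.
move=> GT _ B mB; rewrite setTI; apply: sub_sigma_algebra.
by exists setT, B; split => //; rewrite setTI.
Qed.

(** A sample that has been drawn becomes part of the past. *)
Lemma fresh_pairs_step G X1 X2 : fresh_pairs G X1 X2 ->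
  fresh_pairs (enlarge (enlarge G (X1 0%N)) (X2 0%N)) (fun i => X1 i.+1) (fun i => X2 i.+1).
Proof.
move=> h n C B1 B2 [_ [D2 [[A [D1 [GA mD1 ->]]] mD2 ->]]] mB1 mB2.
have E k : A `&` X1 0%N @^-1` D1 `&` X2 0%N @^-1` D2 `&`
    [set w | forall i, (i < k)%N -> B1 i (X1 i.+1 w) /\ B2 i (X2 i.+1 w)] =
   A `&` [set w | forall i, (i < k.+1)%N ->
     (if i is j.+1 then B1 j else D1) (X1 i w) /\ (if i is j.+1 then B2 j else D2) (X2 i w)].
  apply/seteqP; split => w /=.
    move=> [[[Aw d1] d2] H]; split=> // -[|i] //= ik; exact: H.
  move=> [Aw H]; have [d1 d2] := H 0%N isT; split; first by split.
  by move=> i ik; exact: (H i.+1).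
have mD1' i : measurable (if i is j.+1 then B1 j else D1) by case: i.
have mD2' i : measurable (if i is j.+1 then B2 j else D2) by case: i.
rewrite E (h _ A _ _ GA mD1' mD2') big_ord_recl /= muleA; congr (_ * _)%E.
have := E 0%N; rewrite (_ : [set w | forall i, (i < 0)%N -> _] = setT); last first.
  by apply/seteqP; split.
by rewrite setIT => ->; rewrite (h _ A _ _ GA mD1' mD2') big_ord_recl big_ord0 mule1.
Qed.

Lemma fresh_first G X1 X2 A B : fresh_pairs G X1 X2 -> G A -> measurable B ->
  P (A `&` X1 0%N @^-1` B) = (P A * Z B)%E.
Proof.
move=> h GA mB.
have := h 1%N A (fun=> B) (fun=> setT) GA (fun=> mB) (fun=> measurableT).
rewrite big_ord_recl big_ord0 mule1 probability_setT mule1 => <-.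
congr (P (_ `&` _)); apply/seteqP; split => w /=; first by move=> Bw [|i].
by move=> /(_ 0%N isT)[].
Qed.

Lemma fresh_second G X1 X2 A B : fresh_pairs G X1 X2 -> enlarge G (X1 0%N) A -> measurable B ->
  P (A `&` X2 0%N @^-1` B) = (P A * Z B)%E.
Proof.
move=> h [A0 [D [GA mD ->]]] mB; rewrite (fresh_first h) //.
have := h 1%N A0 (fun=> D) (fun=> B) GA (fun=> mD) (fun=> mB).
rewrite big_ord_recl big_ord0 mule1 muleA => <-.
congr (P _); apply/seteqP; split => w /=; first by move=> [[Aw d] b]; split=> // -[|i].
by move=> [Aw /(_ 0%N isT)[]].
Qed.

Lemma freeze_pair G X1 X2 (phi : g_sigma_algebraType G * (Xi * Xi) -> \bar R) :
  past G -> measurable_fun [set: Om] (X1 0%N) -> measurable_fun [set: Om] (X2 0%N) ->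
  fresh_pairs G X1 X2 -> measurable_fun setT phi -> (forall x, 0 <= phi x)%E ->
  (\int[P]_w phi (w, (X1 0%N w, X2 0%N w)) = \int[P]_w \int[Z \x Z]_s phi (w, s))%E.
Proof.
move=> pG m1 m2 fr mphi phi0; have [Gm GI GT] := pG.
have pG1 := past_enlarge pG m1; have [G1m G1I G1T] := pG1.
pose TG := g_sigma_algebraType G; pose TG1 := g_sigma_algebraType (enlarge G (X1 0%N)).
have mid := @measurable_enlarge_id G (X1 0%N).
have mx1 := @measurable_enlarge_sample G (X1 0%N) GT.
pose phi1 (x : TG1 * Xi) := phi (x.1 : TG, (X1 0%N x.1, x.2)).
have mphi1 : measurable_fun [set: TG1 * Xi] phi1.
  apply: (measurableT_comp mphi); apply: measurable_fun_pair.
    exact: measurableT_comp mid measurable_fst.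
  by apply: measurable_fun_pair; [exact: measurableT_comp mx1 measurable_fst|exact: measurable_snd].
have := freeze G1m G1I G1T m2 (fun A B => fresh_second fr) mphi1 (fun x => phi0 _).
rewrite /phi1 /= => ->.
pose F (x : (TG * Xi) * Xi) := phi (x.1.1, (x.1.2, x.2)).
have mF : measurable_fun [set: (TG * Xi) * Xi] F.
  apply: (measurableT_comp mphi); apply: measurable_fun_pair.
    exact: measurableT_comp measurable_fst measurable_fst.
  apply: measurable_fun_pair; last exact: measurable_snd.
  exact: measurableT_comp measurable_snd measurable_fst.
pose phi2 (x : TG * Xi) := (\int[Z]_s phi (x.1, (x.2, s)))%E.
have mphi2 : measurable_fun [set: TG * Xi] phi2.
  exact: (@measurable_fun_fubini_tonelli_F _ _ _ _ _ Z F mF (fun x => phi0 _)).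
have phi20 x : (0 <= phi2 x)%E by apply: integral_ge0.
have := freeze Gm GI GT m1 (fun A B => fresh_first fr) mphi2 phi20.
rewrite /phi2 /= => ->; apply: eq_integral => w _.
apply/esym/fubini_tonelli1 => [|s]; last exact: phi0.
have mm : measurable_fun [set: Xi * Xi] (fun s => ((w : TG), s)).
  by apply/measurable_fun_pairP; split; [exact: measurable_cst|exact: measurable_id].
exact: (measurableT_comp mphi mm).
Qed.

(** One batch, its samples being drawn one after the other. The potential
    [psi] of the running sum may grow by a factor [a] and a term [v] at each
    sample, in conditional mean; the weight [chi] localizes to an event of the
    past. *)
Lemma fresh_batch_growth p q (psi : 'M[R]_(p, q) -> R) (a : R) :
  (forall d' (T' : measurableType d') (U : T' -> 'M[R]_(p, q)), mxmeas U ->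
     measurable_fun [set: T'] (fun w => psi (U w))) ->
  (forall U, 0 <= psi U) -> 1 <= a ->
  forall n G (X1 X2 : nat -> Om -> Xi)
    (chi v : g_sigma_algebraType G -> R) (u : g_sigma_algebraType G -> 'M[R]_(p, q))
    (phi : g_sigma_algebraType G * (Xi * Xi) -> 'M[R]_(p, q)),
  past G -> (forall i, measurable_fun [set: Om] (X1 i)) ->
  (forall i, measurable_fun [set: Om] (X2 i)) -> fresh_pairs G X1 X2 ->
  measurable_fun setT chi -> (forall w, 0 <= chi w) ->
  measurable_fun setT v -> (forall w, 0 <= v w) -> mxmeas u -> mxmeas phi ->
  (forall w U, 0 < chi w ->
     Ebound (Z \x Z)%E (fun s => psi (U + phi (w, s))) (a * psi U + v w)) ->
  (\int[P]_w (chi w * psi (u w + \sum_(i < n) phi (w, (X1 i w, X2 i w))))%:E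
    <= \int[P]_w (chi w * (a ^+ n * (psi (u w) + n%:R * v w)))%:E)%E.
Proof.
move=> mpsi psi0 a1; have a0 : 0 <= a := le_trans ler01 a1.
elim=> [|n IH] G X1 X2 chi v u phi pG m1 m2 fr mchi chi0 mv v0 mu mphi step.
  rewrite le_eqVlt; apply/orP; left; apply/eqP; apply: eq_integral => w _.
  by rewrite big_ord0 !addr0 mul0r addr0 expr0 mul1r.
pose TG := g_sigma_algebraType G.
pose G' := enlarge (enlarge G (X1 0%N)) (X2 0%N); pose TG' := g_sigma_algebraType G'.
have pG1 := past_enlarge pG (m1 0%N); have pG' := past_enlarge pG1 (m2 0%N).
have mid : measurable_fun [set: TG'] (id : TG' -> TG).
  exact: measurableT_comp (@measurable_enlarge_id G (X1 0%N)) (@measurable_enlarge_id _ (X2 0%N)).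
have mx1 : measurable_fun [set: TG'] (X1 0%N : TG' -> Xi).
  exact: measurableT_comp (@measurable_enlarge_sample G (X1 0%N) (past_setT pG))
    (@measurable_enlarge_id _ (X2 0%N)).
have mx2 : measurable_fun [set: TG'] (X2 0%N : TG' -> Xi).
  exact: measurable_enlarge_sample (past_setT pG1).
pose u' (w : TG') := u w + phi (w, (X1 0%N w, X2 0%N w)).
pose phi' (x : TG' * (Xi * Xi)) := phi (x.1 : TG, x.2).
have mu' : mxmeas u'.
  apply: mxmeasD; first exact: mxmeas_comp mu mid.
  apply: (mxmeas_comp mphi); apply: measurable_fun_pair => //.
  exact: measurable_fun_pair.
have mphi' : mxmeas phi'.
  apply: (mxmeas_comp mphi); apply: measurable_fun_pair; last exact: measurable_snd.
  exact: measurableT_comp mid measurable_fst.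
have mchi' : measurable_fun [set: TG'] (chi : TG' -> R) by exact: measurableT_comp mchi mid.
have mv' : measurable_fun [set: TG'] (v : TG' -> R) by exact: measurableT_comp mv mid.
have := IH G' (fun i => X1 i.+1) (fun i => X2 i.+1) chi v u' phi' pG'
  (fun i => m1 i.+1) (fun i => m2 i.+1) (fresh_pairs_step fr) mchi' chi0 mv' v0 mu' mphi' step.
rewrite /u' /phi' /= => {}IH.
apply: le_trans (le_trans _ IH) _.
  rewrite le_eqVlt; apply/orP; left; apply/eqP; apply: eq_integral => w _.
  by rewrite big_ord_recl /= addrA.
pose psi1 (x : TG * (Xi * Xi)) : \bar R :=
  (chi x.1 * (a ^+ n * (psi (u x.1 + phi x) + n%:R * v x.1)))%:E.
have mpsi1 : measurable_fun setT psi1.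
  apply/measurable_EFinP; apply: measurable_funM; first exact: measurableT_comp mchi measurable_fst.
  apply: measurable_funM; first exact: measurable_cst.
  apply: measurable_funD.
    by apply: mpsi; apply: mxmeasD => //; exact: mxmeas_comp mu measurable_fst.
  apply: measurable_funM; first exact: measurable_cst.
  exact: measurableT_comp mv measurable_fst.
have psi10 x : (0 <= psi1 x)%E.
  by rewrite lee_fin mulr_ge0 // mulr_ge0 ?exprn_ge0 // addr_ge0 // mulr_ge0.
have e : (\int[P]_w (chi w * (a ^+ n * (psi (u w + phi (w, (X1 0%N w, X2 0%N w)))
    + n%:R * v w)))%:E = \int[P]_w fubini_F (Z \x Z)%E psi1 w)%E.
  exact: (freeze_pair pG (m1 0%N) (m2 0%N) fr mpsi1 psi10).
rewrite e.
have mtarget : measurable_fun [set: TG] (fun w : TG =>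
    chi w * (a ^+ n.+1 * (psi (u w) + n.+1%:R * v w))).
  apply: measurable_funM => //; apply: measurable_funM; first exact: measurable_cst.
  apply: measurable_funD; first exact: mpsi.
  by apply: measurable_funM => //; exact: measurable_cst.
have mcoarse := measurable_coarsen (past_measurable pG).
apply: ge0_le_integral => //.
- by move=> w _; apply: integral_ge0 => s _; exact: psi10.
- have mF : measurable_fun [set: TG] (fubini_F (Z \x Z)%E psi1).
    exact: (measurable_inner_integral (Z \x Z)%E mpsi1 psi10).
  exact: (measurableT_comp mF mcoarse).
- apply/measurable_EFinP; exact: measurableT_comp mtarget mcoarse.
move=> w _; rewrite /fubini_F /psi1 /=.
have [c0|cn] := eqVneq (chi w) 0.
  rewrite c0; under eq_integral do rewrite mul0r.
  by rewrite integral0 mul0r.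
have cp : 0 < chi w by rewrite lt_def cn chi0.
have an : 0 <= a ^+ n by rewrite exprn_ge0.
have nv : 0 <= n%:R * v w by rewrite mulr_ge0.
have := EbZ (ltW cp) (EbZ an (EbD (step w (u w) cp) (Eb_cst _ nv))).
move=> /Eb_le h; apply: le_trans h _; rewrite lee_fin ler_wpM2l //.
rewrite exprSr -mulrA ler_wpM2l // mulrDr -addrA lerD2l.
have -> : v w + n%:R * v w = n.+1%:R * v w by rewrite -add1n natrD mulrDl mul1r.
by rewrite ler_peMl // mulr_ge0.
Qed.

End fresh_samples.

Lemma mxmeas_random_average {R : realType} d d1 dX (T' : measurableType d) (T1 : measurableType d1)
  (Xi : measurableType dX) p q (N : T' -> nat) (j : T' -> T1) (X1 X2 : nat -> T' -> Xi)
  (phi : T1 * (Xi * Xi) -> 'M[R]_(p, q)) :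
  (forall n, measurable [set w | N w = n]) -> measurable_fun setT j ->
  (forall i, measurable_fun setT (X1 i)) -> (forall i, measurable_fun setT (X2 i)) ->
  mxmeas phi ->
  mxmeas (fun w => (N w)%:R^-1 *: \sum_(i < N w) phi (j w, (X1 i w, X2 i w))).
Proof.
move=> mN mj m1 m2 mphi.
apply: (mxmeas_countable_pieces (N := N)
  (G := fun n w => n%:R^-1 *: \sum_(i < n) phi (j w, (X1 i w, X2 i w)))) => [//|n|//].
apply: mxmeasZ; first exact: measurable_cst.
apply: mxmeas_sum => i; apply: (mxmeas_comp mphi).
by apply: measurable_fun_pair => //; exact: measurable_fun_pair.
Qed.

Section batch_average.
Context {R : realType} {dO dX : measure_display} {Om : measurableType dO}
  {Xi : measurableType dX} (P : probability Om R) (Z : probability Xi R).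
Context (G : set (set Om)) (X1 X2 : nat -> Om -> Xi).
Context (pG : past G).
Context (m1 : forall i, measurable_fun [set: Om] (X1 i)).
Context (m2 : forall i, measurable_fun [set: Om] (X2 i)).
Context (fr : fresh_pairs P Z G X1 X2).
Local Notation TG := (g_sigma_algebraType G).
Context {p q : nat} (N : Om -> nat) (u : TG -> 'M[R]_(p, q)) (phi : TG * (Xi * Xi) -> 'M[R]_(p, q)).
Context (mN : forall n, measurable ([set w | N w = n] : set TG)).
Context (N0 : forall w, (0 < N w)%N).
Context (mu : mxmeas u).
Context (mphi : mxmeas phi).

Definition batch_average (w : Om) : 'M[R]_(p, q) :=
  (N w)%:R^-1 *: \sum_(i < N w) phi (w, (X1 i w, X2 i w)).

Lemma measurable_of_past (d' : measure_display) (S : measurableType d') (g : TG -> S) :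
  measurable_fun [set: TG] g -> measurable_fun [set: Om] (g : Om -> S).
Proof. by move=> mg; exact: measurableT_comp mg (measurable_coarsen (past_measurable pG)). Qed.

Lemma mxmeas_of_past p' q' (A : TG -> 'M[R]_(p', q')) : mxmeas A -> mxmeas (A : Om -> _).
Proof. by move=> mA i j; apply: measurable_of_past; exact: mA. Qed.

Lemma measurable_event_of_past (A : set TG) : measurable A -> measurable (A : set Om).
Proof. exact: generated_measurable (past_measurable pG) _. Qed.

Lemma mxmeas_batch_average : mxmeas batch_average.
Proof.
have mid := measurable_coarsen (past_measurable pG).
exact: mxmeas_random_average (fun n => measurable_event_of_past (mN n)) mid m1 m2 mphi.
Qed.

(** The batch size is random but known from the past, so the events where it is
    constant are treated separately and summed. For a batch of size [n] the
    potential grows by [a n] at each sample, and [a n ^ n] does not blow up. *)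
Lemma batch_average_bound (psi : 'M[R]_(p, q) -> R) (a : nat -> R) (K : R) (v : TG -> R) r :
  (forall d' (T' : measurableType d') (U : T' -> 'M[R]_(p, q)), mxmeas U ->
     measurable_fun [set: T'] (fun w => psi (U w))) ->
  (forall U, 0 <= psi U) -> (forall n, 1 <= a n) -> (forall n, a n ^+ n <= K) ->
  measurable_fun setT v -> (forall w, 0 <= v w) ->
  (forall w U, Ebound (Z \x Z)%E (fun s => psi (U + (N w)%:R^-1 *: phi (w, s)))
     (a (N w) * psi U + v w / (N w)%:R)) ->
  Ebound P (fun w => K * (psi (u w) + v w)) r ->
  Ebound P (fun w => psi (u w + batch_average w)) r.
Proof.
move=> mpsi psi0 a1 aK mv v0 step [mg g0 hr].
have mf : measurable_fun [set: Om] (fun w => psi (u w + batch_average w)).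
  by apply: mpsi; apply: mxmeasD; [exact: mxmeas_of_past|exact: mxmeas_batch_average].
split => //; apply: le_trans hr.
pose F n : set Om := [set w | N w = n].
have mF n : measurable (F n) by exact: (measurable_event_of_past (mN n)).
have FT : \bigcup_n F n = setT by apply/seteqP; split => // w _; exists (N w).
have tF : trivIset [set: nat] F by move=> i j _ _ [w [/= <- <-]].
have split_int (f : Om -> R) : measurable_fun [set: Om] f -> (forall w, 0 <= f w) ->
    (\int[P]_w (f w)%:E = \sum_(n <oo) \int[P]_w (\1_(F n) w * f w)%:E)%E.
  move=> mf' f0; rewrite -[in LHS]FT ge0_integral_bigcup //.
  - apply: eq_eseriesr => n _; rewrite integral_mkcond; apply: eq_integral => w _.
    rewrite /patch indicE; case: ifPn => _; first by rewrite mul1r.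
    by rewrite mul0r.
  - by rewrite FT; exact/measurable_EFinP.
  - by move=> w _; rewrite lee_fin.
rewrite (split_int _ mf (fun w => psi0 _)) (split_int _ mg g0).
apply: lee_nneseries => [n _ _|n _].
  by apply: integral_ge0 => w _; rewrite lee_fin mulr_ge0.
case: n => [|n].
  rewrite (_ : F 0%N = set0); last by apply/seteqP; split => w //= w0; have := N0 w; rewrite w0.
  by rewrite le_eqVlt; apply/orP; left; apply/eqP; apply: eq_integral => w _; rewrite indic0 !mul0r.
pose chi : TG -> R := \1_(F n.+1).
have mchi : measurable_fun [set: TG] chi by exact: (measurable_indic (mN n.+1)).
have v1 w : 0 <= v w / n.+1%:R by rewrite divr_ge0.
have mphi1 : mxmeas (fun x : TG * (Xi * Xi) => n.+1%:R^-1 *: phi x).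
  by apply: mxmeasZ => //; exact: measurable_cst.
have step' (w : TG) (U : 'M[R]_(p, q)) : 0 < chi w ->
    Ebound (Z \x Z)%E (fun s => psi (U + n.+1%:R^-1 *: phi (w, s)))
      (a n.+1 * psi U + v w / n.+1%:R).
  rewrite /chi indicE; case: (boolP (w \in F n.+1)) => [|_]; last by rewrite ltxx.
  by rewrite inE /F /= => <- _; exact: step.
have := @fresh_batch_growth R _ _ Om Xi P Z p q psi (a n.+1) mpsi psi0 (a1 _) n.+1 G X1 X2
   chi (fun w => v w / n.+1%:R) u (fun x => n.+1%:R^-1 *: phi x) pG m1 m2 fr mchi
   (fun w => ler0n _ _) (measurable_funM mv (measurable_cst _)) v1 mu mphi1 step'.
move=> h; apply: le_trans (le_trans _ h) _.
  rewrite le_eqVlt; apply/orP; left; apply/eqP; apply: eq_integral => w _; congr EFin.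
  rewrite /chi indicE; case: (boolP (w \in F n.+1)) => [|_]; last by rewrite !mul0r.
  by rewrite inE /F /= /batch_average => ->; rewrite scaler_sumr.
have gm (k : R) : measurable_fun [set: Om] (fun w => chi w * (k * (psi (u w) + v w))).
  apply: measurable_funM; first exact: measurable_of_past.
  apply: measurable_funM; first exact: measurable_cst.
  apply: measurable_funD; last exact: measurable_of_past.
  by apply: mpsi; exact: mxmeas_of_past.
have chi0 w : 0 <= chi w by rewrite /chi indicE ler0n.
have an : 0 <= a n.+1 ^+ n.+1 by rewrite exprn_ge0 // (le_trans ler01).
apply: (@le_trans _ _ (\int[P]_w (chi w * (a n.+1 ^+ n.+1 * (psi (u w) + v w)))%:E)%E).
  rewrite le_eqVlt; apply/orP; left; apply/eqP; apply: eq_integral => w _.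
  have e : n.+1%:R * (v w / n.+1%:R) = v w by rewrite mulrC divfK // pnatr_eq0.
  by rewrite e.
apply: ge0_le_integral => //.
- by move=> w _; rewrite lee_fin mulr_ge0 // mulr_ge0 // addr_ge0.
- exact/measurable_EFinP.
- exact/measurable_EFinP.
move=> w _; rewrite lee_fin ler_wpM2l // ler_wpM2r // addr_ge0 //.
Qed.

(** Variances of centered independent terms add up, without any growth factor. *)
Lemma batch_second_moment (V : TG -> R) r : (forall w, has_mean (Z \x Z)%E (fun s => phi (w, s)) 0) ->
  measurable_fun setT V -> (forall w, 0 <= V w) ->
  (forall w, Ebound (Z \x Z)%E (fun s => frobenius (phi (w, s)) ^+ 2) (V w * (N w)%:R)) ->
  Ebound P (fun w => frobenius (u w) ^+ 2 + V w) r ->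
  Ebound P (fun w => frobenius (u w + batch_average w) ^+ 2) r.
Proof.
move=> hm mV V0 hV hr.
apply: (@batch_average_bound (fun U => frobenius U ^+ 2) (fun=> 1) 1 V) => //.
- by move=> d' T' U mU; apply: measurable_funX; exact: mxmeas_frob.
- by move=> U; exact: sqr_ge0.
- move=> w U; rewrite mul1r; apply: second_moment_shift.
    by rewrite -(scaler0 _ (N w)%:R^-1); exact: has_meanZ.
  have n0 : (N w)%:R != 0 :> R by rewrite pnatr_eq0 -lt0n.
  have e2 : 0 <= ((N w)%:R : R)^-1 ^+ 2 by rewrite sqr_ge0.
  have e : ((N w)%:R : R)^-1 ^+ 2 * (V w * (N w)%:R) = V w / (N w)%:R by field.
  have := EbZ e2 (hV w); rewrite e.
  apply: Eb_mono.
    apply: measurable_funX; apply: mxmeas_frob; apply: mxmeasZ; first exact: measurable_cst.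
    exact: has_mean_mxmeas (hm w).
  by move=> s; rewrite sqr_ge0 /= frobZ exprMn real_normK ?num_real.
- by under [X in Ebound _ X]eq_fun do rewrite mul1r.
Qed.

(** The middle term of the expanded cube is absorbed by the potential
    [U ^ 3 + 3 * t ^ 3] at the price of a factor close to 1. *)
Lemma third_moment_growth (U b y t : R) : 0 <= U -> 0 <= b -> b ^+ 2 <= y -> y <= t ^+ 2 -> 0 < t ->
  U ^+ 3 + 3 * U * b ^+ 2 + b ^+ 3 + 3 * t ^+ 3 <= (1 + y / t ^+ 2) * (U ^+ 3 + 3 * t ^+ 3).
Proof.
move=> U0 b0 by2 yt t0.
have y0 : 0 <= y := le_trans (sqr_ge0 _) by2.
have bt : b <= t by rewrite -(@ler_pXn2r _ 2) ?nnegrE ?(ltW t0) // (le_trans by2).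
have h1 : U * b ^+ 2 <= U * y by rewrite ler_wpM2l.
have h2 : b ^+ 3 <= t * y.
  by rewrite exprS ler_pM // sqr_ge0.
have h3 : 3 * U * y <= y / t ^+ 2 * (U ^+ 3 + 2 * t ^+ 3).
  have -> : 3 * U * y = y / t ^+ 2 * (3 * U * t ^+ 2) by field; exact: lt0r_neq0.
  rewrite ler_wpM2l ?divr_ge0 ?sqr_ge0 //.
  have : 0 <= (U - t) ^+ 2 * (U + 2 * t) by rewrite mulr_ge0 ?sqr_ge0 // addr_ge0 // mulr_ge0 // ltW.
  lra.
have e : t * y = y / t ^+ 2 * t ^+ 3 by field; exact: lt0r_neq0.
rewrite e in h2; lra.
Qed.

(** Third moments are not additive, but the potential [U ^ 3 + 3 * t ^ 3] grows
    at most by [1 + y / (N * t ^ 2)] at each of the [N] samples, hence by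
    [expR (y / t ^ 2)] over the batch, whatever its size. *)
Lemma batch_third_moment (b : TG -> R) (y t r : R) :
  (forall w, has_mean (Z \x Z)%E (fun s => phi (w, s)) 0) ->
  (forall w, 0 <= b w) -> 0 < t -> 0 <= y -> y <= t ^+ 2 ->
  (forall w, b w ^+ 2 <= y * (N w)%:R) ->
  (forall w, Ebound (Z \x Z)%E (fun s => frobenius (phi (w, s)) ^+ 3) (b w ^+ 3)) ->
  Ebound P (fun w => frobenius (u w) ^+ 3 + 3 * t ^+ 3) r ->
  Ebound P (fun w => frobenius (u w + batch_average w) ^+ 3 + 3 * t ^+ 3)
    (expR (y / t ^+ 2) * r).
Proof.
move=> hm b0 t0 y0 yt hb h3 hr.
have yt0 : 0 <= y / t ^+ 2 by rewrite divr_ge0 ?sqr_ge0.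
apply: (@batch_average_bound (fun U => frobenius U ^+ 3 + 3 * t ^+ 3)
  (fun n => 1 + y / n%:R / t ^+ 2) (expR (y / t ^+ 2)) (fun=> 0)) => //.
- move=> d' T' U mU; apply: measurable_funD; last exact: measurable_cst.
  by apply: measurable_funX; exact: mxmeas_frob.
- by move=> U; rewrite addr_ge0 ?exprn_ge0 ?frob_ge0 // mulr_ge0 // exprn_ge0 // ltW.
- by move=> n; rewrite lerDl divr_ge0 ?sqr_ge0 // divr_ge0.
- case=> [|n]; first by rewrite expr0; have := expR_ge1Dx (y / t ^+ 2); lra.
  have -> : y / t ^+ 2 = n.+1%:R * (y / n.+1%:R / t ^+ 2).
    have : n.+1%:R != 0 :> R by rewrite pnatr_eq0.
    by move: (n.+1%:R : R) => k k0; field; rewrite k0 /= gt_eqF.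
  rewrite expRM_natl ler_pXn2r ?nnegrE ?expR_ge0 ?expR_ge1Dx //.
  by rewrite addr_ge0 // divr_ge0 ?sqr_ge0 // divr_ge0.
- move=> w U; rewrite mul0r addr0.
  have n0 : 0 < (N w)%:R :> R by rewrite ltr0n.
  have n1 : 1 <= (N w)%:R :> R by rewrite ler1n.
  pose b' := b w / (N w)%:R.
  have b'0 : 0 <= b' by rewrite divr_ge0.
  have b'y : b' ^+ 2 <= y / (N w)%:R.
    rewrite /b' expr_div_n ler_pdivrMr ?exprn_gt0 //.
    have -> : y / (N w)%:R * (N w)%:R ^+ 2 = y * (N w)%:R by field; exact: lt0r_neq0.
    exact: hb.
  have hX : has_mean (Z \x Z)%E (fun s => (N w)%:R^-1 *: phi (w, s)) 0.
    by rewrite -(scaler0 _ (N w)%:R^-1); exact: has_meanZ.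
  have h3' : Ebound (Z \x Z)%E (fun s => frobenius ((N w)%:R^-1 *: phi (w, s)) ^+ 3) (b' ^+ 3).
    have e3 : 0 <= ((N w)%:R : R)^-1 ^+ 3 by rewrite exprn_ge0.
    have := EbZ e3 (h3 w); rewrite -exprMn mulrC -/b'.
    apply: Eb_mono.
      apply: measurable_funX; apply: mxmeas_frob; apply: mxmeasZ; first exact: measurable_cst.
      exact: has_mean_mxmeas (hm w).
    move=> s; rewrite exprn_ge0 ?frob_ge0 //= frobZ exprMn ger0_norm //.
  have t3 : 0 <= 3 * t ^+ 3 by rewrite mulr_ge0 // exprn_ge0 // ltW.
  apply: Eb_weaken (EbD (third_moment_shift U b'0 hX h3') (Eb_cst _ t3)) _.
  apply: third_moment_growth => //; first exact: frob_ge0.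
  apply: le_trans yt; rewrite ler_pdivrMr // ler_peMr //.
under [X in Ebound _ X]eq_fun do rewrite addr0.
by apply: EbZ => //; exact: expR_ge0.
Qed.

End batch_average.

(** * Moments of sampled gradients and Hessians *)

Section product_moments.
Context {R : realType} {dX : measure_display} {Xi : measurableType dX} (Z : probability Xi R).
Local Notation nu := (Z \x Z)%E.

Lemma Eb_product (f g : Xi -> R) r s : Ebound Z f r -> Ebound Z g s ->
  Ebound nu (fun x => f x.1 * g x.2) (r * s).
Proof.
move=> hf hg; have r0 := Eb_real_ge0 hf; have s0 := Eb_real_ge0 hg.
have [mf f0 fr] := hf; have [mg g0 gs] := hg.
have mfg : measurable_fun setT (fun x : Xi * Xi => f x.1 * g x.2).
  apply: measurable_funM; first exact: measurableT_comp mf measurable_fst.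
  exact: measurableT_comp mg measurable_snd.
split => // [x|]; first by rewrite mulr_ge0.
have fg0 (x : Xi * Xi) : (0 <= (f x.1 * g x.2)%:E)%E by rewrite lee_fin mulr_ge0.
have mE : measurable_fun setT (fun x : Xi * Xi => (f x.1 * g x.2)%:E).
  exact/measurable_EFinP.
have -> : (\int[nu]_x (f x.1 * g x.2)%:E =
    \int[Z]_x fubini_F Z (fun y => (f y.1 * g y.2)%:E) x)%E.
  exact: fubini_tonelli1.
rewrite /fubini_F /=.
apply: (@le_trans _ _ (\int[Z]_x (s * f x)%:E)%E); last first.
  by have := Eb_le (EbZ s0 hf); rewrite mulrC.
apply: ge0_le_integral => //.
- by move=> x _; apply: integral_ge0 => y _; rewrite lee_fin mulr_ge0.
- exact: (measurable_inner_integral Z mE fg0).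
- by apply/measurable_EFinP; apply: measurable_funM => //; exact: measurable_cst.
- by move=> x _; have := Eb_le (EbZ (f0 x) hg); rewrite (mulrC s).
Qed.

Lemma Eb_fst (f : Xi -> R) r : Ebound Z f r -> Ebound nu (fun x => f x.1) r.
Proof.
move=> hf; have := Eb_product hf (Eb_cst Z ler01); rewrite mulr1.
by under [X in Ebound _ X]eq_fun do rewrite mulr1.
Qed.

Lemma has_ev_norm (f : Xi -> R) r : has_ev Z f r -> exists s, Ebound Z (fun x => `|f x|) s.
Proof.
move=> [/integrableP[mf fin] _]; exists (fine (\int[Z]_x `|(f x)%:E|)%E).
have mf' : measurable_fun setT f by exact/measurable_EFinP.
split => //; first exact: measurableT_comp.
rewrite fineK //.
by rewrite ge0_fin_numE //; apply: integral_ge0.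
Qed.

Lemma has_ev_product (f g : Xi -> R) r s : has_ev Z f r -> has_ev Z g s ->
  has_ev nu (fun x => f x.1 * g x.2) (r * s).
Proof.
move=> hf hg; have [r' hf'] := has_ev_norm hf; have [s' hg'] := has_ev_norm hg.
have [f_int fr] := hf; have [g_int gs] := hg.
have mf : measurable_fun setT f by have /measurable_int/measurable_EFinP := f_int.
have mg : measurable_fun setT g by have /measurable_int/measurable_EFinP := g_int.
have mfg : measurable_fun setT (fun x : Xi * Xi => f x.1 * g x.2).
  apply: measurable_funM; first exact: measurableT_comp mf measurable_fst.
  exact: measurableT_comp mg measurable_snd.
have fg_int : nu.-integrable setT (EFin \o (fun x : Xi * Xi => f x.1 * g x.2)).
  apply/integrableP; split; first exact/measurable_EFinP.
  have := Eb_le (Eb_product hf' hg') => h.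
  apply: le_lt_trans (_ : _ <= (r' * s')%:E)%E _; last by rewrite ltry.
  apply: le_trans h; rewrite le_eqVlt; apply/orP; left; apply/eqP.
  by apply: eq_integral => x _; rewrite /= normrM.
split => //.
transitivity (\int[Z]_x (s * f x)%:E)%E; last by have [_ ->] := has_evZ s hf; rewrite mulrC.
have -> : (\int[nu]_x (f x.1 * g x.2)%:E = \int[Z]_x \int[Z]_y (f x * g y)%:E)%E.
  by rewrite -(fubini1 fg_int).
apply: eq_integral => x _.
by have [_ ->] := has_evZ (f x) hg; rewrite mulrC.
Qed.

Lemma has_mean_product p q r (X : Xi -> 'M[R]_(p, q)) (Y : Xi -> 'M[R]_(q, r)) M N :
  has_mean Z X M -> has_mean Z Y N ->
  has_mean nu (fun x => X x.1 *m Y x.2) (M *m N).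
Proof.
move=> hX hY i j; rewrite mxE; under [X in has_ev _ X]eq_fun do rewrite mxE.
have hk k := has_ev_product (hX i k) (hY k j).
exact: (has_ev_sum _ hk).
Qed.

Lemma has_mean_fst p q (X : Xi -> 'M[R]_(p, q)) M : has_mean Z X M ->
  has_mean nu (fun x => X x.1) M.
Proof.
move=> hX i j; have := has_ev_product (hX i j) (has_ev_cst Z 1); rewrite mulr1.
by under [X in has_ev _ X]eq_fun do rewrite mulr1.
Qed.

End product_moments.

Section sampled_moments.
Context {R : realType} {n m : nat} {dX : measure_display} {Xi : measurableType dX}
  (Z : probability Xi R) (F : 'cV[R]_(n + m) -> Xi -> R) (f : 'cV[R]_(n + m) -> R)
  (mu L rho beta sigma1 sigma2 : R).
Context (hd : deterministic_assumptions f mu L rho).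
Context (hs : stochastic_assumptions Z F f L rho sigma1 sigma2).
Context (beta_ge0 : 0 <= beta).
Local Notation nu := (Z \x Z)%E.
Local Notation P := (Pmx R n m).
Local Notation sgrad s z := (grad (fun w => F w s) z).
Local Notation shess s z := (hess (fun w => F w s) z).
Local Notation u z := (frobenius (ygrad f z)).
Implicit Types (z : 'cV[R]_(n + m)).
Let L0 := det_L_gt0 hd.
Let rho0 := det_rho_gt0 hd.

Definition sprefactor z (s : Xi) : 'M[R]_(n + m) := 1%:M + beta *: (shess s z *m P).

Lemma mxmeas_sgrad_at z : mxmeas (fun s => sgrad s z).
Proof.
exact: (mxmeas_sample_grad (s := id) (z := fun=> z) (sto_measurable hs)
  (sto_differentiable hs) (@measurable_id _ Xi setT) (mxmeas_cst z)).
Qed.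

Lemma mxmeas_shess_at z : mxmeas (fun s => shess s z).
Proof.
exact: (mxmeas_sample_hess (s := id) (z := fun=> z) (sto_measurable hs)
  (sto_differentiable hs) (@measurable_id _ Xi setT) (mxmeas_cst z)).
Qed.

Lemma expectation_Eb (g : Xi -> R) r : measurable_fun setT g -> (forall s, 0 <= g s) ->
  ('E_Z[g] <= r%:E)%E -> Ebound Z g r.
Proof. by move=> mg g0 h; split=> //; move: h; rewrite unlock. Qed.

Lemma sgrad_cube z : Ebound Z (fun s => frobenius (sgrad s z - grad f z) ^+ 3) (sigma1 ^+ 3).
Proof.
have := sto_grad_moment hs z; under [X in ('E_Z[X] <= _)%E]eq_fun do rewrite enorm_frob.
apply: expectation_Eb => [|s]; last by rewrite exprn_ge0 ?frob_ge0.
apply: measurable_funX; apply: mxmeas_frob.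
by apply: mxmeasB; [exact: mxmeas_sgrad_at|exact: mxmeas_cst].
Qed.

Lemma sgrad_diff_cube z1 z2 : Ebound Z (fun s => frobenius (sgrad s z1 - sgrad s z2) ^+ 3)
  ((L * frobenius (z1 - z2)) ^+ 3).
Proof.
have := sto_grad_lipschitz hs z1 z2; under [X in ('E_Z[X] <= _)%E]eq_fun do rewrite enorm_frob.
rewrite exprMn enorm_frob; apply: expectation_Eb => [|s]; last by rewrite exprn_ge0 ?frob_ge0.
apply: measurable_funX; apply: mxmeas_frob.
by apply: mxmeasB; exact: mxmeas_sgrad_at.
Qed.

Lemma shess_cube z : Ebound Z (fun s => frobenius (shess s z) ^+ 3) (sigma2 ^+ 3).
Proof.
have := sto_hess_moment hs z; apply: expectation_Eb => [|s]; last by rewrite exprn_ge0 ?frob_ge0.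
by apply: measurable_funX; apply: mxmeas_frob; exact: mxmeas_shess_at.
Qed.

Lemma shess_diff_cube z1 z2 : Ebound Z (fun s => frobenius (shess s z1 - shess s z2) ^+ 3)
  ((rho * frobenius (z1 - z2)) ^+ 3).
Proof.
have := sto_hess_lipschitz hs z1 z2; rewrite exprMn enorm_frob.
apply: expectation_Eb => [|s]; last by rewrite exprn_ge0 ?frob_ge0.
by apply: measurable_funX; apply: mxmeas_frob; apply: mxmeasB; exact: mxmeas_shess_at.
Qed.

Lemma cube_ge0 (a : R) : 0 <= a ^+ 3 -> 0 <= a.
Proof. by rewrite real_exprn_odd_ge0 ?num_real. Qed.

Lemma sigma1_ge0 : 0 <= sigma1.
Proof. exact/cube_ge0/(Eb_real_ge0 (sgrad_cube 0)). Qed.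

Lemma sigma2_ge0 : 0 <= sigma2.
Proof. exact/cube_ge0/(Eb_real_ge0 (shess_cube 0)). Qed.

Lemma lower_moments p q (X : Xi -> 'M[R]_(p, q)) b : 0 <= b -> mxmeas X ->
  Ebound Z (fun s => frobenius (X s) ^+ 3) (b ^+ 3) ->
  Ebound Z (fun s => frobenius (X s) ^+ 2) (b ^+ 2) /\ Ebound Z (fun s => frobenius (X s)) b.
Proof.
move=> b0 mX h; have mf := mxmeas_frob mX; have f0 s : 0 <= frobenius (X s) := frob_ge0 _.
have h2 := Eb_sqr_of_cube b0 mf f0 h.
by split=> //; exact: Eb_of_sqr.
Qed.

Lemma has_mean_of_cube p q (X : Xi -> 'M[R]_(p, q)) (M : 'M[R]_(p, q)) b : 0 <= b -> mxmeas X ->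
  (forall i j, ('E_Z[fun s => X s i j] = (M i j)%:E)%E) ->
  Ebound Z (fun s => frobenius (X s) ^+ 3) (b ^+ 3) -> has_mean Z X M.
Proof.
move=> b0 mX hE h i j; split; last by have := hE i j; rewrite unlock.
have [_ h1] := lower_moments b0 mX h.
have [s _ [s_int _]] := Eb_has_ev h1.
apply: le_integrable s_int => //; first exact/measurable_EFinP/mX.
move=> x _ /=; rewrite lee_fin (ger0_norm (frob_ge0 _)).
rewrite -(@ler_pXn2r _ 2) ?nnegrE ?frob_ge0 // real_normK ?num_real // frob_sqr fdotE.
rewrite (bigD1 i) //= (bigD1 j) //= -expr2 -addrA lerDl addr_ge0 //.
  by apply: sumr_ge0 => k _; rewrite -expr2 sqr_ge0.
by do 2![apply: sumr_ge0 => ? _]; rewrite -expr2 sqr_ge0.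
Qed.

Lemma shess_mean z : has_mean Z (fun s => shess s z) (hess f z).
Proof.
apply: (has_mean_of_cube sigma2_ge0) (shess_cube z); first exact: mxmeas_shess_at.
by move=> i j; exact: (sto_hess_mean hs).
Qed.

Lemma sgrad_mean z : has_mean Z (fun s => sgrad s z) (grad f z).
Proof.
have h3 : Ebound Z (fun s => frobenius (sgrad s z) ^+ 3)
    ((4 * (sigma1 + frobenius (grad f z))) ^+ 3).
  have mg := mxmeas_sgrad_at z.
  have h := third_momentD (mxmeasB mg (mxmeas_cst (grad f z))) (mxmeas_cst (grad f z))
    (sgrad_cube z) (Eb_cst Z (exprn_ge0 3 (frob_ge0 (grad f z)))).
  under [X in Ebound _ X]eq_fun do rewrite -[sgrad _ z](subrK (grad f z)).
  apply: Eb_weaken h _; have := sigma1_ge0; have := frob_ge0 (grad f z).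
  move: (frobenius _) => b b0 s0; rewrite exprMn.
  have h1 : sigma1 ^+ 3 + b ^+ 3 <= (sigma1 + b) ^+ 3.
    have : 0 <= sigma1 * b * (sigma1 + b) by rewrite !mulr_ge0 // addr_ge0.
    lra.
  have h2 : 0 <= (sigma1 + b) ^+ 3 by rewrite exprn_ge0 // addr_ge0.
  lra.
apply: (has_mean_of_cube _ (mxmeas_sgrad_at z)) h3.
  by rewrite mulr_ge0 // addr_ge0 ?sigma1_ge0 ?frob_ge0.
move=> i j; rewrite (ord1 j); exact: (sto_grad_mean hs).
Qed.

Lemma sprefactor_mean z : has_mean Z (sprefactor z) (prefactor f beta z).
Proof.
apply: has_meanD; first exact: has_mean_cst.
by apply: has_meanZ; apply: has_mean_mulmxr; exact: shess_mean.
Qed.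

Lemma frob_mulmx_Pmx p (A : 'M[R]_(p, n + m)) : frobenius (A *m P) <= frobenius A.
Proof.
rewrite -frob_trmx trmx_mul Pmx_tr -[leRHS]frob_trmx -[leRHS]mul1r.
exact: (opbound_mulmx _ ler01 (@opbound_Pmx R n m)).
Qed.

Lemma opbound_sprefactor z s : opbound (sprefactor z s) (1 + beta * frobenius (shess s z)).
Proof.
apply: opboundD; first exact: opbound1.
rewrite -{2}(ger0_norm beta_ge0); apply: opboundZ.
by apply: opbound_le (frob_opbound _) (frob_mulmx_Pmx _).
Qed.

Let a_ z s : R := 1 + beta * frobenius (shess s z).

Lemma sprefactor_factor_ge0 z s : 0 <= a_ z s.
Proof. by rewrite /a_ addr_ge0 // mulr_ge0 // frob_ge0. Qed.

Lemma sprefactor_factor_sqr z : Ebound Z (fun s => a_ z s ^+ 2) ((1 + beta * sigma2) ^+ 2).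
Proof.
have [h2 h1] := lower_moments sigma2_ge0 (mxmeas_shess_at z) (shess_cube z).
have b2 : 0 <= beta ^+ 2 by rewrite sqr_ge0.
have bb : 0 <= 2 * beta by rewrite mulr_ge0.
have := EbD (EbD (Eb_cst Z ler01) (EbZ bb h1)) (EbZ b2 h2).
have -> : 1 + 2 * beta * sigma2 + beta ^+ 2 * sigma2 ^+ 2 = (1 + beta * sigma2) ^+ 2 by ring.
have -> : (fun s => a_ z s ^+ 2) = (fun s => 1 + 2 * beta * frobenius (shess s z)
   + beta ^+ 2 * frobenius (shess s z) ^+ 2) by apply/funext => s; rewrite /a_; ring.
by [].
Qed.

Lemma sprefactor_factor_cube z : Ebound Z (fun s => a_ z s ^+ 3) ((1 + beta * sigma2) ^+ 3).
Proof.
have h3 := shess_cube z.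
have [h2 h1] := lower_moments sigma2_ge0 (mxmeas_shess_at z) h3.
have b1 : 0 <= 3 * beta by rewrite mulr_ge0.
have b2 : 0 <= 3 * beta ^+ 2 by rewrite mulr_ge0 ?sqr_ge0.
have b3 : 0 <= beta ^+ 3 by rewrite exprn_ge0.
have := EbD (EbD (EbD (Eb_cst Z ler01) (EbZ b1 h1)) (EbZ b2 h2)) (EbZ b3 h3).
have -> : 1 + 3 * beta * sigma2 + 3 * beta ^+ 2 * sigma2 ^+ 2 + beta ^+ 3 * sigma2 ^+ 3
   = (1 + beta * sigma2) ^+ 3 by ring.
have -> : (fun s => a_ z s ^+ 3) = (fun s => 1 + 3 * beta * frobenius (shess s z)
   + 3 * beta ^+ 2 * frobenius (shess s z) ^+ 2 + beta ^+ 3 * frobenius (shess s z) ^+ 3).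
  by apply/funext => s; rewrite /a_; ring.
by [].
Qed.

Lemma mxmeas_sprefactor z : mxmeas (sprefactor z).
Proof. exact: has_mean_mxmeas (sprefactor_mean z). Qed.

End sampled_moments.

(** Only one factor varies in each of the two products on the right. *)
Lemma prefactor_mul_split (R : realType) d p (b : R) (H H' J : 'M[R]_d) (g g' : 'M[R]_(d, p)) :
  (1%:M + b *: (H *m J)) *m g - (1%:M + b *: (H' *m J)) *m g' =
  (1%:M + b *: (H *m J)) *m (g - g') + b *: (H - H') *m (J *m g').
Proof.
have -> : b *: (H - H') *m (J *m g') = (b *: (H *m J) - b *: (H' *m J)) *m g'.
  by rewrite mulmxA -scalemxAl mulmxBl scalerBr.
move: (b *: _) (b *: _) => X X'; rewrite mulmxBr mulmxBl !mulmxDl.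
by apply/matrixP => i j; rewrite !mxE; ring.
Qed.

Section estimator_moments.
Context {R : realType} {n m : nat} {dX : measure_display} {Xi : measurableType dX}
  (Z : probability Xi R) (F : 'cV[R]_(n + m) -> Xi -> R) (f : 'cV[R]_(n + m) -> R)
  (mu L rho beta sigma1 sigma2 : R).
Context (hd : deterministic_assumptions f mu L rho).
Context (hs : stochastic_assumptions Z F f L rho sigma1 sigma2).
Context (beta_ge0 : 0 <= beta).
Local Notation nu := (Z \x Z)%E.
Local Notation P := (Pmx R n m).
Local Notation h := (h_beta f beta).
Local Notation HW := (hess_model f beta).
Local Notation sgrad s z := (grad (fun w => F w s) z).
Local Notation shess s z := (hess (fun w => F w s) z).
Local Notation A_ := (sprefactor F beta).
Local Notation u z := (frobenius (ygrad f z)).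
Implicit Types (z : 'cV[R]_(n + m)) (x : Xi * Xi).
Let L0 := det_L_gt0 hd.
Let rho0 := det_rho_gt0 hd.
Let s10 := sigma1_ge0 hs.
Let s20 := sigma2_ge0 hs.
Let c3 := 1 + beta * (L + sigma2).

Let c30 : 0 <= c3.
Proof. by rewrite addr_ge0 // mulr_ge0 // addr_ge0 // ltW. Qed.

Let mg z := mxmeas_sgrad_at hs z.
Let mh z := mxmeas_shess_at hs z.
Let mA z := mxmeas_sprefactor beta hs z.

Lemma mxmeas_fst p q (X : Xi -> 'M[R]_(p, q)) : mxmeas X -> mxmeas (fun x => X x.1).
Proof. by move=> mX; exact: mxmeas_comp mX measurable_fst. Qed.

Lemma mxmeas_snd p q (X : Xi -> 'M[R]_(p, q)) : mxmeas X -> mxmeas (fun x => X x.2).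
Proof. by move=> mX; exact: mxmeas_comp mX measurable_snd. Qed.

Lemma second_momentD p q (X Y : Xi * Xi -> 'M[R]_(p, q)) r s : mxmeas X -> mxmeas Y ->
  Ebound nu (fun w => frobenius (X w) ^+ 2) r -> Ebound nu (fun w => frobenius (Y w) ^+ 2) s ->
  Ebound nu (fun w => frobenius (X w + Y w) ^+ 2) (2 * (r + s)).
Proof.
move=> mX mY hX hY; apply: Eb_mono (EbZ (ler0n _ 2) (EbD hX hY)).
  by apply: measurable_funX; apply: mxmeas_frob; exact: mxmeasD.
move=> w; rewrite sqr_ge0 /=.
have e1 : frobenius (X w + Y w) ^+ 2 = frobenius (X w) ^+ 2 + 2 * fdot (X w) (Y w) + frobenius (Y w) ^+ 2.
  by rewrite !frob_sqr !fdot_lin (fdotC (Y w) (X w)); ring.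
have := fdot_ge0 (X w - Y w); rewrite e1.
have -> : fdot (X w - Y w) (X w - Y w) =
    frobenius (X w) ^+ 2 - 2 * fdot (X w) (Y w) + frobenius (Y w) ^+ 2.
  by rewrite !frob_sqr !fdot_lin (fdotC (Y w) (X w)); ring.
move: (frobenius (X w) ^+ 2) (fdot _ _) (frobenius (Y w) ^+ 2) => a b c; lra.
Qed.

(** The two factors use different samples, so that their moments multiply. *)
Lemma prefactor_second_moment z p (X : Xi -> 'M[R]_(n + m, p)) r : mxmeas X ->
  Ebound Z (fun s => frobenius (X s) ^+ 2) r ->
  Ebound nu (fun x => frobenius (A_ z x.1 *m X x.2) ^+ 2) ((1 + beta * sigma2) ^+ 2 * r).
Proof.
move=> mX hX; apply: Eb_mono (Eb_product (sprefactor_factor_sqr hs beta_ge0 z) hX).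
  by apply: measurable_funX; apply: mxmeas_frob; apply: mxmeasM; [exact: mxmeas_fst|exact: mxmeas_snd].
move=> x; rewrite sqr_ge0 /= -exprMn ler_pXn2r ?nnegrE ?frob_ge0 //; last by rewrite mulr_ge0 ?frob_ge0 // sprefactor_factor_ge0.
apply: opbound_mulmx; first exact: sprefactor_factor_ge0.
exact: opbound_sprefactor.
Qed.

Lemma prefactor_third_moment z p (X : Xi -> 'M[R]_(n + m, p)) r : mxmeas X ->
  Ebound Z (fun s => frobenius (X s) ^+ 3) r ->
  Ebound nu (fun x => frobenius (A_ z x.1 *m X x.2) ^+ 3) ((1 + beta * sigma2) ^+ 3 * r).
Proof.
move=> mX hX; apply: Eb_mono (Eb_product (sprefactor_factor_cube hs beta_ge0 z) hX).
  by apply: measurable_funX; apply: mxmeas_frob; apply: mxmeasM; [exact: mxmeas_fst|exact: mxmeas_snd].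
move=> x; rewrite exprn_ge0 ?frob_ge0 //= -exprMn ler_pXn2r ?nnegrE ?frob_ge0 //; last by rewrite mulr_ge0 ?frob_ge0 // sprefactor_factor_ge0.
apply: opbound_mulmx; first exact: sprefactor_factor_ge0.
exact: opbound_sprefactor.
Qed.

Definition q_sample z x := A_ z x.1 *m sgrad x.2 z.
Definition w_sample z x := sympart (A_ z x.1 *m shess x.2 z).
Definition y_sample z x : 'cV[R]_m := grad_y (fun w => F w x.1) z.

Lemma q_sample_mean z : has_mean nu (q_sample z) (grad h z).
Proof.
rewrite grad_h_beta; last exact: det_C3 hd.
exact: has_mean_product (sprefactor_mean beta hs z) (sgrad_mean hs z).
Qed.

Lemma frob_scaled_mulmx p q r k (A : 'M[R]_(p, q)) (B : 'M[R]_(q, r)) : 0 <= k ->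
  frobenius (k *: A *m B) <= k * frobenius A * frobenius B.
Proof.
by move=> k0; rewrite -scalemxAl frobZ ger0_norm // -mulrA ler_wpM2l // frob_mulmx.
Qed.

(** The sampled gradient is split into its centered part and its mean. The mean
    meets [P] and leaves the partial gradient in front of the sampled Hessian. *)
Lemma q_sample_variance z : Ebound nu (fun x => frobenius (q_sample z x - grad h z) ^+ 2)
  (2 * ((1 + beta * sigma2) ^+ 2 * sigma1 ^+ 2 + beta ^+ 2 * sigma2 ^+ 2 * u z ^+ 2)).
Proof.
pose X s := sgrad s z - grad f z.
have mX : mxmeas X by apply: mxmeasB => //; exact: mxmeas_cst.
have [hX _] := lower_moments s10 mX (sgrad_cube hs z).
have [hA _] := lower_moments s20 (mh z) (shess_cube hs z).
have hA' := centered_second_moment (shess_mean hs z) hA.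
pose Y (s : Xi) := beta *: (shess s z - hess f z) *m ygrad f z.
have mY : mxmeas Y.
  apply: mxmeasM; last exact: mxmeas_cst.
  apply: mxmeasZ; first exact: measurable_cst.
  by apply: mxmeasB => //; exact: mxmeas_cst.
have hY : Ebound Z (fun s => frobenius (Y s) ^+ 2) (beta ^+ 2 * sigma2 ^+ 2 * u z ^+ 2).
  have k0 : 0 <= beta ^+ 2 * u z ^+ 2 by rewrite mulr_ge0 ?sqr_ge0.
  have e : beta ^+ 2 * u z ^+ 2 * sigma2 ^+ 2 = beta ^+ 2 * sigma2 ^+ 2 * u z ^+ 2 by ring.
  have := EbZ k0 hA'; rewrite e; apply: Eb_mono; first by apply: measurable_funX; exact: mxmeas_frob.
  move=> s; rewrite sqr_ge0 /=.
  have := frob_scaled_mulmx (shess s z - hess f z) (ygrad f z) beta_ge0.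
  rewrite -(@ler_pXn2r _ 2) ?nnegrE ?frob_ge0 ?mulr_ge0 ?frob_ge0 // !exprMn => k.
  by rewrite mulrAC.
have := second_momentD (mxmeasM (mxmeas_fst (mA z)) (mxmeas_snd mX)) (mxmeas_fst mY)
   (prefactor_second_moment z mX hX) (Eb_fst hY).
congr (Ebound _ _ _); apply/funext => x; congr (frobenius _ ^+ 2).
rewrite grad_h_beta; last exact: det_C3 hd.
exact/esym/prefactor_mul_split.
Qed.

Lemma q_sample_diff_variance z z' :
  Ebound nu (fun x => frobenius (q_sample z x - q_sample z' x - (grad h z - grad h z')) ^+ 2)
  (2 * (L ^+ 2 * (1 + beta * sigma2) ^+ 2 + beta ^+ 2 * rho ^+ 2 * (sigma1 ^+ 2 + u z' ^+ 2))
     * frobenius (z - z') ^+ 2).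
Proof.
set xx := frobenius (z - z'); have xx0 : 0 <= xx := frob_ge0 _.
apply: centered_second_moment.
  by apply: has_meanB; exact: q_sample_mean.
pose X s := sgrad s z - sgrad s z'.
have mX : mxmeas X by exact: mxmeasB.
have Lx0 : 0 <= L * xx by rewrite mulr_ge0 // ltW.
have rx0 : 0 <= rho * xx by rewrite mulr_ge0 // ltW.
have [hX _] := lower_moments Lx0 mX (sgrad_diff_cube hs z z').
pose E s := shess s z - shess s z'.
have mE : mxmeas E by exact: mxmeasB.
have [hE _] := lower_moments rx0 mE (shess_diff_cube hs z z').
pose G s := P *m sgrad s z'.
have mG : mxmeas G by apply: mxmeasM => //; exact: mxmeas_cst.
have hG : Ebound Z (fun s => frobenius (G s) ^+ 2) (u z' ^+ 2 + sigma1 ^+ 2).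
  pose D s := P *m (sgrad s z' - grad f z').
  have mD0 : mxmeas (fun s => sgrad s z' - grad f z').
    by apply: mxmeasB => //; exact: mxmeas_cst.
  have hD0 : has_mean Z D 0.
    have -> : (0 : 'cV[R]_(n + m)) = P *m (grad f z' - grad f z') by rewrite subrr mulmx0.
    apply: has_mean_mulmxl; apply: has_meanB; last exact: has_mean_cst.
    exact: (sgrad_mean hs).
  have [hD _] := lower_moments s10 mD0 (sgrad_cube hs z').
  have hD2 : Ebound Z (fun s => frobenius (D s) ^+ 2) (sigma1 ^+ 2).
    apply: Eb_mono hD; first by apply: measurable_funX; apply: mxmeas_frob; exact: has_mean_mxmeas hD0.
    by move=> s; rewrite sqr_ge0 /= ler_pXn2r ?nnegrE ?frob_ge0 // frob_Pmx.
  have := second_moment_shift (ygrad f z') hD0 hD2.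
  congr (Ebound _ _ _); apply/funext => s; congr (frobenius _ ^+ 2).
  by rewrite /D /G /ygrad mulmxBr addrC subrK.
have b2 : 0 <= beta ^+ 2 by rewrite sqr_ge0.
have mEG : mxmeas (fun x => beta *: E x.1 *m G x.2).
  apply: mxmeasM; last exact: mxmeas_snd.
  by apply: mxmeasZ; [exact: measurable_cst|exact: mxmeas_fst].
have hEG : Ebound nu (fun x => frobenius (beta *: E x.1 *m G x.2) ^+ 2)
    (beta ^+ 2 * ((rho * xx) ^+ 2 * (u z' ^+ 2 + sigma1 ^+ 2))).
  apply: Eb_mono (EbZ b2 (Eb_product hE hG)); first by apply: measurable_funX; exact: mxmeas_frob.
  move=> x; rewrite sqr_ge0 /= -!exprMn mulrA ler_pXn2r ?nnegrE ?frob_ge0 //; last by rewrite !mulr_ge0 ?frob_ge0.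
  exact: frob_scaled_mulmx.
have := second_momentD (mxmeasM (mxmeas_fst (mA z)) (mxmeas_snd mX)) mEG
   (prefactor_second_moment z mX hX) hEG.
have -> : 2 * ((1 + beta * sigma2) ^+ 2 * (L * xx) ^+ 2
     + beta ^+ 2 * ((rho * xx) ^+ 2 * (u z' ^+ 2 + sigma1 ^+ 2))) =
   2 * (L ^+ 2 * (1 + beta * sigma2) ^+ 2 + beta ^+ 2 * rho ^+ 2 * (sigma1 ^+ 2 + u z' ^+ 2)) * xx ^+ 2.
  by ring.
congr (Ebound _ _ _); apply/funext => x; congr (frobenius _ ^+ 2).
exact/esym/prefactor_mul_split.
Qed.

Lemma frob_sympart d (A : 'M[R]_d) : frobenius (sympart A) <= frobenius A.
Proof.
rewrite /sympart frobZ ger0_norm ?invr_ge0 // mulrC ler_pdivrMr //.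
by apply: le_trans (frob_triangle _ _) _; rewrite frob_trmx; lra.
Qed.

Lemma sympartB d (A B : 'M[R]_d) : sympart (A - B) = sympart A - sympart B.
Proof. by apply/matrixP => i j; rewrite !mxE; ring. Qed.

Lemma sympart_id d (A : 'M[R]_d) : A^T = A -> sympart A = A.
Proof.
move=> As; apply/matrixP => i j; have := congr1 (fun B : 'M[R]_d => B i j) As.
by rewrite !mxE => ->; field.
Qed.

Lemma has_mean_sympart d (X : Xi * Xi -> 'M[R]_d) M : has_mean nu X M ->
  has_mean nu (fun x => sympart (X x)) (sympart M).
Proof.
move=> hX; apply: has_meanZ; apply: has_meanD => //.
by move=> i j; rewrite mxE; under [X in has_ev _ X]eq_fun do rewrite mxE; exact: hX.
Qed.

Lemma w_sample_mean z : has_mean nu (w_sample z) (HW z).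
Proof.
have Hs : (HW z)^T = HW z by apply: hess_model_sym; exact: det_C3 hd.
rewrite -(sympart_id Hs); apply: has_mean_sympart.
exact: has_mean_product (sprefactor_mean beta hs z) (shess_mean hs z).
Qed.

Lemma sum_cubes_le (a b c : R) : 0 <= a -> 0 <= b -> a + b <= c -> a ^+ 3 + b ^+ 3 <= c ^+ 3.
Proof.
move=> a0 b0 ab; have : (a + b) ^+ 3 <= c ^+ 3.
  by rewrite ler_pXn2r ?nnegrE ?addr_ge0 // (le_trans _ ab) // addr_ge0.
have : 0 <= a * b * (a + b) by rewrite !mulr_ge0 ?addr_ge0.
lra.
Qed.

(** Symmetrization does not increase the norm, and the product is split as for
    [q_sample_variance]. *)
Lemma w_sample_third z : Ebound nu (fun x => frobenius (w_sample z x - HW z) ^+ 3)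
  ((4 * sigma2 * c3) ^+ 3).
Proof.
have Hs : (HW z)^T = HW z by apply: hess_model_sym; exact: det_C3 hd.
pose B s := shess s z - hess f z.
have mB : mxmeas B by apply: mxmeasB => //; exact: mxmeas_cst.
have hB : Ebound Z (fun s => frobenius (B s) ^+ 3) (8 * sigma2 ^+ 3).
  exact: centered_third_moment s20 (shess_mean hs z) (shess_cube hs z).
pose C s := beta *: B s *m (P *m hess f z).
have mC : mxmeas C.
  apply: mxmeasM; last exact: mxmeas_cst.
  by apply: mxmeasZ; first exact: measurable_cst.
have bL3 : 0 <= (beta * L) ^+ 3 by rewrite exprn_ge0 // mulr_ge0 // ltW.
have hC : Ebound Z (fun s => frobenius (C s) ^+ 3) ((beta * L) ^+ 3 * (8 * sigma2 ^+ 3)).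
  apply: Eb_mono (EbZ bL3 hB); first by apply: measurable_funX; exact: mxmeas_frob.
  move=> s; rewrite exprn_ge0 ?frob_ge0 //= -exprMn ler_pXn2r ?nnegrE ?frob_ge0 //; last by rewrite !mulr_ge0 ?frob_ge0 // ltW.
  rewrite /C -scalemxAl frobZ ger0_norm // -mulrA ler_wpM2l // mulmxA.
  rewrite -frob_trmx trmx_mul (det_hess_sym hd).
  apply: le_trans (opbound_mulmx _ (ltW L0) (det_opbound_hess hd z)) _.
  by rewrite ler_wpM2l ?(ltW L0) // frob_trmx frob_mulmx_Pmx.
have := third_momentD (mxmeasM (mxmeas_fst (mA z)) (mxmeas_snd mB)) (mxmeas_fst mC)
  (prefactor_third_moment z mB hB) (Eb_fst hC).
move=> h0; apply: Eb_weaken (_ : _ <= _) => [|]; last first.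
- have k : (1 + beta * sigma2) ^+ 3 + (beta * L) ^+ 3 <= c3 ^+ 3.
    apply: sum_cubes_le; rewrite ?addr_ge0 ?mulr_ge0 // ?(ltW L0) //.
    by rewrite /c3; lra.
  have s3 : 0 <= sigma2 ^+ 3 by rewrite exprn_ge0.
  have := ler_wpM2l s3 k; have := mulr_ge0 s3 (exprn_ge0 3 c30).
  rewrite !exprMn; instantiate (1 := 4 * ((1 + beta * sigma2) ^+ 3 * (8 * sigma2 ^+ 3)
     + (beta * L) ^+ 3 * (8 * sigma2 ^+ 3))).
  by rewrite exprMn; lra.
apply: Eb_mono h0.
  apply: measurable_funX; apply: mxmeas_frob; apply: mxmeasB; last exact: mxmeas_cst.
  exact: has_mean_mxmeas (w_sample_mean z).
move=> x; rewrite exprn_ge0 ?frob_ge0 //= ler_pXn2r ?nnegrE ?frob_ge0 //.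
rewrite /w_sample -[in leLHS](sympart_id Hs) -sympartB.
apply: le_trans (frob_sympart _) _; rewrite le_eqVlt; apply/orP; left; apply/eqP; congr frobenius.
exact: prefactor_mul_split.
Qed.

Lemma w_sample_diff_third z z' :
  Ebound nu (fun x => frobenius (w_sample z x - w_sample z' x - (HW z - HW z')) ^+ 3)
  ((4 * c3 * rho * frobenius (z - z')) ^+ 3).
Proof.
set xx := frobenius (z - z'); have xx0 : 0 <= xx := frob_ge0 _.
have rx0 : 0 <= rho * xx by rewrite mulr_ge0 // ltW.
have crx0 : 0 <= 2 * c3 * rho * xx by rewrite -mulrA mulr_ge0 // mulr_ge0.
have -> : (4 * c3 * rho * xx) ^+ 3 = 8 * (2 * c3 * rho * xx) ^+ 3 by ring.
apply: centered_third_moment => //.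
  by apply: has_meanB; exact: w_sample_mean.
pose E s := shess s z - shess s z'.
have mE : mxmeas E by exact: mxmeasB.
have hE := shess_diff_cube hs z z'.
pose G s := P *m shess s z'.
have mG : mxmeas G by apply: mxmeasM => //; exact: mxmeas_cst.
have hG : Ebound Z (fun s => frobenius (G s) ^+ 3) (sigma2 ^+ 3).
  apply: Eb_mono (shess_cube hs z'); first by apply: measurable_funX; exact: mxmeas_frob.
  move=> s; rewrite exprn_ge0 ?frob_ge0 //= ler_pXn2r ?nnegrE ?frob_ge0 //.
  by have := opbound_mulmx (shess s z') ler01 (@opbound_Pmx R n m); rewrite mul1r.
have b3 : 0 <= beta ^+ 3 by rewrite exprn_ge0.
have mEG : mxmeas (fun x => beta *: E x.1 *m G x.2).
  apply: mxmeasM; last exact: mxmeas_snd.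
  by apply: mxmeasZ; [exact: measurable_cst|exact: mxmeas_fst].
have hEG : Ebound nu (fun x => frobenius (beta *: E x.1 *m G x.2) ^+ 3)
    (beta ^+ 3 * ((rho * xx) ^+ 3 * sigma2 ^+ 3)).
  apply: Eb_mono (EbZ b3 (Eb_product hE hG)); first by apply: measurable_funX; exact: mxmeas_frob.
  move=> x; rewrite exprn_ge0 ?frob_ge0 //= -!exprMn mulrA ler_pXn2r ?nnegrE ?frob_ge0 //; last by rewrite !mulr_ge0 ?frob_ge0.
  exact: frob_scaled_mulmx.
have h0 := third_momentD (mxmeasM (mxmeas_fst (mA z)) (mxmeas_snd mE)) mEG
   (prefactor_third_moment z mE hE) hEG.
have bL := mulr_ge0 beta_ge0 (ltW L0).
have bs := mulr_ge0 beta_ge0 s20.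
have k1 : (1 + beta * sigma2) ^+ 3 <= c3 ^+ 3.
  by rewrite ler_pXn2r ?nnegrE // /c3; [lra|exact: addr_ge0].
have k2 : beta ^+ 3 * sigma2 ^+ 3 <= c3 ^+ 3.
  by rewrite -exprMn ler_pXn2r ?nnegrE // /c3; lra.
have k3 : 0 <= (rho * xx) ^+ 3 by rewrite exprn_ge0.
have j1 := ler_wpM2l k3 k1; have j2 := ler_wpM2l k3 k2.
have h1 : Ebound nu (fun x => frobenius (A_ z x.1 *m E x.2 + beta *: E x.1 *m G x.2) ^+ 3)
    ((2 * c3 * rho * xx) ^+ 3).
  apply: Eb_weaken h0 _; move: j1 j2.
  have -> : (2 * c3 * rho * xx) ^+ 3 = 8 * ((rho * xx) ^+ 3 * c3 ^+ 3) by ring.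
  move: ((rho * xx) ^+ 3) => t; lra.
apply: Eb_mono h1.
  apply: measurable_funX; apply: mxmeas_frob.
  by apply: mxmeasB; exact: has_mean_mxmeas (w_sample_mean _).
move=> x; rewrite exprn_ge0 ?frob_ge0 //= ler_pXn2r ?nnegrE ?frob_ge0 //.
rewrite /w_sample -sympartB.
apply: le_trans (frob_sympart _) _; rewrite le_eqVlt; apply/orP; left; apply/eqP; congr frobenius.
exact: prefactor_mul_split.
Qed.

Lemma y_sample_mean z : has_mean nu (y_sample z) (grad_y f z).
Proof.
apply: (has_mean_fst (X := fun s => grad_y (fun w => F w s) z)) => i j.
rewrite mxE; under [X in has_ev _ X]eq_fun do rewrite mxE.
exact: (sgrad_mean hs).
Qed.

Lemma y_sample_third z : Ebound nu (fun x => frobenius (y_sample z x - grad_y f z) ^+ 3)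
  (sigma1 ^+ 3).
Proof.
apply: Eb_mono (Eb_fst (sgrad_cube hs z)).
  apply: measurable_funX; apply: mxmeas_frob; apply: mxmeasB; last exact: mxmeas_cst.
  exact: has_mean_mxmeas (y_sample_mean z).
move=> x; rewrite exprn_ge0 ?frob_ge0 //= ler_pXn2r ?nnegrE ?frob_ge0 //.
rewrite /y_sample /grad_y -linearB /= frob_dsubmx; exact: frob_Pmx.
Qed.

End estimator_moments.

(** * Recursive estimators *)

Lemma sigma_algebra_past {R : realType} d (T : measurableType d) (G : set (set T)) :
  sigma_algebra setT G -> G `<=` measurable -> past G.
Proof.
move=> sG Gm; have GE := measurable_g_measurableTypeE sG.
split => // [A B GA GB|].
  by rewrite -GE in GA GB *; exact: measurableI.
by rewrite -GE; exact: measurableT.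
Qed.

Lemma measurable_id_sub d (T : measurableType d) (G G' : set (set T)) : G `<=` G' ->
  measurable_fun [set: g_sigma_algebraType G']
    (id : g_sigma_algebraType G' -> g_sigma_algebraType G).
Proof.
move=> GG' _ A mA; rewrite setTI preimage_id.
exact: (sub_smallest2r (@smallest_sigma_algebra _ setT G') GG').
Qed.

Section integer_valued.
Context {R : realType} {d : measure_display} {T : measurableType d}.

Lemma measurable_fiber_comp (I : countType) (g : T -> I) (J : Type) (psi : I -> J) j :
  (forall i, measurable [set w | g w = i]) -> measurable [set w | psi (g w) = j].
Proof.
move=> mg.
have -> : [set w | psi (g w) = j] =
    \bigcup_i (if `[< psi i = j >] then [set w | g w = i] else set0).
  apply/seteqP; split => w /=; first by move=> e; exists (g w) => //; rewrite (asboolT e).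
  by move=> [i _]; case: asboolP => // pij /= gwi; rewrite gwi.
apply: countable_bigcupT_measurable => [|i]; first exact: countableP.
by case: asboolP => // _; exact: mg.
Qed.

Lemma measurable_truncn_fiber (h : T -> R) k : measurable_fun [set: T] h ->
  measurable [set w | (Num.truncn (h w)).+1 = k].
Proof.
move=> mh.
have := @measurable_fiber_comp _ (fun w => Num.floor (h w)) _
  (fun i => (if i is Posz j then j else 0%N).+1) k (fun i => measurable_floor_fiber i mh).
congr measurable; apply/seteqP; split => w /=; by rewrite truncEfloor.
Qed.

End integer_valued.

Lemma least_pos_ge_gt0 {R : realType} (x : R) : (0 < least_pos_ge x)%N.
Proof. by rewrite /least_pos_ge leq_max. Qed.

Lemma le_least_pos_ge {R : realType} (x : R) : 0 <= x -> x <= (least_pos_ge x)%:R.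
Proof.
move=> x0; apply: (@le_trans _ _ (`|Num.ceil x|%N)%:R); last first.
  by rewrite ler_nat leq_maxr.
rewrite natr_absz ger0_norm ?ceil_ge // ceil_ge0; lra.
Qed.

Lemma least_pos_ge_le {R : realType} (x : R) : 0 <= x -> (least_pos_ge x)%:R <= x + 1.
Proof.
move=> x0; rewrite /least_pos_ge natr_max ge_max; apply/andP; split; first lra.
rewrite natr_absz ger0_norm.
  by rewrite ltW // -ltrBlDr; have := ceilB1_lt x; rewrite intrD rmorphN.
rewrite ceil_ge0; lra.
Qed.

Section recursive_estimator.
Context {R : realType} {dO dX : measure_display} {Om : measurableType dO}
  {Xi : measurableType dX} (P : probability Om R) (Z : probability Xi R)
  (G : nat -> set (set Om)) (T : nat).
Local Notation TG k := (g_sigma_algebraType (G k)).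
Context (pG : forall k, past (G k)) (Gnd : forall k, G k `<=` G k.+1).
Context (X1 X2 : nat -> nat -> Om -> Xi)
  (mX1 : forall k i, (k < T)%N -> measurable_fun [set: TG k.+1] (X1 k i : TG k.+1 -> Xi))
  (mX2 : forall k i, (k < T)%N -> measurable_fun [set: TG k.+1] (X2 k i : TG k.+1 -> Xi))
  (fr : forall k, (k < T)%N -> fresh_pairs P Z (G k) (X1 k) (X2 k)).
Context {b p q : nat} (z : nat -> Om -> 'cV[R]_b)
  (mz : forall k, (k <= T)%N -> mxmeas (z k : TG k -> 'cV[R]_b)).
Context (smp : 'cV[R]_b -> Xi * Xi -> 'M[R]_(p, q)) (tgt : 'cV[R]_b -> 'M[R]_(p, q))
  (msmp : forall d (T' : measurableType d) (y : T' -> 'cV[R]_b) (s : T' -> Xi * Xi),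
     mxmeas y -> measurable_fun setT s -> mxmeas (fun w => smp (y w) (s w)))
  (mtgt : forall d (T' : measurableType d) (y : T' -> 'cV[R]_b),
     mxmeas y -> mxmeas (fun w => tgt (y w)))
  (hsmp : forall y, has_mean (Z \x Z)%E (smp y) (tgt y)).
Context (N : nat -> Om -> nat)
  (mN : forall k j, (k < T)%N -> measurable ([set w | N k w = j] : set (TG k)))
  (N0 : forall k w, (0 < N k w)%N).

Definition sample_average k w y : 'M[R]_(p, q) :=
  (N k w)%:R^-1 *: \sum_(i < N k w) smp y (X1 k i w, X2 k i w).

Context (S : nat) (A : nat -> Om -> 'M[R]_(p, q))
  (AE : forall k w, (k < T)%N -> A k w =
     if (S %| k)%N then sample_average k w (z k w)
     else sample_average k w (z k w) - sample_average k w (z k.-1 w) + A k.-1 w).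

Definition est_error k w := A k w - tgt (z k w).

Definition carried_error k w := if (S %| k)%N then 0 else est_error k.-1 w.

(** What one pair of samples adds to the error of the estimator. *)
Definition innovation k (x : TG k * (Xi * Xi)) :=
  if (S %| k)%N then smp (z k x.1) x.2 - tgt (z k x.1)
  else smp (z k x.1) x.2 - smp (z k.-1 x.1) x.2 - (tgt (z k x.1) - tgt (z k.-1 x.1)).

Lemma mean_subr k (M : 'M[R]_(p, q)) (g : nat -> 'M[R]_(p, q)) : (0 < k)%N ->
  k%:R^-1 *: \sum_(i < k) (g i - M) = k%:R^-1 *: \sum_(i < k) g i - M.
Proof.
move=> k0; rewrite big_split /= scalerDr sumr_const card_ord -[- M *+ k]scaler_nat scalerA.
by rewrite mulVf ?scale1r // pnatr_eq0 -lt0n.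
Qed.

(** The error is a sum of conditionally centered terms since the last
    checkpoint, because the differences are corrected by their own mean. *)
Lemma est_error_rec k w : (k < T)%N ->
  est_error k w = carried_error k w + batch_average (X1 k) (X2 k) (N k) (@innovation k) w.
Proof.
move=> kT; rewrite /est_error AE // /carried_error /batch_average /innovation /=.
case: ifP => _.
  by rewrite add0r (mean_subr _ (fun i => smp (z k w) (X1 k i w, X2 k i w))).
rewrite (mean_subr _ (fun i => smp (z k w) (X1 k i w, X2 k i w) -
  smp (z k.-1 w) (X1 k i w, X2 k i w))) // /est_error /sample_average.
rewrite big_split /= sumrN scalerBr.
move: (_ *: _) (_ *: _) (A _ _) (tgt _) (tgt _) => a1 a2 a3 a4 a5.
by apply/matrixP => i j; rewrite !mxE; ring.
Qed.

Lemma measurable_later j k d' (Y : measurableType d') (g : Om -> Y) : (j <= k)%N ->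
  measurable_fun [set: TG j] (g : TG j -> Y) -> measurable_fun [set: TG k] (g : TG k -> Y).
Proof.
move=> /subnKC <-; elim: (k - j)%N => [|i IH] mg; first by rewrite addn0.
rewrite addnS; exact: measurableT_comp (IH mg) (measurable_id_sub (@Gnd _)).
Qed.

Lemma mxmeas_later j k p' q' (M : Om -> 'M[R]_(p', q')) : (j <= k)%N ->
  mxmeas (M : TG j -> 'M[R]_(p', q')) -> mxmeas (M : TG k -> 'M[R]_(p', q')).
Proof. by move=> jk mM i i'; apply: measurable_later jk _; exact: mM. Qed.

Lemma mxmeas_innovation k : (k < T)%N -> mxmeas (@innovation k).
Proof.
move=> kT.
have my j : (j <= k)%N -> mxmeas (fun x : TG k * (Xi * Xi) => z j x.1).
  move=> jk; apply: (mxmeas_comp (A := z j : TG k -> _)) => //.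
  by apply: mxmeas_later (jk) _; apply: mz; exact: leq_trans jk (ltnW kT).
have pk : (k.-1 <= k)%N by exact: leq_pred.
rewrite /innovation; case: (boolP (S %| k)%N) => _.
  by apply: mxmeasB; [apply: msmp => //; exact: my|apply: mtgt; exact: my].
apply: mxmeasB; apply: mxmeasB; (apply: msmp || apply: mtgt) => //; exact: my.
Qed.

Lemma mxmeas_est_error k : (k < T)%N -> mxmeas (est_error k : TG k.+1 -> 'M[R]_(p, q)).
Proof.
elim/ltn_ind: k => k IH kT.
have -> : est_error k = fun w => carried_error k w + batch_average (X1 k) (X2 k) (N k) (@innovation k) w.
  by apply/funext => w; exact: est_error_rec.
apply: mxmeasD; last first.
  apply: (mxmeas_random_average (T' := TG k.+1) (j := id : TG k.+1 -> TG k)) => [j| | | |].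
  - have := measurable_id_sub (@Gnd k) measurableT (mN j kT); rewrite setTI; exact.
  - exact: measurable_id_sub.
  - by move=> i; exact: mX1.
  - by move=> i; exact: mX2.
  - exact: mxmeas_innovation.
rewrite /carried_error; case: (boolP (S %| k)%N) => [_|]; first exact: mxmeas_cst.
case: k IH kT => [|k] IH kT; first by rewrite dvdn0.
by move=> _ /=; apply: (@mxmeas_later k.+1) => //; apply: IH => //; exact: ltnW.
Qed.

Lemma mxmeas_carried_error k : (k < T)%N -> mxmeas (carried_error k : TG k -> 'M[R]_(p, q)).
Proof.
rewrite /carried_error; case: (boolP (S %| k)%N) => [_ _|]; first exact: mxmeas_cst.
case: k => [|k]; first by rewrite dvdn0.
by move=> _ kT /=; apply: mxmeas_est_error; exact: ltnW.
Qed.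

Lemma innovation_mean k w : has_mean (Z \x Z)%E (fun s => innovation (k := k) (w, s)) 0.
Proof.
rewrite /innovation /=; case: (boolP (S %| k)%N) => _.
  by rewrite -(subrr (tgt (z k w))); apply: has_meanB => //; exact: has_mean_cst.
rewrite -(subrr (tgt (z k w) - tgt (z k.-1 w))); apply: has_meanB; last exact: has_mean_cst.
exact: has_meanB.
Qed.

Lemma measurable_sample1 k i : (k < T)%N -> measurable_fun [set: Om] (X1 k i).
Proof. by move=> kT; apply: (measurable_of_past (pG k.+1)); exact: mX1. Qed.

Lemma measurable_sample2 k i : (k < T)%N -> measurable_fun [set: Om] (X2 k i).
Proof. by move=> kT; apply: (measurable_of_past (pG k.+1)); exact: mX2. Qed.

Lemma estimator_second_moment k (V : TG k -> R) r : (k < T)%N ->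
  measurable_fun setT V -> (forall w, 0 <= V w) ->
  (forall w, Ebound (Z \x Z)%E (fun s => frobenius (innovation (k := k) (w, s)) ^+ 2)
     (V w * (N k w)%:R)) ->
  Ebound P (fun w => frobenius (carried_error k w) ^+ 2 + V w) r ->
  Ebound P (fun w => frobenius (est_error k w) ^+ 2) r.
Proof.
move=> kT mV V0 hV hr; under [X in Ebound _ X]eq_fun do rewrite est_error_rec //.
apply: (batch_second_moment (pG k) _ _ (fr kT) _ _ _ _ _ mV V0 hV hr).
- by move=> i; exact: measurable_sample1.
- by move=> i; exact: measurable_sample2.
- by move=> j; exact: mN.
- exact: N0.
- exact: mxmeas_carried_error.
- exact: mxmeas_innovation.
- by move=> w; exact: innovation_mean.
Qed.

Lemma estimator_third_moment k (v : TG k -> R) (y t r : R) : (k < T)%N ->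
  (forall w, 0 <= v w) -> 0 < t -> 0 <= y -> y <= t ^+ 2 ->
  (forall w, v w ^+ 2 <= y * (N k w)%:R) ->
  (forall w, Ebound (Z \x Z)%E (fun s => frobenius (innovation (k := k) (w, s)) ^+ 3)
     (v w ^+ 3)) ->
  Ebound P (fun w => frobenius (carried_error k w) ^+ 3 + 3 * t ^+ 3) r ->
  Ebound P (fun w => frobenius (est_error k w) ^+ 3 + 3 * t ^+ 3) (expR (y / t ^+ 2) * r).
Proof.
move=> kT v0 t0 y0 yt vy hv hr; under [X in Ebound _ X]eq_fun do rewrite est_error_rec //.
apply: (batch_third_moment (pG k) _ _ (fr kT) _ _ _ _ _ v0 t0 y0 yt vy hv hr).
- by move=> i; exact: measurable_sample1.
- by move=> i; exact: measurable_sample2.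
- by move=> j; exact: mN.
- exact: N0.
- exact: mxmeas_carried_error.
- exact: mxmeas_innovation.
- by move=> w; exact: innovation_mean.
Qed.

End recursive_estimator.

(** * Iterates and estimates of a run *)

Lemma sympart_average (R : realType) d N (A : 'I_N -> 'M[R]_d) :
  sympart (N%:R^-1 *: \sum_(i < N) A i) = N%:R^-1 *: \sum_(i < N) sympart (A i).
Proof.
rewrite /sympart !scaler_sumr [(\sum_(i < N) _)^T]raddf_sum -big_split scaler_sumr /=.
by apply: eq_bigr => i _; apply/matrixP => a b; rewrite !mxE; ring.
Qed.

Lemma modn_notdvd S k : ~~ (S %| k)%N -> (k %% S = (k.-1 %% S).+1)%N.
Proof. by case: k => [|k]; rewrite ?dvdn0 //= modnS => /negbTE ->. Qed.

Section run_adaptedness.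
Context {R : realType} {n m : nat} {dX : measure_display} {Xi : measurableType dX}
  (Z : probability Xi R) (F : 'cV[R]_(n + m) -> Xi -> R) (f : 'cV[R]_(n + m) -> R)
  {dO : measure_display} {Om : measurableType dO} (P : probability Om R)
  (p : sacqrn_params R) (z0 : 'cV[R]_(n + m)) (r : sacqrn_run Z F P p z0) (mu L : R).
Context (hd : deterministic_assumptions f mu L (p_rho p))
  (hs : stochastic_assumptions Z F f L (p_rho p) (p_sigma1 p) (p_sigma2 p))
  (beta_ge0 : 0 <= p_beta p).
Local Notation T := (iter_count p).
Local Notation G := (r_filt r).
Local Notation TG k := (g_sigma_algebraType (G k)).
Local Notation h := (h_beta f (p_beta p)).
Local Notation HW := (hess_model f (p_beta p)).
Let Cf := det_C3 hd.

Lemma run_past k : past (G k).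
Proof. exact: sigma_algebra_past (r_filt_sigma r k) (@r_filt_measurable _ _ _ _ _ _ _ _ _ _ _ _ r k). Qed.

Lemma run_filt_step k : G k `<=` G k.+1.
Proof. exact: r_filt_nondecreasing. Qed.

Lemma measurable_run_sample k b i : (k < T)%N ->
  measurable_fun [set: TG k.+1] (r_sample r k b i : TG k.+1 -> Xi).
Proof.
by move=> kT _ B mB; rewrite setTI; apply: sub_sigma_algebra; exact: r_sample_adapted.
Qed.

Lemma prod_probability_setT N : (\prod_(i < N) Z [set: Xi] = 1)%E.
Proof. by apply: big1 => i _; exact: probability_setT. Qed.

Lemma run_fresh_g k : (k < T)%N -> fresh_pairs P Z (G k) (r_sample r k Bg1) (r_sample r k Bg2).
Proof.
move=> kT N A B1 B2 GA mB1 mB2.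
pose B b := match b with Bg1 => B1 | Bg2 => B2 | _ => fun=> [set: Xi] end.
have mB b i : measurable (B b i) by case: b => //=; exact: measurableT.
have := r_sample_fresh N kT GA mB; rewrite !big_cons big_nil /=.
rewrite prod_probability_setT !(mule1, mul1e).
by rewrite -big_split /= => <-; congr (P (A `&` _)); apply/seteqP; split => w /= H;
  [case=> i iN //=; case: (H i iN)|move=> i iN; split; [exact: (H Bg1)|exact: (H Bg2)]].
Qed.

Lemma run_fresh_h k : (k < T)%N -> fresh_pairs P Z (G k) (r_sample r k Bh1) (r_sample r k Bh2).
Proof.
move=> kT N A B1 B2 GA mB1 mB2.
pose B b := match b with Bh1 => B1 | Bh2 => B2 | _ => fun=> [set: Xi] end.
have mB b i : measurable (B b i) by case: b => //=; exact: measurableT.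
have := r_sample_fresh N kT GA mB; rewrite !big_cons big_nil /=.
rewrite prod_probability_setT !(mule1, mul1e).
by rewrite -big_split /= => <-; congr (P (A `&` _)); apply/seteqP; split => w /= H;
  [case=> i iN //=; case: (H i iN)|move=> i iN; split; [exact: (H Bh1)|exact: (H Bh2)]].
Qed.

(** The estimate of the partial gradient uses one sequence of samples; [Bg1]
    merely fills the second place of the pairs. *)
Lemma run_fresh_y k : (k < T)%N -> fresh_pairs P Z (G k) (r_sample r k By) (r_sample r k Bg1).
Proof.
move=> kT N A B1 B2 GA mB1 mB2.
pose B b := match b with By => B1 | Bg1 => B2 | _ => fun=> [set: Xi] end.
have mB b i : measurable (B b i) by case: b => //=; exact: measurableT.
have := r_sample_fresh N kT GA mB; rewrite !big_cons big_nil /=.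
rewrite prod_probability_setT !(mule1, mul1e).
rewrite -big_split /= [X in (_ * X)%E](eq_bigr (fun i : 'I_N => Z (B1 i) * Z (B2 i))%E); last by move=> i _; rewrite muleC.
by move=> <-; congr (P (A `&` _)); apply/seteqP; split => w /= H;
  [case=> i iN //=; case: (H i iN)|move=> i iN; split; [exact: (H By)|exact: (H Bg1)]].
Qed.

Lemma mxmeas_run_xi k : (k < T)%N -> mxmeas (r_xi r k : TG k.+1 -> 'cV[R]_(n + m)).
Proof.
move=> kT i j _ B mB; rewrite setTI (ord1 j); apply: sub_sigma_algebra.
exact: r_xi_adapted.
Qed.

Lemma mxmeas_run_z k : (k <= T)%N -> mxmeas (r_z r k : TG k -> 'cV[R]_(n + m)).
Proof.
elim: k => [_|k IH kT].
  by have -> : r_z r 0 = fun=> z0; [apply/funext; exact: r_z0|exact: mxmeas_cst].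
have -> : r_z r k.+1 = fun w => r_z r k w + r_xi r k w by apply/funext => w; exact: r_zS.
apply: mxmeasD; last exact: mxmeas_run_xi.
by apply: (mxmeas_later run_filt_step (leqnSn k)); apply: IH; exact: ltnW.
Qed.

Lemma measurable_prev_step k : (k < T)%N -> (0 < k)%N ->
  measurable_fun [set: TG k] (fun w : TG k => enorm (r_xi r k.-1 w)).
Proof. by case: k => // k kT _; apply: mxmeas_enorm; apply: mxmeas_run_xi; exact: ltnW. Qed.

Lemma measurable_cycle_size k S a (b e : R) j : (k < T)%N ->
  measurable ([set w | (if (S %| k)%N then a
     else (Num.truncn (b * enorm (r_xi r k.-1 w) ^+ 2 / e)).+1) = j] : set (TG k)).
Proof.
move=> kT; case: (boolP (S %| k)%N) => [_|Sk].
  have [->|aj] := eqVneq a j.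
    have -> : [set w : TG k | j = j] = setT by apply/seteqP.
    exact: measurableT.
  have -> : [set w : TG k | a = j] = set0 by apply/seteqP; split => // w /= /eqP; rewrite (negbTE aj).
  exact: measurable0.
apply: measurable_truncn_fiber; apply: measurable_funM => //; apply: measurable_funM => //.
apply: measurable_funX; apply: measurable_prev_step => //.
by case: (k) Sk => //; rewrite dvdn0.
Qed.

Lemma measurable_size_g k j : (k < T)%N ->
  measurable ([set w | size_g p k (r_xi r k.-1 w) = j] : set (TG k)).
Proof. by rewrite /size_g; exact: measurable_cycle_size. Qed.

Lemma measurable_size_h k j : (k < T)%N ->
  measurable ([set w | size_h p k (r_xi r k.-1 w) = j] : set (TG k)).
Proof. by rewrite /size_h; exact: measurable_cycle_size. Qed.

Lemma measurable_size_y k j : (k < T)%N ->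
  measurable ([set w | size_y p = j] : set (TG k)).
Proof. by move=> kT; have := measurable_cycle_size 1 (size_y p) 0 0 j kT; rewrite dvd1n. Qed.

Lemma size_g_gt0 k (v : 'cV[R]_(n + m)) : (0 < size_g p k v)%N.
Proof. by rewrite /size_g; case: ifP => // _; exact: least_pos_ge_gt0. Qed.

Lemma size_h_gt0 k (v : 'cV[R]_(n + m)) : (0 < size_h p k v)%N.
Proof. by rewrite /size_h; case: ifP => // _; exact: least_pos_ge_gt0. Qed.

Lemma mxmeas_grad_comp (g : 'cV[R]_(n + m) -> R) d' (T' : measurableType d')
  (y : T' -> 'cV[R]_(n + m)) : class_C 2 g -> mxmeas y -> mxmeas (fun w => grad g (y w)).
Proof.
move=> Cg my i j; under eq_fun do rewrite mxE.
exact: (measurable_continuous_comp (class_C_continuous (class_C_derive (delta_mx i 0) Cg)) my).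
Qed.

Lemma mxmeas_hess_comp (g : 'cV[R]_(n + m) -> R) d' (T' : measurableType d')
  (y : T' -> 'cV[R]_(n + m)) : class_C 2 g -> mxmeas y -> mxmeas (fun w => hess g (y w)).
Proof.
move=> Cg my i j; under eq_fun do rewrite mxE.
exact: (measurable_continuous_comp (class_C_continuous (class_C_derive (delta_mx i 0)
  (class_C_derive (delta_mx j 0) Cg))) my).
Qed.

Lemma mxmeas_hess_model d' (T' : measurableType d') (y : T' -> 'cV[R]_(n + m)) :
  mxmeas y -> mxmeas (fun w => HW (y w)).
Proof.
move=> my; have mH := mxmeas_hess_comp (class_CW Cf) my.
apply: mxmeasM => //; apply: mxmeasD; first exact: mxmeas_cst.
apply: mxmeasZ; first exact: measurable_cst.
by apply: mxmeasM => //; exact: mxmeas_cst.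
Qed.

Lemma mxmeas_sprefactor_comp d' (T' : measurableType d') (y : T' -> 'cV[R]_(n + m)) (s : T' -> Xi) :
  mxmeas y -> measurable_fun setT s -> mxmeas (fun w => sprefactor F (p_beta p) (y w) (s w)).
Proof.
move=> my ms; apply: mxmeasD; first exact: mxmeas_cst.
apply: mxmeasZ; first exact: measurable_cst.
apply: mxmeasM; last exact: mxmeas_cst.
exact: (mxmeas_sample_hess (sto_measurable hs) (sto_differentiable hs) ms my).
Qed.

Lemma mxmeas_q_sample d' (T' : measurableType d') (y : T' -> 'cV[R]_(n + m)) (s : T' -> Xi * Xi) :
  mxmeas y -> measurable_fun setT s -> mxmeas (fun w => q_sample F (p_beta p) (y w) (s w)).
Proof.
move=> my ms; apply: mxmeasM.
  by apply: mxmeas_sprefactor_comp => //; exact: measurableT_comp measurable_fst ms.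
apply: (mxmeas_sample_grad (sto_measurable hs) (sto_differentiable hs) _ my).
exact: measurableT_comp measurable_snd ms.
Qed.

Lemma mxmeas_w_sample d' (T' : measurableType d') (y : T' -> 'cV[R]_(n + m)) (s : T' -> Xi * Xi) :
  mxmeas y -> measurable_fun setT s -> mxmeas (fun w => w_sample F (p_beta p) (y w) (s w)).
Proof.
move=> my ms; have mA : mxmeas (fun w => sprefactor F (p_beta p) (y w) (s w).1 *m hess (fun v => F v (s w).2) (y w)).
  apply: mxmeasM.
    by apply: mxmeas_sprefactor_comp => //; exact: measurableT_comp measurable_fst ms.
  apply: (mxmeas_sample_hess (sto_measurable hs) (sto_differentiable hs) _ my).
  exact: measurableT_comp measurable_snd ms.
apply: mxmeasZ; first exact: measurable_cst.
by apply: mxmeasD => //; exact: mxmeas_tr.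
Qed.

Lemma mxmeas_y_sample d' (T' : measurableType d') (y : T' -> 'cV[R]_(n + m)) (s : T' -> Xi * Xi) :
  mxmeas y -> measurable_fun setT s -> mxmeas (fun w => y_sample F (y w) (s w)).
Proof.
move=> my ms; apply: mxmeas_dsubmx.
apply: (mxmeas_sample_grad (sto_measurable hs) (sto_differentiable hs) _ my).
exact: measurableT_comp measurable_fst ms.
Qed.

Local Notation Ng := (fun k w => size_g p k (r_xi r k.-1 w)).
Local Notation Nh := (fun k w => size_h p k (r_xi r k.-1 w)).
Local Notation Ny := (fun (_ : nat) (_ : Om) => size_y p).
Local Notation X b := (fun k i => r_sample r k b i).

Lemma run_gE k w : (k < T)%N -> r_g r k w =
  let q y := sample_average (X Bg1) (X Bg2) (q_sample F (p_beta p)) Ng k w y in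
  if (p_Sg p %| k)%N then q (r_z r k w) else q (r_z r k w) - q (r_z r k.-1 w) + r_g r k.-1 w.
Proof. by move=> kT; rewrite r_gE. Qed.

Lemma W_est_average N s1 s2 y : W_est F (p_beta p) N s1 s2 y =
  N%:R^-1 *: \sum_(i < N) w_sample F (p_beta p) y (s1 i, s2 i).
Proof. exact: sympart_average. Qed.

Lemma run_HE k w : (k < T)%N -> r_H r k w =
  let W y := sample_average (X Bh1) (X Bh2) (w_sample F (p_beta p)) Nh k w y in
  if (p_Sh p %| k)%N then W (r_z r k w) else W (r_z r k w) - W (r_z r k.-1 w) + r_H r k.-1 w.
Proof. by move=> kT; rewrite r_HE //= !W_est_average. Qed.

(** A cycle of length 1 turns every iteration into a checkpoint. *)
Lemma run_gyE k w : (k < T)%N -> r_gy r k w =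
  let y v := sample_average (X By) (X Bg1) (y_sample F) Ny k w v in
  if (1 %| k)%N then y (r_z r k w) else y (r_z r k w) - y (r_z r k.-1 w) + r_gy r k.-1 w.
Proof. by move=> kT; rewrite r_gyE // dvd1n. Qed.

Lemma sympart_tr d (A : 'M[R]_d) : (sympart A)^T = sympart A.
Proof. by rewrite /sympart; apply/matrixP => i j; rewrite !mxE addrC. Qed.

Lemma trmx_carry d (A B C : 'M[R]_d) : A^T = A -> B^T = B -> C^T = C -> (A - B + C)^T = A - B + C.
Proof. by move=> eA eB eC; rewrite linearD linearB /= eA eB eC. Qed.

Lemma run_H_sym k w : (k < T)%N -> (r_H r k w)^T = r_H r k w.
Proof.
elim: k => [|k IH] kT; rewrite r_HE // ?dvdn0 ?sympart_tr //.
case: ifP => _; first exact: sympart_tr.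
apply: trmx_carry; [exact: sympart_tr|exact: sympart_tr|exact: IH (ltnW kT)].
Qed.

Definition g_error k w := r_g r k w - grad h (r_z r k w).
Definition H_error k w := r_H r k w - HW (r_z r k w).
Definition y_error k w := r_gy r k w - grad_y f (r_z r k w).

End run_adaptedness.

(** * Errors of the estimates *)

(** An average of [N] centered terms of second moment [2 * q] has a second
    moment of at most [e ^ 2 / (32 * c) * q]. *)
Lemma checkpoint_scale {R : realType} (e c N q : R) : 0 < e -> 0 < c -> 0 <= q ->
  64 * c / e ^+ 2 <= N -> 2 * q <= e ^+ 2 / (32 * c) * q * N.
Proof.
move=> e0 c0 q0; rewrite ler_pdivrMr ?exprn_gt0 // => hN.
have -> : e ^+ 2 / (32 * c) * q * N = q * (N * e ^+ 2) / (32 * c) by field; exact: lt0r_neq0.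
rewrite ler_pdivlMr ?mulr_gt0 //.
have -> : 2 * q * (32 * c) = q * (64 * c) by ring.
exact: ler_wpM2l.
Qed.

Lemma recursion_scale {R : realType} (e c S x N q : R) : 0 < e -> 0 < c -> 0 < S -> 0 <= q ->
  64 * c * S * x ^+ 2 / e ^+ 2 <= N -> 2 * q * x ^+ 2 <= e ^+ 2 / (32 * c * S) * q * N.
Proof.
move=> e0 c0 S0 q0; rewrite ler_pdivrMr ?exprn_gt0 // => hN.
have -> : e ^+ 2 / (32 * c * S) * q * N = q * (N * e ^+ 2) / (32 * c * S).
  by field; rewrite !lt0r_neq0.
rewrite ler_pdivlMr ?mulr_gt0 //.
have -> : 2 * q * x ^+ 2 * (32 * c * S) = q * (64 * c * S * x ^+ 2) by ring.
exact: ler_wpM2l.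
Qed.

Lemma cube_checkpoint_scale {R : realType} (e s N : R) : 0 < e ->
  648 * s ^+ 2 / e <= N -> (4 * s) ^+ 2 <= e / 40 * N.
Proof.
move=> e0; rewrite ler_pdivrMr // => hN.
have -> : (4 * s) ^+ 2 = 16 * s ^+ 2 by ring.
have : 0 <= s ^+ 2 by exact: sqr_ge0.
have -> : e / 40 * N = (N * e) / 40 by ring.
rewrite ler_pdivlMr //; lra.
Qed.

Lemma cube_recursion_scale {R : realType} (e s S N : R) : 0 < e -> 0 < S ->
  648 * s ^+ 2 * S / e <= N -> (4 * s) ^+ 2 <= e / (40 * S) * N.
Proof.
move=> e0 S0; rewrite ler_pdivrMr // => hN.
have -> : (4 * s) ^+ 2 = 16 * s ^+ 2 by ring.
have h : 0 <= s ^+ 2 * S by rewrite mulr_ge0 ?sqr_ge0 // ltW.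
have -> : e / (40 * S) * N = (N * e) / (40 * S) by field; exact: lt0r_neq0.
rewrite ler_pdivlMr ?mulr_gt0 //.
apply: le_trans hN; have -> : 16 * s ^+ 2 * (40 * S) = 640 * (s ^+ 2 * S) by ring.
rewrite -mulrA; lra.
Qed.

Lemma weighted_sqr_ratio_ge0 {R : realType} (k : nat) (a b e : R) : 0 < e ->
  0 <= k%:R * a ^+ 2 * b ^+ 2 / e.
Proof.
move=> e0; apply: divr_ge0; last exact: ltW.
apply: mulr_ge0 (sqr_ge0 _); exact: mulr_ge0 (ler0n _ _) (sqr_ge0 _).
Qed.

Lemma mod_ratio_le1 {R : realType} S k : (0 < S)%N -> (k %% S)%:R / S%:R <= 1 :> R.
Proof. by move=> S0; rewrite ler_pdivrMr ?ltr0n // mul1r ler_nat ltnW // ltn_mod. Qed.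

Lemma lt_truncnS {R : realType} (x : R) : x <= (Num.truncn x).+1%:R.
Proof. exact/ltW/truncnS_gt. Qed.

Section run_errors.
Context {R : realType} {n m : nat} {dX : measure_display} {Xi : measurableType dX}
  (Z : probability Xi R) (F : 'cV[R]_(n + m) -> Xi -> R) (f : 'cV[R]_(n + m) -> R)
  {dO : measure_display} {Om : measurableType dO} (P : probability Om R)
  (p : sacqrn_params R) (z0 : 'cV[R]_(n + m)) (r : sacqrn_run Z F P p z0) (mu L : R).
Context (hd : deterministic_assumptions f mu L (p_rho p))
  (hs : stochastic_assumptions Z F f L (p_rho p) (p_sigma1 p) (p_sigma2 p))
  (beta_ge0 : 0 <= p_beta p) (m0 : (0 < m)%N) (e0 : 0 < p_eps p) (D0 : 0 < p_Delta0 p).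
Local Notation T := (iter_count p).
Local Notation G := (r_filt r).
Local Notation TG k := (g_sigma_algebraType (G k)).
Local Notation beta := (p_beta p).
Local Notation rho := (p_rho p).
Local Notation sigma1 := (p_sigma1 p).
Local Notation sigma2 := (p_sigma2 p).
Local Notation eps := (p_eps p).
Local Notation h := (h_beta f beta).
Local Notation HW := (hess_model f beta).
Local Notation u z := (frobenius (ygrad f z)).
Local Notation smpl b := (fun k i => r_sample r k b i).
Context (beta_gt0 : 0 < beta) (c_gt0 : 0 < p_c p)
  (c1E : p_c1 p = (1 + beta * sigma2) ^+ 2 * sigma1 ^+ 2 + beta ^+ 2 * sigma2 ^+ 2 * (4 * mu * p_Delta0 p))
  (c2E : p_c2 p = L ^+ 2 * (1 + beta * sigma2) ^+ 2
            + beta ^+ 2 * rho ^+ 2 * (sigma1 ^+ 2 + 4 * mu * p_Delta0 p))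
  (c3E : p_c3 p = 1 + beta * (L + sigma2))
  (Sg0 : (0 < p_Sg p)%N) (Sh0 : (0 < p_Sh p)%N).
Let Cf := det_C3 hd.
Let mu0 := det_mu_gt0 hd.
Let rho0 := det_rho_gt0 hd.
Let L0 := det_L_gt0 hd.
Let s10 := sigma1_ge0 hs.
Let s20 := sigma2_ge0 hs.

Let gz := @mxmeas_grad_comp R n m h.

Let msamp b k i (kT : (k < T)%N) := measurable_run_sample (r := r) b i kT.

(** The Hessian is bounded away from zero by strong concavity, so that its
    unbiased estimates cannot vanish. *)
Lemma sigma2_gt0 : 0 < sigma2.
Proof.
rewrite lt_neqAle s20 andbT; apply/eqP => s2E.
have [_ h1] := lower_moments s20 (mxmeas_shess_at hs 0) (shess_cube hs 0).
have H0 : frobenius (hess f 0) = 0.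
  by apply/eqP; rewrite eq_le frob_ge0 andbT s2E; exact: mean_frob_le (shess_mean hs 0) h1.
pose w : 'cV[R]_m := delta_mx (Ordinal m0) 0.
have := hess_yy_neg hd 0 w.
have w1 : frobenius w ^+ 2 = 1 by rewrite frob_sqr fdot_delta mxE !eqxx.
by rewrite (frob_eq0 H0) mul0mx fdotC fdot0l w1 mulr1 leNgt oppr_lt0 mu0.
Qed.

Lemma c1_gt0 : 0 < p_c1 p.
Proof.
rewrite c1E; apply: ltr_wpDl; first by rewrite mulr_ge0 ?sqr_ge0.
by rewrite !mulr_gt0 ?exprn_gt0 //; exact: sigma2_gt0.
Qed.

Lemma c2_gt0 : 0 < p_c2 p.
Proof.
rewrite c2E; apply: ltr_wpDl; first by rewrite mulr_ge0 ?sqr_ge0.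
do !apply: mulr_gt0 => //; rewrite ?exprn_gt0 //.
apply: ltr_wpDl; first exact: sqr_ge0.
by do !apply: mulr_gt0.
Qed.

Lemma mxmeas_ygrad d' (T' : measurableType d') (y : T' -> 'cV[R]_(n + m)) :
  mxmeas y -> mxmeas (fun w => ygrad f (y w)).
Proof.
move=> my; apply: mxmeasM; first exact: mxmeas_cst.
exact: mxmeas_grad_comp (class_CW Cf) my.
Qed.

Lemma measurable_ygrad_sqr k : (k <= T)%N -> measurable_fun [set: TG k] (fun w : TG k => u (r_z r k w) ^+ 2).
Proof.
by move=> kT; apply: measurable_funX; apply: mxmeas_frob; apply: mxmeas_ygrad; exact: mxmeas_run_z.
Qed.

Lemma measurable_prev_ygrad_sqr k : (k < T)%N ->
  measurable_fun [set: TG k] (fun w : TG k => u (r_z r k.-1 w) ^+ 2).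
Proof.
move=> kT; apply: (measurable_later (@run_filt_step _ _ _ _ _ _ _ _ _ _ _ _ r) (leq_pred k)).
by apply: measurable_ygrad_sqr; exact: leq_trans (leq_pred k) (ltnW kT).
Qed.

Lemma run_prev_diff k w : (k < T)%N -> (0 < k)%N ->
  frobenius (r_z r k w - r_z r k.-1 w) = enorm (r_xi r k.-1 w).
Proof. by case: k => // k kT _ /=; rewrite r_zS ?(ltnW kT) // add_subl enorm_frob. Qed.

Lemma affine_second_moment (Y : Om -> R) (K a b U : R) : 0 <= K -> 0 <= a -> 0 <= b ->
  Ebound P Y U -> Ebound P (fun w => K * (a + b * Y w)) (K * (a + b * U)).
Proof. by move=> K0 a0 b0 hY; apply: EbZ => //; apply: EbD; [exact: Eb_cst|exact: EbZ]. Qed.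

(** A checkpoint contributes [eps ^ 2 / 32], each further iteration of the cycle
    [eps ^ 2 / (32 * Sg)]. *)
Lemma g_error_second_moment k : (k < T)%N ->
  (forall j, (j <= k)%N -> Ebound P (fun w => u (r_z r j w) ^+ 2) (4 * mu * p_Delta0 p)) ->
  Ebound P (fun w => frobenius (g_error f r k w) ^+ 2)
    (eps ^+ 2 / 32 * (1 + (k %% p_Sg p)%:R / (p_Sg p)%:R)).
Proof.
elim/ltn_ind: k => k IH kT hu.
have c10 := c1_gt0; have c20 := c2_gt0.
have Sg0' : 0 < (p_Sg p)%:R :> R by rewrite ltr0n.
have est V v := @estimator_second_moment _ _ _ _ _ P Z G T (run_past r) (@run_filt_step _ _ _ _ _ _ _ _ _ _ _ _ r)
  (smpl Bg1) (smpl Bg2) (msamp Bg1) (msamp Bg2) (@run_fresh_g _ _ _ _ _ _ _ _ _ _ _ _ r) _ _ _ (r_z r) (@mxmeas_run_z _ _ _ _ _ _ _ _ _ _ _ _ r)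
  (q_sample F beta) (grad h) (fun d T' y s => @mxmeas_q_sample _ _ _ _ _ _ _ _ _ _ hs d T' y s) (fun d T' y => gz (class_C_h_beta beta Cf))
  (q_sample_mean beta hd hs) (fun k w => size_g p k (r_xi r k.-1 w))
  (@measurable_size_g _ _ _ _ _ _ _ _ _ _ _ _ r) (fun k w => size_g_gt0 p k _) (p_Sg p) (r_g r) (@run_gE _ _ _ _ _ _ _ _ _ _ _ _ r) k V v kT.
set a1 := (1 + beta * sigma2) ^+ 2 * sigma1 ^+ 2; set b1 := beta ^+ 2 * sigma2 ^+ 2.
set a2 := L ^+ 2 * (1 + beta * sigma2) ^+ 2 + beta ^+ 2 * rho ^+ 2 * sigma1 ^+ 2.
set b2 := beta ^+ 2 * rho ^+ 2.
have a10 : 0 <= a1 by rewrite mulr_ge0 ?sqr_ge0.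
have b10 : 0 <= b1 by rewrite mulr_ge0 ?sqr_ge0.
have b20 : 0 <= b2 by rewrite mulr_ge0 ?sqr_ge0.
have a20 : 0 <= a2 by rewrite addr_ge0 // mulr_ge0 ?sqr_ge0.
have [Sk|Sk] := boolP (p_Sg p %| k)%N.
  pose K := eps ^+ 2 / (32 * p_c1 p).
  have K0 : 0 <= K by rewrite divr_ge0 ?sqr_ge0 // mulr_ge0 // ltW.
  apply: (est (fun w => K * (a1 + b1 * u (r_z r k w) ^+ 2))).
  - by apply: measurable_funM => //; apply: measurable_funD => //; apply: measurable_funM => //; apply: measurable_ygrad_sqr; exact: ltnW.
  - by move=> w; rewrite mulr_ge0 // addr_ge0 // mulr_ge0 // sqr_ge0.
  - move=> w; rewrite /innovation Sk /=.
    apply: Eb_weaken (q_sample_variance hd hs beta_ge0 (r_z r k w)) _.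
    apply: checkpoint_scale => //; first by rewrite addr_ge0 // mulr_ge0 // sqr_ge0.
    rewrite /size_g Sk; apply: le_least_pos_ge.
    by rewrite divr_ge0 ?sqr_ge0 // mulr_ge0 // ltW.
  - rewrite /carried_error Sk frob0 expr0n /=.
    under [X in Ebound _ X]eq_fun do rewrite add0r.
    rewrite (eqP Sk) mul0r addr0 mulr1.
    apply: Eb_weaken (affine_second_moment K0 a10 b10 (hu k (leqnn k))) _.
    rewrite /a1 /b1 -c1E /K le_eqVlt; apply/orP; left; apply/eqP; field; exact: lt0r_neq0.
have k0 : (0 < k)%N by case: (k) Sk => //; rewrite dvdn0.
have pk : (k.-1 < k)%N by rewrite prednK.
pose K := eps ^+ 2 / (32 * p_c2 p * (p_Sg p)%:R).
have K0 : 0 <= K by rewrite divr_ge0 ?sqr_ge0 // !mulr_ge0 // ltW.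
apply: (est (fun w => K * (a2 + b2 * u (r_z r k.-1 w) ^+ 2))).
- by apply: measurable_funM => //; apply: measurable_funD => //; apply: measurable_funM => //; exact: measurable_prev_ygrad_sqr.
- by move=> w; rewrite mulr_ge0 // addr_ge0 // mulr_ge0 // sqr_ge0.
- move=> w; rewrite /innovation (negbTE Sk) /=.
  apply: Eb_weaken (q_sample_diff_variance hd hs beta_ge0 (r_z r k w) (r_z r k.-1 w)) _.
  rewrite run_prev_diff // -/b2.
  have -> : L ^+ 2 * (1 + beta * sigma2) ^+ 2 + b2 * (sigma1 ^+ 2 + u (r_z r k.-1 w) ^+ 2)
     = a2 + b2 * u (r_z r k.-1 w) ^+ 2 by rewrite /a2 /b2; ring.
  apply: recursion_scale => //; first by rewrite addr_ge0 // mulr_ge0 // sqr_ge0.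
  by rewrite /size_g (negbTE Sk); exact: lt_truncnS.
rewrite /carried_error (negbTE Sk) /=.
have IHk := IH k.-1 pk (ltn_trans pk kT) (fun j jk => hu j (leq_trans jk (ltnW pk))).
apply: Eb_weaken (EbD IHk (affine_second_moment K0 a20 b20 (hu _ (ltnW pk)))) _.
have -> : a2 + b2 * (4 * mu * p_Delta0 p) = p_c2 p by rewrite c2E /a2 /b2; ring.
rewrite (modn_notdvd Sk) -natr1 /K le_eqVlt; apply/orP; left; apply/eqP.
by field; rewrite !lt0r_neq0.
Qed.

Lemma expR_inv_bound (x : R) : x < 1 -> expR x <= (1 - x)^-1.
Proof.
move=> x1; rewrite -[X in X <= _]invrK lef_pV2 ?posrE ?subr_gt0 ?invr_gt0 ?expR_gt0 //.
rewrite -expRN; exact: expR_ge1Dx.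
Qed.

Local Notation tau := (Num.sqrt (p_c p * eps)).

Let tau0 : 0 < tau. Proof. by rewrite sqrtr_gt0 mulr_gt0. Qed.
Let tau2 : tau ^+ 2 = p_c p * eps. Proof. by rewrite sqr_sqrtr // ltW // mulr_gt0. Qed.

Let c30 : 0 <= p_c3 p.
Proof. by rewrite c3E addr_ge0 // mulr_ge0 // addr_ge0 // ltW. Qed.

(** The growth exponents are [1 / 40] at a checkpoint and [1 / (40 * Sh)] at each
    further iteration, hence at most [1 / 20] over a cycle. *)
Lemma H_error_growth k : (k < T)%N ->
  Ebound P (fun w => frobenius (H_error f r k w) ^+ 3 + 3 * tau ^+ 3)
    (expR (40^-1 + (k %% p_Sh p)%:R / (40 * (p_Sh p)%:R)) * (3 * tau ^+ 3)).
Proof.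
elim/ltn_ind: k => k IH kT.
have Sh0' : 0 < (p_Sh p)%:R :> R by rewrite ltr0n.
have Sh1 : 1 <= (p_Sh p)%:R :> R by rewrite ler1n.
have ce : 0 < p_c p * eps by rewrite mulr_gt0.
have est v y v' := @estimator_third_moment _ _ _ _ _ P Z G T (run_past r) (@run_filt_step _ _ _ _ _ _ _ _ _ _ _ _ r)
  (smpl Bh1) (smpl Bh2) (msamp Bh1) (msamp Bh2) (@run_fresh_h _ _ _ _ _ _ _ _ _ _ _ _ r) _ _ _ (r_z r) (@mxmeas_run_z _ _ _ _ _ _ _ _ _ _ _ _ r)
  (w_sample F beta) HW (fun d T' y s => @mxmeas_w_sample _ _ _ _ _ _ _ _ _ _ hs d T' y s) (fun d T' y => @mxmeas_hess_model _ _ _ _ _ _ _ hd d T' y)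
  (w_sample_mean beta hd hs) (fun k w => size_h p k (r_xi r k.-1 w))
  (@measurable_size_h _ _ _ _ _ _ _ _ _ _ _ _ r) (fun k w => size_h_gt0 p k _) (p_Sh p) (r_H r) (run_HE r) k v y tau v' kT.
have [Sk|Sk] := boolP (p_Sh p %| k)%N.
  have -> : 40^-1 + (k %% p_Sh p)%:R / (40 * (p_Sh p)%:R) = p_c p * eps / 40 / tau ^+ 2 :> R.
    by rewrite (eqP Sk) mul0r addr0 tau2; field; rewrite !lt0r_neq0.
  apply: (est (fun=> 4 * (sigma2 * p_c3 p))) => //.
  - by move=> w; rewrite !mulr_ge0.
  - by rewrite divr_ge0 // ltW.
  - by rewrite tau2 ler_pdivrMr //; lra.
  - move=> w; apply: cube_checkpoint_scale => //; rewrite /size_h Sk exprMn.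
    rewrite mulrA; apply: le_least_pos_ge.
    exact: weighted_sqr_ratio_ge0.
  - by move=> w; rewrite /innovation Sk /= mulrA c3E; exact: w_sample_third hd hs beta_ge0 _.
  - rewrite /carried_error Sk frob0 expr0n /=.
    under [X in Ebound _ X]eq_fun do rewrite add0r.
    by apply: Eb_cst; rewrite mulr_ge0 // exprn_ge0 // ltW.
have k0 : (0 < k)%N by case: (k) Sk => //; rewrite dvdn0.
have pk : (k.-1 < k)%N by rewrite prednK.
have -> : 40^-1 + (k %% p_Sh p)%:R / (40 * (p_Sh p)%:R) =
    p_c p * eps / (40 * (p_Sh p)%:R) / tau ^+ 2 + (40^-1 + (k.-1 %% p_Sh p)%:R / (40 * (p_Sh p)%:R)) :> R.
  rewrite (modn_notdvd Sk) -natr1 tau2; field; rewrite !lt0r_neq0 //.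
rewrite expRD -mulrA.
apply: (est (fun w => 4 * (p_c3 p * rho * enorm (r_xi r k.-1 w)))) => //.
- by move=> w; rewrite !mulr_ge0 ?enorm_ge0 // ltW.
- by rewrite divr_ge0 ?mulr_ge0 // ltW.
- rewrite tau2 ler_pdivrMr ?mulr_gt0 // ler_peMr ?(ltW ce) //; lra.
- move=> w; apply: cube_recursion_scale => //; rewrite /size_h (negbTE Sk).
  apply: le_trans (lt_truncnS _); rewrite le_eqVlt; apply/orP; left; apply/eqP.
  rewrite !exprMn; congr (_ / _); ring.
- move=> w; rewrite /innovation (negbTE Sk) /= !mulrA -(run_prev_diff w kT k0) c3E.
  exact: w_sample_diff_third hd hs beta_ge0 _ _.
- rewrite /carried_error (negbTE Sk); exact: IH (ltn_trans pk kT).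
Qed.

Lemma Eb_drop_cst (Y : Om -> R) (a b : R) : 0 <= a -> (forall w, 0 <= Y w) ->
  Ebound P (fun w => Y w + a) b -> Ebound P Y (b - a).
Proof.
move=> a0 Y0 hY; have mY : measurable_fun setT Y.
  have -> : Y = fun w => (Y w + a) - a by apply/funext => w; rewrite addrK.
  by apply: measurable_funB => //; exact: Eb_meas hY.
split => //; have := Eb_le hY.
under eq_integral do rewrite EFinD.
rewrite ge0_integralD //=.
- by rewrite integral_cst //= probability_setT mule1 EFinB leeBrDr.
- by move=> w _; rewrite lee_fin.
- exact/measurable_EFinP.
Qed.

Lemma H_error_third_moment k : (k < T)%N ->
  Ebound P (fun w => frobenius (H_error f r k w) ^+ 3) (4 * tau ^+ 3).
Proof.
move=> kT; have t30 : 0 < tau ^+ 3 by rewrite exprn_gt0.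
have h3 : 0 <= 3 * tau ^+ 3 by rewrite mulr_ge0 // ltW.
apply: Eb_weaken (Eb_drop_cst h3 (fun w => exprn_ge0 _ (frob_ge0 _)) (H_error_growth kT)) _.
suff : expR (40^-1 + (k %% p_Sh p)%:R / (40 * (p_Sh p)%:R)) <= 2 :> R.
  move=> /(ler_wpM2r h3); lra.
have Sh0' : 0 < (p_Sh p)%:R :> R by rewrite ltr0n.
have h : (k %% p_Sh p)%:R / (40 * (p_Sh p)%:R) <= 40^-1 :> R.
  have := @mod_ratio_le1 R _ k Sh0; have -> : (k %% p_Sh p)%:R / (40 * (p_Sh p)%:R) = ((k %% p_Sh p)%:R / (p_Sh p)%:R) / 40 :> R.
    by field; rewrite lt0r_neq0.
  lra.
apply: le_trans (_ : expR (20^-1) <= _); first by rewrite ler_expR; lra.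
apply: le_trans (expR_inv_bound _) _; first by lra.
by rewrite -[X in _ <= X]invrK lef_pV2 ?posrE; lra.
Qed.

Lemma y_error_third_moment k : (k < T)%N ->
  Ebound P (fun w => (beta * rho * frobenius (y_error f r k w)) ^+ 3) (4 * tau ^+ 3).
Proof.
move=> kT; have br0 : 0 < beta * rho by rewrite mulr_gt0.
have ce : 0 < p_c p * eps by rewrite mulr_gt0.
pose t := tau / (beta * rho); have t0 : 0 < t by rewrite divr_gt0.
pose y := p_c p * eps / (36 * (beta * rho) ^+ 2).
have yt : y / t ^+ 2 = 36^-1.
  by rewrite /y /t expr_div_n tau2; field; rewrite !lt0r_neq0.
have y0 : 0 <= y by rewrite divr_ge0 ?(ltW ce) // mulr_ge0 // sqr_ge0.
have est v v' := @estimator_third_moment _ _ _ _ _ P Z G T (run_past r) (@run_filt_step _ _ _ _ _ _ _ _ _ _ _ _ r)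
  (smpl By) (smpl Bg1) (msamp By) (msamp Bg1) (@run_fresh_y _ _ _ _ _ _ _ _ _ _ _ _ r) _ _ _ (r_z r) (@mxmeas_run_z _ _ _ _ _ _ _ _ _ _ _ _ r)
  (y_sample F) (grad_y f) (fun d T' y s => @mxmeas_y_sample _ _ _ _ _ _ _ _ _ _ hs d T' y s)
  (fun d T' y my => mxmeas_dsubmx (mxmeas_grad_comp (class_CW Cf) my))
  (y_sample_mean hs) (fun k w => size_y p)
  (@measurable_size_y _ _ _ _ _ _ _ _ _ _ _ _ r) (fun k w => least_pos_ge_gt0 _) 1%N (r_gy r) (run_gyE r) k v y t v' kT.
have h3 : 0 <= 3 * t ^+ 3 by rewrite mulr_ge0 // exprn_ge0 // ltW.
have ht : Ebound P (fun w => frobenius (y_error f r k w) ^+ 3 + 3 * t ^+ 3) (expR (y / t ^+ 2) * (3 * t ^+ 3)).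
  apply: (est (fun=> sigma1)) => //.
  - have : y / t ^+ 2 <= 1 by rewrite yt; lra.
    by rewrite ler_pdivrMr ?exprn_gt0 // mul1r.
  - move=> w; rewrite /y mulrAC ler_pdivlMr ?mulr_gt0 ?exprn_gt0 // mulrC.
    have hN := le_least_pos_ge (x := 36 * (sigma1 * beta * rho) ^+ 2 / (p_c p * eps)).
    have : 36 * (sigma1 * beta * rho) ^+ 2 / (p_c p * eps) <= (size_y p)%:R.
      by apply: hN; rewrite divr_ge0 ?(ltW ce) // mulr_ge0 // sqr_ge0.
    rewrite ler_pdivrMr // [_ * (p_c p * eps)]mulrC; apply: le_trans.
    by rewrite le_eqVlt; apply/orP; left; apply/eqP; ring.
  - by move=> w; rewrite /innovation dvd1n /=; exact: y_sample_third hs _.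
  - rewrite /carried_error dvd1n frob0 expr0n /=.
    under [X in Ebound _ X]eq_fun do rewrite add0r.
    exact: Eb_cst.
under [X in Ebound _ X]eq_fun do rewrite exprMn.
apply: Eb_weaken (EbZ (exprn_ge0 3 (ltW br0)) (Eb_drop_cst h3 (fun w => exprn_ge0 _ (frob_ge0 _)) ht)) _.
have -> : (beta * rho) ^+ 3 * (expR (y / t ^+ 2) * (3 * t ^+ 3) - 3 * t ^+ 3) =
  expR (y / t ^+ 2) * (3 * tau ^+ 3) - 3 * tau ^+ 3.
  by rewrite /t expr_div_n; move: (expR _) => E; field; rewrite !lt0r_neq0.
rewrite yt; have h4 : 0 <= 3 * tau ^+ 3 by rewrite mulr_ge0 // exprn_ge0 // ltW.
have : expR (36^-1) <= 2 :> R.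
  apply: le_trans (expR_inv_bound _) _; first by lra.
  by rewrite -[X in _ <= X]invrK lef_pV2 ?posrE; lra.
move=> /(ler_wpM2r h4); lra.
Qed.

End run_errors.

(** * Expected descent *)

Lemma cubic_young {R : realType} (c a x : R) : 0 < c -> 0 <= a -> 0 <= x ->
  a / 2 * x ^+ 2 <= c / 3 * x ^+ 3 + a ^+ 3 / (6 * c ^+ 2).
Proof.
move=> c0 a0 x0; rewrite -subr_ge0.
have -> : c / 3 * x ^+ 3 + a ^+ 3 / (6 * c ^+ 2) - a / 2 * x ^+ 2 =
  (c * x - a) ^+ 2 * (2 * c * x + a) / (6 * c ^+ 2) by field; exact: lt0r_neq0.
apply: divr_ge0; last by rewrite mulr_ge0 ?sqr_ge0.
by apply: mulr_ge0 (sqr_ge0 _) _; apply: addr_ge0 => //; rewrite !mulr_ge0 // ltW.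
Qed.

Lemma linear_young {R : realType} (t a x : R) : 0 < t ->
  a * x <= a ^+ 2 / (2 * t) + t / 2 * x ^+ 2.
Proof.
move=> t0; rewrite -subr_ge0.
have -> : a ^+ 2 / (2 * t) + t / 2 * x ^+ 2 - a * x = (a - t * x) ^+ 2 / (2 * t).
  by field; exact: lt0r_neq0.
by rewrite divr_ge0 ?sqr_ge0 // mulr_ge0 // ltW.
Qed.

(** Young's inequality moves the errors of the estimates into cubes of the step,
    which use up half of the decrease. *)
Lemma absorbed_noise {R : realType} (c s x eg eH w b y h h' : R) :
  0 < c -> 0 < s -> 0 <= x -> 0 <= eH -> 0 <= w ->
  h' <= h - 2 * c * x ^+ 3 + eg * x + eH / 2 * x ^+ 2 + (w - b * y) / 2 * x ^+ 2 ->
  h' + (c * x ^+ 3 + b / 2 * y * x ^+ 2) <=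
  h + (eg ^+ 2 / (2 * (c * s)) + c * s ^+ 3 / 6 + (eH ^+ 3 + w ^+ 3) / (6 * c ^+ 2)).
Proof.
move=> c0 s0 x0 eH0 w0.
have cs : 0 < c * s by rewrite mulr_gt0.
have h1 := linear_young eg x cs.
have h2 := cubic_young c0 (ltW cs) x0.
have h3 := cubic_young c0 eH0 x0.
have h4 := cubic_young c0 w0 x0.
have e2 : (c * s) ^+ 3 / (6 * c ^+ 2) = c * s ^+ 3 / 6 by field; exact: lt0r_neq0.
have e3 : (eH ^+ 3 + w ^+ 3) / (6 * c ^+ 2) = eH ^+ 3 / (6 * c ^+ 2) + w ^+ 3 / (6 * c ^+ 2) by rewrite mulrDl.
rewrite e2 in h2; rewrite e3 => h0.
have e4 : (w - b * y) / 2 * x ^+ 2 = w / 2 * x ^+ 2 - b / 2 * y * x ^+ 2 by ring.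
rewrite e4 in h0; have e5 : c * x ^+ 3 = 3 * (c / 3 * x ^+ 3) by field.
have e6 : 2 * c * x ^+ 3 = 6 * (c / 3 * x ^+ 3) by field.
rewrite e5; rewrite e6 in h0.
move: (c / 3 * _) (_ ^+ 2 / _) (c * s / 2 * _) (eH / 2 * _) (w / 2 * _) (b / 2 * _ * _) (c * s ^+ 3 / _)
  (eH ^+ 3 / _) (w ^+ 3 / _) (eg * x) h0 h1 h2 h3 h4 => A1 A2 A3 A4 A5 A6 A7 A8 A9 A10.
lra.
Qed.

Lemma noise_budget {R : realType} (c s : R) : 0 < c -> 0 < s ->
  (2 * (c * s))^-1 * (c * s ^+ 2) ^+ 2 / 16 + c * s ^+ 3 / 6
    + (6 * c ^+ 2)^-1 * (4 * (c * s) ^+ 3 + 4 * (c * s) ^+ 3) <= 2 * (c * s ^+ 3).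
Proof.
move=> c0 s0; have h : 0 < c * s ^+ 3 by rewrite mulr_gt0 // exprn_gt0.
have -> : (2 * (c * s))^-1 * (c * s ^+ 2) ^+ 2 / 16 = c * s ^+ 3 / 32.
  by field; rewrite !lt0r_neq0.
have -> : (6 * c ^+ 2)^-1 * (4 * (c * s) ^+ 3 + 4 * (c * s) ^+ 3) = 8 / 6 * (c * s ^+ 3).
  by field; rewrite !lt0r_neq0.
lra.
Qed.

Lemma powR_three_halves {R : realType} (x : R) : 0 <= x -> x `^ (3 / 2) = Num.sqrt x ^+ 3.
Proof.
by move=> x0; rewrite [3 / 2]mulrC powRrM powR12_sqrt // (powR_mulrn 3) // sqrtr_ge0.
Qed.

(** Relates the parameters of the method to the constants of the problem. Here
    [4 * mu * Delta0] is the square of the radius within which the partial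
    gradients stay, in mean square. *)
Record calibrated {R : realType} (p : sacqrn_params R) (mu L : R) : Prop := {
  cal_eps : 0 < p_eps p;
  cal_Delta0 : 0 < p_Delta0 p;
  cal_beta : p_beta p = 2 * mu^-1;
  cal_c : p_c p = (3 * p_beta p * L + 1) * p_rho p / 6;
  cal_c1 : p_c1 p = (1 + p_beta p * p_sigma2 p) ^+ 2 * p_sigma1 p ^+ 2
    + p_beta p ^+ 2 * p_sigma2 p ^+ 2 * (4 * mu * p_Delta0 p);
  cal_c2 : p_c2 p = L ^+ 2 * (1 + p_beta p * p_sigma2 p) ^+ 2
    + p_beta p ^+ 2 * p_rho p ^+ 2 * (p_sigma1 p ^+ 2 + 4 * mu * p_Delta0 p);
  cal_c3 : p_c3 p = 1 + p_beta p * (L + p_sigma2 p);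
  cal_Sg : (0 < p_Sg p)%N;
  cal_Sh : (0 < p_Sh p)%N
}.

(** The natural length [s] of a step: the gradient tolerance is [c * s ^ 2], the
    curvature tolerance is of order [c * s], and the decrease per iteration is of
    order [c * s ^ 3]. *)
Definition step_scale {R : realType} (p : sacqrn_params R) := Num.sqrt (p_eps p / p_c p).

Section descent.
Context {R : realType} {n m : nat} {dX : measure_display} {Xi : measurableType dX}
  (Z : probability Xi R) (F : 'cV[R]_(n + m) -> Xi -> R) (f : 'cV[R]_(n + m) -> R)
  {dO : measure_display} {Om : measurableType dO} (P : probability Om R)
  (p : sacqrn_params R) (z0 : 'cV[R]_(n + m)) (r : sacqrn_run Z F P p z0) (mu L : R).
Context (hd : deterministic_assumptions f mu L (p_rho p))
  (hs : stochastic_assumptions Z F f L (p_rho p) (p_sigma1 p) (p_sigma2 p))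
  (m0 : (0 < m)%N) (cal : calibrated p mu L).
Local Notation T := (iter_count p).
Local Notation beta := (p_beta p).
Local Notation rho := (p_rho p).
Local Notation eps := (p_eps p).
Local Notation c := (p_c p).
Local Notation s := (step_scale p).
Local Notation h := (h_beta f beta).
Local Notation HW := (hess_model f beta).
Local Notation u z := (frobenius (ygrad f z)).
Local Notation z_ := (r_z r).
Local Notation x_ k w := (frobenius (r_xi r k w)).
Local Notation y_ k w := (frobenius (r_gy r k w)).
Context (hz0 : h z0 - Phi_bar f <= p_Delta0 p) (small : 4 * (c * s ^+ 3) <= p_Delta0 p).
Let Cf := det_C3 hd.
Let mu0 := det_mu_gt0 hd.
Let rho0 := det_rho_gt0 hd.
Let L0 := det_L_gt0 hd.
Let e0 := cal_eps cal.

Lemma beta_gt0 : 0 < beta.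
Proof. by rewrite (cal_beta cal) mulr_gt0 // invr_gt0. Qed.

Lemma p_c_gt0 : 0 < c.
Proof.
by rewrite (cal_c cal) !mulr_gt0 ?invr_gt0 // ltr_wpDl // !mulr_ge0 // ltW // beta_gt0.
Qed.

Lemma step_scale_gt0 : 0 < s.
Proof. by rewrite sqrtr_gt0 divr_gt0 // p_c_gt0. Qed.

Lemma eps_scale : eps = c * s ^+ 2.
Proof.
rewrite sqr_sqrtr; last by rewrite ltW // divr_gt0 // p_c_gt0.
by rewrite mulrCA divff ?mulr1 // lt0r_neq0 // p_c_gt0.
Qed.

Lemma sqrt_c_eps : Num.sqrt (c * eps) = c * s.
Proof.
have -> : c * eps = (c * s) ^+ 2 by rewrite {1}eps_scale; ring.
by rewrite sqrtr_sqr ger0_norm // ltW // mulr_gt0 ?p_c_gt0 ?step_scale_gt0.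
Qed.

Lemma iter_ratio : p_Delta0 p * Num.sqrt c / (6 * eps `^ (3 / 2)) = p_Delta0 p / (6 * (c * s ^+ 3)).
Proof.
have c0 := p_c_gt0; have q0 : 0 < Num.sqrt c by rewrite sqrtr_gt0.
have se : Num.sqrt eps = Num.sqrt c * s.
  by rewrite {1}eps_scale sqrtrM ?(ltW c0) // sqrtr_sqr ger0_norm // ltW // step_scale_gt0.
rewrite powR_three_halves ?(ltW e0) // se.
have -> : c * s ^+ 3 = Num.sqrt c ^+ 2 * s ^+ 3 by rewrite sqr_sqrtr // ltW.
by field; rewrite !lt0r_neq0 // step_scale_gt0.
Qed.

Let cs3 : 0 < c * s ^+ 3. Proof. by rewrite mulr_gt0 ?exprn_gt0 ?p_c_gt0 ?step_scale_gt0. Qed.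

Lemma iter_count_le : T%:R <= p_Delta0 p / (6 * (c * s ^+ 3)) + 1.
Proof.
rewrite /iter_count iter_ratio -natr1 lerD2r truncn_le // divr_ge0 ?(ltW (cal_Delta0 cal)) //.
by rewrite mulr_ge0 // ltW.
Qed.

Lemma iter_count_ge : p_Delta0 p <= T%:R * (6 * (c * s ^+ 3)).
Proof.
have q : 0 < 6 * (c * s ^+ 3) by rewrite mulr_gt0.
by rewrite -ler_pdivrMr // -iter_ratio; exact: lt_truncnS.
Qed.

Lemma iterations_budget k : (k <= T)%N -> k%:R * (2 * (c * s ^+ 3)) <= p_Delta0 p.
Proof.
move=> kT; have h1 : k%:R <= T%:R :> R by rewrite ler_nat.
have D0 := cal_Delta0 cal.
have h2 : k%:R <= p_Delta0 p / (6 * (c * s ^+ 3)) + 1 := le_trans h1 iter_count_le.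
have h3 : 0 <= 2 * (c * s ^+ 3) by rewrite mulr_ge0 // ltW.
apply: le_trans (ler_wpM2r h3 h2) _.
have -> : (p_Delta0 p / (6 * (c * s ^+ 3)) + 1) * (2 * (c * s ^+ 3)) = p_Delta0 p / 3 + 2 * (c * s ^+ 3).
  by field; rewrite !lt0r_neq0 // ?p_c_gt0 ?step_scale_gt0.
by move: (c * _) small => q; lra.
Qed.

Definition progress k w := c * x_ k w ^+ 3 + beta * rho / 2 * y_ k w * x_ k w ^+ 2.

(** Keeps the decrease certified so far, so that it grows by estimation noise
    only. *)
Definition potential k w := h (z_ k w) - Phi_bar f + \sum_(j < k) progress j w.

Definition noise k w := frobenius (g_error f r k w) ^+ 2 / (2 * (c * s)) + c * s ^+ 3 / 6
  + (frobenius (H_error f r k w) ^+ 3 + (beta * rho * frobenius (y_error f r k w)) ^+ 3) / (6 * c ^+ 2).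

Lemma run_model_min k w : (k < T)%N -> forall v,
  cubic_model (r_g r k w) (r_H r k w) (2 * beta * rho * enorm (r_gy r k w))
    (12 * ((3 * beta * L + 1) * rho / 6)) (r_xi r k w) <=
  cubic_model (r_g r k w) (r_H r k w) (2 * beta * rho * enorm (r_gy r k w))
    (12 * ((3 * beta * L + 1) * rho / 6)) v.
Proof. by move=> kT v; have := r_xi_argmin r w v kT; rewrite /alpha2 (cal_c cal). Qed.

Lemma progress_ge0 k w : 0 <= progress k w.
Proof.
by rewrite addr_ge0 // !mulr_ge0 ?exprn_ge0 ?sqr_ge0 ?frob_ge0 ?invr_ge0 // ltW // ?p_c_gt0 ?beta_gt0.
Qed.

Lemma ygrad_sqr_le_potential k w : u (z_ k w) ^+ 2 <= 2 * mu * potential k w.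
Proof.
have := h_beta_lower hd (z_ k w) (cal_beta cal).
have : 0 <= \sum_(j < k) progress j w by apply: sumr_ge0 => j _; exact: progress_ge0.
move=> h1; rewrite addrC -lerBrDr => h2.
have h3 : u (z_ k w) ^+ 2 / (2 * mu) <= potential k w by rewrite /potential ler_wpDr.
by rewrite mulrC -ler_pdivrMr // mulr_gt0.
Qed.

Lemma potential_ge0 k w : 0 <= potential k w.
Proof.
have h2 : 0 < 2 * mu by rewrite mulr_gt0.
by rewrite -(pmulr_rge0 _ h2) (le_trans _ (ygrad_sqr_le_potential k w)) ?sqr_ge0.
Qed.

Lemma potential_step k w : (k < T)%N -> potential k.+1 w <= potential k w + noise k w.
Proof.
move=> kT.
have := @one_step_descent _ _ _ _ _ _ _ _ hd (ltW beta_gt0) (z_ k w) _ _ _ _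
  (run_H_sym r w kT) (run_model_min w kT).
rewrite -r_zS // -(cal_c cal) -/(g_error f r k w) -/(H_error f r k w) -/(y_error f r k w).
rewrite /potential big_ord_recr /= /progress.
have b0 : 0 <= beta * rho by rewrite mulr_ge0 // ltW // beta_gt0.
have w0 : 0 <= beta * rho * frobenius (y_error f r k w) by rewrite mulr_ge0 // frob_ge0.
have -> : beta * rho / 2 * (frobenius (y_error f r k w) - y_ k w) * x_ k w ^+ 2 =
  (beta * rho * frobenius (y_error f r k w) - beta * rho * y_ k w) / 2 * x_ k w ^+ 2 by ring.
move=> /(absorbed_noise p_c_gt0 step_scale_gt0 (frob_ge0 _) (frob_ge0 _) w0).
rewrite -/(noise k w).
move: (h _) (h _) (Phi_bar f) (\sum_(_ < _) _) (noise k w) (c * _ + _) => A1 A2 A3 A4 A5 A6; lra.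
Qed.

Lemma mxmeas_z_Om k : (k <= T)%N -> mxmeas (z_ k : Om -> _).
Proof. by move=> kT; apply: (mxmeas_of_past (run_past r k)); exact: mxmeas_run_z. Qed.

Lemma mxmeas_xi_Om k : (k < T)%N -> mxmeas (r_xi r k : Om -> _).
Proof. by move=> kT; apply: (mxmeas_of_past (run_past r k.+1)); exact: mxmeas_run_xi. Qed.

Lemma mxmeas_gy_Om k : (k < T)%N -> mxmeas (r_gy r k : Om -> _).
Proof.
move=> kT; have -> : r_gy r k = fun w => (size_y p)%:R^-1 *: \sum_(i < size_y p)
    y_sample F (z_ k w) (r_sample r k By i w, r_sample r k By i w).
  by apply/funext => w; rewrite r_gyE.
apply: mxmeasZ; first exact: measurable_cst.
have ms i : measurable_fun [set: Om] (r_sample r k By i).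
  by apply: (measurable_of_past (run_past r k.+1)); exact: measurable_run_sample.
apply: mxmeas_sum => i; apply: (mxmeas_y_sample hs); first by apply: mxmeas_z_Om; exact: ltnW.
exact: measurable_fun_pair.
Qed.

Lemma measurable_step_norm k : (k < T)%N -> measurable_fun [set: Om] (fun w => x_ k w).
Proof. by move=> kT; exact/mxmeas_frob/mxmeas_xi_Om. Qed.

Lemma measurable_gy_norm k : (k < T)%N -> measurable_fun [set: Om] (fun w => y_ k w).
Proof. by move=> kT; exact/mxmeas_frob/mxmeas_gy_Om. Qed.

Lemma measurable_progress k : (k < T)%N -> measurable_fun [set: Om] (progress k).
Proof.
move=> kT; have mx := measurable_step_norm kT; have my := measurable_gy_norm kT.
apply: measurable_funD; first by apply: measurable_funM => //; exact: measurable_funX.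
by apply: measurable_funM; [exact: measurable_funM|exact: measurable_funX].
Qed.

Lemma measurable_potential k : (k <= T)%N -> measurable_fun [set: Om] (potential k).
Proof.
move=> kT; apply: measurable_funD.
  apply: measurable_funB => //.
  apply: (measurable_continuous_comp _ (mxmeas_z_Om kT)).
  exact: class_C_continuous (class_C_h_beta beta Cf).
by apply: measurable_sum => j; apply: measurable_progress; exact: leq_trans (ltn_ord j) kT.
Qed.

Lemma g_error_bound k : (k < T)%N ->
  (forall j, (j <= k)%N -> Ebound P (fun w => u (z_ j w) ^+ 2) (4 * mu * p_Delta0 p)) ->
  Ebound P (fun w => frobenius (g_error f r k w) ^+ 2) ((c * s ^+ 2) ^+ 2 / 16).
Proof.
move=> kT hu.
apply: Eb_weaken (g_error_second_moment hd hs (ltW beta_gt0) m0 e0 (cal_Delta0 cal) beta_gt0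
  (cal_c1 cal) (cal_c2 cal) (cal_Sg cal) kT hu) _.
rewrite -eps_scale; have := @mod_ratio_le1 R _ k (cal_Sg cal).
have : 0 <= eps ^+ 2 by exact: sqr_ge0.
move: (eps ^+ 2) (_ / _) => a b a0 b1; have := ler_wpM2l a0 b1; lra.
Qed.

Lemma H_error_bound k : (k < T)%N ->
  Ebound P (fun w => frobenius (H_error f r k w) ^+ 3) (4 * (c * s) ^+ 3).
Proof.
move=> kT; rewrite -sqrt_c_eps.
exact: H_error_third_moment hd hs (ltW beta_gt0) e0 p_c_gt0 (cal_c3 cal) (cal_Sh cal) _ kT.
Qed.

Lemma y_error_bound k : (k < T)%N ->
  Ebound P (fun w => (beta * rho * frobenius (y_error f r k w)) ^+ 3) (4 * (c * s) ^+ 3).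
Proof. by move=> kT; rewrite -sqrt_c_eps; exact: y_error_third_moment hd hs e0 beta_gt0 p_c_gt0 _ kT. Qed.

Lemma noise_bound k : (k < T)%N ->
  (forall j, (j <= k)%N -> Ebound P (fun w => u (z_ j w) ^+ 2) (4 * mu * p_Delta0 p)) ->
  Ebound P (noise k) (2 * (c * s ^+ 3)).
Proof.
move=> kT hu; apply: Eb_weaken (noise_budget p_c_gt0 step_scale_gt0).
have c0 := p_c_gt0; have s0 := step_scale_gt0.
have -> : noise k = fun w => ((2 * (c * s))^-1 * frobenius (g_error f r k w) ^+ 2 + c * s ^+ 3 / 6)
  + (6 * c ^+ 2)^-1 * (frobenius (H_error f r k w) ^+ 3 + (beta * rho * frobenius (y_error f r k w)) ^+ 3).
  by apply/funext => w; rewrite /noise [_ ^+ 2 / _]mulrC [(_ + _) / _]mulrC.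
apply: EbD.
  apply: EbD; last by apply: Eb_cst; rewrite divr_ge0 // ltW.
  rewrite -mulrA; apply: EbZ; first by rewrite invr_ge0 ltW // !mulr_gt0.
  exact: g_error_bound.
apply: EbZ; first by rewrite invr_ge0 mulr_ge0 // sqr_ge0.
by apply: EbD; [exact: H_error_bound|exact: y_error_bound].
Qed.

Lemma ygrad_second_moment_of_potential k (a : R) : (k <= T)%N -> Ebound P (potential k) a -> a <= 2 * p_Delta0 p ->
  Ebound P (fun w => u (z_ k w) ^+ 2) (4 * mu * p_Delta0 p).
Proof.
move=> kT hD aD; have mu2 : 0 <= 2 * mu by rewrite mulr_ge0 // ltW.
have hb : 2 * mu * a <= 4 * mu * p_Delta0 p.
  have -> : 4 * mu * p_Delta0 p = 2 * mu * (2 * p_Delta0 p) by ring.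
  exact: ler_wpM2l.
apply: Eb_weaken hb; apply: Eb_mono (EbZ mu2 hD).
  apply: measurable_funX; apply: mxmeas_frob; apply: (mxmeas_ygrad hd); exact: mxmeas_z_Om.
by move=> w; rewrite sqr_ge0 ygrad_sqr_le_potential.
Qed.

(** The errors of an iteration are controlled by the partial gradients up to it,
    and these by the potential, which carries the errors of earlier iterations:
    the bounds have to be proved together, by induction. *)
Lemma potential_bound k : (k <= T)%N -> Ebound P (potential k) (p_Delta0 p + k%:R * (2 * (c * s ^+ 3))).
Proof.
elim/ltn_ind: k => -[|k] IH kT.
  have -> : potential 0 = fun=> h z0 - Phi_bar f.
    by apply/funext => w; rewrite /potential big_ord0 addr0 r_z0.
  rewrite mul0r addr0; apply: Eb_weaken hz0; apply: Eb_cst.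
  have := potential_ge0 0 point; by rewrite /potential big_ord0 addr0 r_z0.
have hu j : (j <= k)%N -> Ebound P (fun w => u (z_ j w) ^+ 2) (4 * mu * p_Delta0 p).
  move=> jk; have jT : (j <= T)%N by exact: leq_trans jk (ltnW kT).
  apply: (ygrad_second_moment_of_potential jT (IH j _ jT)) => //.
  by rewrite [2 * p_Delta0 p]mulr_natl mulr2n lerD2l iterations_budget.
rewrite -natr1 mulrDl mul1r addrA.
apply: Eb_mono (EbD (IH k (leqnn _) (ltnW kT)) (noise_bound kT hu)).
  exact: measurable_potential.
by move=> w; rewrite potential_ge0 /= potential_step.
Qed.

Lemma potential_uniform_bound k : (k <= T)%N -> Ebound P (potential k) (2 * p_Delta0 p).
Proof.
move=> kT; apply: Eb_weaken (potential_bound kT) _.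
by rewrite [2 * p_Delta0 p]mulr_natl mulr2n lerD2l iterations_budget.
Qed.

Lemma ygrad_second_moment k : (k <= T)%N -> Ebound P (fun w => u (z_ k w) ^+ 2) (4 * mu * p_Delta0 p).
Proof. by move=> kT; exact: ygrad_second_moment_of_potential (potential_uniform_bound kT) _. Qed.

Lemma total_progress : Ebound P (fun w => \sum_(k < T) progress k w) (2 * p_Delta0 p).
Proof.
apply: Eb_mono (potential_uniform_bound (leqnn T)).
  by apply: measurable_sum => j; exact: measurable_progress.
move=> w; apply/andP; split; first by apply: sumr_ge0 => j _; exact: progress_ge0.
have := h_beta_lower hd (z_ T w) (cal_beta cal).
have : 0 <= u (z_ T w) ^+ 2 / (2 * mu) by rewrite divr_ge0 ?sqr_ge0 // mulr_ge0 // ltW.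
rewrite /potential; move: (h _) (\sum_(_ < _) _) (Phi_bar _) (_ / _) => A1 A2 A3 A4; lra.
Qed.

End descent.

(** * Average stationarity *)

Lemma mul_le_sum_cubes {R : realType} (a t : R) : 0 <= a -> 0 <= t ->
  a * t <= 1 + a ^+ 3 + t ^+ 3.
Proof.
move=> a0 t0; have ha : 0 <= (a - 1) ^+ 2 * (a + 1) by rewrite mulr_ge0 ?sqr_ge0 // addr_ge0.
have ht : 0 <= (t - 1) ^+ 2 * (t + 1) by rewrite mulr_ge0 ?sqr_ge0 // addr_ge0.
have h := sqr_ge0 (a - t); have a1 := sqr_ge0 (a - 1); have t1 := sqr_ge0 (t - 1).
have a3 : 0 <= a ^+ 3 by rewrite exprn_ge0.
have t3 : 0 <= t ^+ 3 by rewrite exprn_ge0.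
nra.
Qed.

Lemma sqr_le_cube {R : realType} (t : R) : 0 <= t -> t ^+ 2 <= 1 + t ^+ 3.
Proof.
move=> t0; have ht : 0 <= (t - 1) ^+ 2 * (t + 1) by rewrite mulr_ge0 ?sqr_ge0 // addr_ge0.
have := exprn_ge0 3 t0; nra.
Qed.

Lemma le_cube {R : realType} (t : R) : 0 <= t -> t <= 1 + t ^+ 3.
Proof.
move=> t0; have ht : 0 <= (t - 1) ^+ 2 * (t + 1) by rewrite mulr_ge0 ?sqr_ge0 // addr_ge0.
have := exprn_ge0 3 t0; nra.
Qed.

Lemma mul_sqr_le_cubes {R : realType} (a t : R) : 0 <= a -> 0 <= t ->
  a * t ^+ 2 <= a ^+ 3 + t ^+ 3.
Proof.
move=> a0 t0; case: (leP a t) => at_.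
  rewrite [X in _ <= _ + X]exprS; apply: le_trans (ler_wpM2r (sqr_ge0 t) at_) _.
  by rewrite lerDr exprn_ge0.
rewrite [X in _ <= X + _]exprS.
have h : t ^+ 2 <= a ^+ 2 by rewrite ler_pXn2r ?nnegrE // ltW.
by apply: le_trans (ler_wpM2l a0 h) _; rewrite lerDl exprn_ge0.
Qed.

Section scaled_inequalities.
Context {R : realType} (c s : R) (c0 : 0 < c) (s0 : 0 < s).
Let cn := lt0r_neq0 c0.
Let sn := lt0r_neq0 s0.

(** This inequality and the next ones compare [x / s] and [a / (c * s)] with 1,
    and are then multiplied by the scale of the left-hand side. *)
Lemma scaled_mul a x : 0 <= a -> 0 <= x ->
  a * x <= c * s ^+ 2 + a ^+ 3 / (c ^+ 2 * s) + s^-1 * (c * x ^+ 3).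
Proof.
move=> a0 x0; have q : 0 <= c * s ^+ 2 by rewrite mulr_ge0 ?sqr_ge0 // ltW.
have h1 : 0 <= a / (c * s) by rewrite divr_ge0 // mulr_ge0 // ltW.
have h2 : 0 <= x / s by rewrite divr_ge0 // ltW.
have := ler_wpM2l q (mul_le_sum_cubes h1 h2).
have -> : c * s ^+ 2 * (a / (c * s) * (x / s)) = a * x by field; rewrite cn sn.
congr (_ <= _); field; rewrite cn sn //.
Qed.

Lemma scaled_sqr x : 0 <= x -> c * x ^+ 2 <= c * s ^+ 2 + s^-1 * (c * x ^+ 3).
Proof.
move=> x0; have q : 0 <= c * s ^+ 2 by rewrite mulr_ge0 ?sqr_ge0 // ltW.
have h2 : 0 <= x / s by rewrite divr_ge0 // ltW.
have := ler_wpM2l q (sqr_le_cube h2).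
have -> : c * s ^+ 2 * (x / s) ^+ 2 = c * x ^+ 2 by field.
congr (_ <= _); field; rewrite //.
Qed.

Lemma scaled_lin x : 0 <= x -> c * x <= c * s + (s ^+ 2)^-1 * (c * x ^+ 3).
Proof.
move=> x0; have q : 0 <= c * s by rewrite mulr_ge0 // ltW.
have h2 : 0 <= x / s by rewrite divr_ge0 // ltW.
have := ler_wpM2l q (le_cube h2).
have -> : c * s * (x / s) = c * x by field.
congr (_ <= _); field; rewrite //.
Qed.

Lemma scaled_err a : 0 <= a -> a <= c * s + a ^+ 3 / (c * s) ^+ 2.
Proof.
move=> a0; have q : 0 <= c * s by rewrite mulr_ge0 // ltW.
have h1 : 0 <= a / (c * s) by rewrite divr_ge0.
have := ler_wpM2l q (le_cube h1).
have -> : c * s * (a / (c * s)) = a by field; rewrite cn sn.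
congr (_ <= _); field; rewrite cn sn //.
Qed.

Lemma scaled_mul_sqr a x : 0 <= a -> 0 <= x -> a * x ^+ 2 <= a ^+ 3 / c ^+ 2 + c * x ^+ 3.
Proof.
move=> a0 x0; have h1 : 0 <= a / c by rewrite divr_ge0 // ltW.
have := ler_wpM2l (ltW c0) (mul_sqr_le_cubes h1 x0).
have -> : c * (a / c * x ^+ 2) = a * x ^+ 2 by field.
congr (_ <= _); field; rewrite //.
Qed.

(** The term [3 * b * u * x], which no moment bound covers, is split into [u / 4],
    to be absorbed by the gradients themselves, and a multiple of the progress. *)
Lemma gradient_step_scalar (b x eg eH ey u y : R) : 0 <= b -> b * s <= 1 -> 0 <= x -> 0 <= eH ->
  0 <= ey -> 0 <= u -> 0 <= y -> u <= y + ey -> y <= u + ey ->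
  eg + eH * x + 9 * c * x ^+ 2 + b * u * x + 2 * b * y * x <=
  eg + 12 * (c * s ^+ 2) + 21 / s * (c * x ^+ 3 + b / 2 * y * x ^+ 2)
    + 11 * ((eH ^+ 3 + (b * ey) ^+ 3) / (c ^+ 2 * s)) + u / 4.
Proof.
move=> b0 bs x0 eH0 ey0 u0 y0 uy yu.
pose w : R := b * ey; have w0 : 0 <= w by rewrite mulr_ge0.
have h1 := scaled_mul eH0 x0; have h2 := scaled_sqr x0; have h3 := scaled_mul w0 x0.
have h4 := scaled_mul_sqr w0 x0.
have bx : 0 <= b * x by rewrite mulr_ge0.
have h5 : 2 * b * y * x <= 2 * (b * u * x) + 2 * (w * x).
  have := ler_wpM2l bx yu; rewrite /w; lra.
have h6 : 3 * (b * u * x) <= u / 4 + 9 * (b * (b * u * x ^+ 2)).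
  have := mulr_ge0 u0 (sqr_ge0 (1 - 6 * (b * x))); lra.
have h7 : b * u * x ^+ 2 <= b * y * x ^+ 2 + w * x ^+ 2.
  have := ler_wpM2l (mulr_ge0 b0 (sqr_ge0 x)) uy; rewrite /w; lra.
have bs1 : b <= s^-1 by rewrite -[s^-1]mul1r ler_pdivlMr.
have q0 : 0 <= b * u * x ^+ 2 by rewrite !mulr_ge0 ?sqr_ge0.
have s10 : 0 <= s^-1 by rewrite invr_ge0 ltW.
have h8 : b * (b * u * x ^+ 2) <= s^-1 * (b * y * x ^+ 2 + (w ^+ 3 / c ^+ 2 + c * x ^+ 3)).
  apply: le_trans (ler_wpM2r q0 bs1) _; apply: ler_wpM2l => //.
  by apply: le_trans h7 _; rewrite lerD2l.
have e1 : s^-1 * (b * y * x ^+ 2 + (w ^+ 3 / c ^+ 2 + c * x ^+ 3)) =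
  s^-1 * (b * y * x ^+ 2) + w ^+ 3 / (c ^+ 2 * s) + s^-1 * (c * x ^+ 3).
  by field; rewrite cn sn.
rewrite e1 in h8.
have e2 : 21 / s * (c * x ^+ 3 + b / 2 * y * x ^+ 2) =
  21 * (s^-1 * (c * x ^+ 3)) + 21 / 2 * (s^-1 * (b * y * x ^+ 2)) by field.
have e3 : (eH ^+ 3 + (b * ey) ^+ 3) / (c ^+ 2 * s) = eH ^+ 3 / (c ^+ 2 * s) + w ^+ 3 / (c ^+ 2 * s).
  by rewrite mulrDl.
rewrite e2 e3.
have p1 : 0 <= s^-1 * (b * y * x ^+ 2) by rewrite !mulr_ge0 ?sqr_ge0.
have p2 : 0 <= eH ^+ 3 / (c ^+ 2 * s) by rewrite divr_ge0 ?exprn_ge0 // mulr_ge0 ?sqr_ge0 // ltW.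
have p3 : 0 <= w ^+ 3 / (c ^+ 2 * s) by rewrite divr_ge0 ?exprn_ge0 // mulr_ge0 ?sqr_ge0 // ltW.
have e4 : 9 * c * x ^+ 2 = 9 * (c * x ^+ 2) by ring.
rewrite e4.
clear e1 e2 e3 e4 q0 bs1 s10 h7 h4 bx.
move: h1 h2 h3 h5 h6 h8 p1 p2 p3.
move: (b * (b * u * x ^+ 2)) (s^-1 * (b * y * x ^+ 2)) (eH ^+ 3 / _) (w ^+ 3 / _) (s^-1 * (c * _))
  (c * s ^+ 2) (c * x ^+ 2) (eH * x) (w * x) (2 * b * y * x) (b * u * x) => A1 A2 A3 A4 A5 A6 A7 A8 A9 A10 A11.
lra.
Qed.

Lemma curvature_step_scalar (b x eH ey u u' y : R) : 0 <= b -> 0 <= x -> 0 <= eH ->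
  0 <= ey -> 0 <= y -> y <= u + ey ->
  12 * c * x + eH + 2 * b * y + b * u' <=
  15 * (c * s) + 12 / s ^+ 2 * (c * x ^+ 3 + b / 2 * y * x ^+ 2)
    + 2 * ((eH ^+ 3 + (b * ey) ^+ 3) / (c * s) ^+ 2) + b * (2 * u + u').
Proof.
move=> b0 x0 eH0 ey0 y0 yu.
pose w : R := b * ey; have w0 : 0 <= w by rewrite mulr_ge0.
have h1 := scaled_lin x0; have h2 := scaled_err eH0; have h3 := scaled_err w0.
have h4 := ler_wpM2l b0 yu.
have e2 : 12 / s ^+ 2 * (c * x ^+ 3 + b / 2 * y * x ^+ 2) =
  12 * ((s ^+ 2)^-1 * (c * x ^+ 3)) + 6 * ((s ^+ 2)^-1 * (b * y * x ^+ 2)) by field.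
have e3 : (eH ^+ 3 + (b * ey) ^+ 3) / (c * s) ^+ 2 = eH ^+ 3 / (c * s) ^+ 2 + w ^+ 3 / (c * s) ^+ 2.
  by rewrite mulrDl.
rewrite e2 e3.
have p1 : 0 <= (s ^+ 2)^-1 * (b * y * x ^+ 2) by rewrite !mulr_ge0 ?invr_ge0 ?sqr_ge0.
have p2 : 0 <= eH ^+ 3 / (c * s) ^+ 2 by apply: divr_ge0; [exact: exprn_ge0|exact: sqr_ge0].
have e5 : b * (u + ey) = b * u + w by rewrite mulrDr.
rewrite e5 in h4; clear e2 e3 e5.
have e6 : 12 * c * x = 12 * (c * x) by ring.
have e7 : 2 * b * y = 2 * (b * y) by ring.
have e8 : b * (2 * u + u') = 2 * (b * u) + b * u' by ring.
rewrite e6 e7 e8; clear e6 e7 e8.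
clearbody w; move: h1 h2 h3 h4 p1 p2.
move: (c * s) (c * x) (b * y) (b * u) (b * u') ((s ^+ 2)^-1 * (b * y * x ^+ 2))
  ((s ^+ 2)^-1 * _) (eH ^+ 3 / _) (w ^+ 3 / _) => A1 A2 A3 A4 A5 A6 A7 A8 A9.
lra.
Qed.

End scaled_inequalities.

(** As [u k <= g k], a quarter of the sum on the left reappears on the right and
    is moved back; only [u 0] has no counterpart on the left. *)
Lemma absorbed_sum {R : realType} (T : nat) (g u A : nat -> R) :
  (forall k, (k < T)%N -> g k.+1 <= A k + u k / 4) -> (forall k, 0 <= u k <= g k) ->
  \sum_(k < T) g k.+1 <= 4 / 3 * (\sum_(k < T) A k + u 0%N / 4).
Proof.
move=> h hu.
have u0 k : 0 <= u k by case/andP: (hu k).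
have h1 : \sum_(k < T) g k.+1 <= \sum_(k < T) A k + (\sum_(k < T) u k) / 4.
  by rewrite mulr_suml -big_split /=; apply: ler_sum => k _; exact: h.
have h2 : \sum_(k < T) u k <= u 0%N + \sum_(k < T) g k.+1.
  case: (T) => [|T']; first by rewrite !big_ord0 addr0.
  rewrite big_ord_recl lerD2l [X in _ <= X]big_ord_recr /=; apply: ler_wpDr.
    by apply: le_trans (u0 T'.+1) _; case/andP: (hu T'.+1).
  by apply: ler_sum => k _; case/andP: (hu k.+1).
lra.
Qed.

Lemma shifted_sum {R : realType} (T : nat) (g u : nat -> R) : (forall k, 0 <= u k <= g k) ->
  \sum_(k < T) (2 * u k + u k.+1) <= 2 * u 0%N + 3 * \sum_(k < T) g k.+1.
Proof.
move=> hu; have u0 k : 0 <= u k by case/andP: (hu k).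
have h2 : \sum_(k < T) u k <= u 0%N + \sum_(k < T) g k.+1.
  case: (T) => [|T']; first by rewrite !big_ord0 addr0.
  rewrite big_ord_recl lerD2l [X in _ <= X]big_ord_recr /=; apply: ler_wpDr.
    by apply: le_trans (u0 T'.+1) _; case/andP: (hu T'.+1).
  by apply: ler_sum => k _; case/andP: (hu k.+1).
have h3 : \sum_(k < T) u k.+1 <= \sum_(k < T) g k.+1.
  by apply: ler_sum => k _; case/andP: (hu k.+1).
rewrite big_split /= -mulr_sumr; lra.
Qed.

Lemma measurable_root {R : realType} d (T : measurableType d) (Y : T -> R) k :
  (forall w, 0 <= Y w) -> measurable_fun [set: T] (fun w => Y w ^+ k.+1) ->
  measurable_fun [set: T] Y.
Proof.
move=> Y0 mY; have -> : Y = fun w => (Y w ^+ k.+1) `^ (k.+1%:R^-1).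
  apply/funext => w; rewrite -powR_mulrn // -powRrM divff ?pnatr_eq0 // powRr1 //.
by apply: measurableT_comp (measurable_powR _) mY.
Qed.

Section average_stationarity.
Context {R : realType} {n m : nat} {dX : measure_display} {Xi : measurableType dX}
  (Z : probability Xi R) (F : 'cV[R]_(n + m) -> Xi -> R) (f : 'cV[R]_(n + m) -> R)
  {dO : measure_display} {Om : measurableType dO} (P : probability Om R)
  (p : sacqrn_params R) (z0 : 'cV[R]_(n + m)) (r : sacqrn_run Z F P p z0) (mu L : R).
Context (hd : deterministic_assumptions f mu L (p_rho p))
  (hs : stochastic_assumptions Z F f L (p_rho p) (p_sigma1 p) (p_sigma2 p))
  (m0 : (0 < m)%N) (cal : calibrated p mu L).
Local Notation T := (iter_count p).
Local Notation beta := (p_beta p).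
Local Notation rho := (p_rho p).
Local Notation b := (p_beta p * p_rho p).
Local Notation c := (p_c p).
Local Notation s := (step_scale p).
Local Notation h := (h_beta f beta).
Local Notation u z := (frobenius (ygrad f z)).
Local Notation z_ := (r_z r).
Local Notation G z := (frobenius (grad h z)).
Local Notation Delta := (p_Delta0 p).
Context (hz0 : h z0 - Phi_bar f <= p_Delta0 p) (small : 6 * (c * s ^+ 3) <= Delta)
  (bs1 : b * s <= 1) (small_start : 2 * s * Num.sqrt (4 * mu * Delta) <= Delta).
Let Cf := det_C3 hd.
Let mu0 := det_mu_gt0 hd.
Let rho0 := det_rho_gt0 hd.
Let L0 := det_L_gt0 hd.
Let b0 : 0 <= b. Proof. by rewrite mulr_ge0 // ltW // (beta_gt0 hd cal). Qed.
Let be0 : 0 <= beta. Proof. by rewrite ltW // (beta_gt0 hd cal). Qed.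
Let c0 := p_c_gt0 hd cal.
Let s0 := step_scale_gt0 hd cal.
Let cs2 : 0 < c * s ^+ 2. Proof. by rewrite mulr_gt0 ?exprn_gt0. Qed.
Let cs3 : 0 < c * s ^+ 3. Proof. by rewrite mulr_gt0 ?exprn_gt0. Qed.
Let small4 : 4 * (c * s ^+ 3) <= Delta. Proof. by apply: le_trans small; rewrite ler_pM2r // ler_nat. Qed.

Lemma ygrad_le_gradient z : 0 <= u z <= G z.
Proof. by rewrite frob_ge0 (ygrad_le_grad_h hd be0 _ (cal_beta cal)). Qed.

Lemma ygrad_gy_distance k w : u (z_ k w) <= frobenius (r_gy r k w) + frobenius (y_error f r k w)
  /\ frobenius (r_gy r k w) <= u (z_ k w) + frobenius (y_error f r k w).
Proof.
rewrite -[X in X <= _]enorm_grad_y -[X in _ /\ _ <= X + _]enorm_grad_y enorm_frob.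
split.
  have := frob_triangle (r_gy r k w) (- y_error f r k w).
  by rewrite frobN /y_error opprB addrC subrK.
have := frob_triangle (grad_y f (z_ k w)) (y_error f r k w).
by rewrite /y_error addrC subrK.
Qed.

Definition error_cubes k w :=
  frobenius (H_error f r k w) ^+ 3 + (b * frobenius (y_error f r k w)) ^+ 3.

Lemma gradient_step k w : (k < T)%N -> G (z_ k.+1 w) <=
  (frobenius (g_error f r k w) + 12 * (c * s ^+ 2) + 21 / s * progress r k w
    + 11 * (error_cubes k w / (c ^+ 2 * s))) + u (z_ k w) / 4.
Proof.
move=> kT; have [h1 h2] := ygrad_gy_distance k w.
have := @one_step_grad _ _ _ _ _ _ _ _ hd be0 (z_ k w) _ _ _ _
  (run_H_sym r w kT) (run_model_min r cal w kT).
rewrite -r_zS // -(cal_c cal) -/(g_error f r k w) -/(H_error f r k w).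
rewrite -[2 * beta * rho]mulrA => /le_trans; apply.
have := gradient_step_scalar c0 s0 (frobenius (g_error f r k w)) b0 bs1 (frob_ge0 (r_xi r k w))
  (frob_ge0 (H_error f r k w)) (frob_ge0 (y_error f r k w)) (frob_ge0 (ygrad f (z_ k w)))
  (frob_ge0 (r_gy r k w)) h1 h2.
exact.
Qed.

Lemma error_cubes_bound k : (k < T)%N -> Ebound P (error_cubes k) (8 * (c * s) ^+ 3).
Proof.
move=> kT; apply: Eb_weaken (EbD (H_error_bound r hd hs cal kT) (y_error_bound r hd hs cal kT)) _.
by rewrite -mulrDl -natrD.
Qed.

Lemma g_error_mean k : (k < T)%N ->
  Ebound P (fun w => frobenius (g_error f r k w)) (c * s ^+ 2 / 4).
Proof.
move=> kT.
have := g_error_bound hd hs m0 cal kT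
  (fun j jk => ygrad_second_moment r hd hs m0 cal hz0 small4 (leq_trans jk (ltnW kT))).
have -> : (c * s ^+ 2) ^+ 2 / 16 = (c * s ^+ 2 / 4) ^+ 2 by field.
move=> hE; apply: Eb_of_sqr (hE); last by move=> w; exact: frob_ge0.
  by rewrite divr_ge0 // ltW.
apply: measurable_root (Eb_meas hE) => w; exact: frob_ge0.
Qed.

Lemma measurable_gradient_norm k : (k <= T)%N -> measurable_fun [set: Om] (fun w => G (z_ k w)).
Proof.
move=> kT; apply: mxmeas_frob; apply: mxmeas_grad_comp (class_C_h_beta beta Cf) _.
exact: mxmeas_z_Om.
Qed.

Lemma initial_u : u z0 <= Num.sqrt (4 * mu * Delta).
Proof.
have := Eb_le (ygrad_second_moment r hd hs m0 cal hz0 small4 (leq0n T)).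
under eq_integral do rewrite r_z0.
rewrite integral_cst //= probability_setT mule1 lee_fin => h2.
by rewrite -(@ger0_norm _ (u z0)) ?frob_ge0 // -sqrtr_sqr ler_wsqrtr.
Qed.

Lemma initial_u_scale : u z0 <= 3 * (c * s ^+ 2 * T%:R).
Proof.
apply: le_trans initial_u _; have hT := iter_count_ge hd cal.
have -> : 3 * (c * s ^+ 2 * T%:R) = (T%:R * (6 * (c * s ^+ 3))) / (2 * s).
  by field; exact: lt0r_neq0.
by rewrite ler_pdivlMr ?mulr_gt0 // mulrC; exact: le_trans small_start hT.
Qed.

Lemma progress_scale : Ebound P (fun w => \sum_(k < T) progress r k w) (12 * (c * s ^+ 3) * T%:R).
Proof.
apply: Eb_weaken (total_progress r hd hs m0 cal hz0 small4) _.
have := iter_count_ge hd cal; move: (c * _) => q; lra.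
Qed.

Lemma const_sum (q : R) : \sum_(k < T) q = q * T%:R.
Proof. by rewrite sumr_const card_ord mulr_natr. Qed.

Lemma gradient_total : Ebound P (fun w => \sum_(k < T) G (z_ k.+1 w)) (500 * (c * s ^+ 2) * T%:R).
Proof.
have q1 : 0 <= 21 / s by rewrite divr_ge0 // ltW.
have q2 : 0 <= 11 / (c ^+ 2 * s) by rewrite divr_ge0 // mulr_ge0 ?sqr_ge0 // ltW.
have B1 : Ebound P (fun w => \sum_(k < T) (frobenius (g_error f r k w) + 12 * (c * s ^+ 2)
    + 11 / (c ^+ 2 * s) * error_cubes k w))
    (\sum_(k < T) (c * s ^+ 2 / 4 + 12 * (c * s ^+ 2) + 11 / (c ^+ 2 * s) * (8 * (c * s) ^+ 3))).
  apply: Eb_sum => k; apply: EbD; last by apply: EbZ => //; exact: error_cubes_bound.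
  by apply: EbD; [exact: g_error_mean|apply: Eb_cst; rewrite mulr_ge0 // ltW].
have q0 : 0 <= u z0 / 4 by rewrite divr_ge0 // frob_ge0.
have q3 : 0 <= 4 / 3 :> R by [].
have B := EbZ q3 (EbD (EbD B1 (EbZ q1 progress_scale)) (Eb_cst P q0)).
apply: Eb_weaken (Eb_mono _ _ B) _.
- by apply: measurable_sum => k; exact: measurable_gradient_norm.
- move=> w; apply/andP; split; first by apply: sumr_ge0 => k _; exact: frob_ge0.
  rewrite mulr_sumr -big_split /= -[X in u X](r_z0 r w).
  apply: (@absorbed_sum _ T (fun k => G (z_ k w)) (fun k => u (z_ k w))
    (fun k => frobenius (g_error f r k w) + 12 * (c * s ^+ 2) + 11 / (c ^+ 2 * s) * error_cubes k w
      + 21 / s * progress r k w)) => [k kT|k]; last exact: ygrad_le_gradient.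
  have := gradient_step w kT.
  have -> : 11 * (error_cubes k w / (c ^+ 2 * s)) = 11 / (c ^+ 2 * s) * error_cubes k w.
    by rewrite mulrCA mulrC.
  by move/le_trans; apply; rewrite lerD2r addrAC.
rewrite const_sum; have hu := initial_u_scale.
have -> : 21 / s * (12 * (c * s ^+ 3) * T%:R) = 252 * (c * s ^+ 2 * T%:R).
  by field; exact: lt0r_neq0.
have -> : (c * s ^+ 2 / 4 + 12 * (c * s ^+ 2) + 11 / (c ^+ 2 * s) * (8 * (c * s) ^+ 3)) * T%:R
  = (4^-1 + 12 + 88) * (c * s ^+ 2 * T%:R).
  by field; rewrite !lt0r_neq0.
(* 1/4 + 12 + 88 from the errors, 252 from the progress and 3/4 from the start,
   times 4/3, is less than 500. *)
rewrite -[500 * (c * s ^+ 2) * T%:R]mulrA.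
have : 0 <= c * s ^+ 2 * T%:R by rewrite mulr_ge0 // ltW.
move: (c * s ^+ 2 * _) hu => q; lra.
Qed.

Definition curvature k w := 12 * c * frobenius (r_xi r k w) + frobenius (H_error f r k w)
  + 2 * beta * rho * frobenius (r_gy r k w) + b * u (z_ k.+1 w).

Lemma curvature_ge0 k w : 0 <= curvature k w.
Proof.
by rewrite /curvature -[2 * beta * rho]mulrA !addr_ge0 ?frob_ge0 // !mulr_ge0 ?frob_ge0 // ltW.
Qed.

Lemma measurable_curvature k : (k < T)%N -> measurable_fun [set: Om] (curvature k).
Proof.
move=> kT; apply: measurable_funD; last first.
  apply: measurable_funM => //; apply: mxmeas_frob; apply: (mxmeas_ygrad hd); exact: mxmeas_z_Om.
apply: measurable_funD; last by apply: measurable_funM => //; exact: (measurable_gy_norm r hs).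
apply: measurable_funD; first by apply: measurable_funM => //; exact: measurable_step_norm.
apply: measurable_root (Eb_meas (H_error_bound r hd hs cal kT)) => w; exact: frob_ge0.
Qed.

Lemma curvature_total : Ebound P (fun w => \sum_(k < T) curvature k w) (1700 * (c * s) * T%:R).
Proof.
have cs : 0 < c * s by rewrite mulr_gt0.
have q1 : 0 <= 12 / s ^+ 2 by rewrite divr_ge0 // sqr_ge0.
have q2 : 0 <= 2 / (c * s) ^+ 2 by rewrite divr_ge0 // sqr_ge0.
have B1 : Ebound P (fun w => \sum_(k < T) (15 * (c * s) + 2 / (c * s) ^+ 2 * error_cubes k w))
    (\sum_(k < T) (15 * (c * s) + 2 / (c * s) ^+ 2 * (8 * (c * s) ^+ 3))).
  apply: Eb_sum => k; apply: EbD; last by apply: EbZ => //; exact: error_cubes_bound.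
  by apply: Eb_cst; rewrite mulr_ge0 // ltW.
have q0 : 0 <= 2 * (b * u z0) by apply: mulr_ge0 => //; apply: mulr_ge0 b0 (frob_ge0 _).
have q3 : 0 <= 3 * b by rewrite mulr_ge0.
have B := EbD (EbD B1 (EbZ q1 progress_scale)) (EbD (Eb_cst P q0) (EbZ q3 gradient_total)).
apply: Eb_weaken (Eb_mono _ _ B) _.
- by apply: measurable_sum => k; exact: measurable_curvature.
- move=> w; apply/andP; split; first by apply: sumr_ge0 => k _; exact: curvature_ge0.
  have hu := @shifted_sum _ T (fun k => G (z_ k w)) (fun k => u (z_ k w)) (fun k => ygrad_le_gradient _).
  have := ler_wpM2l b0 hu; rewrite r_z0.
  have -> : b * (2 * u z0 + 3 * \sum_(k < T) G (z_ k.+1 w)) =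
     2 * (b * u z0) + 3 * b * \sum_(k < T) G (z_ k.+1 w) by ring.
  rewrite mulr_sumr => hb.
  apply: le_trans (lerD (lexx _) hb); rewrite mulr_sumr -!big_split /=; apply: ler_sum => k _.
  have [h1 h2] := ygrad_gy_distance k w; rewrite /curvature -[2 * beta * rho]mulrA.
  apply: le_trans (curvature_step_scalar c0 s0 _ b0 (frob_ge0 _) (frob_ge0 _) (frob_ge0 _) (frob_ge0 _) h2) _.
  rewrite -/(progress r k w) -/(error_cubes k w) lerD2r.
  have -> : 2 * (error_cubes k w / (c * s) ^+ 2) = 2 / (c * s) ^+ 2 * error_cubes k w.
    by rewrite mulrCA mulrC.
  by rewrite addrAC.
rewrite const_sum; have hu := initial_u_scale.
have -> : 12 / s ^+ 2 * (12 * (c * s ^+ 3) * T%:R) = 144 * (c * s * T%:R).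
  by field; exact: lt0r_neq0.
have -> : (15 * (c * s) + 2 / (c * s) ^+ 2 * (8 * (c * s) ^+ 3)) * T%:R = 31 * (c * s * T%:R).
  by field; rewrite !lt0r_neq0.
have q : 0 <= c * s * T%:R by rewrite mulr_ge0 // ltW.
have hb : b * (c * s ^+ 2 * T%:R) <= c * s * T%:R.
  have -> : b * (c * s ^+ 2 * T%:R) = b * s * (c * s * T%:R) by ring.
  by rewrite ler_piMl.
have h1 := ler_wpM2l b0 hu.
have -> : 3 * b * (500 * (c * s ^+ 2) * T%:R) = 1500 * (b * (c * s ^+ 2 * T%:R)) by ring.
(* 31 from the errors, 144 from the progress, 6 from the start and 1500 from the
   partial gradients add up to less than 1700. *)
rewrite -[1700 * (c * s) * T%:R]mulrA.
have e : b * (3 * (c * s ^+ 2 * T%:R)) = 3 * (b * (c * s ^+ 2 * T%:R)) by ring.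
rewrite e in h1; move: (b * (c * _ * _)) (c * s * _) (b * u _) hb q h1 => A1 A2 A3; lra.
Qed.

Lemma lambda_min_curvature k w : (0 < n + m)%N -> (k < T)%N ->
  - curvature k w <= lambda_min (hess h (z_ k.+1 w)).
Proof.
move=> d0 kT; apply: lambda_min_ge => // [|v].
  exact: hess_sym (class_C_h_beta beta Cf).
have := @one_step_hess _ _ _ _ _ _ _ _ hd be0 (z_ k w) _ _ _ _
  (run_H_sym r w kT) (run_model_min r cal w kT) v.
by rewrite -r_zS // -(cal_c cal).
Qed.

End average_stationarity.

(** * Oracle calls *)

Lemma checkpoint_count S T : (0 < S)%N -> ((\sum_(k < T) (S %| k)) * S <= T + S.-1)%N.
Proof.
move=> S0; elim: T => [|T IH]; first by rewrite big_ord0.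
rewrite big_ord_recr /=; case: (boolP (S %| T)%N) => ST /=; last by rewrite addn0; apply: leq_trans IH _; rewrite leq_add2r.
have [q qE] := dvdnP ST; move: IH; rewrite {}qE.
set N := (\sum_(k < _) _)%N => IH.
have Nq : (N <= q)%N.
  rewrite leqNgt; apply/negP => qN; have h : (q.+1 * S <= N * S)%N by rewrite leq_mul2r qN orbT.
  by move: (leq_trans h IH); rewrite mulSn addnC leq_add2l; case: (S) S0 => //= S' _; rewrite ltnn.
have : (N * S <= q * S)%N by rewrite leq_mul2r Nq orbT.
by rewrite mulnDl mul1n addSnnS prednK // leq_add2r.
Qed.

Lemma checkpoint_count_real {R : realType} S T : (0 < S)%N ->
  \sum_(k < T) (S %| k)%:R <= T%:R / S%:R + 1 :> R.
Proof.
move=> S0; have S0' : 0 < S%:R :> R by rewrite ltr0n.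
rewrite -natr_sum -[X in X <= _](@mulfK _ S%:R) ?lt0r_neq0 // ler_pdivrMr // mulrDl mul1r divfK ?lt0r_neq0 //.
rewrite -natrM -natrD ler_nat; apply: leq_trans (checkpoint_count T S0) _.
by rewrite leq_add2l leq_pred.
Qed.

Lemma cycle_total {R : realType} S T (N x2 : nat -> R) (A B : R) : (0 < S)%N -> 0 <= A -> 0 <= B ->
  (forall k, 0 <= x2 k) ->
  (forall k, (k < T)%N -> N k <= 1 + (if (S %| k)%N then A else B * x2 k.-1)) ->
  \sum_(k < T) N k <= T%:R + (T%:R / S%:R + 1) * A + B * \sum_(k < T) x2 k.
Proof.
move=> S0 A0 B0 x0 hN.
apply: le_trans (_ : \sum_(k < T) (1 + (S %| k)%:R * A + (if (k == 0 :> nat)%N then 0 else B * x2 k.-1)) <= _).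
  apply: ler_sum => k _; apply: le_trans (hN k (ltn_ord k)) _; rewrite -addrA lerD2l.
  case: (boolP (S %| k)%N) => Sk /=.
    by rewrite mul1r lerDl; case: ifP => // _; rewrite mulr_ge0.
  by rewrite mul0r add0r; case: (k : nat) Sk => //=; rewrite dvdn0.
rewrite !big_split /= sumr_const card_ord -mulr_suml; apply: lerD.
  by rewrite lerD2l ler_wpM2r // checkpoint_count_real.
rewrite mulr_sumr; case: (T) => [|T']; first by rewrite !big_ord0.
rewrite big_ord_recl /= add0r [X in _ <= X]big_ord_recr /=; apply: ler_wpDr; first by rewrite mulr_ge0.
by apply: ler_sum => k _.
Qed.

(** For a cycle length between [a / (d * s)] and its double, checkpoints and
    updates both cost of the order of [a * d * s * T]. *)
Lemma cycle_cost {R : realType} (c s D T S a d K : R) : 0 < c -> 0 < s -> 0 < a -> 0 < d -> 0 <= K ->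
  0 <= T -> T <= D / (3 * (c * s ^+ 3)) -> a / (d * s) <= S -> S <= 2 * (a / (d * s)) ->
  a * (c * s ^+ 2) <= d * D ->
  (T / S + 1) * (K * a ^+ 2) + K * d ^+ 2 * S * (13 * s ^+ 2 * T)
    <= 10 * (K * (a * d * D / (c * s ^+ 2))).
Proof.
move=> c0 s0 a0 d0 K0 T0 hT hS1 hS2 had.
have ds : 0 < d * s by rewrite mulr_gt0.
have ad : 0 < a * d by rewrite mulr_gt0.
have S0 : 0 < S by apply: lt_le_trans hS1; rewrite divr_gt0.
have hsT : s * T <= D / (c * s ^+ 2) / 3.
  have := ler_wpM2l (ltW s0) hT.
  by have -> : s * (D / (3 * (c * s ^+ 3))) = D / (c * s ^+ 2) / 3 by field; rewrite !lt0r_neq0.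
set E := D / (c * s ^+ 2) in hsT *.
have h1 : T / S * a ^+ 2 <= a * d * (s * T).
  have -> : T / S * a ^+ 2 = T * a * (a / S) by field; exact: lt0r_neq0.
  have -> : a * d * (s * T) = T * a * (d * s) by ring.
  by rewrite ler_wpM2l ?mulr_ge0 ?(ltW a0) // ler_pdivrMr // mulrC -ler_pdivrMr.
have h2 : d ^+ 2 * S * (s ^+ 2 * T) <= 2 * (a * d * (s * T)).
  have q : 0 <= d ^+ 2 * (s ^+ 2 * T) := mulr_ge0 (sqr_ge0 _) (mulr_ge0 (sqr_ge0 _) T0).
  have := ler_wpM2r q hS2.
  have -> : S * (d ^+ 2 * (s ^+ 2 * T)) = d ^+ 2 * S * (s ^+ 2 * T) by ring.
  by have -> : 2 * (a / (d * s)) * (d ^+ 2 * (s ^+ 2 * T)) = 2 * (a * d * (s * T))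
    by field; rewrite !lt0r_neq0.
have h3 : a ^+ 2 <= a * d * E.
  rewrite expr2 -mulrA ler_wpM2l ?(ltW a0) // /E mulrA ler_pdivlMr // mulr_gt0 // exprn_gt0 //.
have h4 := ler_wpM2l (ltW ad) hsT.
have -> : a * d * D / (c * s ^+ 2) = a * d * E by rewrite /E mulrA.
have -> : (T / S + 1) * (K * a ^+ 2) + K * d ^+ 2 * S * (13 * s ^+ 2 * T) =
  K * (T / S * a ^+ 2 + a ^+ 2 + 13 * (d ^+ 2 * S * (s ^+ 2 * T))) by ring.
rewrite [10 * _]mulrCA; apply: ler_wpM2l => //.
have e : a * d * (E / 3) = a * d * E / 3 by rewrite mulrA.
rewrite e in h4.
move: (a ^+ 2) (T / S * a ^+ 2) (d ^+ 2 * S * _) (a * d * E) (a * d * (s * T)) h1 h2 h3 h4 => A1 A2 A3 A4 A5; lra.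
Qed.

Lemma truncnS_bounds {R : realType} (q : R) : 1 <= q ->
  q <= (Num.truncn q).+1%:R /\ (Num.truncn q).+1%:R <= 2 * q.
Proof.
move=> q1; split; first exact: lt_truncnS.
have := truncn_le q; rewrite (le_trans ler01 q1) => h; rewrite -natr1; lra.
Qed.

Section oracle_calls.
Context {R : realType} {n m : nat} {dX : measure_display} {Xi : measurableType dX}
  (Z : probability Xi R) (F : 'cV[R]_(n + m) -> Xi -> R) (f : 'cV[R]_(n + m) -> R)
  {dO : measure_display} {Om : measurableType dO} (P : probability Om R)
  (p : sacqrn_params R) (z0 : 'cV[R]_(n + m)) (r : sacqrn_run Z F P p z0) (mu L : R).
Context (hd : deterministic_assumptions f mu L (p_rho p))
  (hs : stochastic_assumptions Z F f L (p_rho p) (p_sigma1 p) (p_sigma2 p))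
  (m0 : (0 < m)%N) (cal : calibrated p mu L).
Local Notation T := (iter_count p).
Local Notation beta := (p_beta p).
Local Notation rho := (p_rho p).
Local Notation sigma1 := (p_sigma1 p).
Local Notation sigma2 := (p_sigma2 p).
Local Notation eps := (p_eps p).
Local Notation c := (p_c p).
Local Notation c1 := (p_c1 p).
Local Notation c2 := (p_c2 p).
Local Notation c3 := (p_c3 p).
Local Notation s := (step_scale p).
Local Notation x_ k w := (enorm (r_xi r k w)).
Local Notation Delta := (p_Delta0 p).
Local Notation Ng k w := (size_g p k (r_xi r k.-1 w)).
Local Notation Nh k w := (size_h p k (r_xi r k.-1 w)).
Context (hz0 : h_beta f beta z0 - Phi_bar f <= p_Delta0 p) (small : 6 * (c * s ^+ 3) <= Delta).
Context (SgE : p_Sg p = (Num.truncn (Num.sqrt (c1 * c) / Num.sqrt (c2 * eps))).+1)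
  (ShE : p_Sh p = (Num.truncn (sigma2 * Num.sqrt c / (rho * Num.sqrt eps))).+1)
  (small_g : Num.sqrt c2 * s <= Num.sqrt c1)
  (small_g' : Num.sqrt c1 * (c * s ^+ 2) <= Num.sqrt c2 * Delta)
  (small_gT : c ^+ 2 * s ^+ 3 <= Num.sqrt c1 * Num.sqrt c2)
  (small_h : rho * s <= sigma2) (small_h' : sigma2 * (c * s ^+ 2) <= rho * Delta)
  (small_hT : c ^+ 2 * s <= sigma2 * rho * c3 ^+ 2).
Let Cf := det_C3 hd.
Let mu0 := det_mu_gt0 hd.
Let rho0 := det_rho_gt0 hd.
Let L0 := det_L_gt0 hd.
Let D0 := cal_Delta0 cal.
Let e0 := cal_eps cal.
Let be0 := beta_gt0 hd cal.
Let c0 := p_c_gt0 hd cal.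
Let s0 := step_scale_gt0 hd cal.
Let cs3 : 0 < c * s ^+ 3. Proof. by rewrite mulr_gt0 ?exprn_gt0. Qed.
Let s20 := sigma2_gt0 hd hs m0.
Let c10 : 0 < Num.sqrt c1.
Proof. by rewrite sqrtr_gt0; exact: c1_gt0 hd hs m0 D0 be0 (cal_c1 cal). Qed.
Let c20 : 0 < Num.sqrt c2.
Proof. by rewrite sqrtr_gt0; exact: c2_gt0 hd D0 be0 (cal_c2 cal). Qed.
Let q0 : 0 < Num.sqrt c. Proof. by rewrite sqrtr_gt0. Qed.
Let c30 : 0 < c3.
Proof. by rewrite (cal_c3 cal) ltr_pwDl // mulr_ge0 ?addr_ge0 // ltW. Qed.

Lemma sqrt_epsE : Num.sqrt eps = Num.sqrt c * s.
Proof.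
by rewrite {1}(eps_scale hd cal) sqrtrM ?(ltW c0) // sqrtr_sqr ger0_norm // ltW.
Qed.

Lemma iter_count_third : T%:R <= Delta / (3 * (c * s ^+ 3)).
Proof.
apply: le_trans (iter_count_le hd cal) _.
have h : 1 <= Delta / (6 * (c * s ^+ 3)) by rewrite ler_pdivlMr ?mul1r // mulr_gt0.
have -> : Delta / (3 * (c * s ^+ 3)) = Delta / (6 * (c * s ^+ 3)) + Delta / (6 * (c * s ^+ 3)).
  by field; rewrite !lt0r_neq0.
by rewrite lerD2l.
Qed.

Lemma squared_steps : Ebound P (fun w => \sum_(k < T) x_ k w ^+ 2) (13 * s ^+ 2 * T%:R).
Proof.
have q1 : 0 <= s ^+ 2 * T%:R by rewrite mulr_ge0 ?sqr_ge0.
have q2 : 0 <= (c * s)^-1 by rewrite invr_ge0 mulr_ge0 // ltW.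
apply: Eb_weaken (Eb_mono _ _ (EbD (Eb_cst P q1)
  (EbZ q2 (progress_scale r hd hs m0 cal hz0 small)))) _.
- apply: measurable_sum => k; apply: measurable_funX; apply: mxmeas_enorm; exact: mxmeas_xi_Om.
- move=> w; apply/andP; split; first by apply: sumr_ge0 => k _; exact: sqr_ge0.
  rewrite -const_sum mulr_sumr -big_split /=; apply: ler_sum => k _; rewrite enorm_frob.
  have := scaled_sqr c0 s0 (frob_ge0 (r_xi r k w)).
  have y0 : 0 <= beta * rho / 2 * frobenius (r_gy r k w) * frobenius (r_xi r k w) ^+ 2.
    by rewrite !mulr_ge0 ?frob_ge0 ?sqr_ge0 ?invr_ge0 // ltW.
  move=> h; rewrite -(ler_pM2l c0) (le_trans h) // mulrDr lerD2l.
  have -> : c * ((c * s)^-1 * progress r k w) = s^-1 * progress r k w.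
    by move: (progress _ _ _) => X; field; rewrite !lt0r_neq0.
  by rewrite ler_pM2l ?invr_gt0 // /progress lerDl.
rewrite le_eqVlt; apply/orP; left; apply/eqP; field; rewrite !lt0r_neq0 //.
Qed.

Lemma measurable_random_size (N : Om -> nat) (k : nat) :
  (forall j, measurable ([set w | N w = j] : set (g_sigma_algebraType (r_filt r k)))) ->
  measurable_fun [set: Om] (fun w => (N w)%:R : R).
Proof.
move=> mN; apply: (measurable_countable_pieces (N := N) (G := fun (j : nat) (_ : Om) => j%:R : R)) => [j|j|//];
  last exact: measurable_cst.
exact: measurable_event_of_past (run_past r k) _ (mN j).
Qed.

Lemma size_g_le k (x : 'cV[R]_(n + m)) : (size_g p k x)%:R <=
  1 + (if (p_Sg p %| k)%N then 64 / eps ^+ 2 * Num.sqrt c1 ^+ 2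
       else 64 / eps ^+ 2 * Num.sqrt c2 ^+ 2 * (p_Sg p)%:R * enorm x ^+ 2).
Proof.
have e2 : 0 <= 64 / eps ^+ 2 by rewrite divr_ge0 ?sqr_ge0.
have c1p : 0 < c1 by rewrite -sqrtr_gt0. have c2p : 0 < c2 by rewrite -sqrtr_gt0.
rewrite (sqr_sqrtr (ltW c1p)) (sqr_sqrtr (ltW c2p)) /size_g; case: (boolP (p_Sg p %| k)%N) => _.
  have -> : 64 / eps ^+ 2 * c1 = 64 * c1 / eps ^+ 2 by rewrite mulrAC.
  rewrite addrC; apply: least_pos_ge_le.
  by rewrite divr_ge0 ?sqr_ge0 // mulr_ge0 // ltW.
have -> : 64 / eps ^+ 2 * c2 * (p_Sg p)%:R * enorm x ^+ 2 = 64 * c2 * (p_Sg p)%:R * enorm x ^+ 2 / eps ^+ 2.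
  by ring.
rewrite -natr1 addrC lerD2l truncn_le.
apply: divr_ge0 (sqr_ge0 _); apply: mulr_ge0 (sqr_ge0 _); apply: mulr_ge0 (ler0n _ _).
by rewrite mulr_ge0 // ltW.
Qed.

Lemma size_h_le k (x : 'cV[R]_(n + m)) : (size_h p k x)%:R <=
  1 + (if (p_Sh p %| k)%N then 648 * c3 ^+ 2 / (c * eps) * sigma2 ^+ 2
       else 648 * c3 ^+ 2 / (c * eps) * rho ^+ 2 * (p_Sh p)%:R * enorm x ^+ 2).
Proof.
have ce : 0 < c * eps by rewrite mulr_gt0.
rewrite /size_h; case: (boolP (p_Sh p %| k)%N) => _.
  have -> : 648 * c3 ^+ 2 / (c * eps) * sigma2 ^+ 2 = 648 * sigma2 ^+ 2 * c3 ^+ 2 / (c * eps) by ring.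
  by rewrite addrC; apply: least_pos_ge_le; exact: weighted_sqr_ratio_ge0.
have -> : 648 * c3 ^+ 2 / (c * eps) * rho ^+ 2 * (p_Sh p)%:R * enorm x ^+ 2 =
   648 * rho ^+ 2 * c3 ^+ 2 * (p_Sh p)%:R * enorm x ^+ 2 / (c * eps) by ring.
rewrite -natr1 addrC lerD2l truncn_le.
apply: divr_ge0 (ltW ce); apply: mulr_ge0 (sqr_ge0 _); apply: mulr_ge0 (ler0n _ _).
apply: mulr_ge0 (sqr_ge0 _); exact: mulr_ge0 (ler0n _ _) (sqr_ge0 _).
Qed.

Lemma cycle_calls (N : nat -> Om -> nat) S (A B : R) : (0 < S)%N -> 0 <= A -> 0 <= B ->
  (forall k j, (k < T)%N -> measurable ([set w | N k w = j] : set (g_sigma_algebraType (r_filt r k)))) ->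
  (forall k w, (N k w)%:R <= 1 + (if (S %| k)%N then A else B * x_ k.-1 w ^+ 2)) ->
  Ebound P (fun w => \sum_(k < T) (N k w)%:R)
    (T%:R + ((T%:R / S%:R + 1) * A + B * (13 * s ^+ 2 * T%:R))).
Proof.
move=> S0 A0 B0 mN hN; rewrite addrA.
have q : 0 <= T%:R + (T%:R / S%:R + 1) * A by rewrite addr_ge0 // mulr_ge0 // addr_ge0 // divr_ge0.
apply: Eb_mono (EbD (Eb_cst P q) (EbZ B0 squared_steps)).
  by apply: measurable_sum => k; apply: measurable_random_size => j; exact: mN.
move=> w; rewrite sumr_ge0 //=.
by apply: (@cycle_total _ _ _ (fun k => (N k w)%:R) (fun k => x_ k w ^+ 2)) => // k; rewrite sqr_ge0.
Qed.

Local Notation gcost := (Num.sqrt (c1 * c2) * Delta * eps ^- 3).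
Local Notation hcost := (sigma2 * rho * c3 ^+ 2 * c^-1 * Delta * eps ^- 2).

Lemma iter_count_gcost : T%:R <= gcost.
Proof.
apply: le_trans iter_count_third _; rewrite sqrtrM; last by rewrite ltW // -sqrtr_gt0.
have -> : Num.sqrt c1 * Num.sqrt c2 * Delta * eps ^- 3 =
  Num.sqrt c1 * Num.sqrt c2 / (c ^+ 2 * s ^+ 3) * (Delta / (c * s ^+ 3)).
  by rewrite {1}(eps_scale hd cal); field; rewrite !lt0r_neq0.
have -> : Delta / (3 * (c * s ^+ 3)) = 3^-1 * (Delta / (c * s ^+ 3)).
  by field; rewrite !lt0r_neq0.
rewrite ler_pM2r ?divr_gt0 //; apply: le_trans (_ : 1 <= _); first lra.
by rewrite ler_pdivlMr ?mul1r // mulr_gt0 // exprn_gt0.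
Qed.

Lemma iter_count_hcost : T%:R <= hcost.
Proof.
apply: le_trans iter_count_third _.
have -> : hcost = sigma2 * rho * c3 ^+ 2 / (c ^+ 2 * s) * (Delta / (c * s ^+ 3)).
  by rewrite {1}(eps_scale hd cal); field; rewrite !lt0r_neq0.
have -> : Delta / (3 * (c * s ^+ 3)) = 3^-1 * (Delta / (c * s ^+ 3)).
  by field; rewrite !lt0r_neq0.
rewrite ler_pM2r ?divr_gt0 //; apply: le_trans (_ : 1 <= _); first lra.
by rewrite ler_pdivlMr ?mul1r // mulr_gt0 // exprn_gt0.
Qed.

Lemma g_calls : Ebound P (fun w => \sum_(k < T) (Ng k w)%:R) (641 * gcost).
Proof.
have c1p : 0 < c1 by rewrite -sqrtr_gt0. have c2p : 0 < c2 by rewrite -sqrtr_gt0.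
have K0 : 0 <= 64 / eps ^+ 2 by rewrite divr_ge0 ?sqr_ge0.
have hS : Num.sqrt (c1 * c) / Num.sqrt (c2 * eps) = Num.sqrt c1 / (Num.sqrt c2 * s).
  rewrite !sqrtrM ?(ltW c1p) ?(ltW c2p) // sqrt_epsE; field; rewrite !lt0r_neq0 //.
have [hS1 hS2] : Num.sqrt c1 / (Num.sqrt c2 * s) <= (p_Sg p)%:R /\
    (p_Sg p)%:R <= 2 * (Num.sqrt c1 / (Num.sqrt c2 * s)).
  by rewrite SgE hS; apply: truncnS_bounds; rewrite ler_pdivlMr ?mul1r // mulr_gt0.
have := cycle_cost c0 s0 c10 c20 K0 (ler0n _ T) iter_count_third hS1 hS2 small_g'.
have -> : 64 / eps ^+ 2 * (Num.sqrt c1 * Num.sqrt c2 * Delta / (c * s ^+ 2)) = 64 * gcost.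
  rewrite -(eps_scale hd cal) sqrtrM ?(ltW c1p) //; field; exact: lt0r_neq0.
move=> h; have hT := iter_count_gcost.
apply: Eb_weaken (cycle_calls (N := fun k w => Ng k w) (cal_Sg cal)
  (mulr_ge0 K0 (sqr_ge0 (Num.sqrt c1))) _ _ (fun k w => size_g_le k _)) _.
- by rewrite mulr_ge0 // mulr_ge0 // sqr_ge0.
- by move=> k j kT; exact: measurable_size_g.
- move: gcost hT h => M; move: (_ + _ * (13 * _ * _)) => Q; lra.
Qed.

Lemma h_calls : Ebound P (fun w => \sum_(k < T) (Nh k w)%:R) (6481 * hcost).
Proof.
have K0 : 0 <= 648 * c3 ^+ 2 / (c * eps).
  by apply: divr_ge0; [exact: mulr_ge0 (ler0n _ _) (sqr_ge0 _)|rewrite mulr_ge0 // ltW].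
have hS : sigma2 * Num.sqrt c / (rho * Num.sqrt eps) = sigma2 / (rho * s).
  rewrite sqrt_epsE; field; rewrite !lt0r_neq0 //.
have [hS1 hS2] : sigma2 / (rho * s) <= (p_Sh p)%:R /\ (p_Sh p)%:R <= 2 * (sigma2 / (rho * s)).
  by rewrite ShE hS; apply: truncnS_bounds; rewrite ler_pdivlMr ?mul1r // mulr_gt0.
have := cycle_cost c0 s0 s20 rho0 K0 (ler0n _ T) iter_count_third hS1 hS2 small_h'.
have -> : 648 * c3 ^+ 2 / (c * eps) * (sigma2 * rho * Delta / (c * s ^+ 2)) = 648 * hcost.
  rewrite -(eps_scale hd cal); field; rewrite !lt0r_neq0 //.
move=> h; have hT := iter_count_hcost.
apply: Eb_weaken (cycle_calls (N := fun k w => Nh k w) (cal_Sh cal)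
  (mulr_ge0 K0 (sqr_ge0 sigma2)) _ _ (fun k w => size_h_le k _)) _.
- by apply: mulr_ge0 (ler0n _ _); apply: mulr_ge0 K0 (sqr_ge0 _).
- by move=> k j kT; exact: measurable_size_h.
- move: hcost hT h => M; move: (_ + _ * (13 * _ * _)) => Q; lra.
Qed.

Local Notation ycost := (sigma1 ^+ 2 * beta ^+ 2 * rho ^+ 2 * (Num.sqrt c)^-1 * Delta * eps `^ (- (5 / 2))).

Lemma powR_five_halves : eps `^ (- (5 / 2)) = (Num.sqrt eps ^+ 5)^-1.
Proof.
by rewrite powRN [5 / 2]mulrC powRrM powR12_sqrt ?(ltW e0) // (powR_mulrn 5) // sqrtr_ge0.
Qed.

Lemma y_calls : T%:R * (size_y p)%:R <= 12 * ycost + gcost.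
Proof.
have ce : 0 < c * eps by rewrite mulr_gt0.
have x0 : 0 <= 36 * (sigma1 * beta * rho) ^+ 2 / (c * eps).
  by apply: divr_ge0 (ltW ce); exact: mulr_ge0 (ler0n _ _) (sqr_ge0 _).
have h := ler_wpM2l (ler0n R T) (least_pos_ge_le x0).
apply: le_trans h _; rewrite mulrDr mulr1; apply: lerD iter_count_gcost.
apply: le_trans (ler_wpM2r x0 iter_count_third) _.
rewrite le_eqVlt; apply/orP; left; apply/eqP.
rewrite powR_five_halves sqrt_epsE (eps_scale hd cal).
have cE : c = Num.sqrt c ^+ 2 by rewrite sqr_sqrtr // ltW.
move: (q0) (s0) => qp sp; rewrite cE; move: (Num.sqrt c) qp => q qp.
have q1 : Num.sqrt (q ^+ 2) = q by rewrite sqrtr_sqr ger0_norm // ltW.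
by rewrite ?q1; field; rewrite !lt0r_neq0.
Qed.

Lemma sum_expectation (X : 'I_T -> Om -> R) a : (forall k, measurable_fun [set: Om] (X k)) ->
  (forall k w, 0 <= X k w) -> Ebound P (fun w => \sum_(k < T) X k w) a ->
  (\sum_(k < T) 'E_P[X k] <= a%:E)%E.
Proof.
move=> mX X0 hX; apply: le_trans (Eb_le hX).
have EE k : ('E_P[X k] = \int[P]_w (X k w)%:E)%E by rewrite unlock.
rewrite (eq_bigr _ (fun k _ => EE k)) -ge0_integral_sum //=.
- rewrite le_eqVlt; apply/orP; left; apply/eqP.
  by apply: eq_integral => w _; rewrite sumEFin.
- by move=> k; exact/measurable_EFinP.
- by move=> k w _; rewrite lee_fin.
Qed.

Lemma hessian_calls_le : (hessian_calls r <= (20000 * hcost)%:E)%E.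
Proof.
have T0 : 0 <= hcost := le_trans (ler0n _ T) iter_count_hcost.
have h : Ebound P (fun w => \sum_(k < T) (Nh k w + Nh k w)%N%:R) (2 * (6481 * hcost)).
  have -> : (fun w => \sum_(k < T) (Nh k w + Nh k w)%N%:R) = fun w => 2 * \sum_(k < T) (Nh k w)%:R :> R.
    by apply/funext => w; rewrite mulr_sumr; apply: eq_bigr => k _; rewrite natrD mulr_natl mulr2n.
  by apply: EbZ => //; exact: h_calls.
have h' : Ebound P (fun w => \sum_(k < T) (Nh k w + Nh k w)%N%:R) (20000 * hcost).
  by apply: Eb_weaken (h) _; move: hcost T0 => M; lra.
rewrite /hessian_calls.
apply: (sum_expectation (X := fun (k : 'I_T) w => (Nh k w + Nh k w)%N%:R) _ _ h') => k; last first.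
  by move=> w; exact: ler0n.
under eq_fun do rewrite natrD.
by apply: measurable_funD; apply: measurable_random_size => j; exact: measurable_size_h.
Qed.

Lemma ycost_ge0 : 0 <= ycost.
Proof.
have h1 := mulr_ge0 (mulr_ge0 (sqr_ge0 sigma1) (sqr_ge0 beta)) (sqr_ge0 rho).
have h2 : 0 <= (Num.sqrt c)^-1 by rewrite invr_ge0 ltW.
exact: mulr_ge0 (mulr_ge0 (mulr_ge0 h1 h2) (ltW D0)) (powR_ge0 _ _).
Qed.

Lemma gradient_calls_le : (gradient_calls r <= (20000 * (gcost + ycost))%:E)%E.
Proof.
have T0 : 0 <= gcost := le_trans (ler0n _ T) iter_count_gcost.
have y0 := ycost_ge0.
have q : 0 <= T%:R * (size_y p)%:R :> R by rewrite mulr_ge0.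
have h : Ebound P (fun w => \sum_(k < T) (Ng k w + Ng k w + size_y p)%N%:R)
    (2 * (641 * gcost) + T%:R * (size_y p)%:R).
  have -> : (fun w => \sum_(k < T) (Ng k w + Ng k w + size_y p)%N%:R) =
      fun w => 2 * \sum_(k < T) (Ng k w)%:R + T%:R * (size_y p)%:R :> R.
    apply/funext => w; rewrite mulr_sumr [T%:R * _]mulrC -const_sum -big_split /=.
    by apply: eq_bigr => k _; rewrite !natrD mulr_natl mulr2n.
  by apply: EbD (Eb_cst P q); apply: EbZ => //; exact: g_calls.
have h' : Ebound P (fun w => \sum_(k < T) (Ng k w + Ng k w + size_y p)%N%:R) (20000 * (gcost + ycost)).
  apply: Eb_weaken (h) _; have := y_calls.
  move: gcost ycost (_ * (size_y p)%:R) T0 y0 q => M1 M2 M3; lra.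
rewrite /gradient_calls.
apply: (sum_expectation (X := fun (k : 'I_T) w => (Ng k w + Ng k w + size_y p)%N%:R) _ _ h') => k; last first.
  by move=> w; exact: ler0n.
under eq_fun do rewrite !natrD.
apply: measurable_funD => //.
by apply: measurable_funD; apply: measurable_random_size => j; exact: measurable_size_g.
Qed.

Lemma c_le_kappa : c <= 4 * (L / mu * rho).
Proof.
have k1 : 1 <= L / mu by rewrite ler_pdivlMr ?mul1r // (mu_le_L hd m0).
rewrite (cal_c cal) (cal_beta cal).
have -> : (3 * (2 * mu^-1) * L + 1) * rho / 6 = (L / mu) * rho + rho / 6.
  by field; exact: lt0r_neq0.
have := ler_wpM2r (ltW rho0) k1; rewrite mul1r; have := ltW rho0; move: (L / mu * rho) => Q; lra.
Qed.

Lemma sqrt_c_le : Num.sqrt c <= 2 * Num.sqrt (L / mu * rho).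
Proof.
have -> : 2 * Num.sqrt (L / mu * rho) = Num.sqrt (4 * (L / mu * rho)).
  have e4 : 4 = 2 ^+ 2 :> R by ring.
  by rewrite e4 [Num.sqrt (2 ^+ 2 * _)]sqrtrM ?sqr_ge0 // sqrtr_sqr ger0_norm.
by rewrite ler_wsqrtr // c_le_kappa.
Qed.

Lemma iterations_le : T%:R <= 20000 * (Num.sqrt (L / mu * rho) * Delta * eps `^ (- (3 / 2))).
Proof.
apply: le_trans iter_count_third _; rewrite powRN powR_three_halves ?(ltW e0) // sqrt_epsE.
have -> : Delta / (3 * (c * s ^+ 3)) = Num.sqrt c * (Delta * (3 * (Num.sqrt c * s) ^+ 3)^-1).
  have cE : c = Num.sqrt c ^+ 2 by rewrite sqr_sqrtr // ltW.
  by rewrite {1}cE; field; rewrite !lt0r_neq0.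
have k0 : 0 <= Delta * (3 * (Num.sqrt c * s) ^+ 3)^-1.
  apply: mulr_ge0 (ltW D0) _; rewrite invr_ge0; apply: mulr_ge0 => //; apply: exprn_ge0.
  by rewrite mulr_ge0 // ltW.
apply: le_trans (ler_wpM2r k0 sqrt_c_le) _.
have -> : 2 * Num.sqrt (L / mu * rho) * (Delta * (3 * (Num.sqrt c * s) ^+ 3)^-1) =
  2 / 3 * (Num.sqrt (L / mu * rho) * Delta * ((Num.sqrt c * s) ^+ 3)^-1).
  by field; rewrite !lt0r_neq0.
have : 0 <= Num.sqrt (L / mu * rho) * Delta * ((Num.sqrt c * s) ^+ 3)^-1.
  apply: mulr_ge0; first by rewrite mulr_ge0 ?sqrtr_ge0 // ltW.
  by rewrite invr_ge0 exprn_ge0 // mulr_ge0 // ltW.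
move: (_ * Delta * _) => Q; lra.
Qed.

End oracle_calls.

(** * The random output *)

Section random_index.
Context {R : realType} {dO : measure_display} {Om : measurableType dO} (P : probability Om R)
  (G : set (set Om)) (pG : past G).
Local Notation TG := (g_sigma_algebraType G).

(** The event is read as a sample with two values, to which [freeze] applies. *)
Lemma independent_event_integral (D : set Om) (t : R) (V : TG -> R) : measurable D -> 0 <= t ->
  (forall A, G A -> P (A `&` D) = (P A * t%:E)%E) ->
  measurable_fun [set: TG] V -> (forall w, 0 <= V w) ->
  (\int[P]_w (V w * \1_D w)%:E = t%:E * \int[P]_w (V w)%:E)%E.
Proof.
move=> mD t0 ind mV V0.
pose X w : bool := w \in D.
have XT : X @^-1` [set true] = D by apply/seteqP; split => w /=; rewrite /X; [move=> /set_mem|move=> /mem_set].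
have XF : X @^-1` [set false] = ~` D.
  by apply/seteqP; split => w /=; rewrite /X; [move=> /negbT/negP h Dw; apply: h; exact: mem_set|move=> h; apply/negbTE/negP => /set_mem].
have mX : measurable_fun [set: Om] X.
  move=> _ B _; rewrite setTI; have [] := set_bool B; move=> /eqP ->.
  - by rewrite XT.
  - by rewrite XF; exact: measurableC.
  - by rewrite preimage_set0.
  - by rewrite preimage_setT.
pose Xm : {mfun Om >-> bool} := HB.pack X (isMeasurableFun.Build _ _ _ _ _ mX).
pose Z : probability bool R := distribution P Xm.
have PD : P D = t%:E by have := ind _ (past_setT pG); rewrite setTI probability_setT mul1e.
have finP A : measurable A -> P A = (fine (P A))%:E by move=> mA; rewrite fineK // fin_num_measure.
have PDC : P (~` D) = (1 - t)%:E by rewrite probability_setC // PD.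
have indX A B : G A -> measurable B -> P (A `&` X @^-1` B) = (P A * Z B)%E.
  move=> GA _; have mA := past_measurable pG GA.
  have -> : Z B = P (X @^-1` B) by [].
  have [] := set_bool B; move=> /eqP ->.
  - by rewrite XT PD ind.
  - rewrite XF PDC.
    have : (P A = P (A `&` ~` D) + P (A `&` D))%E by rewrite -setDE; exact: measureDI.
    rewrite ind // (finP _ mA).
    have mAD : measurable (A `&` ~` D) by apply: measurableI => //; exact: measurableC.
    rewrite (finP _ mAD) -!EFinM -EFinD => -[e]; congr EFin; move: e.
    move: (fine _) (fine _) => a b e; rewrite mulrBr mulr1 [X in X - _]e; ring.
  - by rewrite preimage_set0 setI0 !measure0 mule0.
  - by rewrite preimage_setT setIT probability_setT mule1.
pose phi (x : TG * bool) : \bar R := (if x.2 then V x.1 else 0)%:E.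
have mphi : measurable_fun [set: TG * bool] phi.
  apply/measurable_EFinP; apply: measurable_fun_ifT => //.
  exact: measurableT_comp mV measurable_fst.
have phi0 x : (0 <= phi x)%E by rewrite /phi lee_fin; case: ifP.
have := freeze (past_measurable pG) (past_setI pG) (past_setT pG) mX indX mphi phi0.
have -> : (\int[P]_w phi (w, X w) = \int[P]_w (V w * \1_D w)%:E)%E.
  apply: eq_integral => w _; rewrite /phi /= /X indicE; case: (w \in D) => /=.
    by rewrite mulr1.
  by rewrite mulr0.
move=> ->.
have mVO := measurable_of_past pG mV.
have -> : (t%:E * \int[P]_w (V w)%:E = \int[P]_w (t%:E * (V w)%:E))%E.
  rewrite ge0_integralZl //=; first exact/measurable_EFinP.
  by move=> w _; rewrite lee_fin.
apply: eq_integral => w _; rewrite muleC.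
have -> : (\int[Z]_s phi (w, s) = \int[P]_v phi (w, X v))%E.
  by rewrite /Z ge0_integral_distribution.
have -> : (\int[P]_v phi (w, X v) = \int[P]_v ((V w)%:E * (\1_D v)%:E))%E.
  apply: eq_integral => v _; rewrite /phi /= /X indicE -EFinM; case: (v \in D) => /=.
    by rewrite mulr1.
  by rewrite mulr0.
rewrite ge0_integralZl //=.
- by rewrite integral_indic // setIT; congr (_ * _)%E; exact: PD.
- exact/measurable_EFinP.
- by rewrite lee_fin.
Qed.

Lemma random_index_mean (T : nat) (kt : Om -> nat) (V : nat -> Om -> R) a : (0 < T)%N ->
  (forall w, (1 <= kt w <= T)%N) -> (forall j, measurable (kt @^-1` [set j])) ->
  (forall A j, G A -> (1 <= j <= T)%N -> P (A `&` kt @^-1` [set j]) = (P A * (T%:R^-1)%:E)%E) ->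
  (forall j, (j <= T)%N -> measurable_fun [set: TG] (V j : TG -> R)) ->
  (forall j w, 0 <= V j w) ->
  Ebound P (fun w => \sum_(j < T) V j.+1 w) a ->
  Ebound P (fun w => V (kt w) w) (a / T%:R).
Proof.
move=> T0 ktT mkt unif mV V0 hV.
have mVO j : (j <= T)%N -> measurable_fun [set: Om] (V j).
  by move=> jT; exact: measurable_of_past pG _ _ _ (mV j jT).
have E w : V (kt w) w = \sum_(j < T) V j.+1 w * \1_(kt @^-1` [set j.+1]) w.
  have /andP[k1 kT] := ktT w.
  have k1T : ((kt w).-1 < T)%N by rewrite prednK.
  rewrite (bigD1 (Ordinal k1T)) //= prednK // indicE mem_set // mulr1 big1 ?addr0 // => j jk.
  rewrite indicE memNset ?mulr0 //= => e; move/eqP: jk; apply; apply: val_inj.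
  by rewrite /= e.
have mind j : measurable_fun [set: Om] (fun w => V j.+1 w * \1_(kt @^-1` [set j.+1]) w) \/ (T <= j)%N.
  case: (ltnP j T) => jT; [left|by right].
  by apply: measurable_funM; [exact: mVO|exact: measurable_indic].
split.
- have -> : (fun w => V (kt w) w) = fun w => \sum_(j < T) V j.+1 w * \1_(kt @^-1` [set j.+1]) w.
    by apply/funext => w; exact: E.
  by apply: measurable_sum => j; case: (mind j) => //; rewrite leqNgt ltn_ord.
- by move=> w; exact: V0.
have -> : (\int[P]_w (V (kt w) w)%:E =
    \int[P]_w \sum_(j < T) (V j.+1 w * \1_(kt @^-1` [set j.+1]) w)%:E)%E.
  by apply: eq_integral => w _; rewrite sumEFin E.
rewrite ge0_integral_sum //=; last 2 first.
- by move=> j; apply/measurable_EFinP; case: (mind j) => //; rewrite leqNgt ltn_ord.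
- by move=> j w _; rewrite lee_fin mulr_ge0 // indicE ler0n.
rewrite (eq_bigr (fun j : 'I_T => (T%:R^-1)%:E * \int[P]_w (V j.+1 w)%:E))%E; last first.
  move=> j _; apply: independent_event_integral => //.
  - by move=> A GA; apply: unif => //; rewrite ltn_ord.
  - exact: mV.
rewrite -ge0_sume_distrr; last by move=> j _; apply: integral_ge0 => w _; rewrite lee_fin.
rewrite -ge0_integral_sum //=; last 2 first.
- by move=> j; apply/measurable_EFinP; exact: mVO.
- by move=> j w _; rewrite lee_fin.
have -> : (\int[P]_w \sum_(j < T) (V j.+1 w)%:E = \int[P]_w (\sum_(j < T) V j.+1 w)%:E)%E.
  by apply: eq_integral => w _; rewrite sumEFin.
rewrite [a / _]mulrC EFinM; apply: lee_pmul => //; last exact: Eb_le hV.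
by apply: integral_ge0 => w _; rewrite lee_fin sumr_ge0.
Qed.

End random_index.

Section random_output.
Context {R : realType} {n m : nat} {dX : measure_display} {Xi : measurableType dX}
  (Z : probability Xi R) (F : 'cV[R]_(n + m) -> Xi -> R) (f : 'cV[R]_(n + m) -> R)
  {dO : measure_display} {Om : measurableType dO} (P : probability Om R)
  (p : sacqrn_params R) (z0 : 'cV[R]_(n + m)) (r : sacqrn_run Z F P p z0) (mu L : R).
Context (hd : deterministic_assumptions f mu L (p_rho p))
  (hs : stochastic_assumptions Z F f L (p_rho p) (p_sigma1 p) (p_sigma2 p))
  (m0 : (0 < m)%N) (cal : calibrated p mu L).
Local Notation T := (iter_count p).
Local Notation beta := (p_beta p).
Local Notation rho := (p_rho p).
Local Notation b := (p_beta p * p_rho p).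
Local Notation c := (p_c p).
Local Notation s := (step_scale p).
Local Notation h := (h_beta f beta).
Local Notation HW := (hess_model f beta).
Local Notation u z := (frobenius (ygrad f z)).
Local Notation z_ := (r_z r).
Local Notation G z := (frobenius (grad h z)).
Local Notation Delta := (p_Delta0 p).
Local Notation lam z := (lambda_min (hess h z)).
Local Notation TG k := (g_sigma_algebraType (r_filt r k)).
Context (hz0 : h z0 - Phi_bar f <= p_Delta0 p) (small : 6 * (c * s ^+ 3) <= Delta)
  (bs1 : b * s <= 1) (small_start : 2 * s * Num.sqrt (4 * mu * Delta) <= Delta).
Let Cf := det_C3 hd.
Let be0 : 0 <= beta. Proof. by rewrite ltW // (beta_gt0 hd cal). Qed.
Let c0 := p_c_gt0 hd cal.
Let s0 := step_scale_gt0 hd cal.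
Let rho0 := det_rho_gt0 hd.
Let L0 := det_L_gt0 hd.
Let d0 : (0 < n + m)%N. Proof. by rewrite addn_gt0 m0 orbT. Qed.
Let TR : 0 < T%:R :> R. Proof. by rewrite ltr0n. Qed.
Let T0 : (0 < T)%N. Proof. by []. Qed.

Lemma hess_h_sym z : (hess h z)^T = hess h z.
Proof. exact: hess_sym (class_C_h_beta beta Cf). Qed.

Lemma output_mean (V : 'cV[R]_(n + m) -> R) a : (forall z, 0 <= V z) ->
  (forall d' (T' : measurableType d') (y : T' -> 'cV[R]_(n + m)), mxmeas y ->
     measurable_fun [set: T'] (fun w => V (y w))) ->
  Ebound P (fun w => \sum_(k < T) V (z_ k.+1 w)) (a * T%:R) ->
  Ebound P (fun w => V (z_out r w)) a.
Proof.
move=> V0 mV hV; rewrite -[a](@mulfK _ T%:R) ?lt0r_neq0 //.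
apply: (random_index_mean (run_past r T) (V := fun j w => V (z_ j w)) T0 _ _ _ _ _ hV) => //.
- exact: r_ktilde_range.
- exact: r_ktilde_measurable.
- exact: r_ktilde_uniform.
- by move=> j jT; apply: mV; apply: (mxmeas_later (@run_filt_step _ _ _ _ _ _ _ _ _ _ _ _ r) jT); exact: mxmeas_run_z.
Qed.

Lemma mxmeas_z_out : mxmeas (z_out r : Om -> 'cV[R]_(n + m)).
Proof.
apply: (mxmeas_countable_pieces (N := r_ktilde r)
  (G := fun j w => if (j <= T)%N then z_ j w else 0)) => [j|j|w].
- exact: r_ktilde_measurable.
- by case: leqP => jT; [exact: mxmeas_z_Om|exact: mxmeas_cst].
- by have /andP[_ kT] := r_ktilde_range r w; rewrite kT.
Qed.

Lemma lambda_min_meas d' (T' : measurableType d') (y : T' -> 'cV[R]_(n + m)) : mxmeas y ->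
  measurable_fun [set: T'] (fun w => lam (y w)).
Proof.
move=> my; apply: (measurable_continuous_comp (g := fun z => lam z) _ my).
apply: lambda_min_continuous => // [z|i j]; first exact: hess_h_sym.
have -> : (fun z => hess h z i j) =
    'D_(delta_mx i 0 : 'cV[R]_(n + m)) (fun w => 'D_(delta_mx j 0 : 'cV[R]_(n + m)) h w).
  by apply/funext => z; rewrite mxE.
exact: class_C_continuous (class_C_derive (delta_mx i 0) (class_C_derive (delta_mx j 0) (class_C_h_beta beta Cf))).
Qed.

Lemma quadratic_form_h_le z (v : 'cV[R]_(n + m)) :
  `|fdot v (hess h z *m v)| <= ((1 + beta * L) * L + b * u z) * frobenius v ^+ 2.
Proof.
have h1 := hess_h_form hd be0 z v.
have h2 : `|fdot v (HW z *m v)| <= (1 + beta * L) * L * frobenius v ^+ 2.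
  apply: le_trans (_ : frobenius v * frobenius (HW z *m v) <= _).
    by rewrite ler_norml cauchy_schwarz cauchy_schwarzN.
  have := ler_wpM2l (frob_ge0 v) (opbound_hess_model hd be0 z v).
  by move/le_trans; apply; rewrite le_eqVlt; apply/orP; left; apply/eqP; ring.
rewrite mulrDl; move: h1 h2.
move: (fdot v (hess h z *m v)) (fdot v (HW z *m v)) ((1 + beta * L) * L * _) (b * u z * _) => A1 A2 A3 A4.
move=> h1 h2; rewrite -[A1](subrK A2) addrC [X in _ <= X]addrC.
by apply: le_trans (ler_normD _ _) _; rewrite addrC; exact: lerD.
Qed.

(** Makes the smallest eigenvalue at the output integrable, as [u] has a finite
    mean there. *)
Lemma lambda_min_abs z : `|lam z| <= (1 + beta * L) * L + b * u z.
Proof.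
rewrite ler_norml; apply/andP; split.
  apply: lambda_min_ge => // [|v]; first exact: hess_h_sym.
  by apply: le_trans (quadratic_form_h_le z v); rewrite -normrN ler_norm.
apply: lambda_min_le => // [|v]; first exact: hess_h_sym.
by apply: le_trans (quadratic_form_h_le z v); exact: ler_norm.
Qed.

Lemma output_gradient : Ebound P (fun w => G (z_out r w)) (500 * (c * s ^+ 2)).
Proof.
apply: (output_mean (V := fun z => G z)) => [z|d' T' y my|]; first exact: frob_ge0.
  by apply: mxmeas_frob; exact: mxmeas_grad_comp (class_C_h_beta beta Cf) my.
exact: (gradient_total r hd hs m0 cal hz0 small bs1 small_start).
Qed.

Lemma output_curvature : Ebound P (fun w => Num.max 0 (- lam (z_out r w))) (1700 * (c * s)).
Proof.
apply: (output_mean (V := fun z => Num.max 0 (- lam z))) => [z|d' T' y my|].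
- by rewrite le_max lexx.
- apply: measurable_maxr => //; apply: measurableT_comp => //; exact: lambda_min_meas.
apply: Eb_mono (curvature_total r hd hs m0 cal hz0 small bs1 small_start).
  apply: measurable_sum => k; apply: measurable_maxr => //; apply: measurableT_comp => //.
  by apply: lambda_min_meas; exact: mxmeas_z_Om.
move=> w; apply/andP; split; first by apply: sumr_ge0 => k _; rewrite le_max lexx.
apply: ler_sum => k _; rewrite ge_max (curvature_ge0 r hd cal) lerNl /=.
exact: (lambda_min_curvature r hd cal).
Qed.

Lemma output_lambda_integrable : P.-integrable setT (fun w => (lam (z_out r w))%:E).
Proof.
have K0 : 0 <= (1 + beta * L) * L by rewrite mulr_ge0 ?addr_ge0 ?mulr_ge0 // ltW.
have b0 : 0 <= b by rewrite mulr_ge0 // ltW.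
have hB := EbD (Eb_cst P K0) (EbZ b0 output_gradient).
have mlam := lambda_min_meas mxmeas_z_out.
apply/integrableP; split; first exact/measurable_EFinP.
apply: le_lt_trans (_ : \int[P]_w ((1 + beta * L) * L + b * G (z_out r w))%:E < +oo)%E; last first.
  by apply: le_lt_trans (Eb_le hB) _; rewrite ltry.
apply: ge0_le_integral => //.
- by apply/measurable_EFinP; apply: measurableT_comp.
- by apply/measurable_EFinP; exact: Eb_meas hB.
- move=> w _; rewrite lee_fin; apply: le_trans (lambda_min_abs _) _.
  by rewrite lerD2l ler_wpM2l // (ygrad_le_grad_h hd be0 _ (cal_beta cal)).
Qed.

Lemma output_sosp (e de : R) : 500 * (c * s ^+ 2) <= e -> 1700 * (c * s) <= de ->
  sosp_in_expectation h P (z_out r) e de.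
Proof.
move=> he hde; split; last 1 first.
- have [t tl [iN EN]] := Eb_has_ev output_curvature.
  apply: (@le_trans _ _ ((- t)%:E)); first by rewrite lee_fin lerN2 (le_trans tl).
  have [iM EM] := has_evZ (-1) (conj iN EN).
  have -> : ((- t)%:E = \int[P]_w (-1 * Num.max 0 (- lam (z_out r w)))%:E)%E by rewrite EM mulN1r.
  rewrite unlock; apply: le_integral => //; first exact: output_lambda_integrable.
  by move=> w _; rewrite lee_fin mulN1r lerNl le_max lexx orbT.
- have hG := output_gradient; rewrite unlock.
  under eq_integral do rewrite enorm_frob.
  by apply: le_trans (Eb_le hG) _; rewrite lee_fin.
- exact: output_lambda_integrable.
Qed.

End random_output.

(** * Complexity bounds *)

Lemma small_product (R : realType) (a b s : R) : 0 < b -> a / b * s <= 1 -> a * s <= b.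
Proof. by move=> b0; rewrite mulrAC ler_pdivrMr // mul1r. Qed.

Lemma mem_le_sum (R : realType) (ks : seq R) k : (forall k, k \in ks -> 0 <= k) ->
  k \in ks -> k <= \sum_(k <- ks) k.
Proof.
move=> ks0 kk; rewrite (big_rem k) //= lerDl big_seq.
by apply: sumr_ge0 => k' /mem_rem; exact: ks0.
Qed.

Theorem corollary4p6 (R : realType) :
  exists C : R, 0 < C /\
  forall (n m : nat) (d : measure_display) (Xi : measurableType d)
    (Z : probability Xi R) (F : 'cV[R]_(n + m) -> Xi -> R)
    (f : 'cV[R]_(n + m) -> R) (mu L rho sigma1 sigma2 Delta0 : R),
  (0 < n)%N -> (0 < m)%N ->
  deterministic_assumptions f mu L rho ->
  stochastic_assumptions Z F f L rho sigma1 sigma2 ->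
  0 < Delta0 ->
  let kappa := L / mu in
  let beta := 2 * mu^-1 in
  let c := (3 * beta * L + 1) * rho / 6 in
  let R_Delta := 2 * Num.sqrt (mu * Delta0 / (beta * mu - 1)) in
  let c1 := (1 + beta * sigma2) ^+ 2 * sigma1 ^+ 2
            + beta ^+ 2 * sigma2 ^+ 2 * R_Delta ^+ 2 in
  let c2 := L ^+ 2 * (1 + beta * sigma2) ^+ 2
            + beta ^+ 2 * rho ^+ 2 * (sigma1 ^+ 2 + R_Delta ^+ 2) in
  let c3 := 1 + beta * (L + sigma2) in
  exists eps0 : R, 0 < eps0 /\
  forall eps : R, 0 < eps < eps0 ->
  let Sg := (Num.truncn (Num.sqrt (c1 * c) / Num.sqrt (c2 * eps))).+1 in
  let Sh := (Num.truncn (sigma2 * Num.sqrt c / (rho * Num.sqrt eps))).+1 in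
  let p := {| p_eps := eps; p_Delta0 := Delta0; p_beta := beta; p_rho := rho;
              p_sigma1 := sigma1; p_sigma2 := sigma2;
              p_c := c; p_c1 := c1; p_c2 := c2; p_c3 := c3;
              p_Sg := Sg; p_Sh := Sh |} in
  forall (z0 : 'cV[R]_(n + m)),
  h_beta f beta z0 - Phi_bar f <= Delta0 ->
  forall (d' : measure_display) (Omega : measurableType d')
    (P : probability Omega R) (r : sacqrn_run Z F P p z0),
  [/\ sosp_in_expectation (h_beta f beta) P (z_out r)
        (C * eps) (C * Num.sqrt (kappa * rho * eps)),
      (iter_count p)%:R
        <= C * (Num.sqrt (kappa * rho) * Delta0 * eps `^ (- (3 / 2))),
      (gradient_calls r
        <= (C * (Num.sqrt (c1 * c2) * Delta0 * eps ^- 3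
                 + sigma1 ^+ 2 * beta ^+ 2 * rho ^+ 2 * (Num.sqrt c)^-1
                   * Delta0 * eps `^ (- (5 / 2))))%:E)%E
    & (hessian_calls r
        <= (C * (sigma2 * rho * c3 ^+ 2 * c^-1 * Delta0 * eps ^- 2))%:E)%E].
Proof.
(* The largest constant met below is [2 * 6481], for the Hessian evaluations. *)
exists 20000; split; first by rewrite ltr0n.
move=> n m d Xi Z F f mu L rho sigma1 sigma2 Delta0 n0 m0 hd hs D0.
move=> kappa beta c R_Delta c1 c2 c3.
have mu0 := det_mu_gt0 hd; have L0 := det_L_gt0 hd; have rho0 := det_rho_gt0 hd.
have betaE : beta = 2 * mu^-1 by [].
have cE : c = (3 * beta * L + 1) * rho / 6 by [].
have RE : R_Delta = 2 * Num.sqrt (mu * Delta0 / (beta * mu - 1)) by [].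
have c1E : c1 = (1 + beta * sigma2) ^+ 2 * sigma1 ^+ 2 + beta ^+ 2 * sigma2 ^+ 2 * R_Delta ^+ 2 by [].
have c2E : c2 = L ^+ 2 * (1 + beta * sigma2) ^+ 2
    + beta ^+ 2 * rho ^+ 2 * (sigma1 ^+ 2 + R_Delta ^+ 2) by [].
have c3E : c3 = 1 + beta * (L + sigma2) by [].
have kappaE : kappa = L / mu by [].
clearbody kappa c3 c2 c1 R_Delta c beta.
have beta0 : 0 < beta by rewrite betaE mulr_gt0 // invr_gt0.
have c0 : 0 < c.
  rewrite cE !mulr_gt0 ?invr_gt0 //; apply: ltr_wpDl => //.
  by rewrite !mulr_ge0 // ltW.
have RD2 : R_Delta ^+ 2 = 4 * mu * Delta0.
  have -> : R_Delta = 2 * Num.sqrt (mu * Delta0).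
    rewrite RE betaE -[2 * mu^-1 * mu]mulrA mulVf ?lt0r_neq0 // mulr1.
    have -> : (2 - 1 : R) = 1 by ring.
    by rewrite divr1.
  by rewrite exprMn sqr_sqrtr ?mulr_ge0 ?ltW //; ring.
pose pp e Sg Sh := {| p_eps := e; p_Delta0 := Delta0; p_beta := beta; p_rho := rho;
   p_sigma1 := sigma1; p_sigma2 := sigma2; p_c := c; p_c1 := c1; p_c2 := c2; p_c3 := c3;
   p_Sg := Sg; p_Sh := Sh |}.
have cal e Sg Sh : 0 < e -> (0 < Sg)%N -> (0 < Sh)%N -> calibrated (pp e Sg Sh) mu L.
  by move=> e0 Sg0 Sh0; split => //=; rewrite ?c1E ?c2E RD2 //; ring.
have cal1 := cal 1 1%N 1%N ltr01 isT isT.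
have s20 : 0 < sigma2 := @sigma2_gt0 R n m d Xi Z F f (pp 1 1%N 1%N) mu L hd hs m0.
have c10 : 0 < c1 := @c1_gt0 R n m d Xi Z F f (pp 1 1%N 1%N) mu L hd hs m0 D0 beta0 (cal_c1 cal1).
have c20 : 0 < c2 := @c2_gt0 R n m f (pp 1 1%N 1%N) mu L hd D0 beta0 (cal_c2 cal1).
have c30 : 0 < c3 by rewrite c3E ltr_pwDl // mulr_ge0 ?addr_ge0 // ltW.
set q1 := Num.sqrt c1; have q10 : 0 < q1 by rewrite sqrtr_gt0.
set q2 := Num.sqrt c2; have q20 : 0 < q2 by rewrite sqrtr_gt0.
(* Every smallness condition on the step scale [s] has the form [k * s <= 1] with
   [k] in this list, hence follows from [s * K <= 1] below. *)
pose ks : seq R := [:: 6 * c / Delta0; beta * rho; 2 * Num.sqrt (4 * mu * Delta0) / Delta0;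
  q2 / q1; q1 * c / (q2 * Delta0); c ^+ 2 / (q1 * q2); rho / sigma2;
  sigma2 * c / (rho * Delta0); c ^+ 2 / (sigma2 * rho * c3 ^+ 2)].
have ks0 k : k \in ks -> 0 <= k.
  have pos (a a' : R) : 0 <= a -> 0 < a' -> 0 <= a / a' by move=> a0 a'0; rewrite divr_ge0 // ltW.
  rewrite !inE; do ![case/predU1P => [->|]] => [||||||||/eqP ->];
    [apply: pos| |apply: pos|apply: pos|apply: pos|apply: pos|apply: pos|apply: pos|apply: pos] => //;
    rewrite ?mulr_ge0 ?mulr_gt0 ?exprn_gt0 ?sqr_ge0 ?sqrtr_ge0 // ?ltW //.
pose K := 1 + \sum_(k <- ks) k.
have sum0 : 0 <= \sum_(k <- ks) k by rewrite big_seq; apply: sumr_ge0 => k; exact: ks0.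
have K0 : 0 < K by rewrite ltr_wpDr.
have K1 : 1 <= K by rewrite lerDl.
have Kk k : k \in ks -> k <= K.
  by move=> kk; apply: ler_wpDl => //; exact: mem_le_sum.
exists (c * K^-1 ^+ 2); split; first by rewrite mulr_gt0 // exprn_gt0 // invr_gt0.
move=> eps /andP[e0 eK] Sg Sh p z0 hz0 d' Omega P r.
have calp : calibrated p mu L := cal eps Sg Sh e0 isT isT.
have hdp : deterministic_assumptions f mu L (p_rho p) := hd.
have hsp : stochastic_assumptions Z F f L (p_rho p) (p_sigma1 p) (p_sigma2 p) := hs.
pose s : R := step_scale p.
have s0 : 0 < s := step_scale_gt0 hdp calp.
have eps_scale : eps = c * s ^+ 2 := eps_scale hdp calp.
have sK : s * K <= 1.
  have Ki : 0 <= K^-1 by rewrite invr_ge0 ltW.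
  rewrite -ler_pdivlMr // mul1r -(@ler_pXn2r _ 2%N) ?nnegrE //; last exact: ltW.
  by rewrite -(ler_pM2l c0) -eps_scale ltW.
have sk k : k \in ks -> k * s <= 1.
  by move=> /Kk kK; apply: le_trans sK; rewrite mulrC ler_wpM2l // ltW.
have s1 : s <= 1 by apply: le_trans sK; rewrite ler_peMr // ltW.
have s21 : s ^+ 2 <= s by rewrite expr2 ler_piMl // ltW.
have s31 : s ^+ 3 <= s by rewrite exprS (le_trans (ler_wpM2l (ltW s0) s21)) // -expr2.
have small : 6 * (c * s ^+ 3) <= Delta0.
  have h : 6 * c * s <= Delta0 by apply: small_product => //; apply: sk; rewrite !inE eqxx.
  by apply: le_trans h; rewrite -mulrA !ler_pM2l.
have bs1 : beta * rho * s <= 1 by apply: sk; rewrite !inE eqxx ?orbT.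
have small_start : 2 * s * Num.sqrt (4 * mu * Delta0) <= Delta0.
  by rewrite mulrAC; apply: small_product => //; apply: sk; rewrite !inE eqxx ?orbT.
have small_g : q2 * s <= q1 by apply: small_product => //; apply: sk; rewrite !inE eqxx ?orbT.
have small_g' : q1 * (c * s ^+ 2) <= q2 * Delta0.
  have h : q1 * c * s <= q2 * Delta0.
    by apply: small_product; rewrite ?mulr_gt0 //; apply: sk; rewrite !inE eqxx ?orbT.
  by apply: le_trans h; rewrite -mulrA !ler_pM2l.
have small_gT : c ^+ 2 * s ^+ 3 <= q1 * q2.
  have h : c ^+ 2 * s <= q1 * q2.
    by apply: small_product; rewrite ?mulr_gt0 //; apply: sk; rewrite !inE eqxx ?orbT.
  by apply: le_trans h; rewrite ler_pM2l // exprn_gt0.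
have small_h : rho * s <= sigma2 by apply: small_product => //; apply: sk; rewrite !inE eqxx ?orbT.
have small_h' : sigma2 * (c * s ^+ 2) <= rho * Delta0.
  have h : sigma2 * c * s <= rho * Delta0.
    by apply: small_product; rewrite ?mulr_gt0 //; apply: sk; rewrite !inE eqxx ?orbT.
  by apply: le_trans h; rewrite -mulrA !ler_pM2l.
have small_hT : c ^+ 2 * s <= sigma2 * rho * c3 ^+ 2.
  by apply: small_product; rewrite ?mulr_gt0 ?exprn_gt0 //; apply: sk; rewrite !inE eqxx ?orbT.
have hsc := sqrt_c_le hdp m0 calp; rewrite /= -kappaE in hsc.
split.
- apply: (output_sosp r hdp hsp m0 calp hz0 small bs1 small_start).
    by rewrite -eps_scale ler_wpM2r ?(ltW e0) // ler_nat.
  have kr0 : 0 <= kappa * rho by rewrite kappaE mulr_ge0 ?divr_ge0 // ltW.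
  have -> : c * s = Num.sqrt c * Num.sqrt eps.
    by rewrite -sqrtrM ?(ltW c0) //; exact/esym/(sqrt_c_eps hdp calp).
  rewrite sqrtrM //; have := ler_wpM2r (sqrtr_ge0 eps) hsc; rewrite -mulrA.
  have : 0 <= Num.sqrt (kappa * rho) * Num.sqrt eps by rewrite mulr_ge0 ?sqrtr_ge0.
  by move: (_ * Num.sqrt eps) (Num.sqrt c * _) => A1 A2; lra.
- by have := iterations_le hdp m0 calp small; rewrite /= -kappaE.
- exact: (gradient_calls_le r hdp hsp m0 calp hz0 small erefl small_g small_g' small_gT).
- exact: (hessian_calls_le r hdp hsp m0 calp hz0 small erefl small_h small_h' small_hT).
Qed.
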